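(* Let $r>0$, $\zeta,t\in(0,1)$ be given and fix $\mu\in(\zeta,\zeta^{-1})$. Suppose $N,M\in\mathbb{N}$ (with $M=M(N)$) are sufficiently large so that $\mu N>(r+2)N^{2/3}$ and $M>\mu N+(r+2)N^{2/3}$. Let $\varnothing=\lambda(0)\prec\lambda(1)\prec\cdots\prec\lambda(M)$ be sampled from the homogeneous ascending Hall-Littlewood process $\mathbb{P}^{M,N}_\zeta$ (with Hall-Littlewood parameter $t$), let $\lambda_1'(i)$ denote the first part of the conjugate of $\lambda(i)$, and define $\lambda_1'(\cdot)$ at non-integer points by linear interpolation. For $x\in[-r-1,r+1]$ set $$f^{HL}_N(x)=\sigma_\mu^{-1}N^{-1/3}\left(\lambda_1'(\mu N+xN^{2/3})-f_1(\mu)N-f_1'(\mu)xN^{2/3}-\tfrac{x^2}{2}f_1''(\mu)N^{1/3}\right),$$ where $$\sigma_\mu=\frac{(\zeta\mu)^{1/6}(1-\sqrt{\zeta\mu})^{2/3}(1-\sqrt{\zeta/\mu})^{2/3}}{1-\zeta},\quad f_1(\mu)=1-\frac{(1-\sqrt{\zeta\mu})^2}{1-\zeta},\quad f_1'(\mu)=\frac{\sqrt{\zeta}(1-\sqrt{\zeta\mu})}{\sqrt{\mu}(1-\zeta)},\quad f_1''(\mu)=\frac{-\sqrt{\zeta}}{2\mu^{3/2}(1-\zeta)}.$$ Then for any $x\in[-r-1,r+1]$ and $y\in\mathbb{R}$, $$\lim_{N\to\infty}\mathbb{P}^{M,N}_\zeta\left(f^{HL}_N(x)\le y\right)=F_{GUE}(y),$$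 where $F_{GUE}$ is the distribution function of the GUE Tracy-Widom distribution.
   Context: A partition is a sequence $\lambda=(\lambda_1\ge\lambda_2\ge\cdots)$ of non-negative integers with finitely many non-zero terms; $|\lambda|=\sum_i\lambda_i$; the conjugate $\lambda'$ has parts $\lambda_i'=|\{j:\lambda_j\ge i\}|$; $m_i(\lambda)=|\{j:\lambda_j=i\}|$; $\varnothing$ is the partition of $0$. Write $\lambda\succ\mu$ (equivalently $\mu\prec\lambda$) if $\mu\subset\lambda$ and $\lambda-\mu$ is a horizontal strip, i.e. $\lambda_1\ge\mu_1\ge\lambda_2\ge\mu_2\ge\cdots$. Fix $t\in(0,1)$. $P_{\lambda/\mu},Q_{\lambda/\mu}$ are the skew Hall-Littlewood symmetric functions with parameter $t$ (and $Q_\lambda=Q_{\lambda/\varnothing}$). In one variable, $P_{\lambda/\mu}(x)=\psi_{\lambda/\mu}(t)x^{|\lambda|-|\mu|}$ and $Q_{\lambda/\mu}(x)=\phi_{\lambda/\mu}(t)x^{|\lambda|-|\mu|}$, where $$\psi_{\lambda/\mu}(t)=\mathbf{1}_{\lambda\succ\mu}\prod_{j\in J}(1-t^{m_j(\mu)}),\qquad \phi_{\lambda/\mu}(t)=\mathbf{1}_{\lambda\succ\mu}\prod_{i\in I}(1-t^{m_i(\lambda)}),$$ $I=\{i\ge1:\lambda_{i+1}'=\mu_{i+1}',\ \lambda_i'>\mu_i'\}$, $J=\{j\ge1:\lambda_{j+1}'>\mu_{j+1}',\ \lambda_j'=\mu_j'\}$. In several variables, $Q_\lambda(x_1,\dots,x_N)=\sum\prod_{i=1}^NQ_{\nu(i)/\nu(i-1)}(x_i)$,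 summed over chains $\varnothing=\nu(0)\prec\nu(1)\prec\cdots\prec\nu(N)=\lambda$; $Q_\lambda(\zeta^N)$ means all $N$ variables equal $\zeta$. Homogeneous ascending Hall-Littlewood process: for $M,N\in\mathbb{N}$, $\zeta\in(0,1)$, it is the probability distribution on sequences $\varnothing=\lambda(0)\prec\lambda(1)\prec\cdots\prec\lambda(M)$ given by $$\mathbb{P}^{M,N}_\zeta(\lambda(1),\dots,\lambda(M))=\left(\frac{1-\zeta}{1-t\zeta}\right)^{NM}\prod_{i=1}^MP_{\lambda(i)/\lambda(i-1)}(1)\cdot Q_{\lambda(M)}(\zeta^N).$$ *)

(* Defs.v *)
From HB Require Import structures.
From mathcomp Require Import all_boot all_order all_algebra.
From mathcomp Require Import all_classical all_reals all_analysis.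
Import Order.TTheory GRing.Theory Num.Theory.
Import numFieldNormedType.Exports.

Set Implicit Arguments.
Unset Strict Implicit.
Unset Printing Implicit Defensive.

Local Open Scope classical_set_scope.
Local Open Scope ring_scope.

(* A partition is the list of its non-zero parts, in decreasing order; lambda_i
   is [nth 0%N la i.-1], which is 0 past the end of the list. *)
Record int_partition := Partition {
  parts :> seq nat;
  partsP : sorted geq parts && (0 \notin parts)%N }.

HB.instance Definition _ := [isSub for parts].
HB.instance Definition _ := [Countable of int_partition by <:].

Definition part0 : int_partition := @Partition [::] isT.

Definition psize (la : int_partition) : nat := sumn la.

(* lambda'_i, meaningful for i >= 1 *)
Definition conj_part (la : int_partition) (i : nat) : nat :=
  count (fun p => i <= p)%N la.

Definition mult_part (i : nat) (la : int_partition) : nat := count_mem i la.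

(* la \succ mu *)
Definition interlace (la mu : int_partition) : Prop := forall i : nat,
  (nth 0%N mu i <= nth 0%N la i)%N /\ (nth 0%N la i.+1 <= nth 0%N mu i)%N.

Definition indexI (la mu : int_partition) (i : nat) : bool :=
  (conj_part la i.+1 == conj_part mu i.+1) &&
  (conj_part mu i < conj_part la i)%N.

Definition indexJ (la mu : int_partition) (j : nat) : bool :=
  (conj_part mu j.+1 < conj_part la j.+1)%N &&
  (conj_part la j == conj_part mu j).

(* The elements of I and J are at most lambda_1 = [head 0 la], since
   lambda'_i = 0 for i > lambda_1. *)
Definition psi (R : realType) (t : R) (la mu : int_partition) : R :=
  if `[< interlace la mu >] then
    \prod_(1 <= j < (head 0%N la).+1 | indexJ la mu j) (1 - t ^+ mult_part j mu)
  else 0.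

Definition phi (R : realType) (t : R) (la mu : int_partition) : R :=
  if `[< interlace la mu >] then
    \prod_(1 <= i < (head 0%N la).+1 | indexI la mu i) (1 - t ^+ mult_part i la)
  else 0.

(* One-variable skew functions; the truncated subtraction is harmless because
   psi and phi vanish unless mu is contained in la. *)
Definition skewP1 (R : realType) (t : R) (la mu : int_partition) (x : R) : R :=
  psi t la mu * x ^+ (psize la - psize mu).

Definition skewQ1 (R : realType) (t : R) (la mu : int_partition) (x : R) : R :=
  phi t la mu * x ^+ (psize la - psize mu).

(* A tuple l of n partitions stands for the sequence lambda(0), ..., lambda(n)
   with lambda(0) empty and lambda(i) the i-th entry of l, counted from 1. *)
Definition chain_at (n : nat) (l : n.-tuple int_partition) (i : nat) : int_partition :=
  nth part0 (part0 :: l) i.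

Definition chains (n : nat) (la : int_partition) : set (n.-tuple int_partition) :=
  [set nu | (forall i, (i < n)%N -> interlace (chain_at nu i.+1) (chain_at nu i)) /\
            chain_at nu n = la].
Arguments chains : clear implicits.

Definition HLQ (R : realType) (t : R) (n : nat) (x : 'I_n -> R)
    (la : int_partition) : R :=
  \sum_(nu \in chains n la)
    \prod_(i < n) skewQ1 t (chain_at nu i.+1) (chain_at nu i) (x i).

(* [\sum_(_ \in A)] is the true sum only when A is finite. *)
Lemma finite_chains (n : nat) (la : int_partition) : finite_set (chains n la).
Proof.
pose b := head 0%N la.
pose dec (s : (size la).-bseq 'I_b.+1) : int_partition :=
  insubd part0 [seq val i | i <- s].
pose F (u : n.-tuple ((size la).-bseq 'I_b.+1)) : n.-tuple int_partition :=
  [tuple of map dec u].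
apply: (@sub_finite_set _ _ [set F u | u in setT]); last first.
  exact/finite_image/finite_finset.
move=> nu [hint hlast].
have nthS (mu : int_partition) i : (nth 0%N mu i != 0)%N = (i < size mu)%N.
  case: (ltnP i (size mu)) => hi; last by rewrite nth_default.
  have /andP[_ h0] := partsP mu.
  by apply: contra h0 => /eqP <-; apply: mem_nth.
have mon k : (k <= n)%N -> forall i, (nth 0%N (chain_at nu k) i <= nth 0%N la i)%N.
  move=> kn i.
  have : chain_at nu (k + (n - k)) = la by rewrite subnKC.
  have : (k + (n - k) <= n)%N by rewrite subnKC.
  move=> + <-.
  elim: (n - k)%N => [|m IH]; first by rewrite addn0.
  rewrite addnS => hm; apply: leq_trans (IH (ltnW hm)) _.
  by have [] := hint _ hm i.
have hsz (mu : int_partition) : (forall i, (nth 0%N mu i <= nth 0%N la i)%N) ->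
    exists s, dec s = mu.
  move=> hmu.
  have sz : (size mu <= size la)%N.
    rewrite leqNgt -nthS -lt0n; apply/negP => h.
    by have := leq_trans h (hmu _); rewrite nth_default.
  have szt : (size [seq (inord p : 'I_b.+1) | p <- mu] <= size la)%N.
    by rewrite size_map.
  exists (Bseq szt); rewrite /dec /= -map_comp.
  have -> : [seq (val \o (fun p => inord p : 'I_b.+1)) p | p <- mu] = mu :> seq nat.
    rewrite -[RHS]map_id; apply/eq_in_map => p pmu /=.
    rewrite inordK // ltnS; have /andP[smu _] := partsP mu.
    apply: leq_trans (hmu 0%N).
    move: pmu smu; case: (parts mu) => //= a l; rewrite inE => /predU1P[->//|pl].
    have gt : transitive geq by move=> x y z /= h1 h2; apply: leq_trans h2 h1.
    by move=> /(order_path_min gt)/allP/(_ _ pl).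
  apply/val_inj; rewrite val_insubd; by have -> := partsP mu.
have hex i : exists s, dec s = tnth nu i.
  apply: hsz => j; rewrite (tnth_nth part0).
  exact: (mon i.+1 (ltn_ord i) j).
have [g hg] := choice hex.
exists [tuple g i | i < n] => //.
by apply: eq_from_tnth => i; rewrite tnth_map tnth_mktuple hg.
Qed.

(* probability mass of (lambda(1), ..., lambda(M)) *)
Definition HLmass (R : realType) (t zeta : R) (M N : nat)
    (l : M.-tuple int_partition) : R :=
  ((1 - zeta) / (1 - t * zeta)) ^+ (N * M) *
  (\prod_(i < M) skewP1 t (chain_at l i.+1) (chain_at l i) 1) *
  HLQ t (fun _ : 'I_N => zeta) (chain_at l M).

(* probability of an event *)
Definition HLprob (R : realType) (t zeta : R) (M N : nat)
    (A : set (M.-tuple int_partition)) : \bar R :=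
  \esum_(l in A) (HLmass t zeta N l)%:E.

(* lambda_1'(s) for real s, linear between consecutive integers *)
Definition lam1' (R : realType) (M : nat) (l : M.-tuple int_partition) (s : R) : R :=
  let k := Num.truncn s in
  let v i : R := (conj_part (chain_at l i) 1%N)%:R in
  v k + (s - k%:R) * (v k.+1 - v k).

Definition sigma_mu (R : realType) (zeta mu : R) : R :=
  (zeta * mu) `^ (1 / 6) * (1 - Num.sqrt (zeta * mu)) `^ (2 / 3) *
  (1 - Num.sqrt (zeta / mu)) `^ (2 / 3) / (1 - zeta).

Definition f1 (R : realType) (zeta mu : R) : R :=
  1 - (1 - Num.sqrt (zeta * mu)) ^+ 2 / (1 - zeta).

Definition f1' (R : realType) (zeta mu : R) : R :=
  Num.sqrt zeta * (1 - Num.sqrt (zeta * mu)) / (Num.sqrt mu * (1 - zeta)).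

Definition f1'' (R : realType) (zeta mu : R) : R :=
  - Num.sqrt zeta / (2 * mu `^ (3 / 2) * (1 - zeta)).

Definition fHL (R : realType) (zeta mu : R) (N M : nat)
    (l : M.-tuple int_partition) (x : R) : R :=
  let n : R := N%:R in
  (sigma_mu zeta mu)^-1 * n `^ (- (1 / 3)) *
  (lam1' l (mu * n + x * n `^ (2 / 3)) - f1 zeta mu * n
   - f1' zeta mu * x * n `^ (2 / 3) - x ^+ 2 / 2 * f1'' zeta mu * n `^ (1 / 3)).

(* Ai(x) = 1/pi * int_0^oo cos(s^3/3 + x s) ds, an improper integral that does
   not converge absolutely *)
Definition Airy (R : realType) (x : R) : R :=
  pi^-1 * lim ((fun A : R =>
    \int[lebesgue_measure]_(s in `[0, A]) cos (s ^+ 3 / 3 + x * s)) @ +oo).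

Definition Airy_kernel (R : realType) (x y : R) : R :=
  \int[lebesgue_measure]_(u in `[0, +oo[) (Airy (x + u) * Airy (y + u)).

(* integral of f(x_1, ..., x_n) over (a, +oo)^n, as an iterated integral *)
Fixpoint iter_integral (R : realType) (a : R) (n : nat) (f : seq R -> R) : R :=
  if n is m.+1 then
    \int[lebesgue_measure]_(x in `]a, +oo[)
      iter_integral a m (fun s => f (x :: s))
  else f [::].

(* Fredholm determinant det(1 - K) on L^2(a, +oo) *)
Definition Fredholm_det (R : realType) (K : R -> R -> R) (a : R) : R :=
  limn (series (fun n => (-1) ^+ n / n`!%:R *
    iter_integral a n (fun s => \det (\matrix_(i < n, j < n) K s`_i s`_j)))).

Definition F_GUE (R : realType) (y : R) : R := Fredholm_det (@Airy_kernel R) y.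

(* Main.v *)
(* By the skew Cauchy identity lambda(k) has the Hall-Littlewood measure with
   weight P_lambda(1^k) Q_lambda(zeta^N), which is symmetric in (k, N); write n <= m
   for these two numbers in increasing order.  In terms of column lengths, adding
   one variable to Q_lambda is an operator whose two parts satisfy the exchange
   relations of an algebraic Bethe ansatz.  This gives, for u <= 0 and l the length
   lambda'_1, the expectation of (u; t)_(n - l) as an n x n determinant, and by
   Sylvester's identity
     E (u; t)_(n - l) = (u; t)_oo lim_L det_L (1 - g K),  g_i = - u t^i / (1 - u t^i),
   where K is, up to conjugation by signs, the Meixner-type kernel
     K(i, j) = sum_k A_(i - k) A*_(j - k)
   built from the coefficients A_j of (1 + w)^n (1 + zeta w)^(-m).  Such determinants
   are non-negative for every g < 1 and affine in each g_i, hence non-increasing in g;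
   taking u = - t^(-a) makes g close to the indicator of {i < a}, so that the
   distribution function of n - l is squeezed between Fredholm determinants of K.
   Steepest descent at the double critical point gives the Airy asymptotics of A_j,
   with an exponential bound away from the edge, and Hadamard's inequality lets the
   Fredholm expansions converge term by term to F_GUE.  Finally lambda'_1(i)
   increases by at most 1 at each step, so linear interpolation does not matter. *)

From HB Require Import structures.
From mathcomp Require Import all_boot all_order all_algebra.
From mathcomp Require Import fingroup perm.
From mathcomp Require Import all_classical all_reals all_analysis.
From mathcomp Require Import measurable_realfun.
From mathcomp Require Import complex.
From mathcomp Require Import ring lra zify.
Require Import Defs.
Set Implicit Arguments.
Unset Strict Implicit.
Unset Printing Implicit Defensive.
Import Order.TTheory GRing.Theory Num.Theory.
Import numFieldNormedType.Exports.
Local Open Scope classical_set_scope.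
Local Open Scope ring_scope.
Import ComplexField.Normc.

(** * Determinant identities and inequalities *)

(** The Bethe relation needs pairwise distinct variables, whereas all variables of Q equal zeta. It
    is used at distinct points, where the expectation is a determinant divided by a Vandermonde
    determinant; factoring out the Vandermonde matrix leaves polynomials in a companion matrix,
    which survive the collision of the points and end at the companion matrix of (X - 1)^n. K is the
    complement of a rank n projection given by division by (X - 1)^n, and the sign of its
    determinants comes from a weighted Gram matrix. Taking u <= 0 keeps all summands of the
    expectation non-negative, so sums over partitions can be rearranged freely. Both factors of K
    obey one estimate: exchanging n with m and e0 with j0 maps the saddle point w to 1 / (z w). The
    saddle is taken at the exact ratio k / N, and the expansion around mu is made only at the end,
    in the centring. The integral defining Ai converges conditionally, so it is first moved to a
    vertical line where it converges absolutely. *)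

Definition posdef (R : realFieldType) n (S : 'M[R]_n) : Prop :=
  S^T = S /\ forall x : 'rV_n, x != 0 -> 0 < (x *m S *m x^T) 0 0.

(** Induction by Schur complement: with corner a, first column b and lower block G, the determinant
    is (a - b^T G^-1 b) \det G, and the subtracted term is non-negative, so each step costs at most
    one diagonal entry. *)
Lemma posdef_det (R : realFieldType) n (S : 'M[R]_n) :
  posdef S -> 0 < \det S <= \prod_i S i i.
Proof.
elim: n S => [|n IH] S [symS pdS]; first by rewrite det_mx00 big_ord0 ltr01 lexx.
pose S' := (S : 'M[R]_(1 + n)).
have pdS' : forall x : 'rV_(1 + n), x != 0 -> 0 < (x *m S' *m x^T) 0 0 := pdS.
pose G := drsubmx S'; pose b := dlsubmx S'; pose a := S 0 0.
have Sblk : S' = block_mx a%:M b^T b G.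
  rewrite -[LHS]submxK; congr block_mx.
    by rewrite [ulsubmx _]mx11_scalar !mxE /a; congr (_%:M); congr (S _ _); apply/val_inj.
  by rewrite /b trmx_dlsub symS.
have symG : G^T = G by rewrite /G trmx_drsub symS.
have qf (c : 'M[R]_1) (v : 'rV_n) :
    (row_mx c v *m S' *m (row_mx c v)^T) =
    c *m a%:M *m c^T + v *m b *m c^T + c *m b^T *m v^T + v *m G *m v^T.
  rewrite Sblk mul_row_block tr_row_mx mul_row_col !mulmxDl !addrA.
  by rewrite -!addrA; congr (_ + _); rewrite addrCA.
have pdG : posdef G.
  split=> // v vn0.
  have := pdS' (row_mx 0 v); rewrite (qf 0 v) !mul0mx trmx0 mulmx0 !add0r; apply.
  by apply: contra vn0 => /eqP /(congr1 rsubmx); rewrite row_mxKr linear0 => ->.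
have /andP[Gpos Gle] := IH _ pdG.
have Gu : G \in unitmx by rewrite unitmxE unitfE gt_eqF.
have symGi : (invmx G)^T = invmx G by rewrite trmx_inv symG.
pose s : 'M[R]_1 := b^T *m invmx G *m b.
have sge0 : 0 <= s 0 0.
  rewrite /s; have [b0|bn0] := eqVneq b 0; first by rewrite b0 mulmx0 mxE.
  have bn0' : (b^T *m invmx G) != 0.
    apply: contra bn0 => /eqP /(congr1 (mulmx^~ G)).
    by rewrite -mulmxA mulVmx // mulmx1 mul0mx => /eqP; rewrite trmx_eq0.
  have := (pdG.2 _ bn0').
  by rewrite trmx_mul symGi trmxK !mulmxA mulmxKV // => /ltW.
(* The quadratic form at the row vector (1, - b^T G^-1) is the Schur complement. *)
have das : 0 < a - s 0 0.
  have := pdS' (row_mx 1%:M (- (b^T *m invmx G))).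
  rewrite (qf 1%:M) !mul1mx trmx1 !mulmx1 [(- _)^T]raddfN /= !(mulmxN, mulNmx) opprK.
  rewrite trmx_mul symGi trmxK !mulmxA mulmxKV // -/s subrK.
  rewrite !mxE eqxx mulr1n; apply.
  apply/eqP => /(congr1 lsubmx); rewrite row_mxKl linear0 => /matrixP/(_ 0 0).
  by rewrite !mxE eqxx => /eqP; rewrite oner_eq0.
have detS : \det S = (a - s 0 0) * \det G.
  have : block_mx 1%:M (- (b^T *m invmx G)) 0 1%:M *m S' =
         block_mx (a%:M - s) 0 b G.
    rewrite Sblk mulmx_block !mul1mx !mul0mx !add0r !mulNmx mulmxKV //.
    by rewrite subrr.
  move/(congr1 determinant); rewrite det_mulmx det_ublock !det1 !mul1r det_lblock.
  by rewrite /S' => ->; congr (_ * _); rewrite det_mx11 !mxE eqxx.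
rewrite detS mulr_gt0 //= big_ord_recl ler_pM ?(ltW das) ?(ltW Gpos) //.
  by rewrite gerBl.
apply: le_trans Gle _; rewrite le_eqVlt; apply/orP; left; apply/eqP.
by apply: eq_bigr => i _; rewrite !mxE; congr (S _ _); apply/val_inj.
Qed.

Lemma rV_sqr_gt0 (R : realFieldType) n (x : 'rV[R]_n) :
  x != 0 -> 0 < (x *m x^T) 0 0.
Proof.
move=> xn0; rewrite mxE.
under eq_bigr do rewrite mxE -expr2.
rewrite lt_def sumr_ge0 ?andbT; last by move=> i _; rewrite sqr_ge0.
apply: contra xn0; rewrite psumr_eq0 => [/allP h|i _]; last by rewrite sqr_ge0.
apply/eqP/rowP => i; rewrite mxE; apply/eqP; rewrite -sqrf_eq0.
by apply: h; rewrite mem_index_enum.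
Qed.

Lemma gram_posdef (R : realFieldType) n p (M : 'M[R]_(n, p)) :
  row_free M -> posdef (M *m M^T).
Proof.
move=> fM; split; first by rewrite trmx_mul trmxK.
move=> x xn0.
have -> : x *m (M *m M^T) *m x^T = (x *m M) *m (x *m M)^T.
  by rewrite trmx_mul !mulmxA.
apply: rV_sqr_gt0.
by apply: contra xn0 => /eqP h; rewrite -(mulmx_free_eq0 x fM) h.
Qed.

(** Apply [posdef_det] to the Gram matrix of the rows, whose diagonal entries are the squared row
    norms. *)
Lemma hadamard (R : realFieldType) n (M : 'M[R]_n) :
  (\det M) ^+ 2 <= \prod_i \sum_j M i j ^+ 2.
Proof.
have [/eqP ->|Mn0] := boolP (\det M == 0).
  by rewrite expr0n /= prodr_ge0 // => i _; rewrite sumr_ge0 // => j _; rewrite sqr_ge0.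
have fM : row_free M by rewrite row_free_unit unitmxE unitfE.
have /andP[_] := posdef_det (gram_posdef fM).
rewrite det_mulmx det_tr -expr2 => /le_trans; apply.
rewrite le_eqVlt; apply/orP; left; apply/eqP; apply: eq_bigr => i _.
by rewrite mxE; apply: eq_bigr => j _; rewrite mxE expr2.
Qed.

(** Dividing column j by b j leaves rows of squared norm at most n (a i)^2, whence the factor n^n.
    Its square root is what the 1 / n! of the Fredholm series has to beat. *)
Lemma hadamard_bound (R : realFieldType) n (M : 'M[R]_n) (a b : 'I_n -> R) :
  (forall i j, `|M i j| <= a i * b j) ->
  (\det M) ^+ 2 <= (n ^ n)%:R * \prod_i (a i * b i) ^+ 2.
Proof.
case: n M a b => [|n] M a b hM.
  by rewrite det_mx00 big_ord0 expr1n mulr1.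
have [bn0|] := boolP [forall j, b j != 0]; last first.
  rewrite negb_forall => /existsP[j]; rewrite negbK => /eqP bj.
  have -> : \det M = 0.
    rewrite (expand_det_col _ j) big1 // => i _.
    have := hM i j; rewrite bj mulr0 normr_le0 => /eqP ->; exact: mul0r.
  rewrite expr0n /= mulr_ge0 ?ler0n // prodr_ge0 // => i _; exact: sqr_ge0.
move/forallP: bn0 => bn0.
pose M' := \matrix_(i, j) (M i j * (b j)^-1).
have -> : \det M = \det M' * \prod_j b j.
  have -> : M = M' *m diag_mx (\row_j b j).
    by apply/matrixP => i j; rewrite mul_mx_diag !mxE divfK.
  by rewrite det_mulmx det_diag; congr (_ * _); apply: eq_bigr => j _; rewrite mxE.
rewrite exprMn.
have -> : \prod_i (a i * b i) ^+ 2 = \prod_i (a i) ^+ 2 * (\prod_i b i) ^+ 2.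
  by rewrite -prodrXl -big_split /=; apply: eq_bigr => i _; rewrite exprMn.
rewrite mulrA ler_wpM2r ?sqr_ge0 //; apply: le_trans (hadamard _) _.
have -> : (n.+1 ^ n.+1)%:R * \prod_i a i ^+ 2 = \prod_i (n.+1%:R * a i ^+ 2) :> R.
  by rewrite [RHS]big_split /= big_const_ord iter_mulr_1 natrX.
apply: ler_prod => i _; rewrite sumr_ge0 /=; last by move=> j _; rewrite sqr_ge0.
have -> : n.+1%:R * a i ^+ 2 = \sum_(j < n.+1) a i ^+ 2.
  by rewrite sumr_const card_ord mulr_natl.
apply: ler_sum => j _; rewrite mxE -real_normK ?num_real // -[leRHS]real_normK ?num_real //.
rewrite ler_sqr ?nnegrE // normrM normfV ler_pdivrMr ?normr_gt0 //.
by rewrite -normrM; apply: le_trans (hM i j) (ler_norm _).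
Qed.

(** One block matrix is multiplied by a block triangular matrix on the right and by another on the
    left. The identity is free of division, so y may be an indeterminate. *)
Lemma sylvester (R : comNzRingType) n k (N : 'M[R]_(n, k)) (M : 'M[R]_(k, n)) (y : R) :
  \det (y%:M + N *m M) * y ^+ k = y ^+ n * \det (y%:M + M *m N).
Proof.
pose X := (block_mx y%:M N (- M) 1%:M : 'M[R]_(n + k)).
have dX : \det X = \det (y%:M + N *m M).
  have : X *m block_mx 1%:M 0 M 1%:M = block_mx (y%:M + N *m M) N 0 1%:M.
    rewrite mulmx_block !mulmx1 !mulmx0 !add0r !mul1mx.
    by rewrite addNr.
  move/(congr1 determinant); rewrite det_mulmx det_lblock !det1 !mulr1 det_ublock.
  by rewrite det1 mulr1.
have : block_mx 1%:M 0 M y%:M *m X = block_mx y%:M N 0 (y%:M + M *m N).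
  rewrite mulmx_block !mul1mx !mul0mx !addr0 mul_mx_scalar mul_scalar_mx scalerN.
  by rewrite subrr mulmx1 addrC.
move/(congr1 determinant).
by rewrite det_mulmx det_lblock det1 mul1r det_ublock !det_scalar dX mulrC.
Qed.

Lemma sylvester1 (R : comNzRingType) n k (N : 'M[R]_(n, k)) (M : 'M[R]_(k, n)) :
  \det (1%:M + N *m M) = \det (1%:M + M *m N).
Proof. by have := sylvester N M 1; rewrite !expr1n mulr1 mul1r. Qed.

(** Multilinearity in the rows. The auxiliary matrix C carries the rows outside the list, so that
    the induction on the list can fix the choice made for one row. *)
Lemma det_pick_rows (R : idomainType) n (A B : 'M[R]_n) :
  \det (A + B) = \sum_(S : {set 'I_n})
    \det (\matrix_(i, j) if i \in S then B i j else A i j).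
Proof.
suff H (r : seq 'I_n) (C : 'M[R]_n) : uniq r ->
    \det (\matrix_(i, j) if i \in r then A i j + B i j else C i j) =
    \sum_(S : {set 'I_n} | S \subset r)
       \det (\matrix_(i, j) if i \in S then B i j else
                            if i \in r then A i j else C i j).
  have := H (enum 'I_n) 0 (enum_uniq _).
  under eq_mx do rewrite mem_enum.
  rewrite (_ : \matrix_(i, j) _ = A + B); last by apply/matrixP => i j; rewrite !mxE.
  move=> ->; apply: eq_big => [S|S _].
    by apply/fintype.subsetP => i _; rewrite mem_enum.
  by congr determinant; apply/matrixP => i j; rewrite !mxE mem_enum.
elim: r C => [|k r IH] C /=.
  move=> _; rewrite (big_pred1 finset.set0) => [|S]; last first.
    rewrite /= -finset.subset0; apply/fintype.subsetP/fintype.subsetP => h i /h; by rewrite inE.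
  by congr determinant; apply/matrixP => i j; rewrite !mxE !inE.
move=> /andP[kr ur].
rewrite (bigID (fun S : {set 'I_n} => k \in S)) /= addrC.
pose CA := \matrix_(i, j) if i == k then A i j else C i j.
pose CB := \matrix_(i, j) if i == k then B i j else C i j.
have -> : \det (\matrix_(i, j) (if i \in k :: r then A i j + B i j else C i j)) =
   \det (\matrix_(i, j) if i \in r then A i j + B i j else CA i j) +
   \det (\matrix_(i, j) if i \in r then A i j + B i j else CB i j).
  rewrite -[X in X + _]mul1r -[X in _ + X]mul1r.
  apply: (determinant_multilinear (i0 := k)).
  - by apply/rowP => j; rewrite !mxE inE eqxx (negbTE kr) /= !mul1r.
  - by apply/matrixP => i j; rewrite !mxE inE lift_eqF.
  - by apply/matrixP => i j; rewrite !mxE inE lift_eqF.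
rewrite !IH //; congr (_ + _).
  apply: eq_big => [S|S SA].
    apply/fintype.subsetP/andP => [h|[/fintype.subsetP h kS] i iS].
      split; first by apply/fintype.subsetP => i /h; rewrite inE => ->; rewrite orbT.
      by apply: contra kr => /h.
    have := h i iS; rewrite inE => /predU1P[ik|//].
    by move: kS; rewrite -ik iS.
  congr determinant; apply/matrixP => i j; rewrite !mxE.
  case: ifP => // iS; rewrite inE; case: ifP => ir; last by rewrite orbF.
  by case: eqP => [//|_] /=.
rewrite [RHS](reindex_onto (fun S => k |: S) (fun S => S :\ k)) /=; last first.
  by move=> S /andP[_ kS]; rewrite finset.setD1K.
apply: eq_big => [S|S SA].
  apply/idP/andP => [Sr|[/andP[/fintype.subsetP h _] /eqP hS]].
    have kS : k \notin S by apply: contra kr => /(fintype.subsetP Sr).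
    rewrite setU11 setU1K // eqxx; split=> //; rewrite andbT; apply/fintype.subsetP => i.
    by rewrite !inE => /predU1P[->|/(fintype.subsetP Sr) ->]; rewrite ?eqxx ?orbT.
  apply/fintype.subsetP => i iS.
  have := iS; rewrite -hS !inE => /andP[ik _].
  by have := h i; rewrite !inE iS orbT (negbTE ik) => /(_ isT).
congr determinant; apply/matrixP => i j; rewrite !mxE !inE.
have kS : k \notin S by apply: contra kr => /(fintype.subsetP SA).
have [->|ik] /= := eqVneq i k; first by rewrite (negbTE kS) (negbTE kr).
by [].
Qed.

(** With E the 0-1 matrix that selects the rows f, [sylvester] relates E A E^T to E^T E A. With y =
    X the powers of X cancel, after which X is set to 0. *)
Lemma det_minor_pick (R : idomainType) n k (f : 'I_k -> 'I_n) (A : 'M[R]_n) :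
  injective f ->
  \det (\matrix_(i, j) A (f i) (f j)) =
  \det (\matrix_(i, j) if i \in [set f x | x : 'I_k] then A i j else (i == j)%:R).
Proof.
move=> finj; set S := [set f x | x : 'I_k].
have kn : (k <= n)%N by have := leq_card f finj; rewrite !card_ord.
pose E : 'M[{poly R}]_(k, n) := \matrix_(i, j) (f i == j)%:R.
pose pA := map_mx polyC A.
have EA i j : (E *m pA) i j = pA (f i) j.
  rewrite mxE (bigD1 (f i)) //= !mxE eqxx mul1r big1 ?addr0 // => l lf.
  by rewrite mxE eq_sym (negbTE lf) mul0r.
have EAE : (E *m pA) *m E^T = \matrix_(i, j) pA (f i) (f j).
  apply/matrixP => i j; rewrite mxE (bigD1 (f j)) //= EA !mxE eqxx mulr1.
  rewrite big1 ?addr0 // => l lf.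
  by rewrite [E^T _ _]mxE [E _ _]mxE eq_sym (negbTE lf) mulr0.
have ETEA : E^T *m (E *m pA) = \matrix_(i, j) if i \in S then pA i j else 0.
  apply/matrixP => i j; rewrite mxE [RHS]mxE.
  case: ifP => [/imsetP[x _ ->]|iS].
    rewrite (bigD1 x) //= EA !mxE eqxx mul1r big1 ?addr0 // => l lx.
    by rewrite [E^T _ _]mxE [E _ _]mxE (inj_eq finj) (negbTE lx) mul0r.
  rewrite big1 // => l _; rewrite [E^T _ _]mxE [E _ _]mxE.
  have [fi|] := eqVneq (f l) i; last by rewrite mul0r.
  by move: iS; rewrite -fi imset_f.
have cardS : #|S| = k by rewrite card_imset // card_ord.
have := sylvester E^T (E *m pA) 'X; rewrite EAE ETEA.
have -> : \det ('X%:M + \matrix_(i, j) (if i \in S then pA i j else 0)) =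
   'X ^+ (n - k) *
   \det (\matrix_(i, j) if i \in S then 'X *+ (i == j) + pA i j else (i == j)%:R).
  have -> : 'X%:M + \matrix_(i, j) (if i \in S then pA i j else 0) =
    diag_mx (\row_i if i \in S then 1 else 'X) *m
    (\matrix_(i, j) if i \in S then 'X *+ (i == j) + pA i j else (i == j)%:R).
    apply/matrixP => i j; rewrite mul_diag_mx !mxE.
    case: ifP => _; first by rewrite mul1r.
    by rewrite addr0 mulr_natr.
  rewrite det_mulmx det_diag; congr (_ * _).
  under eq_bigr do rewrite mxE.
  rewrite (bigID (mem S)) /= big1 ?mul1r; last by move=> i ->.
  rewrite (eq_bigr (fun=> 'X)); last by move=> i /negbTE ->.
  rewrite prodr_const; congr (_ ^+ _).
  have := cardC (mem S); rewrite cardS [in RHS]card_ord => h.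
  by apply: (@addnI k); rewrite subnKC //; apply: etrans h; congr (_ + _)%N; apply: eq_card.
rewrite mulrAC -exprD subnK // => /mulfI.
rewrite expf_eq0 polyX_eq0 andbF => /(_ isT) /(congr1 (fun p => p.[0])).
rewrite -!/(horner_eval 0 _) -!det_map_mx => h.
have -> : \matrix_(i, j) A (f i) (f j) =
   map_mx (horner_eval 0) ('X%:M + \matrix_(i, j) pA (f i) (f j)).
  by apply/matrixP => i j; rewrite !mxE /horner_eval hornerD hornerMn hornerX mul0rn add0r hornerC.
rewrite -h; congr determinant; apply/matrixP => i j; rewrite !mxE.
case: ifP => _; rewrite /= /horner_eval; first by rewrite hornerD hornerMn hornerX mul0rn add0r hornerC.
by rewrite -polyC_natr hornerC.
Qed.

(** Summing over all maps instead of subsets matches iterated integrals: a non-injective map repeats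
    a row, and a subset of size k is the image of k! injective maps. *)
Lemma fredholm_expansion (R : realFieldType) n (A : 'M[R]_n) :
  \det (1%:M + A) =
  \sum_(k < n.+1) (k`!%:R)^-1 *
    \sum_(f : {ffun 'I_k -> 'I_n}) \det (\matrix_(i, j) A (f i) (f j)).
Proof.
pose P (S : {set 'I_n}) := \det (\matrix_(i, j) if i \in S then A i j else (i == j)%:R).
rewrite det_pick_rows.
rewrite (eq_bigr P); last first.
  by move=> S _; congr determinant; apply/matrixP => i j; rewrite !mxE.
rewrite (partition_big (fun S : {set 'I_n} => inord #|S| : 'I_n.+1) xpredT) //=.
apply: eq_bigr => k _.
have cS (S : {set 'I_n}) : (inord #|S| == k) = (#|S| == k).
  rewrite -val_eqE /= inordK // ltnS; apply: leq_trans (max_card _) _.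
  by rewrite card_ord.
rewrite (bigID (fun f : {ffun 'I_k -> 'I_n} => injectiveb f)) /=.
rewrite [X in _ + X]big1 ?addr0; last first.
  move=> f /injectivePn[i [j ij fij]].
  by apply: (determinant_alternate ij) => l; rewrite !mxE fij.
rewrite (partition_big (fun f : {ffun 'I_k -> 'I_n} => [set f x | x : 'I_k])
   (fun S => #|S| == k)) /=; last first.
  by move=> f /injectiveP finj; rewrite card_imset // card_ord.
rewrite mulr_sumr; apply: eq_big => [S|S]; first exact: cS.
rewrite cS => /eqP Sk.
rewrite (eq_bigr (fun=> P S)); last first.
  by move=> f /andP[/injectiveP finj /eqP fS]; rewrite det_minor_pick // fS.
rewrite sumr_const -[X in _ * X]mulr_natl mulrA.
suff -> : #|[pred f : {ffun 'I_k -> 'I_n} | injectiveb f & [set f x | x : 'I_k] == S]| = k`!.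
  by rewrite mulVf ?mul1r // pnatr_eq0 -lt0n fact_gt0.
have := card_inj_ffuns_on 'I_k (mem S); rewrite card_ord Sk ffactnn => <-.
rewrite cardsE; apply: eq_card => f; rewrite inE [RHS]unfold_in /= [RHS]andbC.
have [/injectiveP finj|//] := boolP (injectiveb f); rewrite /=.
apply/eqP/ffun_onP => [<- x|h]; first exact: imset_f.
apply/eqP; rewrite eqEcard card_imset // card_ord Sk leqnn andbT.
by apply/fintype.subsetP => y /imsetP[x _ ->]; exact: h.
Qed.

(** * Convergence of Fredholm determinants *)

Lemma Rintegral_dominated_cvg d (T : measurableType d) (R : realType)
    (mu : {measure set T -> \bar R}) (D : set T) (f_ : nat -> T -> R)
    (f g : T -> R) :
  measurable D -> (forall n, measurable_fun D (f_ n)) ->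
  (forall x, D x -> f_ ^~ x @ \oo --> f x) ->
  mu.-integrable D (EFin \o g) ->
  (\forall n \near \oo, forall x, D x -> `|f_ n x| <= g x) ->
  \int[mu]_(x in D) f_ n x @[n --> \oo] --> \int[mu]_(x in D) f x.
Proof.
move=> mD mf cf ig [N0 _ bd].
rewrite -(cvg_shiftn N0).
have mEf n : measurable_fun D (fun x => (f_ n x)%:E) by exact/measurable_EFinP.
have cEf x : D x -> (f_ (n + N0)%N x)%:E @[n --> \oo] --> (f x)%:E.
  move=> Dx; apply: cvg_EFin; first by apply: nearW.
  by rewrite (_ : fine \o _ = fun n => f_ (n + N0)%N x)//; rewrite (cvg_shiftn N0 (f_ ^~ x)); exact: cf.
have mf' : measurable_fun D (fun x => (f x)%:E).
  by apply: (emeasurable_fun_cvg (fun n x => (f_ (n + N0)%N x)%:E)) => //.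
have [] := @dominated_convergence _ _ _ mu D mD (fun n x => (f_ (n + N0)%N x)%:E)
   (fun x => (f x)%:E) (fun x => (g x)%:E) _ mf' _ ig _ => //.
- by apply: aeW => x; exact: cEf.
- apply: aeW => x n Dx /=; rewrite lee_fin; apply: bd => //=.
  by rewrite leq_addl.
move=> ifi _ h.
move: h; rewrite -(fineK (integrable_fin_num mD ifi)) => /fine_cvg h.
exact: h.
Qed.

Lemma integrable_EFinD d (T : measurableType d) (R : realType)
    (mu : {measure set T -> \bar R}) (D : set T) (f g : T -> R) :
  measurable D -> mu.-integrable D (EFin \o f) -> mu.-integrable D (EFin \o g) ->
  mu.-integrable D (EFin \o (fun x => f x + g x)).
Proof.
move=> mD mf mg; have := integrableD mD mf mg; apply: eq_integrable => // x _ /=.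
Qed.

Lemma integrable_EFinZ d (T : measurableType d) (R : realType)
    (mu : {measure set T -> \bar R}) (D : set T) (f : T -> R) (c : R) :
  measurable D -> mu.-integrable D (EFin \o f) ->
  mu.-integrable D (EFin \o (fun x => c * f x)).
Proof.
move=> mD mf; have := integrableZl mD c mf; apply: eq_integrable => // x _ /=.
Qed.

(** * Lattice sums as integrals of step functions *)

Section step_functions.
Variables (R : realType) (y kappa : R) (b : nat).
Hypothesis kappa0 : 0 < kappa.
Notation mu := (@lebesgue_measure R).

(** Cell of x in the grid of mesh 1 / kappa that starts at y. [Num.truncn] is the floor only for
    non-negative arguments, hence the conditions y <= x below. *)
Definition step_index (x : R) : nat := Num.truncn ((x - y) * kappa).

Definition step_itv (p : nat) : set R := `[y + p%:R / kappa, y + p.+1%:R / kappa[.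

Lemma step_itvP (x : R) p : y <= x -> step_itv p x <-> p = step_index x.
Proof.
move=> yx; rewrite /step_itv /= in_itv /= -lerBrDl -ltrBlDl ler_pdivrMr //.
rewrite ltr_pdivlMr // /step_index.
have h0 : 0 <= (x - y) * kappa by rewrite mulr_ge0 ?subr_ge0 // ltW.
split=> [h|->]; last exact: truncn_itv.
by apply/esym/truncn_def.
Qed.

Lemma step_decomp (phi : nat -> R) (x : R) :
  (forall p, (b <= p)%N -> phi p = 0) -> y <= x ->
  phi (step_index x) = \sum_(p < b) phi p * \1_(step_itv p) x.
Proof.
move=> phi0 yx; set q := step_index x.
have E p : \1_(step_itv p) x = (p == q)%:R :> R.
  rewrite indicE; congr (_%:R); congr nat_of_bool; apply/idP/eqP.
    by rewrite inE => /(step_itvP _ yx).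
  by move=> pq; rewrite inE; apply/(step_itvP _ yx).
have [qb|bq] := ltnP q b; last first.
  rewrite phi0 // big1 // => p _; rewrite E (_ : (_ == _) = false) ?mulr0 //.
  by apply/negbTE; rewrite neq_ltn (leq_trans (ltn_ord p) bq).
rewrite (bigD1 (Ordinal qb)) //= E eqxx mulr1 big1 ?addr0 // => p pq.
by rewrite E; move: pq; rewrite -val_eqE /= => /negbTE ->; rewrite mulr0.
Qed.

Lemma step_integrable (phi : nat -> R) (D : set R) :
  measurable D -> D `<=` `[y, +oo[ ->
  (forall p, (b <= p)%N -> phi p = 0) ->
  mu.-integrable D (EFin \o (phi \o step_index)).
Proof.
move=> mD Dy phi0.
apply: (@eq_integrable _ _ _ mu D mD (fun x => \sum_(p < b) (phi p * \1_(step_itv p) x)%:E)%E).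
  move=> x xD /=; rewrite sumEFin; congr EFin; rewrite -step_decomp //.
  by move: xD; rewrite inE => /Dy /=; rewrite in_itv /= andbT.
apply: integrable_sum => //= p _.
under eq_fun do rewrite EFinM.
apply: integrableZl => //; apply: (@integrableS _ _ _ mu setT) => //.
exact: integrable_indic_itv.
Qed.

Lemma step_Rintegral (phi : nat -> R) :
  (forall p, (b <= p)%N -> phi p = 0) ->
  \int[mu]_(x in `]y, +oo[) phi (step_index x) = kappa^-1 * \sum_(p < b) phi p.
Proof.
move=> phi0.
have int_ind p D : measurable D -> mu.-integrable D (EFin \o (\1_(step_itv p) : R -> R)).
  move=> mD; apply: (@integrableS _ _ _ mu setT) => //.
  exact: integrable_indic_itv.
rewrite Rintegral_itv_obnd_cbnd; last first.
  apply: (@step_integrable phi) => // x /=; rewrite !in_itv /= !andbT; exact: ltW.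
rewrite (@eq_Rintegral _ _ _ mu _ (fun x => \sum_(p < b) phi p * \1_(step_itv p) x)); last first.
  by move=> x; rewrite inE /= in_itv /= andbT => yx; exact: step_decomp.
have H (r : seq 'I_b) : mu.-integrable `[y, +oo[ (EFin \o (fun x => \sum_(p <- r) phi p * \1_(step_itv p) x)) /\
  \int[mu]_(x in `[y, +oo[) (\sum_(p <- r) phi p * \1_(step_itv p) x) =
    \sum_(p <- r) phi p * kappa^-1.
  elim: r => [|p r [IH1 IH2]].
    split.
      apply: (@eq_integrable _ _ _ mu _ _ (cst 0%E)) => //; last exact: integrable0.
      by move=> x _ /=; rewrite big_nil.
    under eq_Rintegral do rewrite big_nil.
    by rewrite Rintegral_cst // mul0r big_nil.
  have i1 : mu.-integrable `[y, +oo[ (EFin \o (fun x => phi p * \1_(step_itv p) x)).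
    by apply: integrable_EFinZ => //; exact: int_ind.
  split.
    under [X in _ (EFin \o X)]eq_fun do rewrite big_cons.
    exact: integrable_EFinD.
  under eq_Rintegral do rewrite big_cons.
  rewrite RintegralD // IH2 big_cons; congr (_ + _).
  rewrite RintegralZl //; last exact: int_ind.
  congr (_ * _); rewrite /Rintegral.
  have -> : (\int[mu]_(x in `[y, +oo[) (\1_(step_itv p) x)%:E = mu (step_itv p))%E.
    have ms : measurable (step_itv p) by exact: measurable_itv.
    rewrite integral_indic //; congr (mu _); apply: setIidl => x.
    rewrite /step_itv /= !in_itv /= andbT => /andP[h _].
    by apply: le_trans h; rewrite lerDl divr_ge0 // ltW.
  rewrite lebesgue_measure_itv /= lte_fin ltrD2l ltr_pM2r ?invr_gt0 //.
  rewrite ltr_nat ltnSn -EFinD /=.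
  by rewrite opprD addrACA subrr add0r -mulrBl -natrB // subSnn mul1r.
by rewrite (H _).2 -mulr_suml mulrC.
Qed.

End step_functions.

(** Shaped like [iter_integral], so that both recursions unfold together; [nested_sum_ffun] leads
    back to the maps of [fredholm_expansion]. *)
Fixpoint nested_sum (R : realType) (b k : nat) (Phi : seq nat -> R) : R :=
  if k is m.+1 then \sum_(p < b) nested_sum b m (fun s => Phi (nat_of_ord p :: s))
  else Phi [::].

Lemma nested_sum0 (R : realType) (b k : nat) (Phi : seq nat -> R) :
  (forall s, Phi s = 0) -> nested_sum b k Phi = 0.
Proof.
elim: k Phi => [|k IH] Phi Phi0 //=.
by rewrite big1 // => p _; apply: IH => s; exact: Phi0.
Qed.

Lemma nested_sum_ffun (R : realType) (b k : nat) (Phi : seq nat -> R) :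
  nested_sum b k Phi =
  \sum_(f : {ffun 'I_k -> 'I_b}) Phi [seq nat_of_ord (f i) | i <- enum 'I_k].
Proof.
elim: k Phi => [|k IH] Phi /=.
  have /card1P[f0 hf0] : #|{: {ffun 'I_0 -> 'I_b}}| == 1%N.
    by rewrite card_ffun [X in (_ ^ X)%N]card_ord.
  rewrite (big_pred1 f0) => [|f]; last by rewrite /= -[RHS](hf0 f).
  by rewrite enum_ord0.
under eq_bigr do rewrite IH.
rewrite pair_big /=.
pose F (pf : 'I_b * {ffun 'I_k -> 'I_b}) : {ffun 'I_k.+1 -> 'I_b} :=
  [ffun i => if unlift ord0 i is Some j then pf.2 j else pf.1].
pose G (f : {ffun 'I_k.+1 -> 'I_b}) : 'I_b * {ffun 'I_k -> 'I_b} :=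
  (f ord0, [ffun j => f (lift ord0 j)]).
rewrite [RHS](reindex F) /=; last first.
  exists G => [[p f] _|f _].
    rewrite /G /F !ffunE unlift_none; congr pair.
    by apply/ffunP => j; rewrite !ffunE liftK.
  apply/ffunP => i; rewrite /F /G !ffunE /=.
  by case: unliftP => [j|] -> //; rewrite ffunE.
apply: eq_bigr => -[p f] _ /=; congr (Phi _).
rewrite enum_ordSl /= /F ffunE unlift_none /= -map_comp; congr cons.
by apply: eq_map => j /=; rewrite ffunE liftK.
Qed.

Section iterated.
Variables (R : realType) (y : R).
Notation mu := (@lebesgue_measure R).
Notation Dy := (`]y, +oo[%classic : set R).

Lemma iter_integral_step (kappa : R) (b k : nat) (Phi : seq nat -> R) :
  0 < kappa -> (forall s, has (leq b) s -> Phi s = 0) ->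
  iter_integral y k (fun s => Phi (map (step_index y kappa) s)) =
  kappa ^- k * nested_sum b k Phi.
Proof.
move=> kappa0; elim: k Phi => [|k IH] Phi Phi0 /=; first by rewrite invr1 mul1r.
pose psi p := kappa ^- k * nested_sum b k (fun s => Phi (p :: s)).
rewrite (@eq_Rintegral _ _ _ mu _ (fun x => psi (step_index y kappa x))).
  rewrite (@step_Rintegral _ y kappa b) //.
    by rewrite -mulr_sumr mulrA exprS invfM.
  move=> p bp; rewrite /psi nested_sum0 ?mulr0 // => s.
  by apply: Phi0 => /=; rewrite bp.
move=> x _ /=; rewrite /psi -IH // => s hs.
by apply: Phi0 => /=; rewrite hs orbT.
Qed.

Lemma iter_step_integrable (kappa : R) (b k : nat) (Phi : seq nat -> R) :
  0 < kappa -> (forall s, has (leq b) s -> Phi s = 0) ->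
  mu.-integrable Dy (EFin \o
    (fun x => iter_integral y k (fun s => Phi (map (step_index y kappa) (x :: s))))).
Proof.
move=> kappa0 Phi0.
pose psi p := kappa ^- k * nested_sum b k (fun s => Phi (p :: s)).
have -> : (fun x => iter_integral y k (fun s => Phi (map (step_index y kappa) (x :: s))))
   = psi \o step_index y kappa.
  apply/funext => x /=; rewrite /psi -iter_integral_step // => s hs.
  by apply: Phi0 => /=; rewrite hs orbT.
apply: (@step_integrable _ y kappa b) => //.
  by move=> x /=; rewrite !in_itv /= !andbT; exact: ltW.
move=> p bp; rewrite /psi nested_sum0 ?mulr0 // => s.
by apply: Phi0 => /=; rewrite bp.
Qed.

Variable h : R -> R.
Hypothesis h0 : forall x, y < x -> 0 <= h x.
Hypothesis ih : mu.-integrable Dy (EFin \o h).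
Let I := \int[mu]_(x in Dy) h x.

(** C is left general because the induction fixes the outermost variable x and absorbs h x into the
    constant. *)
Lemma iter_integral_bound (kappa : R) (b k : nat) (Phi : seq nat -> R) (C : R) :
  0 < kappa -> 0 <= C -> (forall s, has (leq b) s -> Phi s = 0) ->
  (forall s, size s = k -> all (> y) s ->
     `|Phi (map (step_index y kappa) s)| <= C * \prod_(x <- s) h x) ->
  `|iter_integral y k (fun s => Phi (map (step_index y kappa) s))| <= C * I ^+ k.
Proof.
move=> kappa0; elim: k Phi C => [|k IH] Phi C C0 Phi0 bd.
  by rewrite expr0 /=; have := bd [::] erefl isT; rewrite big_nil.
have hI : forall x, Dy x -> `|iter_integral y k (fun s => Phi (map (step_index y kappa) (x :: s)))|
    <= (C * I ^+ k) * h x.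
  move=> x Dx; have yx : y < x by move: Dx; rewrite /= in_itv /= andbT.
  rewrite mulrAC; apply: (IH (fun s => Phi (step_index y kappa x :: s))).
  - by rewrite mulr_ge0 // h0.
  - by move=> s hs; apply: Phi0 => /=; rewrite hs orbT.
  - move=> s sk ys; have := bd (x :: s); rewrite /= sk big_cons mulrA; apply=> //.
    by rewrite yx.
have ii := @iter_step_integrable kappa b k Phi kappa0 Phi0.
apply: le_trans (le_normr_Rintegral _ ii) _ => //.
rewrite exprSr mulrA -RintegralZl //.
apply: le_Rintegral => //.
- have := integrable_norm ii; apply: eq_integrable => // x _ /=.
- exact: integrable_EFinZ.
Qed.

Variables (kappa : nat -> R) (b : nat -> nat).
Hypothesis kappa0 : forall N, 0 < kappa N.

(** Dominated convergence one variable at a time: the inner integrals converge by induction, and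
    [iter_integral_bound] gives the multiple of h that dominates in the outer variable. *)
Lemma iter_integral_cvg k (Phi : nat -> seq nat -> R) (f : seq R -> R) (C : R) :
  0 <= C -> (forall N s, has (leq (b N)) s -> Phi N s = 0) ->
  (\forall N \near \oo, forall s, size s = k -> all (> y) s ->
     `|Phi N (map (step_index y (kappa N)) s)| <= C * \prod_(x <- s) h x) ->
  (forall s, size s = k -> all (> y) s ->
     Phi N (map (step_index y (kappa N)) s) @[N --> \oo] --> f s) ->
  iter_integral y k (fun s => Phi N (map (step_index y (kappa N)) s)) @[N --> \oo]
    --> iter_integral y k f.
Proof.
elim: k Phi f C => [|k IH] Phi f C C0 Phi0 bd cf /=.
  exact: (cf [::]).
apply: (@Rintegral_dominated_cvg _ _ _ mu Dy _ _ (fun x => (C * I ^+ k) * h x)) => //.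
- move=> N; have := measurable_int _ (@iter_step_integrable (kappa N) (b N) k (Phi N) (kappa0 N) (Phi0 N)).
  by move/measurable_EFinP.
- move=> x Dx; have yx : y < x by move: Dx; rewrite /= in_itv /= andbT.
  apply: (IH (fun N s => Phi N (step_index y (kappa N) x :: s)) _ (C * h x)).
  + by rewrite mulr_ge0 // h0.
  + by move=> N s hs; apply: Phi0 => /=; rewrite hs orbT.
  + near=> N => s sk ys.
    have : forall s, size s = k.+1 -> all (> y) s ->
      `|Phi N (map (step_index y (kappa N)) s)| <= C * \prod_(x <- s) h x by near: N.
    by move=> /(_ (x :: s)); rewrite /= sk yx ys big_cons mulrA => /(_ erefl isT).
  + by move=> s sk ys; apply: (cf (x :: s)); rewrite /= ?sk ?yx.
- exact: integrable_EFinZ.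
- near=> N => x Dx; have yx : y < x by move: Dx; rewrite /= in_itv /= andbT.
  rewrite mulrAC; apply: (@iter_integral_bound (kappa N) (b N) k (fun s => Phi N (step_index y (kappa N) x :: s))) => //.
  + by rewrite mulr_ge0 // h0.
  + by move=> s hs; apply: Phi0 => /=; rewrite hs orbT.
  + move=> s sk ys.
    have : forall s, size s = k.+1 -> all (> y) s ->
      `|Phi N (map (step_index y (kappa N)) s)| <= C * \prod_(x <- s) h x by near: N.
    by move=> /(_ (x :: s)); rewrite /= sk yx ys big_cons mulrA => /(_ erefl isT).
Unshelve. all: by end_near. Qed.

End iterated.

Lemma cvg_sumr (R : realType) (T : Type) (F : set_system T) (I : Type) (r : seq I)
    (f : I -> T -> R) (l : I -> R) : Filter F ->
  (forall i, f i x @[x --> F] --> l i) ->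
  \sum_(i <- r) f i x @[x --> F] --> \sum_(i <- r) l i.
Proof.
move=> FF cf; elim: r => [|i r IH].
  by under eq_fun do rewrite big_nil; rewrite big_nil; exact: cvg_cst.
under eq_fun do rewrite big_cons; rewrite big_cons.
by apply: cvgD; [exact: cf|exact: IH].
Qed.

Lemma cvg_prodr (R : realType) (T : Type) (F : set_system T) (I : Type) (r : seq I)
    (f : I -> T -> R) (l : I -> R) : Filter F ->
  (forall i, f i x @[x --> F] --> l i) ->
  \prod_(i <- r) f i x @[x --> F] --> \prod_(i <- r) l i.
Proof.
move=> FF cf; elim: r => [|i r IH].
  by under eq_fun do rewrite big_nil; rewrite big_nil; exact: cvg_cst.
under eq_fun do rewrite big_cons; rewrite big_cons.
by apply: cvgM; [exact: cf|exact: IH].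
Qed.

Lemma cvg_exprn (R : realType) (T : Type) (F : set_system T) (f : T -> R) (l : R) n :
  Filter F -> f x @[x --> F] --> l -> f x ^+ n @[x --> F] --> l ^+ n.
Proof.
move=> FF cf; elim: n => [|n IH]; first exact: cvg_cst.
by under eq_fun do rewrite exprS; rewrite exprS; exact: cvgM.
Qed.

Lemma cvg_det (R : realType) (T : Type) (F : set_system T) n
    (f : T -> 'I_n -> 'I_n -> R) (l : 'I_n -> 'I_n -> R) : Filter F ->
  (forall i j, f x i j @[x --> F] --> l i j) ->
  \det (\matrix_(i, j) f x i j) @[x --> F] --> \det (\matrix_(i, j) l i j).
Proof.
move=> FF cf; rewrite /determinant; apply: cvg_sumr => sg.
apply: cvgM; first exact: cvg_cst.
apply: cvg_prodr => i; under eq_fun do rewrite mxE; rewrite mxE; exact: cf.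
Qed.

(** Dominated convergence for series whose number of terms L N grows with N. *)
Lemma tannery (R : realType) (a_ : nat -> nat -> R) (a M : nat -> R)
    (L : nat -> nat) :
  (forall k, a_ N k @[N --> \oo] --> a k) ->
  (\forall N \near \oo, forall k, `|a_ N k| <= M k) ->
  cvgn (series M) -> (forall A, \forall N \near \oo, (A <= L N)%N) ->
  \sum_(0 <= k < L N) a_ N k @[N --> \oo] --> limn (series a).
Proof.
move=> ca bd cM Loo.
have aM k : `|a k| <= M k.
  rewrite -(cvg_lim (@Rhausdorff R) (cvg_norm (ca k))).
  apply: limr_le; first by apply/cvg_ex; eexists; exact: cvg_norm (ca k).
  by near=> N; have : forall k, `|a_ N k| <= M k by near: N.
have M0 k : 0 <= M k by apply: le_trans (aM k).
have cs : cvgn (series a).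
  apply: normed_cvg; apply: series_le_cvg cM => // k; exact: normr_ge0.
apply/cvgrPdist_le => /= e e0.
have e4 : 0 < e / 4 by rewrite divr_gt0.
have [K _ hK] : \forall K \near \oo, `|limn (series M) - series M K| <= e / 4.
  by move/cvgrPdist_le: cM; apply.
have tailM n : (K <= n)%N -> \sum_(K <= k < n) M k <= e / 4.
  move=> Kn; apply: le_trans (hK K (leqnn K)); apply: le_trans (ler_norm _).
  rewrite lerBrDl; have -> : series M K + \sum_(K <= k < n) M k = series M n.
    by rewrite /series /= -big_cat_nat.
  apply: nondecreasing_cvgn_le => //.
  by apply: nondecreasing_series => k _ _.
have tail (g : nat -> R) n : (forall k, `|g k| <= M k) -> (K <= n)%N ->
    `|\sum_(K <= k < n) g k| <= e / 4.
  move=> gM Kn; apply: le_trans (ler_norm_sum _ _ _) _; apply: le_trans (tailM n Kn).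
  exact: ler_sum.
have fin : \sum_(0 <= k < K) a_ N k @[N --> \oo] --> \sum_(0 <= k < K) a k.
  apply: cvg_sumr => k; exact: ca.
near=> N.
have KL : (K <= L N)%N by near: N; exact: Loo.
have bdN k : `|a_ N k| <= M k.
  by move: k; near: N.
have finN : `|\sum_(0 <= k < K) a k - \sum_(0 <= k < K) a_ N k| <= e / 4.
  by near: N; move/cvgrPdist_le: fin; apply.
have lim_tail : `|limn (series a) - \sum_(0 <= k < K) a k| <= e / 4.
  have c2 : series a n - \sum_(0 <= k < K) a k @[n --> \oo] --> limn (series a) - \sum_(0 <= k < K) a k.
    by apply: cvgB => //; exact: cvg_cst.
  rewrite -(cvg_lim (@Rhausdorff R) (cvg_norm c2)).
  apply: limr_le; first by apply/cvg_ex; eexists; exact: cvg_norm c2.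
  near=> n; have Kn : (K <= n)%N by near: n; exact: nbhs_infty_ge.
  rewrite /series /= (@big_cat_nat _ _ _ K) //= addrAC subrr add0r.
  exact: tail.
rewrite (@big_cat_nat _ _ _ K 0 (L N)) //=.
set A := limn (series a); set B := \sum_(0 <= k < K) a k in finN lim_tail *.
set B' := \sum_(0 <= k < K) a_ N k in finN *; set T := \sum_(K <= k < L N) a_ N k.
have hT : `|T| <= e / 4 by exact: tail.
have -> : A - (B' + T) = (A - B) + (B - B') - T by ring.
apply: le_trans (ler_normB _ _) _; apply: le_trans (lerD (ler_normD _ _) (lexx _)) _.
by move: finN lim_tail hT e0; lra.
Unshelve. all: by end_near. Qed.

Lemma expR_integrable (R : realType) (a y : R) : 0 < a ->
  (@lebesgue_measure R).-integrable (`]y, +oo[%classic)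
    (EFin \o (fun x => expR (- a * (x - y)))).
Proof.
move=> a0.
have ca : continuous (fun x : R => expR (- a * (x - y))).
  move=> x; apply: continuous_comp; last exact: continuous_expR.
  by apply: continuousM; [exact: cvg_cst|apply: continuousB => //; exact: cvg_cst].
apply: (@integrableS _ _ _ lebesgue_measure (`[y, +oo[%classic : set R)) => //.
  by move=> x /=; rewrite !in_itv /= !andbT; exact: ltW.
apply/integrableP; split.
  apply/measurable_EFinP; apply: measurable_funTS; exact: continuous_measurable_fun.
under eq_integral do rewrite /= ger0_norm ?expR_ge0 //.
rewrite (@ge0_continuous_FTC2y R _ (fun x : R => - a^-1 * expR (- a * (x - y))) _ 0) ?ltry //.
- exact: continuous_subspaceT.
- have -> : 0 = - a^-1 * 0 :> R by rewrite mulr0.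
  under eq_fun do rewrite [- a * _]mulNr.
  apply: cvgM; first exact: cvg_cst.
  apply: (cvg_comp (fun x => a * (x - y)) (fun x => expR (- x))); last exact: cvgr_expR.
  apply/cvgryPge => A; near=> x.
  rewrite -ler_pdivrMl // lerBrDr; near: x; apply: nbhs_pinfty_ge; exact: num_real.
- apply: cvg_at_right_filter; apply: cvgM; [exact: cvg_cst|exact: ca].
- move=> x _; rewrite derive1E.
  have d : is_derive x (1 : R) (fun x : R => - a^-1 * expR (- a * (x - y))) (expR (- a * (x - y))).
    apply: is_derive_eq.
    rewrite /GRing.scale /=; field; exact: lt0r_neq0.
  by rewrite derive_val.
Unshelve. all: by end_near. Qed.

Lemma sqrt_amgm (R : realType) (p q : R) : 0 <= p -> 0 <= q ->
  Num.sqrt (p * q) <= 2^-1 * (p + q).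
Proof.
move=> p0 q0; have pq : 0 <= 2^-1 * (p + q) by rewrite mulr_ge0 ?addr_ge0.
rewrite -(@ler_pXn2r _ 2) ?nnegrE ?sqrtr_ge0 //.
rewrite sqr_sqrtr ?mulr_ge0 //.
have := sqr_ge0 (p - q); nra.
Qed.

(** Since k^k / k! <= e^k, the left side is at most the geometric mean of (2 e X^2)^k / k! and 2^-k,
    both summable. *)
Lemma sqrt_expn_fact_le (R : realType) (X : R) k : 0 <= X ->
  (k`!%:R)^-1 * Num.sqrt ((k ^ k)%:R) * X ^+ k <=
  2^-1 * ((expR 1 * 2 * X ^+ 2) ^+ k / k`!%:R + 2^-1 ^+ k) :> R.
Proof.
move=> X0.
have f0 : 0 < k`!%:R :> R by rewrite ltr0n fact_gt0.
have hk : (k ^ k)%:R / k`!%:R <= expR 1 ^+ k :> R.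
  case: k f0 => [|k] _; first by rewrite fact0 divr1 expr0.
  have := @expR_ge1Dxn R k.+1%:R k (ler0n _ _).
  rewrite -expRM_natl mulr1 natrX; apply: le_trans.
  by rewrite lerDr.
pose p := expR 1 ^+ k * (2 * X ^+ 2) ^+ k / k`!%:R; pose q : R := 2^-1 ^+ k.
have p0 : 0 <= p by rewrite /p !mulr_ge0 ?exprn_ge0 ?expR_ge0 ?invr_ge0 ?mulr_ge0 ?exprn_ge0 // ltW.
have q0 : 0 <= q by rewrite exprn_ge0.
have -> : (expR 1 * 2 * X ^+ 2) ^+ k / k`!%:R = p by rewrite /p -mulrA exprMn.
apply: (@le_trans _ _ (Num.sqrt (p * q))); last first.
  exact: sqrt_amgm.
have -> : (k`!%:R)^-1 * Num.sqrt ((k ^ k)%:R) * X ^+ k =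
   Num.sqrt ((k ^ k)%:R / k`!%:R * (X ^+ 2) ^+ k / k`!%:R) :> R.
  have -> : (k ^ k)%:R / k`!%:R * (X ^+ 2) ^+ k / k`!%:R =
     (k ^ k)%:R * ((k`!%:R)^-1 * X ^+ k) ^+ 2 :> R.
    rewrite -exprM mulnC exprM; field; exact: lt0r_neq0.
  rewrite sqrtrM ?ler0n // sqrtr_sqr ger0_norm; first by ring.
  by rewrite mulr_ge0 ?exprn_ge0 // invr_ge0 ltW.
rewrite ler_wsqrtr //.
have -> : p * q = expR 1 ^+ k * (X ^+ 2) ^+ k / k`!%:R * (2 * 2^-1) ^+ k.
  by rewrite /p /q !(exprMn k 2); ring.
rewrite divff // expr1n mulr1 ler_wpM2r ?invr_ge0 ?(ltW f0) // ler_wpM2r //.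
by rewrite exprn_ge0 // sqr_ge0.
Qed.

Lemma cvg_series_sqrt_expn_fact (R : realType) (X : R) : 0 <= X ->
  cvgn (series (fun k => (k`!%:R)^-1 * Num.sqrt ((k ^ k)%:R) * X ^+ k)).
Proof.
move=> X0.
pose v k : R := 2^-1 * ((expR 1 * 2 * X ^+ 2) ^+ k / k`!%:R + 2^-1 ^+ k).
apply: (@series_le_cvg _ _ v).
- move=> k; rewrite !mulr_ge0 ?exprn_ge0 ?sqrtr_ge0 ?invr_ge0 //.
- move=> k; rewrite /v mulr_ge0 ?addr_ge0 ?exprn_ge0 ?divr_ge0 //.
  by rewrite exprn_ge0 // !mulr_ge0 ?expR_ge0 ?sqr_ge0.
- by move=> k; exact: sqrt_expn_fact_le.
pose w : R^nat := exp_coeff (expR 1 * 2 * X ^+ 2) + geometric 1 2^-1.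
have -> : v = 2^-1 *: w.
  apply/funext => k; have -> : (2^-1 *: w) k =
      2^-1 * ((expR 1 * 2 * X ^+ 2) ^+ k / k`!%:R + 1 * 2^-1 ^+ k) by [].
  by rewrite mul1r.
apply: is_cvg_seriesZ; apply: is_cvg_seriesD; first exact: is_cvg_series_exp_coeff.
apply: is_cvg_geometric_series.
by rewrite ger0_norm // invf_lt1 // ltr1n.
Qed.

(** On b N lattice points the kernel is a step kernel of mesh 1 / kappa N, so each term of
    [fredholm_expansion] is an iterated integral with a limit. The scalar c N is there because the
    determinants to come carry a constant weight slightly below 1. *)
Theorem fredholm_det_cvg (R : realType) (y : R) (K : R -> R -> R)
    (kappa c : nat -> R) (b : nat -> nat) (KN : nat -> nat -> nat -> R) (C delta : R) :
  (forall N, 0 < kappa N) -> (\forall N \near \oo, 1 <= kappa N) ->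
  (forall A, \forall N \near \oo, (A <= b N)%N) ->
  0 <= C -> 0 < delta -> c N @[N --> \oo] --> (1 : R) ->
  (\forall N \near \oo, forall p q, (p < b N)%N -> (q < b N)%N ->
     `|kappa N * KN N p q| <=
       C * expR (- delta * (p%:R / kappa N)) * expR (- delta * (q%:R / kappa N))) ->
  (forall x, y < x -> \forall N \near \oo, (step_index y (kappa N) x < b N)%N) ->
  (forall x x', y < x -> y < x' ->
     kappa N * KN N (step_index y (kappa N) x) (step_index y (kappa N) x')
       @[N --> \oo] --> K x x') ->
  \det (1%:M - c N *: \matrix_(i < b N, j < b N) KN N i j) @[N --> \oo]
    --> Fredholm_det K y.
Proof.
move=> kappa0 kappa1 boo C0 delta0 c1 bd bx cK.
(* Rounding x - y down to the grid loses at most 1 / kappa N <= 1 in each of the two exponents. *)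
pose C' := C * expR delta ^+ 2.
have C'0 : 0 <= C' by rewrite mulr_ge0 ?exprn_ge0 ?expR_ge0.
pose h0 (x : R) := expR (- delta * (x - y)).
pose h (x : R) := expR (- (delta *+ 2) * (x - y)).
have hh x : h0 x * h0 x = h x by rewrite /h0 /h -expRD; congr expR; ring.
(* The integrals run to infinity, so indices outside the matrix must be cut off. *)
pose Psi k N s : R := if has (leq (b N)) s then 0 else
  \det (\matrix_(i < k, j < k) (kappa N * KN N (nth 0%N s i) (nth 0%N s j))).
pose T k N := iter_integral y k (fun s => Psi k N (map (step_index y (kappa N)) s)).
pose Tl k := iter_integral y k (fun s => \det (\matrix_(i < k, j < k) K s`_i s`_j)).
have Psi0 k N s : has (leq (b N)) s -> Psi k N s = 0 by rewrite /Psi => ->.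
have h_ge0 x : y < x -> 0 <= h x by move=> _; exact: expR_ge0.
have ih : (@lebesgue_measure R).-integrable (`]y, +oo[%classic) (EFin \o h).
  by apply: expR_integrable; rewrite mulrn_wgt0.
have Psibd : \forall N \near \oo, forall k s, size s = k -> all (> y) s ->
    `|Psi k N (map (step_index y (kappa N)) s)| <=
      Num.sqrt ((k ^ k)%:R) * C' ^+ k * \prod_(x <- s) h x.
  near=> N => k s sk ys.
  have kN1 : 1 <= kappa N by near: N.
  have bdN : forall p q, (p < b N)%N -> (q < b N)%N ->
     `|kappa N * KN N p q| <=
       C * expR (- delta * (p%:R / kappa N)) * expR (- delta * (q%:R / kappa N)) by near: N.
  have rhs0 : 0 <= Num.sqrt ((k ^ k)%:R) * C' ^+ k * \prod_(x <- s) h x.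
    rewrite !mulr_ge0 ?sqrtr_ge0 ?exprn_ge0 //.
    by rewrite prodr_ge0 // => x _; exact: expR_ge0.
  rewrite /Psi; case: ifPn => [_|/hasPn hs]; first by rewrite normr0.
  have stepb x : y < x -> expR (- delta * ((step_index y (kappa N) x)%:R / kappa N)) <=
      expR delta * h0 x.
    move=> yx; rewrite /h0 -expRD ler_expR.
    have : x - y < ((step_index y (kappa N) x).+1)%:R / kappa N.
      rewrite ltr_pdivlMr //; apply: truncnS_gt.
    rewrite -natr1 mulrDl => xy.
    have : 1 / kappa N <= 1 by rewrite ler_pdivrMr // mul1r.
    move: xy delta0; set p := _%:R / kappa N; set q := 1 / _; set z := x - y; nra.
  have := @hadamard_bound R k (\matrix_(i < k, j < k) (kappa N *
      KN N (nth 0%N (map (step_index y (kappa N)) s) i) (nth 0%N (map (step_index y (kappa N)) s) j)))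
    (fun i => C' * h0 s`_i) (fun j => h0 s`_j).
  have ssz (i : 'I_k) : (i < size s)%N by rewrite sk.
  have ysi (i : 'I_k) : y < s`_i by move/allP : ys; apply; exact: mem_nth.
  move=> /(_ _) hb.
  rewrite -(@ler_pXn2r _ 2) ?nnegrE // -normrX ger0_norm ?sqr_ge0 //.
  apply: le_trans (hb _) _ => [i j|].
    rewrite mxE !(nth_map 0) //; apply: le_trans (bdN _ _ _ _) _.
    - by rewrite ltnNge; apply: hs; rewrite map_f // mem_nth.
    - by rewrite ltnNge; apply: hs; rewrite map_f // mem_nth.
    - have -> : C' * h0 s`_i * h0 s`_j = C * (expR delta * h0 s`_i) * (expR delta * h0 s`_j).
        by rewrite /C'; ring.
      apply: ler_pM; rewrite ?mulr_ge0 ?expR_ge0 //; last exact: stepb.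
      by rewrite ler_wpM2l //; exact: stepb.
  set S := Num.sqrt _; set P := \prod_(x <- s) h x.
  have -> : (S * C' ^+ k * P) ^+ 2 = S ^+ 2 * ((C' ^+ 2) ^+ k * P ^+ 2).
    by rewrite -[(C' ^+ 2) ^+ k]exprM mulnC exprM; ring.
  rewrite sqr_sqrtr ?ler0n // ler_wpM2l ?ler0n //.
  rewrite le_eqVlt; apply/orP; left; apply/eqP.
  rewrite /P (big_nth 0) sk big_mkord -prodrXl.
  under eq_bigr do rewrite -mulrA hh (exprMn 2 C').
  by rewrite big_split /= prodr_const card_ord.
have cT k : T k N @[N --> \oo] --> Tl k.
  apply: (@iter_integral_cvg R y h h_ge0 ih kappa b kappa0 k (Psi k) _
    (Num.sqrt ((k ^ k)%:R) * C' ^+ k)).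
  - by rewrite mulr_ge0 ?sqrtr_ge0 ?exprn_ge0.
  - by move=> N s; exact: Psi0.
  - by near=> N; move=> s sk ys; move: s sk ys; move: k; near: N.
  - move=> s sk ys.
    have ssz (i : 'I_k) : (i < size s)%N by rewrite sk.
    have ysi (i : 'I_k) : y < s`_i by move/allP : ys; apply; exact: mem_nth.
    have : \forall N \near \oo, \det (\matrix_(i < k, j < k) (kappa N *
        KN N (step_index y (kappa N) s`_i) (step_index y (kappa N) s`_j))) =
        Psi k N (map (step_index y (kappa N)) s).
      have : \forall N \near \oo, forall x, x \in s -> (step_index y (kappa N) x < b N)%N.
        elim: s ys {sk ssz ysi} => [|x s IH] /=; first by move=> _; apply: nearW.
        move=> /andP[yx /IH IHs]; near=> N => z; rewrite inE => /predU1P[->|].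
          by near: N; exact: bx.
        by move: z; near: N.
      apply: filterS => N hN; rewrite /Psi ifF; last first.
        apply/negbTE/hasPn => p /mapP[x xs ->]; rewrite -ltnNge; exact: hN.
      by congr determinant; apply/matrixP => i j; rewrite !mxE !(nth_map 0).
    move=> hdet; apply: cvg_trans (near_eq_cvg hdet) _.
    by apply: cvg_det => i j; exact: cK.
pose I := \int[@lebesgue_measure R]_(x in `]y, +oo[) h x.
have I0 : 0 <= I by apply: Rintegral_ge0 => x _; exact: expR_ge0.
have detE N : \det (1%:M - c N *: \matrix_(i < b N, j < b N) KN N i j) =
  \sum_(0 <= k < (b N).+1) (- c N) ^+ k / k`!%:R * T k N.
  rewrite -scaleNr fredholm_expansion big_mkord; apply: eq_bigr => k _.
  rewrite mulrAC mulrC; congr (_ * _).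
  rewrite /T (@iter_integral_step R y (kappa N) (b N) k (Psi k N)) //; last first.
    by move=> s; exact: Psi0.
  rewrite nested_sum_ffun mulrA mulr_sumr; apply: eq_bigr => f _.
  rewrite /Psi ifF; last first.
    by apply/negbTE/hasPn => p /mapP[i _ ->]; rewrite -ltnNge.
  have nthE (i : 'I_k) : nth 0%N [seq nat_of_ord (f i) | i <- enum 'I_k] i = f i.
    by rewrite (nth_map i) ?size_enum_ord // nth_ord_enum.
  have -> : \matrix_(i < k, j < k) (kappa N * KN N (nth 0%N [seq nat_of_ord (f i) | i <- enum 'I_k] i)
       (nth 0%N [seq nat_of_ord (f i) | i <- enum 'I_k] j)) =
     kappa N *: \matrix_(i < k, j < k) KN N (f i) (f j).
    by apply/matrixP => i j; rewrite !mxE !nthE.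
  have -> : \matrix_(i < k, j < k) (- c N *: \matrix_(i0, j0) KN N i0 j0) (f i) (f j) =
      - c N *: \matrix_(i < k, j < k) KN N (f i) (f j).
    by apply/matrixP => i j; rewrite !mxE.
  rewrite !detZ mulrA; congr (_ * _).
  by rewrite -mulrA mulVf ?mulr1 // expf_neq0 // gt_eqF.
under eq_fun do rewrite detE.
rewrite /Fredholm_det.
(* The 2 in the majorant bounds [|c N|] for large N. *)
apply: (@tannery R (fun N k => (- c N) ^+ k / k`!%:R * T k N) _
   (fun k => (k`!%:R)^-1 * Num.sqrt ((k ^ k)%:R) * (2 * C' * I) ^+ k)).
- move=> k; apply: cvgM; last exact: cT.
  apply: cvgM; last exact: cvg_cst.
  by apply: cvg_exprn; apply: cvgN.
- near=> N => k.
  have c2 : `|c N| <= 2.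
    near: N; have /cvgrPdist_le/(_ 1 ltr01) := c1; apply: filterS => N hN.
    by rewrite -[c N](subrKC 1) addrC; apply: le_trans (ler_normD _ _) _; rewrite normr1 distrC; lra.
  have TN : `|T k N| <= Num.sqrt ((k ^ k)%:R) * C' ^+ k * I ^+ k.
    apply: (@iter_integral_bound R y h h_ge0 ih (kappa N) (b N) k (Psi k N)) => //.
    + by rewrite mulr_ge0 ?sqrtr_ge0 ?exprn_ge0.
    + by move=> s; exact: Psi0.
    + by move: k; near: N.
  rewrite normrM normrM normfV normrX normrN (ger0_norm (ler0n _ _)).
  have -> : (k`!%:R)^-1 * Num.sqrt ((k ^ k)%:R) * (2 * C' * I) ^+ k =
     (2 ^+ k / k`!%:R) * (Num.sqrt ((k ^ k)%:R) * C' ^+ k * I ^+ k) :> R.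
    by rewrite !exprMn; ring.
  apply: ler_pM => //.
  by rewrite ler_wpM2r ?invr_ge0 // lerXn2r ?nnegrE.
- by apply: cvg_series_sqrt_expn_fact; rewrite !mulr_ge0.
- move=> A; near=> N; rewrite ltnW // ltnS; near: N; exact: boo.
Unshelve. all: by end_near. Qed.

(** * Coefficients as contour integrals *)

Section circle.
Variable R : realType.
Notation C := R[i].
Notation mu := (@lebesgue_measure R).
Notation Re := complex.Re.
Notation Im := complex.Im.

(** Only real parts get integrated, but products mix both components, so continuity of both is
    carried along. *)
Definition ccont (f : R -> C) : Prop :=
  continuous (fun x => Re (f x)) /\ continuous (fun x => Im (f x)).

Lemma ReM (a b : C) : Re (a * b) = Re a * Re b - Im a * Im b.
Proof. by case: a b => [a1 a2] [b1 b2]. Qed.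
Lemma ImM (a b : C) : Im (a * b) = Re a * Im b + Im a * Re b.
Proof. by case: a b => [a1 a2] [b1 b2]. Qed.
Lemma ReD (a b : C) : Re (a + b) = Re a + Re b.
Proof. by case: a b => [a1 a2] [b1 b2]. Qed.
Lemma ImD (a b : C) : Im (a + b) = Im a + Im b.
Proof. by case: a b => [a1 a2] [b1 b2]. Qed.
Lemma ReV (a : C) : Re a^-1 = Re a / (Re a ^+ 2 + Im a ^+ 2).
Proof. by case: a. Qed.
Lemma ImV (a : C) : Im a^-1 = - Im a / (Re a ^+ 2 + Im a ^+ 2).
Proof. by case: a => x y /=; rewrite mulNr. Qed.
Lemma complex_ext (a b : C) : Re a = Re b -> Im a = Im b -> a = b.
Proof. by case: a b => [a1 a2] [b1 b2] /= -> ->. Qed.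

Lemma normc_sqr (a : C) : normc a ^+ 2 = Re a ^+ 2 + Im a ^+ 2.
Proof. by case: a => x y /=; rewrite sqr_sqrtr // addr_ge0 // sqr_ge0. Qed.

Lemma normc_ge0 (a : C) : 0 <= normc a.
Proof. by case: a => x y /=; exact: sqrtr_ge0. Qed.

Lemma abs_Re_le (a : C) : `|Re a| <= normc a.
Proof.
rewrite -(@ler_pXn2r _ 2) ?nnegrE ?normc_ge0 // normc_sqr real_normK ?num_real //.
by rewrite lerDl sqr_ge0.
Qed.

Lemma normcX (a : C) n : normc (a ^+ n) = normc a ^+ n.
Proof. by elim: n => [|n IH]; rewrite ?normc1 // !exprS normcM IH. Qed.

Lemma normc_exprz (a : C) (k : int) : normc (a ^ k) = normc a ^ k.
Proof.
case: k => n; first exact: normcX.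
by rewrite NegzE -!exprz_inv -!exprnP normcX normcV.
Qed.

Lemma normc_real (x : R) : normc (x%:C)%C = `|x|.
Proof. by rewrite /= expr0n /= addr0 sqrtr_sqr. Qed.

Lemma normc_gt0 (a : C) : a != 0 -> 0 < normc a.
Proof.
move=> a0; rewrite lt_def normc_ge0 andbT; apply: contra a0 => /eqP h.
by apply/eqP; exact: eq0_normc.
Qed.

Lemma ccont_cst c : ccont (fun=> c).
Proof. by split; move=> x; exact: cvg_cst. Qed.

Lemma ccontD f g : ccont f -> ccont g -> ccont (fun x => f x + g x).
Proof.
move=> [f1 f2] [g1 g2]; split => x; rewrite /continuous_at.
  by under eq_fun do rewrite ReD; rewrite ReD; apply: cvgD; [exact: f1|exact: g1].
by under eq_fun do rewrite ImD; rewrite ImD; apply: cvgD; [exact: f2|exact: g2].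
Qed.

Lemma ccontM f g : ccont f -> ccont g -> ccont (fun x => f x * g x).
Proof.
move=> [f1 f2] [g1 g2]; split => x; rewrite /continuous_at.
  under eq_fun do rewrite ReM; rewrite ReM; apply: cvgB; apply: cvgM;
  by [exact: f1|exact: g1|exact: f2|exact: g2].
under eq_fun do rewrite ImM; rewrite ImM; apply: cvgD; apply: cvgM;
by [exact: f1|exact: g1|exact: f2|exact: g2].
Qed.

Lemma ccontV f : ccont f -> (forall x, f x != 0) -> ccont (fun x => (f x)^-1).
Proof.
move=> [f1 f2] f0.
have n0 x : Re (f x) ^+ 2 + Im (f x) ^+ 2 != 0.
  rewrite -normc_sqr sqrf_eq0; apply: contra (f0 x) => /eqP h.
  by apply/eqP; exact: eq0_normc.
have cn : continuous (fun x => Re (f x) ^+ 2 + Im (f x) ^+ 2).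
  move=> x; rewrite /continuous_at; apply: cvgD; rewrite expr2; under eq_fun do rewrite expr2;
  by apply: cvgM; [exact: f1|exact: f1] || apply: cvgM; exact: f2.
split => x; rewrite /continuous_at.
  under eq_fun do rewrite ReV; rewrite ReV.
  by apply: cvgM; [exact: f1|apply: cvgV => //; exact: cn].
under eq_fun do rewrite ImV; rewrite ImV.
by apply: cvgM; [apply: cvgN; exact: f2|apply: cvgV => //; exact: cn].
Qed.

Lemma ccontX f n : ccont f -> ccont (fun x => f x ^+ n).
Proof.
move=> cf; elim: n => [|n IH]; first exact: ccont_cst.
by under eq_fun do rewrite exprS; exact: ccontM.
Qed.

Lemma ccont_exprz f (k : int) : ccont f -> (forall x, f x != 0) ->
  ccont (fun x => f x ^ k).
Proof.
move=> cf f0; case: k => n; first exact: ccontX.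
under eq_fun do rewrite NegzE -exprz_inv -exprnP.
by apply: ccontX; exact: ccontV.
Qed.

Definition cis (x : R) : C := Complex (cos x) (sin x).

Lemma ccont_cis : ccont cis.
Proof. by split; [exact: continuous_cos|exact: continuous_sin]. Qed.

Lemma normc_cis x : normc (cis x) = 1.
Proof. by rewrite /= cos2Dsin2 sqrtr1. Qed.

Lemma cis_neq0 x : cis x != 0.
Proof.
by apply/eqP => /(congr1 (@normc R)); rewrite normc_cis normc0 => /eqP; rewrite oner_eq0.
Qed.

Lemma cisD x y : cis (x + y) = cis x * cis y.
Proof. by apply: complex_ext; rewrite ?ReM ?ImM /= ?cosD ?sinD // addrC. Qed.

Lemma cis_nat x n : cis x ^+ n = cis (n%:R * x).
Proof.
elim: n => [|n IH]; first by rewrite mul0r; apply: complex_ext => /=; rewrite ?cos0 ?sin0.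
by rewrite exprS IH -cisD -natr1 mulrDl mul1r addrC.
Qed.

Lemma cisN x : cis (- x) = (cis x)^-1.
Proof.
apply: (mulIf (cis_neq0 x)); rewrite mulVf ?cis_neq0 // -cisD addNr.
by apply: complex_ext => /=; rewrite ?cos0 ?sin0.
Qed.

Lemma cis_int x (k : int) : cis x ^ k = cis (k%:~R * x).
Proof.
case: k => n; first by rewrite -exprnP cis_nat.
by rewrite NegzE -exprz_inv -exprnP -cisN cis_nat mulrN mulrNz mulNr.
Qed.

Notation circ := (`[0, pi]%classic : set R).

Lemma sin_mulrn_pi n : sin (pi *+ n) = 0 :> R.
Proof.
elim: n => [|n IH]; first by rewrite mulr0n sin0.
by rewrite mulrSr sinDpi IH oppr0.
Qed.

(** Mean of the real part over the upper half circle. For integrands taking conjugate values at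
    conjugate points, as those below do, it is the mean over the whole circle, hence a contour
    integral. *)
Definition avg (f : R -> C) : R :=
  pi^-1 * \int[mu]_(x in circ) Re (f x).

Lemma avg_integrable f : ccont f -> mu.-integrable circ (EFin \o (fun x => Re (f x))).
Proof.
move=> [cf _]; apply: continuous_compact_integrable; first exact: segment_compact.
exact: continuous_subspaceT.
Qed.

Lemma avgD f g : ccont f -> ccont g -> avg (fun x => f x + g x) = avg f + avg g.
Proof.
move=> cf cg; rewrite /avg -mulrDr -RintegralD //; try exact: avg_integrable.
by congr (_ * _); apply: eq_Rintegral => x _; rewrite ReD.
Qed.

Lemma avgZ f (c : R) : ccont f -> avg (fun x => (c%:C)%C * f x) = c * avg f.
Proof.
move=> cf; rewrite /avg [RHS]mulrCA -[X in _ = _ * X]RintegralZl //; last exact: avg_integrable.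
by congr (_ * _); apply: eq_Rintegral => x _; rewrite ReM /= mul0r subr0.
Qed.

Lemma mu_circ : mu circ = pi%:E.
Proof.
have pi0 := pi_gt0 R.
by rewrite lebesgue_measure_itv /= lte_fin ifT ?pi0 // -EFinD subr0.
Qed.

Lemma avg_bound f (B : R) : ccont f -> (forall x, normc (f x) <= B) -> `|avg f| <= B.
Proof.
move=> cf fB; have pi0 := pi_gt0 R.
rewrite /avg normrM ger0_norm ?invr_ge0 ?(ltW pi0) // ler_pdivrMl //.
apply: le_trans (le_normr_Rintegral _ (avg_integrable cf)) _ => //.
apply: (@le_trans _ _ (\int[mu]_(x in circ) B)).
  apply: le_Rintegral => //.
  - have := integrable_norm (avg_integrable cf); by apply: eq_integrable.
  - apply: continuous_compact_integrable; first exact: segment_compact.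
    by apply: continuous_subspaceT => x; exact: cvg_cst.
  - by move=> x _; apply: le_trans (fB x); exact: abs_Re_le.
rewrite Rintegral_cst //.
rewrite [fine _](_ : _ = pi); first by rewrite mulrC.
exact: (congr1 fine mu_circ).
Qed.

Lemma avg_cis (k : int) : avg (fun x => cis x ^ k) = (k == 0)%:R.
Proof.
have pi0 := pi_gt0 R.
have [->|k0] := eqVneq k 0.
  rewrite /avg (@eq_Rintegral _ _ _ mu _ (fun=> 1)) //.
  rewrite Rintegral_cst //.
  rewrite [fine _](_ : _ = pi); last exact: (congr1 fine mu_circ).
  by rewrite mul1r mulVf // lt0r_neq0.
rewrite /avg (@eq_Rintegral _ _ _ mu _ (fun x => cos (k%:~R * x))); last first.
  by move=> x _; rewrite cis_int.
have kR : k%:~R != 0 :> R by rewrite intr_eq0.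
have d x : is_derive x (1 : R) (fun x : R => (k%:~R)^-1 * sin (k%:~R * x)) (cos (k%:~R * x)).
  apply: is_derive_eq; rewrite /GRing.scale /=; field.
  exact: kR.
have cc : continuous (fun x : R => cos (k%:~R * x)).
  move=> x; apply: continuous_comp; last exact: continuous_cos.
  by apply: cvgM; [exact: cvg_cst|exact: cvg_id].
have cs : continuous (fun x : R => (k%:~R)^-1 * sin (k%:~R * x)).
  by move=> x; apply: differentiable_continuous; apply/derivable1_diffP; apply: ex_derive.
rewrite /Rintegral (@continuous_FTC2 _ _ (fun x : R => (k%:~R)^-1 * sin (k%:~R * x))).
- rewrite mulr0 sin0 mulr0 /=.
  suff -> : sin (k%:~R * pi) = 0 :> R by rewrite !(oppr0, mulr0, subr0, addr0).
  case: (intP k) => [|n|n]; first by rewrite mul0r sin0.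
    by rewrite -pmulrn mulr_natl sin_mulrn_pi.
  by rewrite mulrNz mulNr sinN -pmulrn mulr_natl sin_mulrn_pi oppr0.
- exact: pi0.
- exact: continuous_subspaceT.
- split.
  + by move=> x _; apply: ex_derive.
  + apply: cvg_at_right_filter; exact: cs.
  + apply: cvg_at_left_filter; exact: cs.
- by move=> x _; rewrite derive1E derive_val.
Qed.

End circle.

(** * Power series coefficients and their integral representation *)

Definition coef_mul1 (R : pzRingType) (s : nat -> R) (j : nat) : R :=
  s j + (if j is i.+1 then s i else 0).

Fixpoint coef_div (R : pzRingType) (z : R) (s : nat -> R) (j : nat) : R :=
  if j is i.+1 then s j - z * coef_div z s i else s 0%N.

(* The coefficient of w^j in (1 + w)^n (1 + z w)^(-m). *)
Definition acoef (R : pzRingType) (z : R) (n m j : nat) : R :=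
  iter n (@coef_mul1 R) (iter m (@coef_div R z) (fun j => (j == 0%N)%:R)) j.

Lemma acoefSn (R : pzRingType) (z : R) n m j :
  acoef z n.+1 m j.+1 = acoef z n m j.+1 + acoef z n m j.
Proof. by []. Qed.

Lemma acoef0 (R : pzRingType) (z : R) n m : acoef z n m 0 = 1.
Proof.
elim: n => [|n IH]; last by rewrite /acoef iterS /coef_mul1 addr0; exact: IH.
elim: m => [|m IH]; first by [].
by rewrite /acoef iterS /=; exact: IH.
Qed.

Lemma acoefSm (R : comPzRingType) (z : R) n m j :
  acoef z n m j.+1 = acoef z n m.+1 j.+1 + z * acoef z n m.+1 j.
Proof.
elim: n j => [|n IH] j; first by rewrite /acoef [iter m.+1 _ _]iterS /= subrK.
case: j => [|j]; last by rewrite !acoefSn !IH; ring.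
by rewrite !acoefSn IH !acoef0; ring.
Qed.

Lemma acoef00 (R : pzRingType) (z : R) j : acoef z 0 0 j = (j == 0%N)%:R.
Proof. by []. Qed.

(** The two recurrences and the boundary values determine the array, so an integral can be
    identified with the coefficients without expanding its integrand. The index is an integer so
    that j - 1 always makes sense. *)
Lemma acoef_unique (R : pzRingType) (z : R) (J : nat -> nat -> int -> R) :
  (forall n m (j : nat), J n m (- j.+1%:Z) = 0) ->
  (forall j : nat, J 0%N 0%N j = (j == 0%N)%:R) ->
  (forall n m j, J n.+1 m j = J n m j + J n m (j - 1)) ->
  (forall n m j, J n m j = J n m.+1 j + z * J n m.+1 (j - 1)) ->
  forall n m (j : nat), J n m j = acoef z n m j.
Proof.
move=> Jneg J00 Jn Jm.
have Jm1 n m : J n m (0%:Z - 1) = 0 by rewrite sub0r; exact: (Jneg n m 0%N).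
have S1 (j : nat) : j.+1%:Z - 1 = j by rewrite -[j.+1]addn1 PoszD addrK.
have H m (j : nat) : J 0%N m j = acoef z 0 m j.
  elim: m j => [|m IH] j; first by rewrite J00.
  elim: j => [|j IHj].
    by have := Jm 0%N m 0; rewrite IH !acoef0 Jm1 mulr0 addr0 => ->.
  have := Jm 0%N m j.+1; rewrite IH S1 IHj => h.
  by apply: (addIr (z * acoef z 0 m.+1 j)); rewrite -h /acoef [in RHS]iterS /= subrK.
elim=> [|n IH] m j; first exact: H.
case: j => [|j]; first by rewrite Jn IH Jm1 addr0 !acoef0.
by rewrite Jn S1 !IH acoefSn.
Qed.

Lemma geometric_bound_eq0 (R : realType) (c B q : R) :
  0 <= q < 1 -> (forall k : nat, `|c| <= B * q ^+ k) -> c = 0.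
Proof.
move=> /andP[q0 q1] h; apply/eqP; rewrite -normr_le0.
have : B * q ^+ k @[k --> \oo] --> B * 0.
  by apply: cvgM; [exact: cvg_cst|apply: cvg_expr; rewrite ger0_norm].
rewrite mulr0 => hc; rewrite -(cvg_lim (@Rhausdorff R) hc).
apply: limr_ge; first by apply/cvg_ex; eexists; exact: hc.
by near=> k; exact: h.
Unshelve. all: by end_near. Qed.

Section integral_representation.
Local Open Scope complex_scope.
Local Open Scope ring_scope.
Variables (R : realType) (z v : R).
Hypotheses (z01 : 0 < z < 1) (v0 : 0 < v) (zv1 : z * v < 1).
Notation C := R[i].

Let zN : (- z)%:C = - z%:C :> C. Proof. by rewrite rmorphN. Qed.
Let zB : (1 - z)%:C = 1 - z%:C :> C. Proof. by rewrite rmorphB. Qed.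

(** Origin of the three factors: with w = V / (1 - z V) one has 1 + w = D / E and 1 + z w = 1 / E,
    so that only powers of D, E and V remain. *)
Let V (x : R) : C := v%:C * cis x.
Let D (x : R) : C := 1 + (1 - z)%:C * V x.
Let E (x : R) : C := 1 - z%:C * V x.

Let normV x : normc (V x) = v.
Proof. by rewrite /V normcM normc_real normc_cis mulr1 gtr0_norm. Qed.

Let V_neq0 x : V x != 0.
Proof.
by apply/eqP => h; have := normV x; rewrite h normc0 => /eqP; rewrite lt_eqF.
Qed.

Let z0 : 0 < z. Proof. by case/andP: z01. Qed.

Let normE_ge x : 1 - z * v <= normc (E x).
Proof.
have : normc (1 : C) <= normc (E x) + normc (z%:C * V x).
  by apply: le_trans (le_normcD _ _); rewrite subrK.
by rewrite normc1 normcM normc_real normV gtr0_norm // lerBlDr.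
Qed.

Let E_neq0 x : E x != 0.
Proof.
apply/eqP => h; have := normE_ge x; rewrite h normc0 leNgt.
by rewrite subr_gt0 zv1.
Qed.

Let cV : ccont V. Proof. by apply: ccontM; [exact: ccont_cst|exact: ccont_cis]. Qed.
Let cD : ccont D.
Proof. by apply: ccontD; [exact: ccont_cst|apply: ccontM => //; exact: ccont_cst]. Qed.
Let cE : ccont E.
Proof.
rewrite (_ : E = fun x => 1 + (- z)%:C * V x); last first.
  by apply/funext => x; rewrite /E zN mulNr.
by apply: ccontD; [exact: ccont_cst|apply: ccontM => //; exact: ccont_cst].
Qed.

Let G (n : nat) (k i : int) x := D x ^+ n * E x ^ k * V x ^ i.

Let cG n k i : ccont (G n k i).
Proof.
apply: ccontM; last exact: ccont_exprz.
by apply: ccontM; [exact: ccontX|exact: ccont_exprz].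
Qed.

Let GSn n k i x : G n.+1 k i x = G n k i x + (1 - z)%:C * G n k (i + 1) x.
Proof. by rewrite /G exprS expfzDr ?V_neq0 // expr1z {1}/D; ring. Qed.

Let GE n k i x : G n (k + 1) i x = G n k i x + (- z)%:C * G n k (i + 1) x.
Proof.
have E1 : E x ^ 1 = 1 - z%:C * V x by rewrite expr1z.
by rewrite /G !expfzDr ?V_neq0 ?E_neq0 // E1 expr1z zN; ring.
Qed.

Let avgGS n k i : avg (G n.+1 k i) = avg (G n k i) + (1 - z) * avg (G n k (i + 1)).
Proof.
rewrite -avgZ // -avgD //; last by apply: ccontM; [exact: ccont_cst|].
by congr avg; apply/funext => x; exact: GSn.
Qed.

Let avgGE n k i : avg (G n (k + 1) i) = avg (G n k i) + (- z) * avg (G n k (i + 1)).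
Proof.
rewrite -avgZ // -avgD //; last by apply: ccontM; [exact: ccont_cst|].
by congr avg; apply/funext => x; exact: GE.
Qed.

Let avgV (i : nat) : avg (G 0 0 i.+1) = 0.
Proof.
have -> : G 0 0 i.+1 = fun x => (v ^+ i.+1)%:C * cis x ^ i.+1%:Z.
  by apply/funext => x; rewrite /G expr0 expr0z !mul1r -!exprnP /V exprMn rmorphXn.
rewrite avgZ; last by apply: ccontX; exact: ccont_cis.
by rewrite avg_cis mulr0.
Qed.

Let i1 (i : nat) : i.+1%:Z + 1 = i.+2. Proof. by rewrite -PoszD addn1. Qed.

(** The integrand is analytic in the disc |V| <= v and vanishes at 0, so its mean is 0. In place of
    Cauchy's theorem: by the case of one negative power less, the mean equals z^k times the mean
    with k more factors V, which is bounded by a constant times v^k, and z v < 1. *)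
Lemma avg_vanish_neg (q n i : nat) : avg (G n (- q%:Z) i.+1) = 0.
Proof.
elim: q n i => [|q IH] n i.
  rewrite oppr0; elim: n i => [|n IHn] i; first exact: avgV.
  by rewrite avgGS i1 !IHn mulr0 addr0.
have rec i' : avg (G n (- q.+1%:Z) i'.+1) = z * avg (G n (- q.+1%:Z) i'.+2).
  have : avg (G n (- q.+1%:Z + 1) i'.+1) = 0.
    by rewrite -[q.+1]addn1 PoszD opprD subrK IH.
  rewrite avgGE i1 => /eqP; rewrite addr_eq0 => /eqP ->; ring.
have iterk k : avg (G n (- q.+1%:Z) i.+1) = z ^+ k * avg (G n (- q.+1%:Z) (i + k).+1).
  elim: k => [|k IHk]; first by rewrite addn0 mul1r.
  by rewrite IHk rec addnS exprSr mulrA.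
pose B := (1 + (1 - z) * v) ^+ n * (1 - z * v) ^- q.+1 * v ^+ i.+1.
have zv0 : 0 <= z * v by rewrite mulr_ge0 // ltW.
apply: (@geometric_bound_eq0 _ _ B (z * v)); first by rewrite zv0.
move=> k; rewrite (iterk k) normrM ger0_norm ?exprn_ge0 // ?(ltW z0) //.
have -> : B * (z * v) ^+ k = z ^+ k * ((1 + (1 - z) * v) ^+ n * (1 - z * v) ^- q.+1 * v ^+ (i + k).+1).
  by rewrite /B exprMn -addSn exprD; ring.
apply: ler_wpM2l; first by rewrite exprn_ge0 // ltW.
apply: avg_bound => // x; rewrite /G 2!normcM -exprnP !normcX normV normc_exprz.
rewrite ler_wpM2r ?exprn_ge0 // ?(ltW v0) //.
apply: ler_pM; rewrite ?exprn_ge0 ?normc_ge0 //.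
- by rewrite exprz_ge0 // normc_ge0.
- apply: lerXn2r; rewrite ?nnegrE ?normc_ge0 //.
    by rewrite addr_ge0 // mulr_ge0 // ?(ltW v0) // subr_ge0; case/andP: z01 => _ /ltW.
  rewrite /D; apply: le_trans (le_normcD _ _) _; rewrite normc1 lerD2l.
  rewrite normcM normc_real normV ger0_norm // subr_ge0; by case/andP: z01 => _ /ltW.
- rewrite -exprnN lef_pV2 ?posrE ?exprn_gt0 //.
  + by apply: lerXn2r; rewrite ?nnegrE ?normc_ge0 // subr_ge0 ltW.
  + by rewrite normc_gt0.
  + by rewrite subr_gt0.
Qed.

Lemma avg_vanish (k : int) (n i : nat) : avg (G n k i.+1) = 0.
Proof.
case: (intP k) => [|q|q].
- by have := avg_vanish_neg 0 n i; rewrite oppr0.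
- elim: q.+1 i => [|q' IH] i; first by have := avg_vanish_neg 0 n i; rewrite oppr0.
  rewrite -addn1 PoszD.
  by rewrite avgGE i1 !IH mulr0 addr0.
- exact: avg_vanish_neg.
Qed.

Let avg_low (k j : nat) : (k < j)%N -> avg (G 0 k (- j%:Z)) = 0.
Proof.
elim: k j => [|k IH] j kj.
  have vj : v%:C ^ (- j%:Z) = (v ^- j)%:C by rewrite -exprnN fmorphV rmorphXn.
  have -> : G 0 0 (- j%:Z) = fun x => (v ^- j)%:C * cis x ^ (- j%:Z).
    by apply/funext => x; rewrite /G expr0 expr0z !mul1r /V expfzMl vj.
  rewrite avgZ; last by apply: ccont_exprz; [exact: ccont_cis|exact: cis_neq0].
  by rewrite avg_cis oppr_eq0; case: j {vj} kj => // j _; rewrite mulr0.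
case: j kj => // j kj; rewrite -[k.+1]addn1 PoszD.
have e1 : - j.+1%:Z + 1 = - j%:Z by rewrite -addn1 PoszD opprD subrK.
by rewrite avgGE e1 !IH ?mulr0 ?addr0 // ltnW.
Qed.

(** In the variable V the form dw / w becomes dV / (V E), whence the exponent m - n + j - 1 of E.
    The proof only checks the recurrences of [acoef_unique]. *)
Lemma acoef_avg n m (j : nat) :
  acoef z n m j = avg (fun x => D x ^+ n * E x ^ (m%:Z - n%:Z + j%:Z - 1) * V x ^ (- j%:Z)).
Proof.
pose J n m (j : int) := avg (G n (m%:Z - n%:Z + j - 1) (- j)).
rewrite -[RHS]/(J n m j); apply/esym/acoef_unique => {n m j}.
- by move=> n m j; rewrite /J opprK; exact: avg_vanish.
- case=> [|j]; rewrite /J.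
    have -> : 0%:Z - 0%:Z + 0%:Z - 1 = -1 :> int by [].
    rewrite oppr0.
    have : avg (G 0 (-1 + 1) 0) = 1.
      rewrite addNr (_ : G 0 0 0 = fun x => cis x ^ 0); first by rewrite avg_cis.
      by apply/funext => x; rewrite /G !expr0z expr0 !mul1r.
    by rewrite avgGE add0r (avg_vanish _ 0 0) mulr0 addr0.
  have -> : 0%:Z - 0%:Z + j.+1%:Z - 1 = j by rewrite subrr add0r -[j.+1]addn1 PoszD addrK.
  exact: avg_low.
- move=> n m j; rewrite /J -avgD //; congr avg; apply/funext => x.
  have -> : m%:Z - n.+1%:Z + j - 1 = m%:Z - n%:Z + (j - 1) - 1.
    by rewrite -addn1 PoszD; ring.
  have -> : m%:Z - n%:Z + j - 1 = m%:Z - n%:Z + (j - 1) - 1 + 1 by ring.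
  rewrite GE GSn opprB; rewrite [1 - j]addrC zN zB; ring.
- move=> n m j; rewrite /J -avgZ // -avgD //; last by apply: ccontM; [exact: ccont_cst|].
  congr avg; apply/funext => x.
  have -> : m.+1%:Z - n%:Z + (j - 1) - 1 = m%:Z - n%:Z + j - 1.
    by rewrite -addn1 PoszD; ring.
  have -> : m.+1%:Z - n%:Z + j - 1 = m%:Z - n%:Z + j - 1 + 1.
    by rewrite -addn1 PoszD; ring.
  rewrite GE opprB [1 - j]addrC zN; ring.
Qed.

End integral_representation.

(** * The Airy integral *)

Lemma Rintegral_FTC2 (R : realType) (F f : R -> R) (a b : R) :
  a < b -> continuous f -> (forall x, is_derive x (1 : R) F (f x)) ->
  \int[@lebesgue_measure R]_(x in `[a, b]) f x = F b - F a.
Proof.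
move=> ab cf dF.
have cF : continuous F.
  by move=> x; apply: differentiable_continuous; apply/derivable1_diffP; apply: ex_derive.
rewrite /Rintegral (@continuous_FTC2 _ _ F) //.
- exact: continuous_subspaceT.
- split; first by move=> x _; apply: ex_derive.
    by apply: cvg_at_right_filter; exact: cF.
  by apply: cvg_at_left_filter; exact: cF.
- by move=> x _; rewrite derive1E derive_val.
Qed.

Lemma continuous_itv_integrable (R : realType) (f : R -> R) (a b : R) :
  continuous f -> (@lebesgue_measure R).-integrable (`[a, b]%classic) (EFin \o f).
Proof.
move=> cf; apply: continuous_compact_integrable; first exact: segment_compact.
exact: continuous_subspaceT.
Qed.

Lemma derive_continuous (R : realType) (F f : R -> R) :
  (forall x, is_derive x (1 : R) F (f x)) -> continuous F.
Proof.
by move=> dF x; apply: differentiable_continuous; apply/derivable1_diffP; apply: ex_derive.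
Qed.

Lemma derive_le_subr (R : realType) (F G f g : R -> R) (a b : R) : a <= b ->
  (forall x, a <= x <= b -> is_derive x (1 : R) F (f x)) ->
  (forall x, a <= x <= b -> is_derive x (1 : R) G (g x)) ->
  (forall x, a <= x <= b -> f x <= g x) -> F b - F a <= G b - G a.
Proof.
move=> ab dF dG fg.
have dFG x : a <= x <= b -> is_derive x (1 : R) (F - G) (f x - g x).
  by move=> h; have h1 := dF _ h; have h2 := dG _ h; apply: is_deriveB.
have hab x : x \in `]a, b[ -> a <= x <= b.
  by rewrite in_itv /= => /andP[h1 h2]; rewrite (ltW h1) (ltW h2).
suff : (F - G) b <= (F - G) a by rewrite !fctE /=; lra.
apply: (@ler0_derive1_nincr _ (F - G) a b) => //.
- by move=> x /hab/dFG h; apply: ex_derive.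
- move=> x /hab h; have h1 := dFG _ h.
  by rewrite derive1E derive_val subr_le0 fg.
- apply: derivable_within_continuous => x; rewrite in_itv /= => /dFG h.
  exact: ex_derive.
Qed.

Section airy.
Variables (R : realType) (xi : R).
Notation mu := (@lebesgue_measure R).

(* [airyR] and [airyI] are the real and imaginary parts of exp (w ^ 3 / 3 - xi w)
   at w = s + i x. *)
Let amp (s x : R) := expR (s ^+ 3 / 3 - s * x ^+ 2 - xi * s).
Let phase (s x : R) := s ^+ 2 * x - x ^+ 3 / 3 - xi * x.
Definition airyR (s x : R) := amp s x * cos (phase s x).
Definition airyI (s x : R) := amp s x * sin (phase s x).
(** By the Cauchy-Riemann equations this is the derivative of [airyR] in s as well as that of
    [airyI] in x. *)
Let dR (s x : R) := (s ^+ 2 - x ^+ 2 - xi) * airyR s x - (2 * s * x) * airyI s x.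

Let d_airyR_s x s : is_derive s (1 : R) (airyR ^~ x) (dR s x).
Proof.
rewrite /dR /airyR /airyI /amp /phase; apply: is_derive_eq.
by rewrite /GRing.scale /=; field.
Qed.

Let d_airyI_x s x : is_derive x (1 : R) (airyI s) (dR s x).
Proof.
rewrite /dR /airyR /airyI /amp /phase; apply: is_derive_eq.
by rewrite /GRing.scale /=; field.
Qed.

Let c_airyI s : continuous (airyI s).
Proof. exact: derive_continuous (d_airyI_x s). Qed.

Let d_airyR_x s x : is_derive x (1 : R) (airyR s)
  (- (2 * s * x) * airyR s x - (s ^+ 2 - x ^+ 2 - xi) * airyI s x).
Proof.
rewrite /airyR /airyI /amp /phase; apply: is_derive_eq.
by rewrite /GRing.scale /=; field.
Qed.

Let c_airyR s : continuous (airyR s).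
Proof. exact: derive_continuous (d_airyR_x s). Qed.

Let c_dR s : continuous (dR s).
Proof.
move=> x; apply: cvgB; apply: cvgM.
- apply: cvgB; last exact: cvg_cst.
  by apply: cvgB; [exact: cvg_cst|exact: exprn_continuous].
- exact: c_airyR.
- by apply: cvgM; [exact: cvg_cst|exact: cvg_id].
- exact: c_airyI.
Qed.

Let normcos (x : R) : `|cos x| <= 1.
Proof. by rewrite ler_norml cos_geN1 cos_le1. Qed.
Let normsin (x : R) : `|sin x| <= 1.
Proof. by rewrite ler_norml sin_geN1 sin_le1. Qed.

Let airyR_le s x : `|airyR s x| <= amp s x.
Proof. by rewrite normrM ger0_norm ?expR_ge0 // ler_piMr ?expR_ge0. Qed.
Let airyI_le s x : `|airyI s x| <= amp s x.
Proof. by rewrite normrM ger0_norm ?expR_ge0 // ler_piMr ?expR_ge0. Qed.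

Variable sigma : R.
Hypothesis sigma0 : 0 < sigma.

(** Differentiation under the integral sign produces an x-derivative by Cauchy-Riemann; of the two
    boundary terms the one at x = 0 vanishes because the phase is 0 there. *)
Let contour_derive (A s : R) : 0 < A -> 0 <= s <= sigma ->
  is_derive s (1 : R) (fun s => \int[mu]_(x in `[0, A]) airyR s x) (airyI s A).
Proof.
move=> A0 /andP[s0 ssig].
(* The open interval from - 1 to S contains [0, sigma]; B is a crude bound of the derivative over
   it, up to height A. *)
pose S := sigma + 1.
have S1 : 1 <= S by rewrite lerDr ltW.
pose M := expR (S ^+ 3 + A ^+ 2 + `|xi| * S).
pose B := (S ^+ 2 + A ^+ 2 + `|xi| + 2 * S * A) * M.
have Is : (`]-1, S[%classic : set R) s by rewrite /= in_itv /= /S; apply/andP; split; lra.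
have bd x y : (`]-1, S[%classic : set R) x -> (`[0, A]%classic : set R) y ->
    `|partial1of2 airyR x y| <= B.
  rewrite /= !in_itv /= => /andP[x1 xS] /andP[y0 yA].
  rewrite partial1of2E (@derive_val _ _ _ _ _ _ _ (d_airyR_s y x)) /dR.
  have ampM : amp x y <= M.
    rewrite ler_expR.
    have h1 : x ^+ 3 / 3 <= S ^+ 3.
      have [x0|x0] := leP 0 x.
        have : x ^+ 3 <= S ^+ 3 by rewrite lerXn2r ?nnegrE //; lra.
        have : 0 <= x ^+ 3 by rewrite exprn_ge0.
        lra.
      have : x ^+ 3 <= 0 by rewrite exprn_odd_le0 // ltW.
      have : 0 <= S ^+ 3 by rewrite exprn_ge0 //; lra.
      lra.
    have h2 : - (x * y ^+ 2) <= A ^+ 2.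
      have : y ^+ 2 <= A ^+ 2 by rewrite lerXn2r ?nnegrE // ltW.
      have := sqr_ge0 y; nra.
    have h3 : - (xi * x) <= `|xi| * S.
      apply: le_trans (ler_norm _) _; rewrite normrN normrM ler_wpM2l //.
      by rewrite ler_norml; apply/andP; split; lra.
    lra.
  have nx : `|x| <= S by rewrite ler_norml; apply/andP; split; lra.
  have x2 : x ^+ 2 <= S ^+ 2.
    by rewrite -(real_normK (num_real x)) lerXn2r ?nnegrE //; lra.
  have y2 : y ^+ 2 <= A ^+ 2 by rewrite lerXn2r ?nnegrE // ltW.
  have ha : `|x ^+ 2 - y ^+ 2 - xi| <= S ^+ 2 + A ^+ 2 + `|xi|.
    have [xi1 xi2] : - `|xi| <= xi /\ xi <= `|xi|.
      by split; [rewrite lerNl -normrN ler_norm|rewrite ler_norm].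
    have := sqr_ge0 x; have := sqr_ge0 y => y3 x3.
    by rewrite ler_norml; apply/andP; split; lra.
  have hb : `|2 * x * y| <= 2 * S * A.
    rewrite normrM normrM (ger0_norm y0) ger0_norm // -!mulrA ler_wpM2l //.
    exact: ler_pM.
  have hR := le_trans (airyR_le x y) ampM; have hI := le_trans (airyI_le x y) ampM.
  apply: le_trans (ler_normB _ _) _; rewrite (normrM _ (airyR x y)) (normrM _ (airyI x y)).
  by rewrite /B [leRHS]mulrDl; apply: lerD; apply: ler_pM.
have M0 : 0 <= B.
  by rewrite mulr_ge0 ?expR_ge0 // !addr_ge0 ?sqr_ge0 // mulr_ge0 ?(ltW A0) //; lra.
have iB : mu.-integrable `[0, A]%classic (EFin \o cst B).
  by apply: continuous_itv_integrable => x; exact: cvg_cst.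
have ifx x : (`]-1, S[%classic : set R) x -> mu.-integrable `[0, A]%classic (EFin \o airyR x).
  by move=> _; exact: continuous_itv_integrable.
have dfx x y : (`]-1, S[%classic : set R) x -> (`[0, A]%classic : set R) y ->
    derivable (airyR ^~ y) x 1 by move=> _ _; apply: ex_derive.
have mA : measurable (`[0, A]%classic : set R) by [].
have d1 := @derivable_under_integral _ _ _ mu airyR _ mA s (-1) S Is ifx dfx (cst B) (fun=> M0) iB bd.
apply: DeriveDef => //.
have := @differentiation_under_integral _ _ _ mu airyR _ mA s (-1) S Is ifx dfx (cst B) (fun=> M0) iB bd.
rewrite derive1E => ->.
rewrite (@eq_Rintegral _ _ _ mu _ (dR s)); last first.
  by move=> y _; rewrite partial1of2E (@derive_val _ _ _ _ _ _ _ (d_airyR_s y s)).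
rewrite (Rintegral_FTC2 A0 (@c_dR s) (d_airyI_x s)).
by rewrite /airyI /phase; rewrite expr0n /= !(mulr0, mul0r, subr0) sin0 mulr0 subr0.
Qed.

Let ampE s x : amp s x = expR (s ^+ 3 / 3 - xi * s) * expR (- (x ^+ 2) * s).
Proof. by rewrite /amp -expRD; congr expR; ring. Qed.

Let Cs := expR (sigma ^+ 3 + `|xi| * sigma).

Let amp_bound s x : 0 <= s <= sigma -> amp s x <= Cs * expR (- (x ^+ 2) * s).
Proof.
move=> /andP[s0 ss]; rewrite ampE ler_wpM2r ?expR_ge0 // ler_expR.
have h1 : s ^+ 3 <= sigma ^+ 3 by rewrite lerXn2r ?nnegrE // ltW.
have h0 : 0 <= s ^+ 3 by rewrite exprn_ge0.
have h3 : - (xi * s) <= `|xi| * sigma.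
  apply: le_trans (ler_norm _) _; rewrite normrN normrM ler_wpM2l //.
  by rewrite ger0_norm.
lra.
Qed.

(** The horizontal side at height A contributes at most the integral of Cs exp(- A^2 s) over s in
    [0, sigma], which is below Cs / A^2. *)
Let contour_shift (A : R) : 0 < A ->
  `|\int[mu]_(x in `[0, A]) airyR sigma x - \int[mu]_(x in `[0, A]) airyR 0 x|
    <= Cs / A ^+ 2.
Proof.
move=> A0; pose D s := \int[mu]_(x in `[0, A]) airyR s x.
have A2 : 0 < A ^+ 2 by rewrite exprn_gt0.
pose W s := Cs / A ^+ 2 * expR (- (A ^+ 2) * s).
have dW s : is_derive s (1 : R) W (- (Cs * expR (- (A ^+ 2) * s))).
  rewrite /W; apply: is_derive_eq; rewrite /GRing.scale /=; field.
  exact: lt0r_neq0.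
have mono (e : R) : `|e| = 1 -> e * (D sigma - D 0) <= Cs / A ^+ 2.
  move=> e1.
  have dD s : 0 <= s <= sigma -> is_derive s (1 : R) (fun s => e * D s) (e * airyI s A).
    move=> hs; have := contour_derive A0 hs => h.
    exact: (is_deriveZ e).
  have dV s : is_derive s (1 : R) (fun s => - W s) (Cs * expR (- (A ^+ 2) * s)).
    by have := dW s => h; apply: is_derive_eq; rewrite opprK.
  have := @derive_le_subr _ _ _ _ _ 0 sigma (ltW sigma0) dD (fun s _ => dV s).
  rewrite -mulrBr => /(_ _)/le_trans; apply.
    move=> s hs; apply: le_trans (ler_norm _) _.
    rewrite normrM e1 mul1r; apply: le_trans (airyI_le _ _) _.
    exact: amp_bound.
  rewrite /W mulr0 expR0 mulr1 opprK addrC lerBlDr lerDl.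
  by rewrite mulr_ge0 ?expR_ge0 // divr_ge0 ?expR_ge0 // ltW.
rewrite -/(D sigma) -/(D 0) ler_norml.
have := mono 1 (normr1 _); have := mono (-1) (normrN1 _); rewrite mulN1r mul1r => h1 h2.
by rewrite h2 andbT lerNl.
Qed.

(** Gaussian decay weakened to exp(- x), by completing the square in sigma x^2 - x + 1 / (4
    sigma). *)
Lemma airyR_bound x : `|airyR sigma x| <=
  Cs * expR (4^-1 / sigma) * expR (- 1 * (x - 0)).
Proof.
apply: le_trans (airyR_le _ _) _; apply: le_trans (amp_bound _ _) _.
  by rewrite lexx ltW.
rewrite -mulrA ler_wpM2l ?expR_ge0 // -expRD ler_expR.
rewrite -subr_ge0.
have -> : 4^-1 / sigma + -1 * (x - 0) - - x ^+ 2 * sigma =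
   (2 * sigma * x - 1) ^+ 2 / (4 * sigma).
  by field; exact: lt0r_neq0.
by rewrite divr_ge0 ?sqr_ge0 // mulr_ge0 // ltW.
Qed.

Let K := Cs * expR (4^-1 / sigma).

Lemma airyR_integrable : mu.-integrable (`[0, +oo[%classic) (EFin \o airyR sigma).
Proof.
have iK : mu.-integrable (`[0, +oo[%classic) (EFin \o (fun x => K * expR (- 1 * (x - 0)))).
  apply: integrable_EFinZ => //.
  apply: (@integrableS _ _ _ mu (`]-1, +oo[%classic : set R)) => //.
    move=> x /=; rewrite !in_itv /= !andbT; lra.
  have := @expR_integrable R 1 (-1) ltr01 => h.
  have mI : measurable (`]-1, +oo[%classic : set R) by [].
  have := @integrable_EFinZ _ _ _ mu _ _ (expR 1) mI h.
  apply: eq_integrable => // x _ /=.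
  by rewrite -expRD; congr (expR _)%:E; ring.
apply: le_integrable iK => //.
  by apply/measurable_EFinP; apply: measurable_funTS; exact: continuous_measurable_fun.
move=> x _ /=; rewrite lee_fin; apply: le_trans (airyR_bound x) _.
exact: ler_norm.
Qed.

Lemma airyR_tail (A : R) : 0 < A ->
  `|\int[mu]_(x in `[0, +oo[) airyR sigma x - \int[mu]_(x in `[0, A]) airyR sigma x|
    <= K * expR (- A).
Proof.
move=> A0.
have := @Rintegral_itvB R (airyR sigma) (BLeft 0) +oo%O A airyR_integrable.
rewrite bnd_simp => /(_ (ltW A0) isT) ->.
have iA : mu.-integrable (`]A, +oo[%classic) (EFin \o airyR sigma).
  apply: integrableS airyR_integrable => // x /=.
  by rewrite !in_itv /= !andbT => /ltW; apply: le_trans; exact: ltW.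
apply: le_trans (le_normr_Rintegral _ iA) _ => //.
have iE : mu.-integrable (`]A, +oo[%classic) (EFin \o (fun x => expR (- 1 * (x - A)))).
  exact: expR_integrable.
apply: (@le_trans _ _ (\int[mu]_(x in `]A, +oo[) (K * expR (- A) * expR (- 1 * (x - A))))).
  apply: le_Rintegral => //.
  - by have := integrable_norm iA; apply: eq_integrable.
  - exact: integrable_EFinZ.
  - move=> x _; apply: le_trans (airyR_bound x) _.
    rewrite -/K subr0 -[leRHS]mulrA ler_wpM2l ?mulr_ge0 ?expR_ge0 // -expRD.
    by rewrite ler_expR; lra.
rewrite RintegralZl // ler_piMr ?mulr_ge0 ?expR_ge0 //.
rewrite Rintegral_itv_obnd_cbnd //.
have dF x : is_derive x (1 : R) (fun x => - expR (- 1 * (x - A))) (expR (- 1 * (x - A))).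
  by apply: is_derive_eq; rewrite /GRing.scale /=; ring.
have cE : continuous (fun x => expR (- 1 * (x - A))).
  have dE x : is_derive x (1 : R) (fun x => expR (- 1 * (x - A))) (- expR (- 1 * (x - A))).
    by apply: is_derive_eq; rewrite /GRing.scale /=; ring.
  exact: derive_continuous dE.
rewrite (@Rintegral_ge0_continuous_FTC2y _ _ (fun x => - expR (- 1 * (x - A))) _ 0).
- by rewrite subrr mulr0 expR0 opprK add0r.
- by move=> x _; exact: expR_ge0.
- exact: continuous_subspaceT.
- rewrite -[X in _ --> X]oppr0; apply: cvgN.
  under eq_fun do rewrite mulN1r.
  apply: (cvg_comp (fun x => x - A) (fun x => expR (- x))); last exact: cvgr_expR.
  apply/cvgryPge => B; near=> x.
  rewrite lerBrDr; near: x; apply: nbhs_pinfty_ge; exact: num_real.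
- by move=> x _; apply: ex_derive.
- by apply: cvg_at_right_filter; apply: (derive_continuous dF).
- by move=> x _; rewrite derive1E derive_val.
Unshelve. all: by end_near. Qed.

(** The absolutely convergent form of the Airy integral; steepest descent arrives at it with sigma =
    1. *)
Theorem Airy_contour :
  Airy xi = pi^-1 * \int[mu]_(x in `[0, +oo[) airyR sigma x.
Proof.
rewrite /Airy; congr (_ * _); apply: cvg_lim => //.
have E A : \int[mu]_(s in `[0, A]) cos (s ^+ 3 / 3 + xi * s) = \int[mu]_(x in `[0, A]) airyR 0 x.
  apply: eq_Rintegral => x _; rewrite /airyR /amp /phase.
  rewrite expr0n /= expr0n /= !mul0r mulr0 !subr0 expR0 mul1r sub0r -opprD cosN.
  by congr cos; ring.
under eq_fun do rewrite E.
set I := \int[mu]_(x in `[0, +oo[) airyR sigma x.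
apply/cvgrPdist_le => /= e e0.
have Cs0 : 0 < Cs by exact: expR_gt0.
have K0 : 0 < K by rewrite mulr_gt0 // expR_gt0.
have tail0 : K * expR (- A) @[A --> +oo] --> 0.
  by rewrite -[X in _ --> X](mulr0 K); apply: cvgM; [exact: cvg_cst|exact: cvgr_expR].
near=> A.
have A1 : 1 <= A by near: A; apply: nbhs_pinfty_ge; exact: num_real.
have A0 : 0 < A by apply: lt_le_trans A1.
have h1 := airyR_tail A0; have h2 := contour_shift A0.
have h3 : K * expR (- A) <= e / 2.
  have : `|0 - K * expR (- A)| <= e / 2.
    near: A; move/cvgrPdist_le : tail0; apply; lra.
  by rewrite sub0r normrN ger0_norm // mulr_ge0 ?expR_ge0 // ltW.
have h4 : Cs / A ^+ 2 <= e / 2.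
  have h5 : 2 * Cs / e <= A by near: A; apply: nbhs_pinfty_ge; exact: num_real.
  rewrite ler_pdivrMr ?exprn_gt0 //.
  have : 2 * Cs <= A * e by rewrite -ler_pdivrMr.
  have : A <= A ^+ 2 by rewrite expr2 ler_peMr // ltW.
  nra.
set J := \int[mu]_(x in `[0, A]) airyR 0 x in h2 *.
set J' := \int[mu]_(x in `[0, A]) airyR sigma x in h1 h2.
have -> : I - J = (I - J') + (J' - J) by ring.
apply: le_trans (ler_normD _ _) _; lra.
Unshelve. all: by end_near. Qed.

End airy.

(** * Steepest descent *)

Section complex_exponential.
Variable R : realType.
Notation C := R[i].
Notation Re := complex.Re.
Notation Im := complex.Im.

Lemma normc_triangle (a b : C) : normc (a + b) <= normc a + normc b.
Proof. exact: le_normcD. Qed.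

Lemma normc_opp (a : C) : normc (- a) = normc a.
Proof. exact: normcN. Qed.

Lemma normc_natr (n : nat) : normc (n%:R : C) = n%:R.
Proof.
have -> : (n%:R : C) = (n%:R : R)%:C%C by rewrite rmorph_nat.
by rewrite normc_real ger0_norm.
Qed.

Lemma normc_le_abs (a : C) : normc a <= `|Re a| + `|Im a|.
Proof.
rewrite -(@ler_pXn2r _ 2) ?nnegrE ?normc_ge0 ?addr_ge0 // normc_sqr.
rewrite sqrrD !real_normK ?num_real //.
have := mulr_ge0 (normr_ge0 (Re a)) (normr_ge0 (Im a)); lra.
Qed.

Lemma abs_Im_le (a : C) : `|Im a| <= normc a.
Proof.
rewrite -(@ler_pXn2r _ 2) ?nnegrE ?normc_ge0 // normc_sqr real_normK ?num_real //.
by rewrite lerDr sqr_ge0.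
Qed.

Lemma real_complexM (x : R) (a : C) : (x%:C)%C * a = Complex (x * Re a) (x * Im a).
Proof. by apply: complex_ext; rewrite ?ReM ?ImM /=; ring. Qed.

Definition cexp (a : C) : C := ((expR (Re a))%:C)%C * cis (Im a).

Lemma Re_cexp a : Re (cexp a) = expR (Re a) * cos (Im a).
Proof. by rewrite /cexp real_complexM. Qed.

Lemma Im_cexp a : Im (cexp a) = expR (Re a) * sin (Im a).
Proof. by rewrite /cexp real_complexM. Qed.

Lemma normc_cexp a : normc (cexp a) = expR (Re a).
Proof. by rewrite /cexp normcM normc_cis mulr1 normc_real ger0_norm ?expR_ge0. Qed.

Lemma cexp_neq0 a : cexp a != 0.
Proof.
apply/eqP => h; have := normc_cexp a; rewrite h normc0 => /eqP.
by rewrite lt_eqF ?expR_gt0.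
Qed.

Lemma cexpD a b : cexp (a + b) = cexp a * cexp b.
Proof.
rewrite /cexp ReD ImD expRD cisD rmorphM; ring.
Qed.

Lemma cexp0 : cexp 0 = 1.
Proof. by apply: complex_ext; rewrite ?Re_cexp ?Im_cexp /= expR0 ?cos0 ?sin0 mul1r. Qed.

Lemma cexpN a : cexp (- a) = (cexp a)^-1.
Proof.
apply: (mulfI (cexp_neq0 a)); rewrite -cexpD subrr cexp0 mulfV //; exact: cexp_neq0.
Qed.

Lemma cexp_natM n a : cexp (n%:R * a) = cexp a ^+ n.
Proof.
elim: n => [|n IH]; first by rewrite mul0r cexp0 expr0.
by rewrite -add1n natrD mulrDl mul1r cexpD IH exprS.
Qed.

Lemma cexp_intM (k : int) a : cexp (k%:~R * a) = cexp a ^ k.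
Proof.
case: k => n; first by rewrite -pmulrn cexp_natM.
by rewrite NegzE rmorphN /= mulNr cexpN -exprnN -cexp_natM.
Qed.

(** P + i Q has derivative (sg + i tau) (p + i q), as successive Taylor remainders of exp(x (sg + i
    tau)) do. One integration gains a power of x and a factor 2 beta. *)
Lemma taylor_step (sg tau beta c : R) (P Q p q : R -> R) (k : nat) :
  `|sg| <= beta -> `|tau| <= beta -> 0 <= c ->
  (forall x, is_derive x (1 : R) P (sg * p x - tau * q x)) ->
  (forall x, is_derive x (1 : R) Q (sg * q x + tau * p x)) ->
  P 0 = 0 -> Q 0 = 0 ->
  (forall x, 0 <= x <= 1 -> `|p x| <= c * x ^+ k /\ `|q x| <= c * x ^+ k) ->
  forall x, 0 <= x <= 1 ->
    `|P x| <= 2 * beta * c * x ^+ k.+1 /\ `|Q x| <= 2 * beta * c * x ^+ k.+1.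
Proof.
move=> hs ht c0 dP dQ P0 Q0 hpq x /andP[x0 x1].
have b0 : 0 <= beta by apply: le_trans hs.
pose G y : R := 2 * beta * c * y ^+ k.+1.
have dG y : is_derive y (1 : R) G (2 * beta * c * (k.+1%:R * y ^+ k)).
  have dX : is_derive y (1 : R) (fun y : R => y ^+ k.+1) (k.+1%:R * y ^+ k).
    have h := @is_deriveX R R id k.+1 y 1 1 (is_derive_id y 1).
    have -> : (fun y : R => y ^+ k.+1) = id ^+ k.+1.
      by apply/funext => u; rewrite exprfctE.
    by apply: is_derive_eq; rewrite /GRing.scale /= mulr1.
  exact: (is_deriveZ (2 * beta * c) dX).
have key (H h : R -> R) : (forall y, is_derive y (1 : R) H (h y)) -> H 0 = 0 ->
    (forall y, 0 <= y <= 1 -> `|h y| <= 2 * beta * c * y ^+ k) -> `|H x| <= G x.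
  move=> dH H0 hh.
  have hG y : 0 <= y <= x -> `|h y| <= 2 * beta * c * (k.+1%:R * y ^+ k).
    move=> /andP[y0 yx]; have hy : 0 <= y <= 1 by rewrite y0 (le_trans yx).
    apply: le_trans (hh _ hy) _; rewrite ler_wpM2l ?mulr_ge0 //.
    by rewrite ler_peMl ?exprn_ge0 // ler1n.
  have G0 : G 0 = 0 by rewrite /G expr0n /= mulr0.
  rewrite ler_norml; apply/andP; split.
    have dN y : is_derive y (1 : R) (fun y => - H y) (- h y).
      by have := dH y => ?; apply: is_deriveN.
    have := @derive_le_subr _ _ _ _ _ 0 x x0 (fun y _ => dN y) (fun y _ => dG y).
    rewrite H0 G0 !oppr0 !addr0 => hN; rewrite lerNl; apply: hN => y hy.
    by apply: le_trans (hG y hy); rewrite -normrN ler_norm.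
  have := @derive_le_subr _ _ _ _ _ 0 x x0 (fun y _ => dH y) (fun y _ => dG y).
  rewrite H0 G0 !subr0; apply => y hy.
  by apply: le_trans (hG y hy); rewrite ler_norm.
have two y u v : 0 <= y <= 1 -> `|u| <= c * y ^+ k -> `|v| <= c * y ^+ k ->
    `|sg * u + tau * v| <= 2 * beta * c * y ^+ k.
  move=> /andP[y0 _] hu hv; apply: le_trans (ler_normD _ _) _; rewrite !normrM.
  have h1 : `|sg| * `|u| <= beta * (c * y ^+ k) by apply: ler_pM.
  have h2 : `|tau| * `|v| <= beta * (c * y ^+ k) by apply: ler_pM.
  lra.
split.
  apply: (key P _ dP P0) => y hy; have [h1 h2] := hpq _ hy.
  by rewrite -mulrN; apply: two => //; rewrite normrN.
by apply: (key Q _ dQ Q0) => y hy; have [h1 h2] := hpq _ hy; apply: two.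
Qed.

(** Four uses of [taylor_step], starting from the bound e on the exponential itself, give (2 beta)^4
    e. *)
Lemma cexp_taylor_components (sg tau : R) : `|sg| <= 1 -> `|tau| <= 1 ->
  forall beta, `|sg| <= beta -> `|tau| <= beta ->
  `|expR sg * cos tau - 1 - sg - (sg ^+ 2 - tau ^+ 2) / 2
      - (sg ^+ 3 - 3 * sg * tau ^+ 2) / 6| <= 16 * expR 1 * beta ^+ 4 /\
  `|expR sg * sin tau - tau - sg * tau
      - (3 * sg ^+ 2 * tau - tau ^+ 3) / 6| <= 16 * expR 1 * beta ^+ 4.
Proof.
move=> s1 t1 beta sb tb.
have b0 : 0 <= beta by apply: le_trans sb.
pose p0 x : R := expR (x * sg) * cos (x * tau).
pose q0 x : R := expR (x * sg) * sin (x * tau).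
pose p1 x : R := p0 x - 1.
pose p2 x : R := p1 x - x * sg.
pose q2 x : R := q0 x - x * tau.
pose p3 x : R := p2 x - x ^+ 2 * (sg ^+ 2 - tau ^+ 2) / 2.
pose q3 x : R := q2 x - x ^+ 2 * (sg * tau).
pose p4 x : R := p3 x - x ^+ 3 * (sg ^+ 3 - 3 * sg * tau ^+ 2) / 6.
pose q4 x : R := q3 x - x ^+ 3 * (3 * sg ^+ 2 * tau - tau ^+ 3) / 6.
have e1 x : 0 <= x <= 1 -> `|p0 x| <= expR 1 * x ^+ 0 /\ `|q0 x| <= expR 1 * x ^+ 0.
  move=> /andP[x0 x1]; rewrite expr0 mulr1 /p0 /q0 !normrM (ger0_norm (expR_ge0 _)).
  have h : expR (x * sg) <= expR 1.
    rewrite ler_expR; apply: le_trans (ler_norm _) _; rewrite normrM (ger0_norm x0).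
    by rewrite mulr_ile1.
  have hc : `|cos (x * tau)| <= 1 by rewrite ler_norml cos_geN1 cos_le1.
  have hs : `|sin (x * tau)| <= 1 by rewrite ler_norml sin_geN1 sin_le1.
  split; rewrite -[leRHS]mulr1; apply: ler_pM => //; exact: expR_ge0.
have E0 : 0 <= expR 1 :> R by exact: expR_ge0.
have B0 : 0 <= 2 * beta by rewrite mulr_ge0.
have st1 := @taylor_step sg tau beta _ p1 q0 p0 q0 0 sb tb E0.
have {}st1 x : 0 <= x <= 1 -> `|p1 x| <= 2 * beta * expR 1 * x ^+ 1 /\
    `|q0 x| <= 2 * beta * expR 1 * x ^+ 1.
  apply: st1 => {x}.
  - by move=> x; rewrite /p1 /p0 /q0; apply: is_derive_eq; rewrite /GRing.scale /=; ring.
  - by move=> x; rewrite /p0 /q0; apply: is_derive_eq; rewrite /GRing.scale /=; ring.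
  - by rewrite /p1 /p0 !mul0r expR0 cos0 mulr1 subrr.
  - by rewrite /q0 !mul0r sin0 mulr0.
  - exact: e1.
have st2 := @taylor_step sg tau beta _ p2 q2 p1 q0 1 sb tb (mulr_ge0 B0 E0).
have {}st2 x : 0 <= x <= 1 -> `|p2 x| <= 2 * beta * (2 * beta * expR 1) * x ^+ 2 /\
    `|q2 x| <= 2 * beta * (2 * beta * expR 1) * x ^+ 2.
  apply: st2 => {x}.
  - by move=> x; rewrite /p2 /p1 /p0 /q0; apply: is_derive_eq; rewrite /GRing.scale /=; ring.
  - by move=> x; rewrite /q2 /p1 /p0 /q0; apply: is_derive_eq; rewrite /GRing.scale /=; ring.
  - by rewrite /p2 /p1 /p0 !mul0r expR0 cos0; ring.
  - by rewrite /q2 /q0 !mul0r sin0; ring.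
  - exact: st1.
have st3 := @taylor_step sg tau beta _ p3 q3 p2 q2 2 sb tb
  (mulr_ge0 B0 (mulr_ge0 B0 E0)).
have {}st3 x : 0 <= x <= 1 ->
    `|p3 x| <= 2 * beta * (2 * beta * (2 * beta * expR 1)) * x ^+ 3 /\
    `|q3 x| <= 2 * beta * (2 * beta * (2 * beta * expR 1)) * x ^+ 3.
  apply: st3 => {x}.
  - move=> x; rewrite /p3 /p2 /q2 /p1 /p0 /q0; apply: is_derive_eq.
    by rewrite /GRing.scale /=; field.
  - move=> x; rewrite /q3 /p2 /q2 /p1 /p0 /q0; apply: is_derive_eq.
    by rewrite /GRing.scale /=; field.
  - by rewrite /p3 /p2 /p1 /p0 !mul0r expR0 cos0; ring.
  - by rewrite /q3 /q2 /q0 !mul0r sin0; ring.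
  - exact: st2.
have st4 := @taylor_step sg tau beta _ p4 q4 p3 q3 3 sb tb
  (mulr_ge0 B0 (mulr_ge0 B0 (mulr_ge0 B0 E0))).
have {}st4 x : 0 <= x <= 1 ->
    `|p4 x| <= 2 * beta * (2 * beta * (2 * beta * (2 * beta * expR 1))) * x ^+ 4 /\
    `|q4 x| <= 2 * beta * (2 * beta * (2 * beta * (2 * beta * expR 1))) * x ^+ 4.
  apply: st4 => {x}.
  - move=> x; rewrite /p4 /p3 /p2 /q3 /q2 /p1 /p0 /q0; apply: is_derive_eq.
    by rewrite /GRing.scale /=; field.
  - move=> x; rewrite /q4 /q3 /p3 /p2 /q2 /p1 /p0 /q0; apply: is_derive_eq.
    by rewrite /GRing.scale /=; field.
  - by rewrite /p4 /p3 /p2 /p1 /p0 !mul0r expR0 cos0; ring.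
  - by rewrite /q4 /q3 /q2 /q0 !mul0r sin0; ring.
  - exact: st3.
have := st4 1; rewrite lexx ler01 => /(_ isT).
have -> : 2 * beta * (2 * beta * (2 * beta * (2 * beta * expR 1))) * 1 ^+ 4 =
  16 * expR 1 * beta ^+ 4 by ring.
by rewrite /p4 /q4 /p3 /q3 /p2 /q2 /p1 /p0 /q0 !expr1n !mul1r.
Qed.

Lemma cexp_taylor (a : C) : normc a <= 1 ->
  normc (cexp a - (1 + a + a ^+ 2 / 2%:R + a ^+ 3 / 6%:R)) <=
    32 * expR 1 * normc a ^+ 4.
Proof.
move=> a1.
have hs := le_trans (abs_Re_le a) a1; have ht := le_trans (abs_Im_le a) a1.
have [h1 h2] := cexp_taylor_components hs ht (abs_Re_le a) (abs_Im_le a).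
apply: le_trans (normc_le_abs _) _.
have inv (n : nat) : ((n%:R : C)^-1) = ((n%:R^-1 : R)%:C)%C.
  by rewrite fmorphV rmorph_nat.
have -> : Re (cexp a - (1 + a + a ^+ 2 / 2%:R + a ^+ 3 / 6%:R)) =
  expR (Re a) * cos (Im a) - 1 - Re a - (Re a ^+ 2 - Im a ^+ 2) / 2
      - (Re a ^+ 3 - 3 * Re a * Im a ^+ 2) / 6.
  rewrite !inv ReD Re_cexp; case: a {a1 hs ht h1 h2} => x y /=.
  by rewrite !exprS expr0 !mulr1 /=; field.
have -> : Im (cexp a - (1 + a + a ^+ 2 / 2%:R + a ^+ 3 / 6%:R)) =
  expR (Re a) * sin (Im a) - Im a - Re a * Im a
      - (3 * Re a ^+ 2 * Im a - Im a ^+ 3) / 6.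
  rewrite !inv ImD Im_cexp; case: a {a1 hs ht h1 h2} => x y /=.
  by rewrite !exprS expr0 !mulr1 /=; field.
lra.
Qed.

End complex_exponential.

(** Jordan's inequality: sin t / t decreases, its derivative having the sign of t cos t - sin t. *)
Lemma sin_ge_linear (R : realType) (x : R) : 0 <= x <= pi / 2 -> 2 / pi * x <= sin x.
Proof.
move=> /andP[x0 x1]; have pi0 := pi_gt0 R.
have [->|xn0] := eqVneq x 0; first by rewrite mulr0 sin0.
have {xn0}x0 : 0 < x by rewrite lt_neqAle eq_sym xn0.
have h (t : R) : 0 <= t <= pi / 2 -> t * cos t - sin t <= 0.
  move=> /andP[t0 t1].
  have d1 u : is_derive u (1 : R) (fun t => t * cos t - sin t) (- (u * sin u)).
    by apply: is_derive_eq; rewrite /GRing.scale /=; ring.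
  have := @derive_le_subr R _ (cst 0) _ (cst 0) 0 t t0 (fun u _ => d1 u)
     (fun u _ => is_derive_cst _ _ _).
  rewrite /= mul0r sin0 !subr0; apply => u /andP[u0 u1].
  rewrite oppr_le0 mulr_ge0 // sin_ge0_pi // u0 /=; lra.
have d2 u : x <= u <= pi / 2 -> is_derive u (1 : R) (fun t => sin t / t)
    ((u * cos u - sin u) / u ^+ 2).
  move=> /andP[u0 u1]; have u0' : u != 0 by apply: lt0r_neq0; lra.
  have dV : is_derive u (1 : R) (fun t : R => t^-1) (- u ^- 2).
    apply: (is_derive_eq (is_deriveV u0' (is_derive_id u (1 : R)))).
    by rewrite /GRing.scale /= mulr1.
  by apply: is_derive_eq; rewrite /GRing.scale /=; field.
have := @derive_le_subr R _ (cst 0) _ (cst 0) x (pi / 2) x1 d2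
     (fun u _ => is_derive_cst _ _ _).
rewrite /= sin_pihalf subrr subr_le0.
have -> : 1 / (pi / 2) = 2 / pi :> R by rewrite mul1r invfM invrK mulrC.
rewrite ler_pdivlMr // => hd; apply: hd => u /andP[u0 u1].
have uu : 0 <= u <= pi / 2 by rewrite u1 andbT; lra.
by rewrite mulr_le0_ge0 ?h // invr_ge0 sqr_ge0.
Qed.

Lemma cos_le_quadratic (R : realType) (x : R) : 0 <= x <= pi ->
  2 / pi ^+ 2 * x ^+ 2 <= 1 - cos x.
Proof.
move=> /andP[x0 x1]; have pi0 := pi_gt0 R.
have h : 2 / pi * (x / 2) <= sin (x / 2) by apply: sin_ge_linear; apply/andP; split; lra.
have -> : cos x = 1 - 2 * sin (x / 2) ^+ 2.
  have -> : x = x / 2 + x / 2 by field.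
  rewrite cosD; have -> : x / 2 + x / 2 = x by field.
  have := cos2Dsin2 (x / 2); rewrite !expr2; lra.
have -> : 2 / pi ^+ 2 * x ^+ 2 = 2 * (2 / pi * (x / 2)) ^+ 2.
  by rewrite -exprVn; set i := pi^-1; field.
have : (2 / pi * (x / 2)) ^+ 2 <= sin (x / 2) ^+ 2.
  rewrite lerXn2r ?nnegrE //; last by apply: le_trans h; rewrite !mulr_ge0 ?invr_ge0 // ltW.
  by rewrite !mulr_ge0 ?invr_ge0 // ltW.
lra.
Qed.

(** * Third-order expansion of log (1 + p (exp a - 1)) *)

Section logarithm.
Variable R : realType.
Notation C := R[i].
Notation Re := complex.Re.
Notation Im := complex.Im.

Lemma normc_pow_sub1 (r : C) (e : R) n : normc (r - 1) <= e ->
  normc (r ^+ n - 1) <= expR (n%:R * e) - 1.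
Proof.
move=> hr; elim: n => [|n IH]; first by rewrite expr0 subrr normc0 mul0r expR0 subrr.
have e0 : 0 <= e by apply: le_trans hr; exact: normc_ge0.
have hn : normc (r ^+ n) <= expR (n%:R * e).
  have := normc_triangle (r ^+ n - 1) 1; rewrite subrK normc1; lra.
have -> : r ^+ n.+1 - 1 = r ^+ n * (r - 1) + (r ^+ n - 1) by rewrite exprSr; ring.
apply: le_trans (normc_triangle _ _) _; rewrite normcM.
have h1 : normc (r ^+ n) * normc (r - 1) <= expR (n%:R * e) * e.
  by apply: ler_pM => //; exact: normc_ge0.
have -> : n.+1%:R * e = n%:R * e + e by rewrite -natr1; ring.
rewrite expRD.
have h2 : expR (n%:R * e) * (1 + e) <= expR (n%:R * e) * expR e.
  by rewrite ler_wpM2l ?expR_ge0 // expR_ge1Dx.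
lra.
Qed.

(** With [lcum3], the second and third cumulants of a Bernoulli variable of parameter p; negative p
    will occur too. *)
Definition lcum2 (p : R) := p * (1 - p).
Definition lcum3 (p : R) := p * (1 - p) * (1 - 2 * p).

(* The expansion to third order of log (1 + p (exp a - 1)), the cumulant
   generating function of a Bernoulli variable when 0 <= p <= 1. *)
Definition lcgf (p : R) (a : C) : C :=
  (p%:C)%C * a + ((lcum2 p / 2)%:C)%C * a ^+ 2 + ((lcum3 p / 6)%:C)%C * a ^+ 3.

(** Collected in [log_taylor]: the remainder 32 e of two exponentials, with weights P and (3 P^3)^4
    = 81 P^12; the polynomial mismatch 30 P^9; and a last e for dividing by an exponential whose
    argument has modulus at most 1. *)
Definition lcgf_const (P : R) : R :=
  (32 * expR 1 * (81 * P ^+ 12 + P) + 30 * P ^+ 9) * expR 1.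

(** The truncated exponential of the truncated logarithm is correct to third order; the quotient of
    the error by a^4 is written out so that it can be bounded. *)
Lemma lcgf_remainder (p : R) (a : C) :
  let P := (p%:C)%C in let c := ((lcum2 p)%:C)%C in let d := ((lcum3 p)%:C)%C in
  let q := P + c / 2%:R * a + d / 6%:R * a ^+ 2 in
  let q2 := c ^+ 2 / 4%:R + P * d / 3%:R + c * d / 6%:R * a + d ^+ 2 / 36%:R * a ^+ 2 in
  let q3 := (c / 2%:R + d / 6%:R * a) * (q ^+ 2 + q * P + P ^+ 2) in
  lcgf p a = a * q /\
  1 + P * ((1 + a + a ^+ 2 / 2%:R + a ^+ 3 / 6%:R) - 1) -
  (1 + a * q + (a * q) ^+ 2 / 2%:R + (a * q) ^+ 3 / 6%:R) =
  - (a ^+ 4 * (q2 / 2%:R + q3 / 6%:R)).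
Proof.
move=> P c d q q2 q3.
have cE : c = P * (1 - P) by rewrite /c /lcum2 /P !(rmorphM, rmorphB, rmorph1).
have dE : d = P * (1 - P) * (1 - 2%:R * P).
  by rewrite /d /lcum3 /P !(rmorphM, rmorphB, rmorph1, rmorph_nat).
have E2 : ((lcum2 p / 2)%:C)%C = c / 2%:R by rewrite rmorphM fmorphV rmorph_nat.
have E6 : ((lcum3 p / 6)%:C)%C = d / 6%:R by rewrite rmorphM fmorphV rmorph_nat.
split; first by rewrite /lcgf E2 E6 /q -/P; ring.
by rewrite /q3 /q2 /q cE dE; field.
Qed.

(** A factor r close to 1 plays the part of an additive error on a complex logarithm, which would
    require a choice of branch. *)
Lemma log_taylor (p P : R) (a : C) : 1 <= P -> `|p| <= P -> 3 * P ^+ 3 * normc a <= 1 ->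
  exists r, 1 + (p%:C)%C * (cexp a - 1) = r * cexp (lcgf p a) /\
    normc (r - 1) <= lcgf_const P * normc a ^+ 4.
Proof.
move=> P1 hp ha.
have P0 : 0 < P by apply: lt_le_trans P1.
have na0 := normc_ge0 a.
have Pn n : 1 <= P ^+ n by rewrite exprn_ege1.
have na1 : normc a <= 1.
  apply: le_trans ha; rewrite ler_peMl //; have := Pn 3; lra.
have na2 : normc a ^+ 2 <= 1 by rewrite exprn_ile1.
have mono i j : (i <= j)%N -> P ^+ i <= P ^+ j by move=> ij; rewrite ler_weXn2l.
have nE (n : nat) : normc ((n%:R : C)^-1) = n%:R^-1 by rewrite normcV normc_natr.
have c2 : `|lcum2 p| <= 2 * P ^+ 2.
  rewrite /lcum2 normrM; have h1 : `|1 - p| <= 2 * P.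
    by apply: le_trans (ler_normB _ _) _; rewrite normr1; lra.
  have -> : 2 * P ^+ 2 = P * (2 * P) by ring.
  exact: ler_pM.
have d2 : `|lcum3 p| <= 6 * P ^+ 3.
  rewrite /lcum3 normrM; have h1 : `|1 - 2 * p| <= 3 * P.
    by apply: le_trans (ler_normB _ _) _; rewrite normr1 normrM ger0_norm //; lra.
  have -> : 6 * P ^+ 3 = (2 * P ^+ 2) * (3 * P) by ring.
  exact: ler_pM.
have [] := lcgf_remainder p a.
set PC := (p%:C)%C; set c := ((lcum2 p)%:C)%C; set d := ((lcum3 p)%:C)%C.
set q := PC + _ + _; set q2 := _ + _ * a ^+ 2; set q3 := (_ + _) * (_ + _).
move=> QE remE.
have nP : normc PC <= P by rewrite normc_real.
have nc : normc c <= 2 * P ^+ 2 by rewrite normc_real.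
have nd : normc d <= 6 * P ^+ 3 by rewrite normc_real.
have g0 := @normc_ge0 R.
have nc2 : normc (c / 2%:R) <= P ^+ 2 by rewrite normcM nE; lra.
have nd6 : normc (d / 6%:R) <= P ^+ 3 by rewrite normcM nE; lra.
have le1 (u v x : R) : 0 <= u -> 0 <= v -> u <= x -> v <= 1 -> u * v <= x.
  by move=> u0 v0 ux v1; apply: le_trans ux; rewrite ler_piMr.
have nq : normc q <= 3 * P ^+ 3.
  apply: le_trans (normc_triangle _ _) _.
  have h := normc_triangle PC (c / 2%:R * a).
  rewrite [normc (d / _ * _)]normcM normcX; rewrite [normc (c / _ * a)]normcM in h.
  have h1 := le1 _ _ _ (g0 _) (g0 _) nc2 na1.
  have h2 := le1 _ _ _ (g0 _) (exprn_ge0 2 na0) nd6 na2.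
  have := mono 2 3 isT; have := mono 1 3 isT; rewrite expr1; lra.
have nq2 : normc q2 <= 6 * P ^+ 6.
  have e1 : normc (c ^+ 2 / 4%:R) <= P ^+ 4.
    have -> : c ^+ 2 / 4%:R = (c / 2%:R) * (c / 2%:R) by field.
    rewrite normcM (_ : P ^+ 4 = P ^+ 2 * P ^+ 2); last ring.
    exact: ler_pM.
  have e2 : normc (PC * d / 3%:R) <= 2 * P ^+ 4.
    have -> : PC * d / 3%:R = 2%:R * (PC * (d / 6%:R)) by field.
    rewrite normcM normc_natr ler_pM2l // normcM (_ : P ^+ 4 = P * P ^+ 3); last ring.
    exact: ler_pM.
  have e3 : normc (c * d / 6%:R * a) <= 2 * P ^+ 5.
    have -> : c * d / 6%:R * a = c * (d / 6%:R) * a by ring.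
    rewrite normcM; apply: le1 => //.
    rewrite normcM (_ : 2 * P ^+ 5 = (2 * P ^+ 2) * P ^+ 3); last ring.
    exact: ler_pM.
  have e4 : normc (d ^+ 2 / 36%:R * a ^+ 2) <= P ^+ 6.
    have -> : d ^+ 2 / 36%:R * a ^+ 2 = (d / 6%:R) * (d / 6%:R) * a ^+ 2 by field.
    rewrite normcM normcX; apply: le1 => //; first exact: exprn_ge0.
    rewrite normcM (_ : P ^+ 6 = P ^+ 3 * P ^+ 3); last ring.
    exact: ler_pM.
  rewrite /q2; apply: le_trans (normc_triangle _ _) _.
  have h1 := normc_triangle (c ^+ 2 / 4%:R + PC * d / 3%:R) (c * d / 6%:R * a).
  have h2 := normc_triangle (c ^+ 2 / 4%:R) (PC * d / 3%:R).
  have := mono 4%N 6%N isT; have := mono 5%N 6%N isT; lra.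
have nq3 : normc q3 <= 54 * P ^+ 9.
  have e1 : normc (c / 2%:R + d / 6%:R * a) <= 2 * P ^+ 3.
    apply: le_trans (normc_triangle _ _) _.
    have h := le1 _ _ _ (g0 (d / 6%:R)) (g0 _) nd6 na1; rewrite -normcM in h.
    have := mono 2 3 isT; lra.
  have e2 : normc (q ^+ 2 + q * PC + PC ^+ 2) <= 27 * P ^+ 6.
    apply: le_trans (normc_triangle _ _) _.
    have h := normc_triangle (q ^+ 2) (q * PC).
    have PP : normc PC <= 3 * P ^+ 3.
      by apply: le_trans nP _; have := mono 1%N 3%N isT; have := Pn 3; rewrite expr1; lra.
    have f u v : normc u <= 3 * P ^+ 3 -> normc v <= 3 * P ^+ 3 ->
        normc (u * v) <= 9 * P ^+ 6.
      move=> hu hv; rewrite normcM (_ : 9 * P ^+ 6 = (3 * P ^+ 3) * (3 * P ^+ 3)); last ring.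
      exact: ler_pM.
    have := f _ _ nq nq; have := f _ _ nq PP; have := f _ _ PP PP.
    rewrite -!expr2; lra.
  rewrite normcM (_ : 54 * P ^+ 9 = (2 * P ^+ 3) * (27 * P ^+ 6)); last ring.
  exact: ler_pM.
have nQ : normc (lcgf p a) <= 3 * P ^+ 3 * normc a.
  by rewrite QE normcM mulrC ler_wpM2r.
have nQ1 := le_trans nQ ha.
exists ((1 + PC * (cexp a - 1)) * cexp (- lcgf p a)); split.
  by rewrite -mulrA -cexpD addNr cexp0 mulr1.
have -> : (1 + PC * (cexp a - 1)) * cexp (- lcgf p a) - 1 =
    ((1 + PC * (cexp a - 1)) - cexp (lcgf p a)) * cexp (- lcgf p a).
  by rewrite mulrBl -cexpD subrr cexp0.
rewrite normcM normc_cexp.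
have e5 : expR (Re (- lcgf p a)) <= expR 1.
  rewrite ler_expR; apply: le_trans (ler_norm _) _.
  by apply: le_trans (abs_Re_le _) _; rewrite normc_opp.
have t1 := cexp_taylor na1; have t2 := cexp_taylor nQ1.
set Ta := (1 + a + _ + _) in t1; set TQ := (1 + lcgf p a + _ + _) in t2.
have e6 : normc (1 + PC * (Ta - 1) - TQ) <= 30 * P ^+ 9 * normc a ^+ 4.
  rewrite /Ta /TQ QE remE normc_opp normcM normcX mulrC ler_wpM2r ?exprn_ge0 //.
  apply: le_trans (normc_triangle _ _) _; rewrite (normcM q2) (normcM q3) !nE.
  have := mono 6%N 9%N isT; have := Pn 6; lra.
have e7 : normc (lcgf p a) ^+ 4 <= 81 * P ^+ 12 * normc a ^+ 4.
  have -> : 81 * P ^+ 12 * normc a ^+ 4 = (3 * P ^+ 3 * normc a) ^+ 4 by ring.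
  by apply: lerXn2r; rewrite ?nnegrE ?g0 //; rewrite !mulr_ge0 ?exprn_ge0 ?(ltW P0).
rewrite /lcgf_const [leRHS]mulrAC; apply: ler_pM; rewrite ?g0 ?expR_ge0 //.
have -> : 1 + PC * (cexp a - 1) - cexp (lcgf p a) =
  (1 + PC * (Ta - 1) - TQ) + (PC * (cexp a - Ta) - (cexp (lcgf p a) - TQ)) by ring.
apply: le_trans (normc_triangle _ _) _.
have h1 := normc_triangle (PC * (cexp a - Ta)) (- (cexp (lcgf p a) - TQ)).
rewrite normc_opp normcM in h1.
have h2 : normc PC * normc (cexp a - Ta) <= P * (32 * expR 1 * normc a ^+ 4).
  by apply: ler_pM.
have h3 : 32 * expR 1 * normc (lcgf p a) ^+ 4 <= 32 * expR 1 * (81 * P ^+ 12 * normc a ^+ 4).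
  by rewrite ler_wpM2l // mulr_ge0 ?expR_ge0.
lra.
Qed.

(** For 0 <= p <= 1, the characteristic function of a Bernoulli variable; the factor E of the
    integrand leads to p < 0. *)
Definition chi (p th : R) : C := 1 + (p%:C)%C * (cis th - 1).

Lemma normc_chi_sqr p th : normc (chi p th) ^+ 2 = 1 - 2 * lcum2 p * (1 - cos th).
Proof.
rewrite normc_sqr /chi real_complexM /= /lcum2.
have := cos2Dsin2 th; set u := cos th; set v := sin th => h.
have -> : (0 + p * (v - 0)) ^+ 2 = p ^+ 2 * v ^+ 2 by ring.
have -> : v ^+ 2 = 1 - u ^+ 2 by rewrite -h; ring.
ring.
Qed.

Lemma normc_chi_le p th : normc (chi p th) <= expR (- (lcum2 p * (1 - cos th))).
Proof.
rewrite -(@ler_pXn2r _ 2) ?nnegrE ?normc_ge0 ?expR_ge0 // normc_chi_sqr.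
rewrite -expRM_natl; apply: le_trans (expR_ge1Dx _); rewrite -mulr_natl; lra.
Qed.

Lemma normc_chi_ge1 p th : p <= 0 -> 1 <= normc (chi p th).
Proof.
move=> p0; rewrite -(@ler_pXn2r _ 2) ?nnegrE ?normc_ge0 // normc_chi_sqr expr1n.
have h : 0 <= 1 - cos th by rewrite subr_ge0 cos_le1.
rewrite lerDl oppr_ge0 mulr_le0_ge0 // mulr_ge0_le0 // /lcum2 mulr_le0_ge0 //; lra.
Qed.

(** Exponential tilting: moving the contour by the real amount al changes the parameter p into
    [tilt p al], up to a scalar. *)
Definition tilt (p al : R) := p * expR al / (1 + p * (expR al - 1)).

Lemma chi_tilt (p al th : R) : 1 + p * (expR al - 1) != 0 ->
  1 + (p%:C)%C * (cexp (Complex al th) - 1) =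
  ((1 + p * (expR al - 1))%:C)%C * chi (tilt p al) th.
Proof.
move=> h0; rewrite /chi /tilt /cexp /=.
apply: complex_ext; rewrite !real_complexM /=; field => //.
Qed.

End logarithm.

Lemma Rintegral_scale (R : realType) (f : R -> R) (k b : R) :
  continuous f -> 0 < k -> 0 <= b ->
  k * \int[@lebesgue_measure R]_(x in `[0, b]) f x =
  \int[@lebesgue_measure R]_(x in `[0, b * k]) f (x / k).
Proof.
move=> cf k0 b0.
pose F (x : R) := x / k.
have dF x : is_derive x (1 : R) F k^-1.
  by rewrite /F; apply: is_derive_eq; rewrite /GRing.scale /= mulr1 mulr0 add0r.
have F'E : F^`()%classic = cst k^-1.
  by apply/funext => x; rewrite derive1E derive_val.
have cF := derive_continuous dF.
have := @integration_by_substitution_increasing R F f 0 (b * k).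
rewrite F'E /F mul0r mulfK ?gt_eqF // => /(_ _ _ _ _ _ _ _)/(congr1 (@fine R)) h.
rewrite /Rintegral h //=.
- rewrite -[LHS]/(k * Rintegral _ _ _) -RintegralZl //; last first.
    apply: continuous_itv_integrable => x; apply: cvgM; last exact: cvg_cst.
    by apply: (@continuous_comp _ _ _ F f); [exact: cF|exact: cf].
  by apply: eq_Rintegral => x _; rewrite mulrCA mulfV ?mulr1 // gt_eqF.
- by rewrite mulr_ge0 // ltW.
- by move=> x y _ _ xy; rewrite ltr_pM2r // invr_gt0.
- by move=> x _; exact: cvg_cst.
- exact: is_cvg_cst.
- exact: is_cvg_cst.
- split; first by move=> x _; apply: ex_derive.
    by apply: cvg_at_right_filter; exact: cF.
  by apply: cvg_at_left_filter; exact: cF.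
- exact: continuous_subspaceT.
Qed.

Section complex_helpers.
Variable R : realType.
Notation C := R[i].

Lemma ccont_cexp (al : R) : ccont (fun th => cexp (Complex al th)).
Proof. by apply: (ccontM (ccont_cst ((expR al)%:C)%C)); exact: ccont_cis. Qed.

Lemma real_complexN (x : R) : ((- x)%:C)%C = - (x%:C)%C :> C.
Proof. by apply: complex_ext; rewrite /= ?oppr0. Qed.

Lemma rcM (x y : R) : ((x * y)%:C)%C = (x%:C)%C * (y%:C)%C :> C.
Proof. exact: rmorphM. Qed.

Lemma rcX (x : R) n : ((x ^+ n)%:C)%C = (x%:C)%C ^+ n :> C.
Proof. exact: rmorphXn. Qed.

Lemma real_complex_exprz (x : R) (k : int) : ((x ^ k)%:C)%C = (x%:C)%C ^ k :> C.
Proof. by case: k => k; rewrite ?NegzE -?exprnN -?exprnP ?fmorphV rmorphXn. Qed.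

Lemma real_complex_neq0 (x : R) : x != 0 -> (x%:C)%C != 0 :> C.
Proof. by move=> h; apply: contra h => /eqP/(congr1 (@complex.Re R)) /= ->. Qed.

(** A zero would give 1 - p = - p exp a, whose right side has modulus at most - p. *)
Lemma lcgf_neq0 (p : R) (a : C) : p <= 0 -> complex.Re a <= 0 ->
  1 + (p%:C)%C * (cexp a - 1) != 0.
Proof.
move=> p0 a0; apply/eqP => h.
have h1 : ((1 - p)%:C)%C = ((- p)%:C)%C * cexp a.
  by rewrite real_complexN rmorphB rmorph1 -[RHS]addr0 -h; ring.
have := congr1 (@ComplexField.Normc.normc R) h1.
rewrite normcM !normc_real normc_cexp !ger0_norm; try lra.
have : - p * expR (complex.Re a) <= - p.
  by rewrite ler_piMr ?oppr_ge0 // -expR0 ler_expR.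
lra.
Qed.

End complex_helpers.

(** * The integrand near a saddle point w *)

Section saddle.
Variables (R : realType) (z w : R).
Hypotheses (z01 : 0 < z < 1) (w0 : 0 < w).
Notation C := R[i].
Notation Re := complex.Re.
Notation Im := complex.Im.

(** With V = w e^a / (1 + z w), the factors D and E are constants times 1 + p (e^a - 1), where p is
    [sad1] for D and [sad2] for E. *)
Definition sad1 : R := (1 - z) * w / (1 + w).
Definition sad2 : R := - (z * w).

Let zz : 0 < z. Proof. by case/andP: z01. Qed.
Let z1 : z < 1. Proof. by case/andP: z01. Qed.
Let zw0 : 0 < z * w. Proof. exact: mulr_gt0. Qed.

Lemma sad1_gt0 : 0 < sad1.
Proof. by rewrite /sad1 divr_gt0 ?mulr_gt0 ?subr_gt0 ?addr_gt0. Qed.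

Lemma sad1_lt1 : sad1 < 1.
Proof. rewrite /sad1 ltr_pdivrMr ?addr_gt0 // mul1r; have := zw0; lra. Qed.

(** The integrand of [acoef_avg] divided by its value [sadpref] at a = 0, with e = m - n + j. The
    exponent e is an integer because p will be subtracted from it. *)
Definition sadf (n : nat) (e : int) (j : nat) (a : C) : C :=
  (1 + (sad1%:C)%C * (cexp a - 1)) ^+ n * (1 + (sad2%:C)%C * (cexp a - 1)) ^ (e - 1) *
  cexp (- j%:R * a).

Definition sadpref (n : nat) (e : int) (j : nat) : R :=
  ((1 + w) / (1 + z * w)) ^+ n * (1 + z * w) ^ (1 - e) * (w / (1 + z * w)) ^ (- j%:Z).

Lemma sadpref_gt0 n e j : 0 < sadpref n e j.
Proof.
by rewrite /sadpref !mulr_gt0 ?exprz_gt0 ?exprn_gt0 ?divr_gt0 ?addr_gt0.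
Qed.

(** The shift al <= 0 shrinks the circle, so E still has no zero on it; the curvature estimate will
    need a strict shift. *)
Lemma acoef_saddle n m e j (al : R) : n%:Z + e = m%:Z + j%:Z -> al <= 0 ->
  acoef z n m j = sadpref n e j * avg (fun th => sadf n e j (Complex al th)).
Proof.
move=> nemj al0.
have me : m%:Z - n%:Z + j%:Z - 1 = e - 1 by clear -nemj; lia.
pose v := w / (1 + z * w); pose v' := v * expR al.
have zw1 : 0 < 1 + z * w by rewrite addr_gt0.
have v0 : 0 < v by rewrite divr_gt0.
have v'0 : 0 < v' by rewrite mulr_gt0 // expR_gt0.
have e1 : expR al <= 1 by rewrite -expR0 ler_expR.
have zv : z * v < 1 by rewrite /v mulrA ltr_pdivrMr // mul1r; lra.
have zv' : z * v' < 1.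
  apply: le_lt_trans zv; rewrite /v' ler_wpM2l ?ler_piMr // ltW //.
have cE th : cexp (Complex al th) = ((expR al)%:C)%C * cis th by [].
have czw := real_complex_neq0 (lt0r_neq0 zw1).
have s20 : sad2 <= 0 by rewrite oppr_le0 ltW.
rewrite (@acoef_avg _ z v' z01 v'0 zv') -avgZ; last first.
  apply: ccontM; first apply: ccontM.
  - apply: ccontX; apply: ccontD; [exact: ccont_cst|apply: ccontM; first exact: ccont_cst].
    by apply: ccontD; [exact: ccont_cexp|exact: ccont_cst].
  - apply: ccont_exprz => [|th]; last exact: lcgf_neq0.
    apply: ccontD; [exact: ccont_cst|apply: ccontM; first exact: ccont_cst].
    by apply: ccontD; [exact: ccont_cexp|exact: ccont_cst].
  - have E : (fun th => cexp (- j%:R * Complex al th)) =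
       (fun th => cexp (Complex al th) ^ (- j%:Z)).
      by apply/funext => th; rewrite -cexp_intM rmorphN.
    rewrite E; apply: ccont_exprz => [|th]; last exact: cexp_neq0.
    exact: ccont_cexp.
congr avg; apply/funext => th.
have VE : (v'%:C)%C * cis th = (v%:C)%C * cexp (Complex al th).
  by rewrite cE mulrA -rmorphM.
have -> : m%:Z - n%:Z + j%:Z - 1 = e - 1.
  exact: me.
rewrite VE; set ex := cexp _.
have E1 : 1 + ((1 - z)%:C)%C * ((v%:C)%C * ex) =
    (((1 + w) / (1 + z * w))%:C)%C * (1 + (sad1%:C)%C * (ex - 1)).
  have -> : 1 + (sad1%:C)%C * (ex - 1) = ((1 - sad1)%:C)%C + (sad1%:C)%C * ex.
    by rewrite rmorphB rmorph1; ring.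
  rewrite mulrA mulrDr mulrA -!rmorphM; congr (_ + _%:C%C * _); last first.
    by rewrite /v /sad1; field; rewrite !gt_eqF ?addr_gt0.
  have -> : (1 + w) / (1 + z * w) * (1 - sad1) = 1.
    by rewrite /sad1; field; rewrite !gt_eqF ?addr_gt0.
  by rewrite rmorph1.
have E2 : 1 - (z%:C)%C * ((v%:C)%C * ex) =
    (((1 + z * w)^-1)%:C)%C * (1 + (sad2%:C)%C * (ex - 1)).
  have -> : 1 + (sad2%:C)%C * (ex - 1) = ((1 - sad2)%:C)%C + (sad2%:C)%C * ex.
    by rewrite rmorphB rmorph1; ring.
  rewrite mulrA mulrDr mulrA -!rmorphM.
  have -> : (1 + z * w)^-1 * (1 - sad2) = 1.
    by rewrite /sad2; field; rewrite !gt_eqF ?addr_gt0.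
  have -> : (1 + z * w)^-1 * sad2 = - (z * v) by rewrite /v /sad2; field; rewrite gt_eqF.
  by rewrite -[X in _ = X + _]/(1%:C)%C -[X in _ = _ + X * _]/((- (z * v))%:C)%C real_complexN mulNr.
have E20 : 1 + (sad2%:C)%C * (ex - 1) != 0 by exact: lcgf_neq0.
have ui : (((1 + z * w)^-1)%:C)%C \is a @GRing.unit C.
  by rewrite unitfE real_complex_neq0 // invr_neq0 // gt_eqF.
have uv : ((v%:C)%C : C) \is a GRing.unit by rewrite unitfE real_complex_neq0 // gt_eqF.
have uE : 1 + (sad2%:C)%C * (ex - 1) \is a GRing.unit by rewrite unitfE.
have ux : ex \is a GRing.unit by rewrite unitfE cexp_neq0.
rewrite E1 E2 exprMn (exprzMl _ ui uE) (exprzMl _ uv ux).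
rewrite /sadf /sadpref -/ex -/v !rcM rcX !real_complex_exprz -!rcM.
have -> : ((1 + z * w)^-1%:C)%C ^ (e - 1) = ((1 + z * w)%:C)%C ^ (1 - e).
  by rewrite fmorphV exprz_inv opprB.
have -> : cexp (- j%:R * Complex al th) = ex ^ (- j%:Z).
  by rewrite -cexp_intM rmorphN.
have gen (a b c d f g : C) : a * b * (c * d) * (f * g) = a * c * f * (b * d * g) by ring.
exact: gen.
Qed.

End saddle.

Section saddle_point.
Variables (R : realType) (z w : R).
Hypotheses (z01 : 0 < z < 1) (w0 : 0 < w).
Notation C := R[i].
Notation Re := complex.Re.
Notation Im := complex.Im.
Notation mu := (@lebesgue_measure R).
Notation p1 := (sad1 z w).
Notation p2 := (sad2 z w).
Notation f := (sadf z w).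

Let zz : 0 < z. Proof. by case/andP: z01. Qed.
Let zw0 : 0 < z * w. Proof. exact: mulr_gt0. Qed.
Let p10 := sad1_gt0 z01 w0.
Let p11 := sad1_lt1 z01 w0.
Let p20 : p2 < 0. Proof. by rewrite oppr_lt0. Qed.

Lemma lcum2_tilt (p al : R) : 1 + p * (expR al - 1) != 0 ->
  lcum2 (tilt p al) = lcum2 p * expR al / (1 + p * (expR al - 1)) ^+ 2.
Proof. by move=> h; rewrite /lcum2 /tilt; field. Qed.

Lemma sadf_ccont n e j al : al <= 0 -> ccont (fun th => f n e j (Complex al th)).
Proof.
move=> al0; apply: ccontM; first apply: ccontM.
- apply: ccontX; apply: ccontD; [exact: ccont_cst|apply: ccontM; first exact: ccont_cst].
  by apply: ccontD; [exact: ccont_cexp|exact: ccont_cst].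
- apply: ccont_exprz => [|th]; last by apply: lcgf_neq0 => //; exact: ltW.
  apply: ccontD; [exact: ccont_cst|apply: ccontM; first exact: ccont_cst].
  by apply: ccontD; [exact: ccont_cexp|exact: ccont_cst].
- have E : (fun th => cexp (- j%:R * Complex al th)) =
     (fun th => cexp (Complex al th) ^ (- j%:Z)).
    by apply/funext => th; rewrite -cexp_intM rmorphN.
  rewrite E; apply: ccont_exprz => [|th]; last exact: cexp_neq0.
  exact: ccont_cexp.
Qed.

(** The contour Re a = - 1 / k with angle x / k views the integrand at scale k; there it corresponds
    to the line of abscissa 1 of the Airy integral. *)
Lemma saddle_scaled n m e j (k : R) : n%:Z + e = m%:Z + j%:Z -> 0 < k ->
  k * acoef z n m j / sadpref z w n e j =
  pi^-1 * \int[mu]_(x in `[0, pi * k]) Re (f n e j (Complex (- k^-1) (x / k))).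
Proof.
move=> h k0.
have al0 : - k^-1 <= 0 by rewrite oppr_le0 invr_ge0 ltW.
rewrite (acoef_saddle z01 w0 h al0) mulrCA -mulrA [_ * avg _]mulrC mulrA mulrAC.
rewrite mulfV ?gt_eqF ?sadpref_gt0 // mul1r mulrC /avg mulrCA; congr (_ * _).
have [cRe _] := sadf_ccont n e j al0.
by apply: (Rintegral_scale cRe) => //; exact: pi_ge0.
Qed.

Variables (n e0 j0 : nat) (al : R).
Hypothesis al0 : al <= 0.

Let E := expR al.
Let E0 : 0 < E. Proof. exact: expR_gt0. Qed.
Let E1 : E <= 1. Proof. by rewrite /E -expR0 ler_expR. Qed.
Let X1 := 1 + p1 * (E - 1).
Let X2 := 1 + p2 * (E - 1).

Let X10 : 0 < X1.
Proof.
have : p1 * (1 - E) < 1 * 1.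
  apply: (@le_lt_trans _ _ (p1 * 1)); last by rewrite ltr_pM2r.
  by rewrite ler_wpM2l ?(ltW p10) //; have := E0; lra.
rewrite /X1; lra.
Qed.

Let X11 : X1 <= 1.
Proof. by rewrite /X1 gerDl mulr_ge0_le0 ?(ltW p10) // subr_le0. Qed.

Let X21 : 1 <= X2.
Proof. by rewrite /X2 lerDl mulr_le0 ?(ltW p20) // subr_le0. Qed.

(** Curvature of the modulus along the shifted circle: a positive part from D and a negative part
    from E. *)
Definition sadvar := n%:R * lcum2 (tilt p1 al) + e0%:R * lcum2 (tilt p2 al).

(** [chi_tilt] isolates the value at angle 0 and [normc_chi_le] bounds the rest. Lowering the
    exponent of E by p only helps, since the moduli concerned are at least 1; lowering j0 by p
    yields exp(al p), the source of all decay in p. *)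
Lemma sadf_norm_le (p : nat) th : (p <= j0)%N ->
  normc (f n (e0%:Z - p%:Z) (j0 - p) (Complex al th)) <=
  normc (f n e0 j0 (Complex al 0)) * expR (al * p%:R) *
  expR (- (sadvar * (1 - cos th))).
Proof.
move=> pj.
have X20 : 0 < X2 by apply: lt_le_trans X21.
have u0 : 0 <= 1 - cos th by rewrite subr_ge0 cos_le1.
have l2 : lcum2 (tilt p2 al) <= 0.
  rewrite lcum2_tilt -/E -/X2 ?gt_eqF // mulr_le0_ge0 ?invr_ge0 ?sqr_ge0 //.
  rewrite mulr_le0_ge0 ?(ltW E0) // /lcum2 mulr_le0_ge0 ?(ltW p20) //; have := p20; lra.
have t2 : tilt p2 al <= 0.
  by rewrite /tilt -/E -/X2 mulr_le0_ge0 ?invr_ge0 ?(ltW X20) // mulr_le0_ge0 ?(ltW E0) ?(ltW p20).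
rewrite /sadf !(chi_tilt _ _) -/E -/X1 -/X2 ?gt_eqF //.
have chi0 q : chi q 0 = 1 :> C.
  by rewrite /chi /cis cos0 sin0 (_ : Complex 1 0 = 1) // subrr mulr0 addr0.
rewrite !chi0 !mulr1 !(normcM, normcX, normc_exprz, normc_real, normc_cexp).
rewrite !(ger0_norm (ltW X10)) !(ger0_norm (ltW X20)).
have ReE j t : Re (- j%:R * Complex al t) = - (j%:R * al).
  by rewrite -[j%:R]/(j%:R : C) -(rmorph_nat (real_complex R)) -real_complexN real_complexM /= mulNr.
have c2n0 : normc (chi (tilt p2 al) th) != 0.
  by rewrite gt_eqF // (lt_le_trans ltr01) // normc_chi_ge1.
rewrite !ReE exprMn exprzMl ?unitfE ?(gt_eqF X20) //.
set c1 := normc (chi _ th); set c2 := normc (chi (tilt p2 al) th).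
have c1le : c1 <= expR (- (lcum2 (tilt p1 al) * (1 - cos th))) by exact: normc_chi_le.
have c2le : c2 <= expR (- (lcum2 (tilt p2 al) * (1 - cos th))) by exact: normc_chi_le.
have c10 : 0 <= c1 by exact: normc_ge0.
have c21 : 1 <= c2 by exact: normc_chi_ge1.
have c20 : 0 < c2 by apply: lt_le_trans c21.
have A1 : c1 ^+ n <= expR (- (n%:R * lcum2 (tilt p1 al) * (1 - cos th))).
  apply: le_trans (_ : expR (- (lcum2 (tilt p1 al) * (1 - cos th))) ^+ n <= _).
    by rewrite lerXn2r ?nnegrE // expR_ge0.
  by rewrite -expRM_natl ler_expR -mulr_natl; lra.
have A2 : c2 ^ (e0%:Z - p%:Z - 1) <= expR (- (e0%:R * lcum2 (tilt p2 al) * (1 - cos th))).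
  apply: (@le_trans _ _ (c2 ^+ e0)).
    rewrite (_ : e0%:Z - p%:Z - 1 = e0%:Z + (- p.+1%:Z)); last first.
      by rewrite -addn1 PoszD; ring.
    rewrite expfzDr ?gt_eqF // -exprnP ler_piMr ?exprn_ge0 ?(ltW c20) //.
    by rewrite -exprnN invf_le1 ?exprn_gt0 // exprn_ege1.
  apply: le_trans (_ : expR (- (lcum2 (tilt p2 al) * (1 - cos th))) ^+ e0 <= _).
    by rewrite lerXn2r ?nnegrE ?expR_ge0 // ltW.
  by rewrite -expRM_natl ler_expR -mulr_natl; lra.
have A3 : X2 ^ (e0%:Z - p%:Z - 1) <= X2 ^ (e0%:Z - 1).
  rewrite (_ : e0%:Z - p%:Z - 1 = (e0%:Z - 1) + (- p%:Z)); last by ring.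
  rewrite expfzDr ?gt_eqF // ler_piMr ?exprz_ge0 ?(ltW X20) //.
  by rewrite -exprnN invf_le1 ?exprn_gt0 // exprn_ege1.
have A4 : expR (- ((j0 - p)%:R * al)) = expR (- (j0%:R * al)) * expR (al * p%:R).
  by rewrite -expRD natrB //; congr expR; ring.
rewrite A4.
have -> : sadvar * (1 - cos th) = n%:R * lcum2 (tilt p1 al) * (1 - cos th) +
    e0%:R * lcum2 (tilt p2 al) * (1 - cos th) by rewrite /sadvar; ring.
rewrite opprD expRD.
set a1 := expR (- (n%:R * _ * _)) in A1 *; set a2 := expR (- (e0%:R * _ * _)) in A2 *.
set b1 := c1 ^+ n in A1 *; set b2 := c2 ^ _ in A2 *.
set x2' := X2 ^ _ in A3 *; set x2 := X2 ^ (e0%:Z - 1) in A3 *.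
set x1 := X1 ^+ n; set g := expR (- (j0%:R * al)); set h := expR (al * p%:R).
have -> : x1 * b1 * (x2' * b2) * (g * h) = (x1 * g * h) * (x2' * (b1 * b2)) by ring.
have -> : x1 * x2 * g * h * (a1 * a2) = (x1 * g * h) * (x2 * (a1 * a2)) by ring.
apply: ler_wpM2l; first by rewrite !mulr_ge0 ?expR_ge0 ?exprn_ge0 // ltW.
apply: ler_pM => //; first by rewrite exprz_ge0 // ltW.
  by rewrite mulr_ge0 ?exprn_ge0 // exprz_ge0 // ltW.
by apply: ler_pM => //; rewrite ?exprn_ge0 ?exprz_ge0 // ltW.
Qed.

(** At al = 0 the two parts of the curvature cancel up to the term in d: this is the double critical
    point. A shift al < 0 divides them by X1^2 and X2^2 with X1 <= 1 <= X2, apart from a common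
    factor e^al, and this leaves a positive curvature of first order in al. *)
Lemma sadvar_ge (d : R) :
  n%:R * (1 - z) / (1 + w) ^+ 2 = z * (e0%:R + d) ->
  n%:R * lcum2 p1 * p1 * (1 - expR al) * expR al - w * (1 + z * w) * z * `|d| <= sadvar.
Proof.
move=> h2; have X20 : 0 < X2 by apply: lt_le_trans X21.
have V0 : e0%:R * lcum2 p2 = - (n%:R * lcum2 p1) + w * (1 + z * w) * z * d.
  have -> : n%:R * lcum2 p1 = w * (1 + z * w) * (n%:R * (1 - z) / (1 + w) ^+ 2).
    by rewrite /lcum2 /sad1; field; rewrite gt_eqF // addr_gt0.
  by rewrite h2 /lcum2 /sad2; ring.
rewrite /sadvar !lcum2_tilt -/E -/X1 -/X2 ?gt_eqF //.
have -> : e0%:R * (lcum2 p2 * E / X2 ^+ 2) = (e0%:R * lcum2 p2) * (E / X2 ^+ 2) by ring.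
rewrite V0.
set S := n%:R * lcum2 p1.
have S0 : 0 <= S by rewrite mulr_ge0 // mulr_ge0 ?(ltW p10) // subr_ge0 ltW.
have i1 : 1 + p1 * (1 - E) <= (X1 ^+ 2)^-1.
  have h : (1 + p1 * (1 - E)) * X1 <= 1.
    have := sqr_ge0 (p1 * (1 - E)); rewrite /X1; lra.
  have hx : (X1 ^+ 2)^-1 = X1^-1 * X1^-1 by rewrite expr2 invfM.
  have h1 : 1 + p1 * (1 - E) <= X1^-1 by rewrite -[X1^-1]mul1r ler_pdivlMr.
  have h2' : 1 <= X1^-1 by rewrite invf_ge1.
  by rewrite hx; apply: le_trans h1 _; rewrite ler_peMl // invr_ge0 ltW.
have i2 : (X2 ^+ 2)^-1 <= 1 by rewrite invf_le1 ?exprn_gt0 // exprn_ege1.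
have i20 : 0 <= (X2 ^+ 2)^-1 by rewrite invr_ge0 sqr_ge0.
set a := (X1 ^+ 2)^-1 in i1 *; set b := (X2 ^+ 2)^-1 in i2 i20 *.
have k1 : S * p1 * (1 - E) * E <= S * E * (a - b).
  have -> : S * p1 * (1 - E) * E = S * E * (p1 * (1 - E)) by ring.
  by apply: ler_wpM2l; [rewrite mulr_ge0 // ltW|lra].
have Wz0 : 0 <= w * (1 + z * w) * z.
  by rewrite !mulr_ge0 ?(ltW w0) ?(ltW zz) // addr_ge0 // ltW.
have k2 : - (w * (1 + z * w) * z * `|d|) <= w * (1 + z * w) * z * d * (E * b).
  have Eb : 0 <= E * b <= 1 by rewrite mulr_ge0 ?(ltW E0) // mulr_ile1 // ltW.
  have h : `|d * (E * b)| <= `|d|.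
    by case/andP: Eb => Eb0 Eb1; rewrite normrM (ger0_norm Eb0) ler_piMr.
  have h' : - `|d| <= d * (E * b) by move: h; rewrite ler_norml => /andP[].
  rewrite -mulrN -[leRHS]mulrA; exact: ler_wpM2l.
have -> : n%:R * (lcum2 p1 * E * a) = S * E * a by rewrite /S; ring.
rewrite -/S -/E; lra.
Qed.

End saddle_point.

Lemma expR_integrable_cbnd (R : realType) (K : R) :
  (@lebesgue_measure R).-integrable (`[0, +oo[%classic)
    (EFin \o (fun x => K * expR (- x))).
Proof.
have mI : measurable (`]-1, +oo[%classic : set R) by [].
apply: integrable_EFinZ => //.
apply: (@integrableS _ _ _ (@lebesgue_measure R) (`]-1, +oo[%classic : set R)) => //.
  by move=> x /=; rewrite !in_itv /= !andbT; lra.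
have h := @expR_integrable R 1 (-1) ltr01.
have := @integrable_EFinZ _ _ _ (@lebesgue_measure R) _ _ (expR 1) mI h.
apply: eq_integrable => // x _ /=.
by rewrite -expRD; congr (expR _)%:E; ring.
Qed.

(** Limits of rational expressions by recursion on their syntax; limits of the atoms and
    non-vanishing of limit denominators are taken from the context. *)
Ltac cvg_arith := lazymatch goal with
  | |- context [fmap ?f _] => lazymatch f with
    | (fun _ => ?c) => exact: cvg_cst
    | (fun x => @GRing.mul _ (@?a x) (@?b x)) => apply: cvgM; cvg_arith
    | (fun x => @GRing.add _ (@?a x) (@?b x)) => apply: cvgD; cvg_arith
    | (fun x => @GRing.opp _ (@?a x)) => apply: cvgN; cvg_arith
    | (fun x => @GRing.exp _ (@?a x) ?n) => apply: cvg_exprn; cvg_arith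
    | (fun x => @GRing.inv _ (@?a x)) =>
      first [eassumption | apply: cvgV; [assumption|cvg_arith]]
    | _ => eassumption
    end
  end.

Lemma cvg_continuous (R : realType) (T : Type) (F : set_system T) (g : R -> R)
    (f : T -> R) (l : R) : Filter F -> continuous g ->
  f x @[x --> F] --> l -> g (f x) @[x --> F] --> g l.
Proof. by move=> FF cg cf; apply: cvg_comp cf _; exact: cg. Qed.

Section factorization.
Variables (R : realType) (z w : R).
Hypotheses (z01 : 0 < z < 1) (w0 : 0 < w).
Notation C := R[i].
Notation p1 := (sad1 z w).
Notation p2 := (sad2 z w).

(** Writing the exponent as e.+1 absorbs the - 1 in [sadf]. [log_taylor] applies to both factors,
    and [normc_pow_sub1] controls the errors of the powers. *)
Lemma sadf_factor (n e j : nat) (a : C) (P : R) :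
  1 <= P -> z * w <= P -> 3 * P ^+ 3 * normc a <= 1 ->
  exists rho, sadf z w n e.+1 j a =
    rho * cexp (n%:R * lcgf p1 a + e%:R * lcgf p2 a - j%:R * a) /\
    normc (rho - 1) <= expR ((n%:R + e%:R) * (lcgf_const P * normc a ^+ 4)) - 1.
Proof.
move=> P1 zwP ha.
have hp1 : `|p1| <= P.
  rewrite ger0_norm ?(ltW (sad1_gt0 z01 w0)) //.
  exact: ltW (lt_le_trans (sad1_lt1 z01 w0) P1).
have z0 : 0 < z by case/andP: z01.
have hp2 : `|p2| <= P by rewrite normrN ger0_norm // mulr_ge0 // ltW.
have [r1 [E1 b1]] := log_taylor P1 hp1 ha.
have [r2 [E2 b2]] := log_taylor P1 hp2 ha.
exists (r1 ^+ n * r2 ^+ e); split.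
  rewrite /sadf E1 E2 (_ : e.+1%:Z - 1 = e%:Z); last by rewrite -addn1 PoszD addrK.
  have F1 : (r1 * cexp (lcgf p1 a)) ^+ n = r1 ^+ n * cexp (n%:R * lcgf p1 a).
    by rewrite exprMn cexp_natM.
  have F2 : (r2 * cexp (lcgf p2 a)) ^ e%:Z = r2 ^+ e * cexp (e%:R * lcgf p2 a).
    by rewrite -exprnP exprMn cexp_natM.
  by rewrite F1 F2 !cexpD mulNr; ring.
have := normc_pow_sub1 n b1; have := normc_pow_sub1 e b2.
set L := lcgf_const P * _; rewrite mulrDl expRD.
set x := expR (n%:R * L); set y := expR (e%:R * L).
set A := r1 ^+ n; set B := r2 ^+ e => hB hA.
have -> : A * B - 1 = (A - 1) * B + (B - 1) by ring.
apply: le_trans (normc_triangle _ _) _; rewrite normcM.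
have nB : normc B <= y by have := normc_triangle (B - 1) 1; rewrite subrK normc1; lra.
have : normc (A - 1) * normc B <= (x - 1) * y by apply: ler_pM => //; exact: normc_ge0.
lra.
Qed.

(** c1, c2, c3 are the first three derivatives of the exponent at 0; the point a = (- 1 + i tau) / k
    weights them with k^-1, k^-2 and k^-3. *)
Lemma sadf_exponent (n e j : nat) (c1 c2 c3 k tau : R) :
  c1 = n%:R * p1 + e%:R * p2 - j%:R ->
  c2 = n%:R * lcum2 p1 + e%:R * lcum2 p2 ->
  c3 = n%:R * lcum3 p1 + e%:R * lcum3 p2 ->
  0 < k ->
  let a := Complex (- k^-1) (tau / k) in
  n%:R * lcgf p1 a + e%:R * lcgf p2 a - j%:R * a =
  Complex (- (c1 / k) + c2 / k ^+ 2 / 2 * (1 - tau ^+ 2) + c3 / k ^+ 3 / 6 * (3 * tau ^+ 2 - 1))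
    (c1 / k * tau - c2 / k ^+ 2 * tau + c3 / k ^+ 3 / 6 * (3 * tau - tau ^+ 3)).
Proof.
move=> -> -> -> k0 a.
have kn : k != 0 by rewrite gt_eqF.
have nr (i : nat) (u : C) : i%:R * u = Complex (i%:R * complex.Re u) (i%:R * complex.Im u).
  by rewrite -real_complexM rmorph_nat.
apply: complex_ext; rewrite !(ReD, ImD) ?(nr, real_complexM) /lcgf !(ReD, ImD) !real_complexM
   /a /= !exprS !expr0 !mulr1 /=; field => //.
Qed.

End factorization.

(** * Limit and uniform bound of the scaled coefficients *)

Section asymptotics.
Variables (R : realType) (z : R) (n m e0 j0 : nat -> nat) (w d kap : nat -> R) (winf y : R).
Hypotheses (z01 : 0 < z < 1) (w0 : forall N, 0 < w N) (winf0 : 0 < winf).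
Hypothesis (kap0 : forall N, 0 < kap N).
Hypothesis nemj : forall N, (n N + e0 N = m N + j0 N)%N.
(** d measures how far j0 is from the critical index: for d = 0, [crit1] and [crit2] say that the
    first two derivatives of the exponent vanish at w, up to the - 1 in the exponent of E. [kap3]
    normalises the third derivative. *)
Hypothesis crit1 : forall N, (n N)%:R * (1 - z) * w N / (1 + w N) =
  (e0 N)%:R * z * w N + (j0 N)%:R + d N * (1 + z * w N).
Hypothesis crit2 : forall N,
  (n N)%:R * (1 - z) / (1 + w N) ^+ 2 = z * ((e0 N)%:R + d N).
Hypothesis kap3 : forall N, kap N ^+ 3 =
  (n N)%:R * (1 - z) * w N ^+ 2 / ((1 + w N) ^+ 3 * (1 + z * w N)).
Hypothesis cw : w N @[N --> \oo] --> winf.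
Hypothesis ckap : kap N @[N --> \oo] --> +oo.
Hypothesis cd : d N / kap N @[N --> \oo] --> y.
Notation C := R[i].
Notation Re := complex.Re.
Notation Im := complex.Im.
Notation mu := (@lebesgue_measure R).

Let z0 : 0 < z. Proof. by case/andP: z01. Qed.
Let zw0 N : 0 < z * w N. Proof. exact: mulr_gt0. Qed.
Let v0 N : 0 < 1 + z * w N. Proof. by rewrite addr_gt0. Qed.
Let w10 N : 0 < 1 + w N. Proof. by rewrite addr_gt0. Qed.

Definition sadk N := kap N * (1 + z * w N).
Notation k := sadk.

Let k0 N : 0 < k N. Proof. by rewrite mulr_gt0. Qed.

(** The coefficient of index j0 - p, scaled by k and by the saddle value. As n and m are fixed, e0
    also decreases by p. *)
Definition sadcoef N p :=
  k N * acoef z (n N) (m N) (j0 N - p) / sadpref z (w N) (n N) ((e0 N)%:Z - p%:Z) (j0 N - p).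

Let ckapV : (kap N)^-1 @[N --> \oo] --> (0 : R).
Proof.
have h : \forall N \near \oo, 0 < kap N by near=> N; exact: kap0.
exact: (gtr0_cvgV0 h).2 ckap.
Unshelve. all: by end_near. Qed.

Let czw : z * w N @[N --> \oo] --> z * winf.
Proof. by apply: cvgM; [exact: cvg_cst|]. Qed.

Let c1zw : 1 + z * w N @[N --> \oo] --> 1 + z * winf.
Proof. by apply: cvgD; [exact: cvg_cst|]. Qed.

Let n1w : 1 + winf != 0. Proof. by rewrite gt_eqF // addr_gt0. Qed.
Let n1zw : 1 + z * winf != 0. Proof. by rewrite gt_eqF // addr_gt0 // mulr_gt0. Qed.

Let ckV : (k N)^-1 @[N --> \oo] --> (0 : R).
Proof.
rewrite /sadk; under eq_fun do rewrite invfM.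
by rewrite -(mul0r (1 + z * winf)^-1); cvg_arith.
Qed.

Let ck : k N @[N --> \oo] --> +oo.
Proof.
have h : \forall N \near \oo, 0 < k N by near=> N; exact: k0.
exact: (gtr0_cvgV0 h).1 ckV.
Unshelve. all: by end_near. Qed.

Let S N := (n N)%:R * lcum2 (sad1 z (w N)).

Let SE N : S N * (sad1 z (w N) + z * w N) = k N ^+ 3.
Proof.
rewrite /sadk exprMn kap3 /S /lcum2 /sad1; field.
by rewrite !gt_eqF.
Qed.

(** The remainder of [sadf_factor] is of order (n + e0) k^-4, so this bound makes it O(1 / k). *)
Let n_le : exists2 c : R, 0 <= c & \forall N \near \oo, (n N)%:R + (e0 N)%:R <= c * k N ^+ 3.
Proof.
pose F N := (1 + w N) ^+ 3 * ((1 - z)^-1 * (w N)^-1 ^+ 2 * (1 + z * w N)^-1 ^+ 2).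
have z1 : 1 - z != 0 by case/andP: z01 => _; rewrite -subr_gt0 => /lt0r_neq0.
have nE N : (n N)%:R / k N ^+ 3 = F N.
  rewrite /sadk exprMn; have -> : (n N)%:R = kap N ^+ 3 * ((1 + w N) ^+ 3 * (1 + z * w N)) /
      ((1 - z) * w N ^+ 2).
    by rewrite kap3; field; rewrite z1 !gt_eqF.
  by rewrite /F; field; rewrite z1 !gt_eqF.
pose dk N := d N / kap N.
have cdk : dk N @[N --> \oo] --> y by exact: cd.
have cw' : w x @[x --> \oo] --> winf by exact: cw.
pose G N := F N * ((1 - z) * z^-1 * (1 + w N)^-1 ^+ 2) -
   dk N * (1 + z * w N)^-1 * (k N)^-1 ^+ 2.
have eE N : (e0 N)%:R / k N ^+ 3 = G N.
  have -> : (e0 N)%:R = (n N)%:R * (1 - z) / (1 + w N) ^+ 2 / z - d N.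
    by rewrite crit2; field; rewrite gt_eqF.
  rewrite /G -nE /dk /sadk; field.
  by rewrite !gt_eqF.
have wn : winf != 0 by rewrite gt_eqF.
pose Fl := (1 + winf) ^+ 3 * ((1 - z)^-1 * winf^-1 ^+ 2 * (1 + z * winf)^-1 ^+ 2).
have cF : F N @[N --> \oo] --> Fl by rewrite /F /Fl; cvg_arith.
have zn : z != 0 by rewrite gt_eqF.
pose Gl := Fl * ((1 - z) * z^-1 * (1 + winf)^-1 ^+ 2) - y * (1 + z * winf)^-1 * 0 ^+ 2.
have cG : G N @[N --> \oo] --> Gl by rewrite /G /Gl; cvg_arith.
pose c := `|Fl + Gl| + 1.
exists c; first by rewrite addr_ge0.
have cFG : F N + G N @[N --> \oo] --> Fl + Gl by apply: cvgD.
have hlt : Fl + Gl < c by rewrite /c; have := ler_norm (Fl + Gl); lra.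
near=> N.
have : F N + G N <= c by near: N; apply: cvgr_le cFG _ hlt.
by rewrite -nE -eE -mulrDl ler_pdivrMr // exprn_gt0.
Unshelve. all: by end_near. Qed.

(** e is e0 - p - 1 because of the - 1 in [sadf]. With d and p of order kap, V is of order k and
    disappears after division by k^2, while the third coefficient is - 2 k^3 to leading order. *)
Let exponent N (p : nat) : (p < e0 N)%N -> (p <= j0 N)%N ->
  let e := (e0 N - p).-1 in let j := (j0 N - p)%N in
  let W := z * w N in let D := d N + p%:R in let V := w N * (1 + W) * z * D + W * (1 + W) in
  [/\ (n N)%:R * sad1 z (w N) + e%:R * sad2 z (w N) - j%:R = D * (1 + W) + W,
    (n N)%:R * lcum2 (sad1 z (w N)) + e%:R * lcum2 (sad2 z (w N)) = V &
    (n N)%:R * lcum3 (sad1 z (w N)) + e%:R * lcum3 (sad2 z (w N)) =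
      - 2 * k N ^+ 3 + V * (1 + 2 * W)].
Proof.
move=> pe pj e j W D V.
have eE : e%:R = (e0 N)%:R - p%:R - 1 :> R.
  by rewrite /e -subn1 natrB ?subn_gt0 // natrB // ltnW.
have jE : j%:R = (j0 N)%:R - p%:R :> R by rewrite natrB.
have E2 : (n N)%:R * lcum2 (sad1 z (w N)) + e%:R * lcum2 (sad2 z (w N)) = V.
  have -> : (n N)%:R * lcum2 (sad1 z (w N)) =
      w N * (1 + W) * ((n N)%:R * (1 - z) / (1 + w N) ^+ 2).
    by rewrite /lcum2 /sad1 /W; field; rewrite gt_eqF.
  by rewrite crit2 /lcum2 /sad2 eE /V /D /W; ring.
split=> //.
  have -> : (n N)%:R * sad1 z (w N) = (n N)%:R * (1 - z) * w N / (1 + w N).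
    by rewrite /sad1; ring.
  by rewrite crit1 eE jE /sad2 /D /W; ring.
rewrite -SE -E2 /S /lcum3 /lcum2 -/(sad2 z (w N)) /W.
have -> : z * w N = - sad2 z (w N) by rewrite /sad2 opprK.
ring.
Qed.

Section along.
Variables (p : nat -> nat) (x : R).
Hypothesis cp : (p N)%:R / kap N @[N --> \oo] --> x.
Hypothesis pe : \forall N \near \oo, (p N < e0 N)%N.
Hypothesis pj : \forall N \near \oo, (p N <= j0 N)%N.

(** The exponent tends to that of the Airy integrand at 1 - i tau; what remains is a multiplicative
    error [err] that vanishes with 1 / k. *)
Lemma sadf_cvg tau :
  let f N := sadf z (w N) (n N) ((e0 N)%:Z - (p N)%:Z) (j0 N - p N) (Complex (- (k N)^-1) (tau / k N)) in
  let A := 3^-1 - tau ^+ 2 - (x + y) in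
  let B := (x + y) * tau - (3 * tau - tau ^+ 3) / 3 in
  Re (f N) @[N --> \oo] --> expR A * cos B /\
  Im (f N) @[N --> \oo] --> expR A * sin B.
Proof.
move=> f A B.
pose W N := z * w N.
pose Dk N := (d N / kap N + (p N)%:R / kap N).
have cDk : Dk N @[N --> \oo] --> y + x by apply: cvgD.
pose C1 N := Dk N + W N * (k N)^-1.
pose C2 N := w N * z * (1 + W N)^-1 * Dk N * (kap N)^-1 + W N * (1 + W N)^-1 * (kap N)^-1 ^+ 2.
pose C3 N := - 2 + C2 N * (k N)^-1 * (1 + 2 * W N).
have cC1 : C1 N @[N --> \oo] --> y + x.
  rewrite -[X in _ --> X]addr0 -[X in _ --> _ + X](mulr0 (z * winf)).
  by rewrite /C1 /W; cvg_arith.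
have cC2 : C2 N @[N --> \oo] --> (0 : R).
  have -> : 0 = winf * z * (1 + z * winf)^-1 * (y + x) * 0 +
     z * winf * (1 + z * winf)^-1 * 0 ^+ 2 by rewrite expr0n /= !mulr0 addr0.
  by rewrite /C2 /W; cvg_arith.
have cC3 : C3 N @[N --> \oo] --> (- 2 : R).
  rewrite -[X in _ --> X]addr0; apply: cvgD; first exact: cvg_cst.
  have -> : 0 = 0 * 0 * (1 + 2 * (z * winf)) by rewrite !mul0r.
  by rewrite /W; cvg_arith.
pose ZR N := - C1 N + C2 N / 2 * (1 - tau ^+ 2) + C3 N / 6 * (3 * tau ^+ 2 - 1).
pose ZI N := C1 N * tau - C2 N * tau + C3 N / 6 * (3 * tau - tau ^+ 3).
have cZR : ZR N @[N --> \oo] --> A.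
  have -> : A = - (y + x) + 0 / 2 * (1 - tau ^+ 2) + (-2) / 6 * (3 * tau ^+ 2 - 1).
    by rewrite /A; field.
  by rewrite /ZR; cvg_arith.
have cZI : ZI N @[N --> \oo] --> B.
  have -> : B = (y + x) * tau - 0 * tau + (-2) / 6 * (3 * tau - tau ^+ 3).
    by rewrite /B; field.
  by rewrite /ZI; cvg_arith.
have [c c0 hc] := n_le.
(* For large N this bounds [sad1] < 1 and z w, as [sadf_factor] requires. *)
pose P : R := winf + 2.
pose an := 1 + `|tau|.
pose err N := expR (c * (lcgf_const P * an ^+ 4) * (k N)^-1) - 1.
have L0 : 0 <= lcgf_const P.
  have P0 : 0 <= P by rewrite addr_ge0 // ltW.
  have P9 := exprn_ge0 9 P0; have P12 := exprn_ge0 12 P0; have e1 := expR_ge0 (1 : R).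
  rewrite /lcgf_const mulr_ge0 // addr_ge0 ?mulr_ge0 // addr_ge0 ?mulr_ge0 //.
have cerr : err N @[N --> \oo] --> (0 : R).
  rewrite -[X in _ --> X](subrr (1 : R)); apply: cvgB; last exact: cvg_cst.
  rewrite -[X in _ --> X]expR0 -(mulr0 (c * (lcgf_const P * an ^+ 4))).
  apply: (@cvg_continuous _ _ _ expR); first exact: continuous_expR.
  by cvg_arith.
have key : \forall N \near \oo, exists rho,
    f N = rho * cexp (Complex (ZR N) (ZI N)) /\ normc (rho - 1) <= err N.
  near=> N.
  have pe1 : (p N < e0 N)%N by near: N.
  have pj1 : (p N <= j0 N)%N by near: N.
  have kn : k N != 0 by rewrite gt_eqF.
  have [x1 x2 x3] := exponent pe1 pj1.
  set a := Complex (- (k N)^-1) (tau / k N).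
  have na : normc a <= an * (k N)^-1.
    apply: le_trans (normc_le_abs _) _; rewrite /a /= normrN normrM.
    rewrite (ger0_norm (_ : 0 <= (k N)^-1)) ?invr_ge0 ?(ltW (k0 N)) // /an mulrDl mul1r //.
  have ha : 3 * P ^+ 3 * normc a <= 1.
    have P0 : 0 <= P by rewrite addr_ge0 // ltW.
    apply: (@le_trans _ _ (3 * P ^+ 3 * (an * (k N)^-1))).
      by rewrite ler_wpM2l // mulr_ge0 // exprn_ge0.
    rewrite mulrA ler_pdivrMr // mul1r; near: N.
    exact: ((cvgryPge _).1 ck).
  have P1 : 1 <= P by rewrite /P; have := winf0; lra.
  have wP : z * w N <= P.
    have : w N <= winf + 1 by near: N; apply: cvgr_le cw _ _; lra.
    have : z * w N <= w N by rewrite ler_piMl ?(ltW (w0 N)) // ltW //; case/andP: z01.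
    rewrite /P; lra.
  have eS : (e0 N)%:Z - (p N)%:Z = (e0 N - p N).-1.+1%:Z.
    by rewrite prednK ?subn_gt0 // subzn // ltnW.
  have [rho [rE rB]] := sadf_factor z01 (w0 N) (n N) (e0 N - p N).-1 (j0 N - p N) P1 wP ha.
  exists rho; split.
    rewrite /f eS rE; congr (_ * cexp _).
    rewrite (sadf_exponent tau (esym x1) (esym x2) (esym x3) (k0 N)).
    have kE : k N = kap N * (1 + z * w N) by [].
    have E1 : ((d N + (p N)%:R) * (1 + z * w N) + z * w N) / k N = C1 N.
      by rewrite /C1 /Dk /W kE; field; rewrite !gt_eqF.
    have E2 : (w N * (1 + z * w N) * z * (d N + (p N)%:R) + z * w N * (1 + z * w N)) /
        k N ^+ 2 = C2 N.
      by rewrite /C2 /Dk /W kE; field; rewrite !gt_eqF.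
    have E3 : (- 2 * k N ^+ 3 +
        (w N * (1 + z * w N) * z * (d N + (p N)%:R) + z * w N * (1 + z * w N)) *
        (1 + 2 * (z * w N))) / k N ^+ 3 = C3 N.
      by rewrite /C3 -E2 /W; field.
    by rewrite E1 E2 E3.
  apply: le_trans rB _; rewrite lerD2r ler_expR.
  have ne : (n N)%:R + (e0 N - p N).-1%:R <= c * k N ^+ 3.
    have : (n N)%:R + (e0 N)%:R <= c * k N ^+ 3 by near: N.
    apply: le_trans; rewrite lerD2l ler_nat.
    by apply: leq_trans (leq_pred _) (leq_subr _ _).
  have a4 : normc a ^+ 4 <= (an * (k N)^-1) ^+ 4.
    by rewrite lerXn2r ?nnegrE ?normc_ge0 //; apply: le_trans na; exact: normc_ge0.
  apply: (@le_trans _ _ (c * k N ^+ 3 * (lcgf_const P * (an * (k N)^-1) ^+ 4))).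
    apply: ler_pM => //.
    - by rewrite mulr_ge0 // exprn_ge0 // normc_ge0.
    - by rewrite ler_wpM2l.
  by rewrite le_eqVlt; apply/orP; left; apply/eqP; field.
have bnd (F : C -> R) (Flim : R) : (forall u v, F (u + v) = F u + F v) ->
    (forall u, `|F u| <= normc u) ->
    F (cexp (Complex (ZR N) (ZI N))) @[N --> \oo] --> Flim -> F (f N) @[N --> \oo] --> Flim.
  move=> FD Fb cF.
  have cE : err N * expR (ZR N) @[N --> \oo] --> (0 : R).
    rewrite -(mul0r (expR A)); apply: cvgM => //.
    by apply: (@cvg_continuous _ _ _ expR) => //; exact: continuous_expR.
  have c0' : F (f N) - F (cexp (Complex (ZR N) (ZI N))) @[N --> \oo] --> (0 : R).
    apply/cvgrPdist_le => /= eps eps0; near=> N.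
    rewrite sub0r normrN.
    have [rho [fE rB]] : exists rho,
      f N = rho * cexp (Complex (ZR N) (ZI N)) /\ normc (rho - 1) <= err N by near: N.
    have -> : f N = (rho - 1) * cexp (Complex (ZR N) (ZI N)) + cexp (Complex (ZR N) (ZI N)).
      by rewrite fE; ring.
    rewrite FD addrK; apply: le_trans (Fb _) _; rewrite normcM normc_cexp /=.
    apply: (@le_trans _ _ (err N * expR (ZR N))); first by rewrite ler_wpM2r ?expR_ge0.
    by near: N; apply: cvgr_le cE _ eps0.
  have := cvgD c0' cF; rewrite add0r.
  have -> : (fun N => F (f N)) = (fun N => F (f N) - F (cexp (Complex (ZR N) (ZI N)))) \+
      (fun N => F (cexp (Complex (ZR N) (ZI N)))).
    by apply/funext => N /=; rewrite subrK.
  exact.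
have cex : expR (ZR N) @[N --> \oo] --> expR A.
  by apply: (@cvg_continuous _ _ _ expR) => //; exact: continuous_expR.
split.
  apply: bnd => [u v|u|]; [exact: ReD|exact: abs_Re_le|].
  under eq_fun do rewrite Re_cexp /=.
  apply: cvgM => //.
  by apply: (@cvg_continuous _ _ _ cos) => //; exact: continuous_cos.
apply: bnd => [u v|u|]; [exact: ImD|exact: abs_Im_le|].
under eq_fun do rewrite Im_cexp /=.
apply: cvgM => //.
by apply: (@cvg_continuous _ _ _ sin) => //; exact: continuous_sin.
Unshelve. all: by end_near. Qed.

End along.

Let al N := - (k N)^-1.

Let al0 N : al N <= 0.
Proof. by rewrite /al oppr_le0 invr_ge0 ltW. Qed.

Hypothesis e0pos : \forall N \near \oo, (0 < e0 N)%N.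

Let f0_bound : exists2 c : R, 0 <= c & \forall N \near \oo,
  normc (sadf z (w N) (n N) (e0 N) (j0 N) (Complex (al N) 0)) <= c.
Proof.
have cp0 : (0%N)%:R / kap N @[N --> \oo] --> (0 : R).
  by under eq_fun do rewrite mul0r; exact: cvg_cst.
have pj0 : \forall N \near \oo, (0 <= j0 N)%N by near=> N.
have [] := @sadf_cvg (fun=> 0%N) 0 cp0 e0pos pj0 0.
set A := expR _ * cos _; set B := expR _ * sin _ => cA cB.
exists (`|A| + `|B| + 2); first by rewrite !addr_ge0.
near=> N.
have E : sadf z (w N) (n N) (e0 N) (j0 N) (Complex (al N) 0) =
    sadf z (w N) (n N) ((e0 N)%:Z - 0%:Z) (j0 N - 0) (Complex (- (k N)^-1) (0 / k N)).
  by rewrite subn0 subr0 mul0r.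
rewrite E; apply: le_trans (normc_le_abs _) _.
have -> : `|A| + `|B| + 2 = (`|A| + 1) + (`|B| + 1) by ring.
apply: lerD.
  near: N; apply: cvgr_le (cvg_norm cA) _ _; lra.
near: N; apply: cvgr_le (cvg_norm cB) _ _; lra.
Unshelve. all: by end_near. Qed.

(** With al = - 1 / k, the gain q k^3 (1 - e^al) e^al in [sadvar_ge] is of order k^2, and the loss r
    k^2 is negligible because r tends to 0. *)
Let sadvar_bound : exists2 c : R, 0 < c & \forall N \near \oo,
  c * k N ^+ 2 <= sadvar z (w N) (n N) (e0 N) (al N).
Proof.
have z1 : 0 < 1 - z by case/andP: z01; lra.
pose q N := (1 - z) * (1 + w N)^-1 * ((1 - z) * (1 + w N)^-1 + z)^-1.
pose qi := (1 - z) * (1 + winf)^-1 * ((1 - z) * (1 + winf)^-1 + z)^-1.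
have qin : (1 - z) * (1 + winf)^-1 + z != 0.
  by rewrite gt_eqF // addr_gt0 // mulr_gt0 // invr_gt0 addr_gt0.
have cq : q N @[N --> \oo] --> qi by rewrite /q /qi; cvg_arith.
have qi0 : 0 < qi.
  have a0 : 0 < (1 - z) * (1 + winf)^-1 by rewrite mulr_gt0 // invr_gt0 addr_gt0.
  by rewrite mulr_gt0 // invr_gt0 addr_gt0.
pose dk N := `|d N / kap N|.
have cdk : dk N @[N --> \oo] --> `|y| by exact: cvg_norm cd.
have cw' : w x @[x --> \oo] --> winf by exact: cw.
pose r N := w N * z * (1 + z * w N)^-1 * dk N * (kap N)^-1.
have cr : r N @[N --> \oo] --> (0 : R).
  have -> : 0 = winf * z * (1 + z * winf)^-1 * `|y| * 0 by rewrite mulr0.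
  by rewrite /r; cvg_arith.
exists (qi / 16); first by rewrite divr_gt0.
near=> N.
apply: le_trans (sadvar_ge z01 (w0 N) (al0 N) (crit2 N)).
have h1 : qi / 2 <= q N by near: N; apply: cvgr_ge cq _ _; lra.
have h2 : r N <= qi / 16 by near: N; apply: cvgr_le cr _ _; lra.
have k2 : 2 <= k N by near: N; exact: ((cvgryPge _).1 ck).
have rE : w N * (1 + z * w N) * z * `|d N| = r N * k N ^+ 2.
  rewrite /r /dk normrM (ger0_norm (_ : 0 <= (kap N)^-1)) ?invr_ge0 ?(ltW (kap0 N)) //.
  by rewrite /sadk; field; rewrite !gt_eqF.
rewrite rE.
have qE : (n N)%:R * lcum2 (sad1 z (w N)) * sad1 z (w N) = q N * k N ^+ 3.
  rewrite -/(S N) -SE /q /sad1; field.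
  by rewrite !gt_eqF // addr_gt0 // mulr_gt0.
rewrite qE.
set u := (k N)^-1.
have ku : k N * u = 1 by rewrite /u mulfV // gt_eqF.
have u0 : 0 < u by rewrite invr_gt0.
have u2 : u <= 1 / 2 by rewrite /u div1r lef_pV2 // posrE.
have e1 : 1 - u <= expR (al N) by apply: expR_ge1Dx.
have e2 : expR (al N) * (1 + u) <= 1.
  have h : expR (al N) * expR u = 1 by rewrite -expRD /al -/u addNr expR0.
  apply: (@le_trans _ _ (expR (al N) * expR u)); last by rewrite h.
  by rewrite ler_wpM2l ?expR_ge0 // expR_ge1Dx.
set E := expR (al N) in e1 e2 *.
have e3 : u / 2 <= 1 - E by nra.
have e4 : u / 4 <= (1 - E) * E.
  have h : (u / 2) * (1 / 2) <= (1 - E) * E by apply: ler_pM; lra.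
  lra.
have q0 : 0 <= q N by lra.
have h3 : q N * k N ^+ 3 * (u / 4) <= q N * k N ^+ 3 * (1 - E) * E.
  rewrite -[leRHS]mulrA; apply: ler_wpM2l => //.
  by rewrite mulr_ge0 // exprn_ge0 // ltW.
have h4 : q N * k N ^+ 3 * (u / 4) = q N / 4 * k N ^+ 2.
  by rewrite /u; field; rewrite gt_eqF.
have h5 : qi / 16 * k N ^+ 2 + r N * k N ^+ 2 <= q N / 4 * k N ^+ 2.
  rewrite -mulrDl; apply: ler_wpM2r; first exact: sqr_ge0.
  lra.
lra.
Unshelve. all: by end_near. Qed.

(** By [cos_le_quadratic] the bound exp(- b k^2 (1 - cos(tau / k))) is Gaussian in tau, hence below
    a multiple of exp(- tau); the factor exp(1 / (4 B)) comes from completing the square. *)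
Let integrand_bound : exists2 K : R, 0 <= K & \forall N \near \oo,
  forall p, (p <= j0 N)%N -> forall tau, 0 <= tau <= pi * k N ->
  normc (sadf z (w N) (n N) ((e0 N)%:Z - p%:Z) (j0 N - p) (Complex (al N) (tau / k N))) <=
  K * expR (- tau) * expR (al N * p%:R).
Proof.
have [c c0 hc] := f0_bound; have [b b0 hb] := sadvar_bound.
have pi0 := pi_gt0 R.
pose B : R := b * (2 / pi ^+ 2).
have B0 : 0 < B by rewrite mulr_gt0 // divr_gt0 // exprn_gt0.
exists (c * expR (4^-1 / B)); first by rewrite mulr_ge0 // expR_ge0.
near=> N.
have hcN : normc (sadf z (w N) (n N) (e0 N) (j0 N) (Complex (al N) 0)) <= c by near: N.
have hbN : b * k N ^+ 2 <= sadvar z (w N) (n N) (e0 N) (al N) by near: N.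
move=> p pj tau /andP[tau0 tau1].
apply: le_trans (sadf_norm_le z01 (w0 N) (n N) (e0 N) (al0 N) (tau / k N) pj) _.
rewrite mulrAC; apply: ler_wpM2r; first exact: expR_ge0.
have -> : c * expR (4^-1 / B) * expR (- tau) = c * (expR (4^-1 / B) * expR (- tau)) by ring.
apply: ler_pM; rewrite ?normc_ge0 ?expR_ge0 // -expRD ler_expR.
have th : 0 <= tau / k N <= pi.
  by rewrite divr_ge0 ?(ltW (k0 N)) //= ler_pdivrMr.
have h1 := cos_le_quadratic th.
have u0 : 0 <= 1 - cos (tau / k N) by rewrite subr_ge0 cos_le1.
have h2 : b * k N ^+ 2 * (1 - cos (tau / k N)) <=
    sadvar z (w N) (n N) (e0 N) (al N) * (1 - cos (tau / k N)) by apply: ler_wpM2r.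
have h3 : b * k N ^+ 2 * (2 / pi ^+ 2 * (tau / k N) ^+ 2) <=
    b * k N ^+ 2 * (1 - cos (tau / k N)).
  by apply: ler_wpM2l => //; rewrite mulr_ge0 ?sqr_ge0 // ltW.
have h4 : b * k N ^+ 2 * (2 / pi ^+ 2 * (tau / k N) ^+ 2) = B * tau ^+ 2.
  have kn : k N != 0 by rewrite gt_eqF.
  by rewrite /B; set i := 2 / pi ^+ 2; field.
have h5 : tau <= B * tau ^+ 2 + 4^-1 / B.
  rewrite -subr_ge0.
  have -> : B * tau ^+ 2 + 4^-1 / B - tau = (2 * B * tau - 1) ^+ 2 / (4 * B).
    by field; rewrite gt_eqF.
  by rewrite divr_ge0 ?sqr_ge0 // mulr_ge0 // ltW.
lra.
Unshelve. all: by end_near. Qed.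

Let sadcoefE N p : (p <= j0 N)%N ->
  sadcoef N p = pi^-1 * \int[mu]_(x in `[0, pi * k N])
    Re (sadf z (w N) (n N) ((e0 N)%:Z - p%:Z) (j0 N - p) (Complex (al N) (x / k N))).
Proof.
move=> pj; apply: saddle_scaled => //.
by have := nemj N; rewrite -subzn //; clear; lia.
Qed.

Let reg_cont N p : continuous (fun x : R =>
  Re (sadf z (w N) (n N) ((e0 N)%:Z - p%:Z) (j0 N - p) (Complex (al N) (x / k N)))).
Proof.
have [cRe _] := sadf_ccont z01 (w0 N) (n N) ((e0 N)%:Z - p%:Z) (j0 N - p) (al0 N).
move=> x; apply: (@cvg_continuous _ _ _ (fun t : R =>
  Re (sadf z (w N) (n N) ((e0 N)%:Z - p%:Z) (j0 N - p) (Complex (al N) t))) (fun x : R => x / k N)).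
  exact: cRe.
by apply: cvgM; [exact: cvg_id|exact: cvg_cst].
Qed.

(** Extension by 0 gives all integrals the fixed domain [0, +oo[ that dominated convergence asks
    for. *)
Let h_ N p (x : R) : R := (fun x : R =>
  Re (sadf z (w N) (n N) ((e0 N)%:Z - p%:Z) (j0 N - p) (Complex (al N) (x / k N)))) \_ `[0, pi * k N] x.

Let sub_itv N : `[0, +oo[ `&` `[0, pi * k N] = (`[0, pi * k N]%classic : set R).
Proof.
by apply/seteqP; split=> x /=; rewrite !in_itv /= ?andbT; [case|move=> /andP[-> ->]].
Qed.

Let h_int N p : \int[mu]_(x in `[0, pi * k N])
    Re (sadf z (w N) (n N) ((e0 N)%:Z - p%:Z) (j0 N - p) (Complex (al N) (x / k N))) =
  \int[mu]_(x in `[0, +oo[) h_ N p x.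
Proof. by rewrite -Rintegral_mkcondr sub_itv. Qed.

Let h_meas N p : measurable_fun (`[0, +oo[%classic : set R) (h_ N p).
Proof.
apply/(measurable_restrict _ _ _).1 => //.
by rewrite sub_itv; apply: measurable_funTS; apply: continuous_measurable_fun; exact: reg_cont.
Qed.

Theorem sadcoef_bound : exists C delta : R, [/\ 0 <= C, 0 < delta &
  \forall N \near \oo, forall p, (p <= j0 N)%N ->
    `|sadcoef N p| <= C * expR (- delta * (p%:R / kap N))].
Proof.
have [K K0 hK] := integrand_bound.
have pi0 := pi_gt0 R.
have iG := expR_integrable_cbnd K.
pose I := \int[mu]_(x in `[0, +oo[) (K * expR (- x)).
have v00 : 0 < 1 + z * winf by rewrite addr_gt0 // mulr_gt0.
(* The rate comes from exp(al p) = exp(- p / (kap (1 + z w))), where 1 + z w is eventually below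
   twice its limit. *)
exists (pi^-1 * I), ((1 + z * winf) * 2)^-1; split.
- rewrite mulr_ge0 ?invr_ge0 ?(ltW pi0) // Rintegral_ge0 // => x _.
  by rewrite mulr_ge0 // expR_ge0.
- by rewrite invr_gt0 mulr_gt0.
near=> N => p pj.
have hKN : forall tau, 0 <= tau <= pi * k N ->
  normc (sadf z (w N) (n N) ((e0 N)%:Z - p%:Z) (j0 N - p) (Complex (al N) (tau / k N))) <=
  K * expR (- tau) * expR (al N * p%:R).
  by have : (p <= j0 N)%N := pj; move: (p); near: N.
rewrite sadcoefE // h_int normrM ger0_norm ?invr_ge0 ?(ltW pi0) // -mulrA.
apply: ler_wpM2l; first by rewrite invr_ge0 ltW.
have hb x : (`[0, +oo[%classic : set R) x ->
    `|h_ N p x| <= expR (al N * p%:R) * (K * expR (- x)).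
  rewrite /= in_itv /= andbT => x0; rewrite /h_ patchE.
  case: ifPn => [|_]; last by rewrite normr0 !mulr_ge0 ?expR_ge0.
  rewrite inE /= in_itv /= => hx; apply: le_trans (abs_Re_le _) _.
  by rewrite [leRHS]mulrC; exact: hKN.
have iG' : mu.-integrable `[0, +oo[%classic
    (EFin \o (fun x => expR (al N * p%:R) * (K * expR (- x)))).
  exact: integrable_EFinZ.
have ih : mu.-integrable `[0, +oo[%classic (EFin \o h_ N p).
  apply: le_integrable iG' => //; first by apply/measurable_EFinP; exact: h_meas.
  move=> x Dx /=; rewrite lee_fin; apply: le_trans (hb x Dx) _; exact: ler_norm.
apply: le_trans (le_normr_Rintegral _ ih) _ => //.
apply: (@le_trans _ _ (\int[mu]_(x in `[0, +oo[) (expR (al N * p%:R) * (K * expR (- x))))).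
  apply: le_Rintegral => //.
  by have := integrable_norm ih; apply: eq_integrable.
rewrite RintegralZl // -/I mulrC; apply: ler_wpM2l.
  by apply: Rintegral_ge0 => x _; rewrite mulr_ge0 // expR_ge0.
rewrite ler_expR /al !mulNr lerN2.
have -> : (k N)^-1 * p%:R = (1 + z * w N)^-1 * (p%:R / kap N).
  by rewrite /sadk invfM; ring.
apply: ler_wpM2r; first by rewrite divr_ge0 // ltW.
rewrite lef_pV2 ?posrE // ?mulr_gt0 //.
near: N; apply: cvgr_le c1zw _ _; lra.
Unshelve. all: by end_near. Qed.

Theorem sadcoef_cvg (p : nat -> nat) (x : R) : (p N)%:R / kap N @[N --> \oo] --> x ->
  (\forall N \near \oo, (p N < e0 N)%N) -> (\forall N \near \oo, (p N <= j0 N)%N) ->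
  sadcoef N (p N) @[N --> \oo] --> Airy (x + y).
Proof.
move=> cp pe pj.
have [K K0 hK] := integrand_bound.
have pi0 := pi_gt0 R.
rewrite (@Airy_contour R (x + y) 1 ltr01).
have iG := expR_integrable_cbnd K.
have cI : \int[mu]_(t in `[0, +oo[) h_ N (p N) t @[N --> \oo] -->
    \int[mu]_(t in `[0, +oo[) airyR (x + y) 1 t.
  apply: (Rintegral_dominated_cvg _ _ _ iG) => //.
  - by move=> N; exact: h_meas.
  - move=> t; rewrite /= in_itv /= andbT => t0.
    have [cR _] := sadf_cvg cp pe pj t.
    have -> : airyR (x + y) 1 t =
      expR (3^-1 - t ^+ 2 - (x + y)) * cos ((x + y) * t - (3 * t - t ^+ 3) / 3).
      by rewrite /airyR -[in RHS]cosN; congr (expR _ * cos _); field.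
    apply: cvg_trans cR; apply: near_eq_cvg; near=> N.
    rewrite /h_ patchE ifT // inE /= in_itv /= t0 /= mulrC -ler_pdivrMr //.
    near: N; exact: ((cvgryPge _).1 ck).
  - near=> N => t; rewrite /= in_itv /= andbT => t0.
    rewrite /h_ patchE; case: ifPn => [|_]; last by rewrite normr0 mulr_ge0 ?expR_ge0.
    rewrite inE /= in_itv /= => ht; apply: le_trans (abs_Re_le _) _.
    have pj1 : (p N <= j0 N)%N by near: N.
    have h : normc (sadf z (w N) (n N) ((e0 N)%:Z - (p N)%:Z) (j0 N - p N) (Complex (al N) (t / k N))) <=
        K * expR (- t) * expR (al N * (p N)%:R).
      by move: (p N) pj1 (t) ht; near: N.
    apply: le_trans h _; rewrite ler_piMr ?mulr_ge0 ?expR_ge0 //.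
    by rewrite -expR0 ler_expR mulr_le0_ge0.
have cJ : pi^-1 * \int[mu]_(t in `[0, +oo[) h_ N (p N) t @[N --> \oo] -->
    pi^-1 * \int[mu]_(t in `[0, +oo[) airyR (x + y) 1 t.
  by apply: cvgM; [exact: cvg_cst|exact: cI].
apply: cvg_trans cJ; apply: near_eq_cvg; near=> N.
by rewrite sadcoefE ?h_int //; near: N.
Unshelve. all: by end_near. Qed.

End asymptotics.

(** * Airy limit of the kernel *)

(* The kernel K up to conjugation by (-1)^l; see [hlkernel_complement]. *)
Definition hlkernel (R : fieldType) (z : R) (n m l l' : nat) : R :=
  \sum_(i < l.+1 | (i <= l' + (m - n))%N)
    acoef z n m (l - i) * (z ^ (n%:Z - l'%:Z + i%:Z) * acoef z m n (l' + (m - n) - i)).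

Lemma sadpref_shift (R : realType) (z w : R) (n e0 j0 p : nat) :
  0 < z -> 0 < w -> (p <= j0)%N ->
  sadpref z w n (e0%:Z - p%:Z) (j0 - p) = sadpref z w n e0 j0 * w ^+ p.
Proof.
move=> z0 w0 pj; rewrite /sadpref -!subzn //.
have zwn : 1 + z * w != 0 by rewrite gt_eqF // addr_gt0 // mulr_gt0.
have vn : w / (1 + z * w) != 0 by rewrite mulf_neq0 ?invr_neq0 // gt_eqF.
rewrite (_ : 1 - (e0%:Z - p%:Z) = (1 - e0%:Z) + p%:Z); last by ring.
rewrite (_ : - (j0%:Z - p%:Z) = - j0%:Z + p%:Z); last by ring.
rewrite !expfzDr // -!exprnP.
have -> : w ^+ p = (1 + z * w) ^+ p * (w / (1 + z * w)) ^+ p.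
  by rewrite -exprMn mulrCA mulfV // mulr1.
ring.
Qed.

Section kernel_identity.
Variables (R : realType) (z w kap : R) (n m e0 j0 : nat).
Hypotheses (z01 : 0 < z < 1) (w0 : 0 < w) (kap0 : 0 < kap).
Hypothesis nemj : (n + e0 = m + j0)%N.

Let z0 : 0 < z. Proof. by case/andP: z01. Qed.
Let zn : z != 0. Proof. by rewrite gt_eqF. Qed.
Let wn : w != 0. Proof. by rewrite gt_eqF. Qed.
Let zwn : 1 + z * w != 0. Proof. by rewrite gt_eqF // addr_gt0 // mulr_gt0. Qed.
Let w1n : 1 + w != 0. Proof. by rewrite gt_eqF // addr_gt0. Qed.

Lemma expR_exprz (r : R) (k : int) : expR r ^ k = expR (k%:~R * r).
Proof.
case: k => k; first by rewrite -exprnP -pmulrn expRM_natl.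
by rewrite NegzE -exprnN rmorphN /= mulNr expRN -pmulrn expRM_natl.
Qed.

(** All bases are positive; written as exponentials, the identity becomes linear in the exponents
    and follows from n + e0 = m + j0. *)
Lemma sadpref_dual :
  sadpref z w n e0 j0 * sadpref z (z * w)^-1 m j0 e0 * z ^ (n%:Z - j0%:Z) =
  (1 + w) * (1 + z * w) / w.
Proof.
rewrite /sadpref.
have -> : 1 + z * (z * w)^-1 = (1 + w) / w by field; rewrite zn wn.
have -> : (1 + (z * w)^-1) / ((1 + w) / w) = (1 + z * w) / (z * (1 + w)).
  by field; rewrite w1n zn wn.
have -> : (z * w)^-1 / ((1 + w) / w) = (z * (1 + w))^-1.
  by field; rewrite w1n zn wn.
have l (x : R) : 0 < x -> exists r, x = expR r by move=> x0; exists (ln x); rewrite lnK.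
have [c cE] : exists r, 1 + w = expR r by apply: l; rewrite addr_gt0.
have [d dE] : exists r, 1 + z * w = expR r by apply: l; rewrite addr_gt0 // mulr_gt0.
have [a aE] := l _ w0; have [b bE] := l _ z0.
rewrite dE cE {}aE {}bE -!expRN -!expRD -!expRN -!expRD !exprnP.
rewrite !expR_exprz -!expRD; congr expR.
have Em : m%:R = n%:R + e0%:R - j0%:R :> R.
  by apply: (addIr j0%:R); rewrite subrK -!natrD nemj.
rewrite !(rmorphD, rmorphN) /= -!pmulrn Em; ring.
Qed.

(** The reversal l = j0 - p puts the edge near p = 0. The saddle values leave w^p / w^q, a
    conjugation invisible to determinants, and the constant of [sadpref_dual] cancels against k k'
    up to kap^-2. *)
Lemma hlkernel_saddle (p q : nat) : (n <= m)%N -> (p <= j0)%N -> (q <= j0)%N ->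
  let k := kap * (1 + z * w) in let k' := kap * (1 + z * (z * w)^-1) in
  let at_ p := k * acoef z n m (j0 - p) / sadpref z w n (e0%:Z - p%:Z) (j0 - p) in
  let at'_ q := k' * acoef z m n (e0 - q) / sadpref z (z * w)^-1 m (j0%:Z - q%:Z) (e0 - q) in
  hlkernel z n m (j0 - p) (j0 - q) =
  w ^+ p * w ^- q * (kap ^- 2 *
    \sum_(i < j0.+1 | (p + i <= j0)%N && (q + i <= e0)%N) at_ (p + i)%N * at'_ (q + i)%N).
Proof.
move=> nm pj qj k k' at_ at'_.
have je : (j0 <= e0)%N by clear -nemj nm; lia.
have emj : (m - n = e0 - j0)%N by clear -nemj nm; lia.
rewrite /hlkernel !big_distrr /= (big_ord_widen_cond j0.+1 (fun i => (i <= j0 - q + (m - n))%N)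
  (fun i => acoef z n m (j0 - p - i) *
   (z ^ (n%:Z - (j0 - q)%:Z + i%:Z) * acoef z m n (j0 - q + (m - n) - i)))); last first.
  by rewrite ltnS leq_subr.
apply: eq_big => [i|i /andP[iq ip]].
  by rewrite emj; clear -pj qj je; lia.
have ip' : (p + i <= j0)%N by move: ip; clear -pj; lia.
have iq' : (q + i <= e0)%N by move: iq; rewrite emj; clear -qj je; lia.
have -> : (j0 - p - i = j0 - (p + i))%N by clear; lia.
have -> : (j0 - q + (m - n) - i = e0 - (q + i))%N by rewrite emj; clear -qj je; lia.
have zw'0 : 0 < (z * w)^-1 by rewrite invr_gt0 mulr_gt0.
rewrite /at_ /at'_ (sadpref_shift _ _ z0 w0 ip') (sadpref_shift _ _ z0 zw'0 iq').
have -> : z ^ (n%:Z - (j0 - q)%:Z + i%:Z) = z ^ (n%:Z - j0%:Z) * z ^+ (q + i).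
  rewrite exprnP -expfzDr //; congr (_ ^ _).
  by rewrite -subzn // PoszD; ring.
have PA := sadpref_gt0 z01 w0 n e0 j0; have PB := sadpref_gt0 z01 zw'0 m j0 e0.
have := sadpref_dual.
set PA0 := sadpref z w n e0 j0 in PA *; set PB0 := sadpref z _ m j0 e0 in PB *.
move=> h; have -> : z ^ (n%:Z - j0%:Z) = (1 + w) * (1 + z * w) / w / (PA0 * PB0).
  by rewrite -h mulrC mulKf // mulf_neq0 // gt_eqF.
have -> : w ^+ p = w ^+ (p + i) / w ^+ i by rewrite exprD mulfK // expf_neq0.
have -> : w ^+ q = w ^+ (q + i) / w ^+ i by rewrite exprD mulfK // expf_neq0.
rewrite exprVn exprMn /k /k'.
have X1 := expf_neq0 (p + i) wn; have X2 := expf_neq0 (q + i) wn.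
have X3 := expf_neq0 i wn; have X4 := expf_neq0 (q + i) zn.
move: X1 X2 X3 X4; set x1 := w ^+ (p + i); set x2 := w ^+ (q + i).
set x3 := w ^+ i; set x4 := z ^+ (q + i) => X1 X2 X3 X4.
set A := acoef _ _ _ _; set B := acoef _ _ _ _.
field.
by rewrite X1 X2 X3 X4 zn wn ?zwn ?w1n !gt_eqF.
Qed.

End kernel_identity.

Lemma det_conj_diag (F : fieldType) (b : nat) (f : nat -> F) (K : nat -> nat -> F) (c : F) :
  (forall p, f p != 0) ->
  \det (1%:M - c *: \matrix_(i < b, j < b) (f i / f j * K i j)) =
  \det (1%:M - c *: \matrix_(i < b, j < b) K i j).
Proof.
move=> f0; set A := 1%:M - _; set B := 1%:M - _.
pose D : 'rV[F]_b := \row_i f i.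
have E : A *m diag_mx D = diag_mx D *m B.
  apply/matrixP => i j; rewrite mul_mx_diag mul_diag_mx !mxE.
  have [->|ij] := eqVneq i j.
    by rewrite /= divff // mul1r mulrC.
  by rewrite !mulr0n !sub0r !mulNr !mulrN; congr (- _); field.
have Dn : \det (diag_mx D) != 0.
  by rewrite det_diag; apply/prodf_neq0 => i _; rewrite mxE.
have := congr1 determinant E; rewrite !det_mulmx mulrC => /(mulfI Dn).
by [].
Qed.

(** * Both factors of the kernel and their common limit *)

Section kernel_limit.
Variables (R : realType) (z : R) (n m e0 j0 : nat -> nat) (w d kap : nat -> R) (winf y : R).
Hypotheses (z01 : 0 < z < 1) (w0 : forall N, 0 < w N) (winf0 : 0 < winf).
Hypothesis (kap0 : forall N, 0 < kap N).
Hypothesis nm : forall N, (n N <= m N)%N.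
Hypothesis nemj : forall N, (n N + e0 N = m N + j0 N)%N.
Hypothesis crit1 : forall N, (n N)%:R * (1 - z) * w N / (1 + w N) =
  (e0 N)%:R * z * w N + (j0 N)%:R + d N * (1 + z * w N).
Hypothesis crit2 : forall N,
  (n N)%:R * (1 - z) / (1 + w N) ^+ 2 = z * ((e0 N)%:R + d N).
Hypothesis kap3 : forall N, kap N ^+ 3 =
  (n N)%:R * (1 - z) * w N ^+ 2 / ((1 + w N) ^+ 3 * (1 + z * w N)).
Hypothesis cw : w N @[N --> \oo] --> winf.
Hypothesis ckap : kap N @[N --> \oo] --> +oo.
Hypothesis cd : d N / kap N @[N --> \oo] --> y.
Notation mu := (@lebesgue_measure R).

Let z0 : 0 < z. Proof. by case/andP: z01. Qed.
Let zw0 N : 0 < z * w N. Proof. exact: mulr_gt0. Qed.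
Let v0 N : 0 < 1 + z * w N. Proof. by rewrite addr_gt0. Qed.
Let w10 N : 0 < 1 + w N. Proof. by rewrite addr_gt0. Qed.
(** Saddle point of the second factor. The relations down to [kap3_s] check that after exchanging n
    with m and e0 with j0 it satisfies the same hypotheses, with the same d and kap. *)
Let ws N := (z * w N)^-1.
Let ws0 N : 0 < ws N. Proof. by rewrite invr_gt0. Qed.
Let wsinf := (z * winf)^-1.

Let je N : (j0 N <= e0 N)%N. Proof. by have := nemj N; have := nm N; lia. Qed.

Let ne N : (n N)%:R * (1 - z) = z * ((e0 N)%:R + d N) * (1 + w N) ^+ 2.
Proof. by rewrite -crit2 mulfVK // expf_neq0 // gt_eqF. Qed.

Let jd N : (j0 N)%:R + d N = z * ((e0 N)%:R + d N) * w N ^+ 2.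
Proof.
have : (n N)%:R * (1 - z) * w N / (1 + w N) = z * ((e0 N)%:R + d N) * (1 + w N) * w N.
  by rewrite ne; field; rewrite gt_eqF.
by rewrite crit1; lra.
Qed.

Let mE N : (m N)%:R = (n N)%:R + (e0 N)%:R - (j0 N)%:R :> R.
Proof. by apply: (addIr (j0 N)%:R); rewrite subrK -!natrD nemj. Qed.

Let me N : (m N)%:R * (1 - z) = ((e0 N)%:R + d N) * (1 + z * w N) ^+ 2.
Proof.
have -> : (m N)%:R * (1 - z) = (n N)%:R * (1 - z) + ((e0 N)%:R + d N) * (1 - z) -
    ((j0 N)%:R + d N) * (1 - z) by rewrite mE; ring.
by rewrite ne jd; ring.
Qed.

Let nemj_s N : (m N + j0 N = n N + e0 N)%N. Proof. by []. Qed.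

Let crit1_s N : (m N)%:R * (1 - z) * ws N / (1 + ws N) =
  (j0 N)%:R * z * ws N + (e0 N)%:R + d N * (1 + z * ws N).
Proof.
have -> : (j0 N)%:R = z * ((e0 N)%:R + d N) * w N ^+ 2 - d N by rewrite -jd addrK.
by rewrite me /ws; field; rewrite !gt_eqF // addr_gt0.
Qed.

Let crit2_s N : (m N)%:R * (1 - z) / (1 + ws N) ^+ 2 = z * ((j0 N)%:R + d N).
Proof. by rewrite me jd /ws; field; rewrite !gt_eqF // addr_gt0. Qed.

Let kap3e N : kap N ^+ 3 = z * ((e0 N)%:R + d N) * w N ^+ 2 / ((1 + w N) * (1 + z * w N)).
Proof. by rewrite kap3 ne; field; rewrite !gt_eqF. Qed.

Let kap3_s N : kap N ^+ 3 =
  (m N)%:R * (1 - z) * ws N ^+ 2 / ((1 + ws N) ^+ 3 * (1 + z * ws N)).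
Proof. by rewrite kap3e me /ws; field; rewrite !gt_eqF // addr_gt0. Qed.

Let cws : ws N @[N --> \oo] --> wsinf.
Proof.
have h : z * winf != 0 by rewrite gt_eqF // mulr_gt0.
by rewrite /ws /wsinf; cvg_arith.
Qed.

Let wsinf0 : 0 < wsinf. Proof. by rewrite invr_gt0 mulr_gt0. Qed.

Let kap_ge (A : R) : \forall N \near \oo, A <= kap N.
Proof. exact: ((cvgryPge _).1 ckap). Qed.

(** j0 + d is at least kap^3, far beyond the scale kap on which the kernel lives, so the finite
    range of the indices is not felt in the limit. *)
Let j0_kap (A : R) : \forall N \near \oo, A * kap N <= (j0 N)%:R.
Proof.
have cdn : `|d N / kap N| @[N --> \oo] --> `|y| by exact: cvg_norm cd.
near=> N.
have h1 : `|d N / kap N| <= `|y| + 1 by near: N; apply: cvgr_le cdn _ _; lra.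
have h2 : `|A| + `|y| + 2 <= kap N by near: N; exact: kap_ge.
have h3 : d N <= (`|y| + 1) * kap N.
  rewrite -ler_pdivrMr //; apply: le_trans h1; exact: ler_norm.
have h4 : kap N ^+ 3 <= (j0 N)%:R + d N.
  have -> : (j0 N)%:R + d N = kap N ^+ 3 * ((1 + w N) * (1 + z * w N)).
    by rewrite kap3e jd mulfVK // mulf_neq0 // gt_eqF.
  rewrite ler_peMr ?exprn_ge0 ?(ltW (kap0 N)) //.
  have := mulr_gt0 (w0 N) (v0 N); have := zw0 N; nra.
have k1 : 1 <= kap N by have := normr_ge0 A; have := normr_ge0 y; lra.
have h5 : (`|A| + `|y| + 2) * kap N <= kap N ^+ 3.
  have -> : kap N ^+ 3 = kap N ^+ 2 * kap N by ring.
  rewrite ler_pM2r //; apply: le_trans h2 _; rewrite expr2 ler_peMl // ltW //.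
have h6 : A * kap N <= `|A| * kap N by rewrite ler_wpM2r ?ler_norm // ltW.
have := kap0 N; lra.
Unshelve. all: by end_near. Qed.

Let j0_nat (A : nat) : \forall N \near \oo, (A < j0 N)%N.
Proof.
near=> N.
have h : A.+1%:R * kap N <= (j0 N)%:R by near: N; exact: j0_kap.
have k1 : 1 <= kap N by near: N; exact: kap_ge.
rewrite -(@ler_nat R); apply: le_trans h; rewrite ler_peMr //.
Unshelve. all: by end_near. Qed.

Let at_ := sadcoef z n m e0 j0 w kap.
Let as_ := sadcoef z m n j0 e0 ws kap.

Definition rescaled_hlkernel N p q : R := kap N ^- 2 *
  \sum_(i < (j0 N).+1 | (p + i <= j0 N)%N && (q + i <= e0 N)%N) at_ N (p + i)%N * as_ N (q + i)%N.

Lemma hlkernel_rescaled N p q : (p <= j0 N)%N -> (q <= j0 N)%N ->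
  hlkernel z (n N) (m N) (j0 N - p) (j0 N - q) =
  w N ^+ p / w N ^+ q * rescaled_hlkernel N p q.
Proof. by move=> pj qj; exact: hlkernel_saddle. Qed.

(** Set to 0 outside the range of summation, so that the kernel is the integral of a step function,
    a Riemann sum for the Airy kernel. *)
Let phi N p q i : R := if (p + i <= j0 N)%N && (q + i <= e0 N)%N then
  at_ N (p + i)%N * as_ N (q + i)%N else 0.

Let phi_out N p q i : ((j0 N).+1 <= i)%N -> phi N p q i = 0.
Proof. by move=> h; rewrite /phi; case: ifP => // /andP[h1 _]; lia. Qed.

Let phi_int N p q : mu.-integrable `[0, +oo[%classic
  (EFin \o (fun x => phi N p q (step_index 0 (kap N) x))).
Proof.
by apply: (@step_integrable R 0 (kap N) (j0 N).+1 (kap0 N) (phi N p q)) => //; exact: phi_out.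
Qed.

Let exp_int (dl : R) : 0 < dl -> mu.-integrable `[0, +oo[%classic
  (EFin \o (fun t : R => expR (- dl * (t - 0)))).
Proof.
move=> dl0; have mI : measurable (`]-1, +oo[%classic : set R) by [].
apply: (@integrableS _ _ _ mu (`]-1, +oo[%classic : set R)) => //.
  by move=> x /=; rewrite !in_itv /= !andbT; lra.
have := @integrable_EFinZ _ _ _ mu _ _ (expR dl) mI (@expR_integrable R dl (-1) dl0).
apply: eq_integrable => // x _ /=.
by rewrite -expRD; congr (expR _)%:E; ring.
Qed.

Let rescaledE N p q : kap N * rescaled_hlkernel N p q =
  \int[mu]_(x in `[0, +oo[) phi N p q (step_index 0 (kap N) x).
Proof.
rewrite -Rintegral_itv_obnd_cbnd; last first.
  by apply: integrableS (phi_int N p q) => // x /=; rewrite !in_itv /= !andbT; exact: ltW.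
rewrite (@step_Rintegral _ 0 (kap N) (j0 N).+1 (kap0 N)); last exact: phi_out.
rewrite /rescaled_hlkernel big_mkcond mulrA; congr (_ * _).
by field; rewrite gt_eqF.
Qed.

Let as_bound : exists C delta : R, [/\ 0 <= C, 0 < delta &
  \forall N \near \oo,
   (forall p, (p <= j0 N)%N -> `|at_ N p| <= C * expR (- delta * (p%:R / kap N))) /\
   (forall p, (p <= e0 N)%N -> `|as_ N p| <= C * expR (- delta * (p%:R / kap N)))].
Proof.
have e0pos : \forall N \near \oo, (0 < e0 N)%N.
  near=> N; apply: leq_trans (je N); near: N; exact: (j0_nat 0).
have j0pos : \forall N \near \oo, (0 < j0 N)%N by exact: (j0_nat 0).
have [C [dl [C0 dl0 h]]] := sadcoef_bound z01 w0 winf0 kap0 nemj crit1 crit2 kap3 cw ckap cd e0pos.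
have [C' [dl' [C'0 dl'0 h']]] :=
  sadcoef_bound z01 ws0 wsinf0 kap0 nemj_s crit1_s crit2_s kap3_s cws ckap cd j0pos.
exists (C + C'), (Num.min dl dl'); split; first exact: addr_ge0.
  by rewrite lt_min dl0.
near=> N.
have hN : forall p, (p <= j0 N)%N -> `|at_ N p| <= C * expR (- dl * (p%:R / kap N)).
  by near: N.
have h'N : forall p, (p <= e0 N)%N -> `|as_ N p| <= C' * expR (- dl' * (p%:R / kap N)).
  by near: N.
have pk p : 0 <= p%:R / kap N by rewrite divr_ge0 // ltW.
split=> p hp; [apply: le_trans (hN p hp) _|apply: le_trans (h'N p hp) _];
  (apply: ler_pM; rewrite ?expR_ge0 //; [by rewrite ?lerDl ?lerDr|]);
  by rewrite ler_expR ler_wpM2r // lerN2 ge_min lexx ?orbT.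
Unshelve. all: by end_near. Qed.

Let phi_bound : exists C delta : R, [/\ 0 <= C, 0 < delta &
  \forall N \near \oo, forall p q x, 0 <= x ->
    `|phi N p q (step_index 0 (kap N) x)| <=
     C * expR (- delta * (p%:R / kap N)) * expR (- delta * (q%:R / kap N)) *
     expR (- delta * (x - 0))].
Proof.
have [C [dl [C0 dl0 h]]] := as_bound.
exists (C ^+ 2 * expR (dl)), dl; split => //.
  by rewrite mulr_ge0 ?expR_ge0 // sqr_ge0.
near=> N.
have [h1 h2] : (forall p, (p <= j0 N)%N -> `|at_ N p| <= C * expR (- dl * (p%:R / kap N))) /\
   (forall p, (p <= e0 N)%N -> `|as_ N p| <= C * expR (- dl * (p%:R / kap N))).
  by near: N.
have k1 : 1 <= kap N by near: N; exact: kap_ge.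
move=> p q x x0; rewrite /phi; case: ifP => [/andP[pj qe]|_]; last first.
  by rewrite normr0 !mulr_ge0 ?expR_ge0 // sqr_ge0.
set i := step_index 0 (kap N) x.
have hi : x - 1 <= i%:R / kap N.
  have /andP[_] : i%:R <= (x - 0) * kap N < i.+1%:R.
    by apply: truncn_itv; rewrite subr0 mulr_ge0 // ltW.
  rewrite subr0 -natr1 ler_pdivlMr // => hx.
  have -> : (x - 1) * kap N = x * kap N - kap N by ring.
  lra.
have i0 : 0 <= i%:R / kap N by rewrite divr_ge0 // ltW.
rewrite normrM; apply: le_trans (ler_pM _ _ (h1 _ pj) (h2 _ qe)) _ => //.
set P := p%:R / kap N; set Q := q%:R / kap N.
have -> : (p + i)%:R / kap N = P + i%:R / kap N by rewrite natrD mulrDl.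
have -> : (q + i)%:R / kap N = Q + i%:R / kap N by rewrite natrD mulrDl.
set I := i%:R / kap N in hi i0 *.
have -> : C * expR (- dl * (P + I)) * (C * expR (- dl * (Q + I))) =
    C ^+ 2 * expR (- dl * (P + I) + - dl * (Q + I)) by rewrite expRD; ring.
have -> : C ^+ 2 * expR dl * expR (- dl * P) * expR (- dl * Q) * expR (- dl * (x - 0)) =
    C ^+ 2 * expR (dl + - dl * P + - dl * Q + - dl * (x - 0)) by rewrite !expRD; ring.
rewrite ler_wpM2l ?sqr_ge0 // ler_expR; nra.
Unshelve. all: by end_near. Qed.

Let stepi_cvg (a x : R) : a <= x ->
  (step_index a (kap N) x)%:R / kap N @[N --> \oo] --> x - a.
Proof.
move=> ax.
have ckV : (kap N)^-1 @[N --> \oo] --> (0 : R).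
  have h : \forall N \near \oo, 0 < kap N by near=> N; exact: kap0.
  exact: (gtr0_cvgV0 h).2 ckap.
have lo : x - a - (kap N)^-1 @[N --> \oo] --> x - a.
  by rewrite -[X in _ --> X]subr0; apply: cvgB => //; exact: cvg_cst.
have hi : cst (x - a) N @[N --> \oo] --> x - a by exact: cvg_cst.
apply: squeeze_cvgr lo hi; near=> N.
have /andP[h1 h2] : (step_index a (kap N) x)%:R <= (x - a) * kap N < (step_index a (kap N) x).+1%:R.
  by apply: truncn_itv; rewrite mulr_ge0 ?subr_ge0 // ?(ltW (kap0 N)) // ltW.
rewrite ler_pdivrMr // h1 andbT ler_pdivlMr // mulrBl mulVf ?gt_eqF //.
by move: h2; rewrite -natr1; lra.
Unshelve. all: by end_near. Qed.

Let rescaled_cvg x x' : y < x -> y < x' ->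
  kap N * rescaled_hlkernel N (step_index y (kap N) x) (step_index y (kap N) x')
    @[N --> \oo] --> Airy_kernel x x'.
Proof.
move=> yx yx'.
have [C [dl [C0 dl0 hb]]] := phi_bound.
have iG : mu.-integrable `[0, +oo[%classic (EFin \o (fun t : R => C * expR (- dl * (t - 0)))).
  by apply: integrable_EFinZ => //; exact: exp_int.
under eq_fun do rewrite rescaledE.
have e0pos : \forall N \near \oo, (0 < e0 N)%N.
  near=> N; apply: leq_trans (je N); near: N; exact: (j0_nat 0).
have j0pos : \forall N \near \oo, (0 < j0 N)%N by exact: (j0_nat 0).
have small a t u : a < t -> 0 <= u -> \forall N \near \oo,
    (step_index a (kap N) t + step_index 0 (kap N) u < j0 N)%N.
  move=> at_t u0; near=> N.
  have h1 : (t - a + u + 1) * kap N <= (j0 N)%:R by near: N; exact: j0_kap.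
  have h2 : (step_index a (kap N) t)%:R <= (t - a) * kap N.
    have /andP[] : (step_index a (kap N) t)%:R <= (t - a) * kap N < (step_index a (kap N) t).+1%:R => //.
    by apply: truncn_itv; rewrite mulr_ge0 ?subr_ge0 // ?(ltW (kap0 N)) // ltW.
  have h3 : (step_index 0 (kap N) u)%:R <= (u - 0) * kap N.
    have /andP[] : (step_index 0 (kap N) u)%:R <= (u - 0) * kap N < (step_index 0 (kap N) u).+1%:R => //.
    by apply: truncn_itv; rewrite mulr_ge0 ?subr_ge0 // ?(ltW (kap0 N)) // ltW.
  rewrite -(@ltr_nat R) natrD; have := kap0 N; lra.
have lim1 t u : y < t -> 0 <= u ->
    at_ N (step_index y (kap N) t + step_index 0 (kap N) u)%N @[N --> \oo] --> Airy (t + u).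
  move=> yt u0; have -> : t + u = (t - y + u) + y by ring.
  apply: (sadcoef_cvg z01 w0 winf0 kap0 nemj crit1 crit2 kap3 cw ckap cd e0pos).
  - under eq_fun do rewrite natrD mulrDl.
    apply: cvgD; first by apply: stepi_cvg; exact: ltW.
    by have := stepi_cvg u0; rewrite subr0.
  - near=> N; apply: leq_trans (je N); near: N; exact: small.
  - near=> N; apply: ltnW; near: N; exact: small.
have lim2 t u : y < t -> 0 <= u ->
    as_ N (step_index y (kap N) t + step_index 0 (kap N) u)%N @[N --> \oo] --> Airy (t + u).
  move=> yt u0; have -> : t + u = (t - y + u) + y by ring.
  apply: (sadcoef_cvg z01 ws0 wsinf0 kap0 nemj_s crit1_s crit2_s kap3_s cws ckap cd j0pos).
  - under eq_fun do rewrite natrD mulrDl.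
    apply: cvgD; first by apply: stepi_cvg; exact: ltW.
    by have := stepi_cvg u0; rewrite subr0.
  - near=> N; near: N; exact: small.
  - near=> N; apply: leq_trans (je N); apply: ltnW; near: N; exact: small.
rewrite /Airy_kernel; apply: (Rintegral_dominated_cvg _ _ _ iG) => //.
  - by move=> N; apply/measurable_EFinP; exact: (measurable_int _ (phi_int N _ _)).
  - move=> u; rewrite /= in_itv /= andbT => u0.
    have h : at_ N (step_index y (kap N) x + step_index 0 (kap N) u)%N *
        as_ N (step_index y (kap N) x' + step_index 0 (kap N) u)%N @[N --> \oo] -->
        Airy (x + u) * Airy (x' + u) by apply: cvgM; [exact: lim1|exact: lim2].
    apply: cvg_trans h; apply: near_eq_cvg; near=> N.
    rewrite /phi ifT //; apply/andP; split.
      by apply: ltnW; near: N; exact: small.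
    by apply: leq_trans (je N); apply: ltnW; near: N; exact: small.
  - near=> N => u; rewrite /= in_itv /= andbT => u0.
    have h : forall p q x, 0 <= x -> `|phi N p q (step_index 0 (kap N) x)| <=
     C * expR (- dl * (p%:R / kap N)) * expR (- dl * (q%:R / kap N)) *
     expR (- dl * (x - 0)) by near: N.
    apply: le_trans (h _ _ _ u0) _; apply: ler_wpM2r; first exact: expR_ge0.
    have e1 (p : nat) : expR (- dl * (p%:R / kap N)) <= 1.
      by rewrite -expR0 ler_expR mulNr oppr_le0 mulr_ge0 ?divr_ge0 // ltW.
    rewrite -mulrA ler_piMr // mulr_ile1 ?expR_ge0 ?e1 //.
Unshelve. all: by end_near. Qed.

Theorem hlkernel_det_cvg (c : nat -> R) : c N @[N --> \oo] --> (1 : R) ->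
  \det (1%:M - c N *: \matrix_(i < (j0 N).+1, j < (j0 N).+1)
     hlkernel z (n N) (m N) (j0 N - i) (j0 N - j)) @[N --> \oo] --> F_GUE y.
Proof.
move=> c1.
have E N : \det (1%:M - c N *: \matrix_(i < (j0 N).+1, j < (j0 N).+1)
     hlkernel z (n N) (m N) (j0 N - i) (j0 N - j)) =
   \det (1%:M - c N *: \matrix_(i < (j0 N).+1, j < (j0 N).+1) rescaled_hlkernel N i j).
  have wp p : w N ^+ p != 0 by rewrite expf_neq0 // gt_eqF.
  rewrite -(@det_conj_diag _ _ (fun p => w N ^+ p) _ _ wp); congr (\det (_ - _ *: _)).
  by apply/matrixP => i j; rewrite !mxE hlkernel_rescaled // -ltnS.
under eq_fun do rewrite E.
have [C [dl [C0 dl0 hb]]] := phi_bound.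
have iE := exp_int dl0.
pose I := \int[mu]_(t in `[0, +oo[) expR (- dl * (t - 0)).
have I0 : 0 <= I by apply: Rintegral_ge0 => t _; exact: expR_ge0.
apply: (@fredholm_det_cvg _ _ _ kap c (fun N => (j0 N).+1) rescaled_hlkernel (C * I) dl) => //.
- move=> A; near=> N; apply: ltnW; apply: ltnW; near: N; exact: j0_nat.
- exact: mulr_ge0.
- near=> N => p q pj qj.
  have h : forall p q x, 0 <= x -> `|phi N p q (step_index 0 (kap N) x)| <=
     C * expR (- dl * (p%:R / kap N)) * expR (- dl * (q%:R / kap N)) *
     expR (- dl * (x - 0)) by near: N.
  rewrite rescaledE.
  have ip := phi_int N p q.
  apply: le_trans (le_normr_Rintegral _ ip) _ => //.
  set P := expR _; set Q := expR _.
  apply: (@le_trans _ _ (\int[mu]_(t in `[0, +oo[) (C * P * Q * expR (- dl * (t - 0))))).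
    apply: le_Rintegral => //.
    - by have := integrable_norm ip; apply: eq_integrable.
    - exact: integrable_EFinZ.
    - by move=> t; rewrite /= in_itv /= andbT => t0; exact: h.
  rewrite RintegralZl // -/I; have -> : C * I * P * Q = C * P * Q * I by ring.
  by [].
- move=> x yx; near=> N.
  have h1 : (x - y) * kap N <= (j0 N)%:R by near: N; exact: j0_kap.
  have /andP[h2 _] : (step_index y (kap N) x)%:R <= (x - y) * kap N < (step_index y (kap N) x).+1%:R.
    by apply: truncn_itv; rewrite mulr_ge0 ?subr_ge0 // ?(ltW (kap0 N)) // ltW.
  by rewrite ltnS -(@ler_nat R); exact: le_trans h2 h1.
Unshelve. all: by end_near. Qed.

End kernel_limit.

(** * The kernel as a complementary projection *)

Local Arguments acoef _ _ _ _ _ : simpl never.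

Section coefficients.
Variables (F : fieldType) (z : F).
Hypothesis zn0 : z != 0.

(** The coefficients of (1 - z X)^(- m). *)
Definition hcoef (m l : nat) : F := (-1) ^+ l * acoef z 0 m l.

Lemma hcoef0 m : hcoef m 0 = 1.
Proof. by rewrite /hcoef acoef0 expr0 mul1r. Qed.

Lemma hcoef_delta l : hcoef 0 l = (l == 0%N)%:R.
Proof. by rewrite /hcoef acoef00; case: l => [|l]; rewrite ?expr0 ?mul1r //= mulr0. Qed.

Lemma hcoefS m l : hcoef m.+1 l.+1 = hcoef m l.+1 + z * hcoef m.+1 l.
Proof. by rewrite /hcoef (acoefSm z 0 m l) !exprS; ring. Qed.

Definition hpoly m L : {poly F} := \poly_(l < L) hcoef m l.

(** Truncation of (X - 1)^n (1 - z X)^(- m): the signs come from w = - X and from (X - 1)^n = (-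
    1)^n (1 - X)^n. *)
Definition acpoly n m L : {poly F} := \poly_(l < L) ((-1) ^+ (n + l) * acoef z n m l).

(** Series are handled as polynomials modulo X^L; this lets a factor be replaced by another one that
    agrees with it below L. *)
Lemma coef_mul_trunc (p s1 s2 : {poly F}) L :
  (forall i, (i < L)%N -> s1`_i = s2`_i) ->
  forall i, (i < L)%N -> (p * s1)`_i = (p * s2)`_i.
Proof.
move=> h i iL; rewrite !coefM; apply: eq_bigr => j _; rewrite h //.
by apply: leq_ltn_trans iL; exact: leq_subr.
Qed.

Lemma hpoly_inv m L l : (l < L)%N ->
  ((1 - z *: 'X) ^+ m * hpoly m L)`_l = (l == 0%N)%:R.
Proof.
elim: m l => [|m IH] l lL.
  by rewrite expr0 mul1r coef_poly lL hcoef_delta.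
rewrite exprSr -mulrA -(IH _ lL); apply: (coef_mul_trunc _ _ lL) => {l lL} l lL.
rewrite mulrBl mul1r coefB -scalerAl coefZ coefXM !coef_poly lL.
case: l lL => [|l] lL /=; first by rewrite mulr0 subr0 !hcoef0.
by rewrite (ltnW lL) hcoefS addrK.
Qed.

Lemma acpoly_hpoly n m L l : (l < L)%N ->
  (('X - 1) ^+ n * hpoly m L)`_l = (-1) ^+ (n + l) * acoef z n m l.
Proof.
elim: n l => [|n IH] l lL; first by rewrite expr0 mul1r coef_poly lL.
have E i : (i < L)%N -> (('X - 1) ^+ n * hpoly m L)`_i = (acpoly n m L)`_i.
  by move=> iL; rewrite IH // coef_poly iL.
rewrite exprS -mulrA (coef_mul_trunc _ E lL) mulrBl mul1r coefB coefXM !coef_poly lL.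
case: l lL => [|l] lL /=.
  by rewrite sub0r !acoef0 !addn0 exprS; ring.
by rewrite (ltnW lL) acoefSn !addSn !addnS !exprS; ring.
Qed.

Lemma acoef_binomial n m J :
  \sum_(k < J.+1) ('C(n, k)%:R * z ^+ k) * acoef z m n (J - k) = 'C(m, J)%:R.
Proof.
have key L l : (l < L)%N ->
    ((1 + z *: 'X) ^+ n * \poly_(l < L) acoef z m n l)`_l = ((1 + 'X) ^+ m)`_l.
  elim: n l => [|n' IH] l lL.
    rewrite expr0 mul1r coef_poly lL; elim: m l lL => [|m' IH] l lL.
      by rewrite expr0 coef1 acoef00.
    rewrite exprS mulrDl mul1r coefD coefXM; case: l lL => [|l] lL /=.
      by rewrite addr0 -IH // !acoef0.
    by rewrite acoefSn !IH // ltnW.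
  rewrite exprSr -mulrA -(IH _ lL); apply: (coef_mul_trunc _ _ lL) => {l lL} l lL.
  rewrite mulrDl mul1r coefD -scalerAl coefZ coefXM !coef_poly lL.
  case: l lL => [|l] lL /=; first by rewrite mulr0 addr0 !acoef0.
  by rewrite (ltnW lL) (acoefSm z m n' l).
have bin (c : F) p i : ((1 + c *: 'X) ^+ p)`_i = 'C(p, i)%:R * c ^+ i.
  rewrite exprDn coef_sum; have [ip|ip] := leqP i p.
    rewrite (bigD1 (Ordinal (ip : (i < p.+1)%N))) //= big1 => [|k ki].
      by rewrite addr0 expr1n mul1r exprZn coefMn coefZ coefXn eqxx mulr1 mulr_natl.
    rewrite expr1n mul1r exprZn coefMn coefZ coefXn.
    case: eqP => [e|_]; last by rewrite mulr0 mul0rn.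
    by case/eqP: ki; apply/val_inj.
  rewrite bin_small // mul0r big1 // => k _.
  rewrite expr1n mul1r exprZn coefMn coefZ coefXn.
  have -> : (i == k) = false by apply/eqP; have := ltn_ord k; lia.
  by rewrite mulr0 mul0rn.
have := key J.+1 J (ltnSn J); rewrite coefM => h.
have := bin 1 m J; rewrite scale1r expr1n mulr1 => <-; rewrite -h.
apply: eq_bigr => k _; rewrite bin coef_poly ifT //.
by rewrite ltnS leq_subr.
Qed.

(** Up to a shift of degree, the coefficients of (1 - z X)^m (X - 1)^(- n) expanded at infinity, by
    w = - 1 / (z X). *)
Definition qcoef (n m J : nat) : F := (- z) ^ (m%:Z - J%:Z) * acoef z m n J.

Lemma qcoef_sum n m J :
  \sum_(k < J.+1) 'C(n, k)%:R * (-1) ^+ k * qcoef n m (J - k) =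
  (- z) ^ (m%:Z - J%:Z) * 'C(m, J)%:R.
Proof.
rewrite -(acoef_binomial n) big_distrr; apply: eq_bigr => k _.
have kJ : (k <= J)%N by rewrite -ltnS.
have zN : - z != 0 by rewrite oppr_eq0.
rewrite /qcoef -subzn // (_ : m%:Z - (J%:Z - k%:Z) = m%:Z - J%:Z + k%:Z); last by ring.
rewrite expfzDr // -exprnP.
have h : (-1) ^+ k * (- z) ^+ k = z ^+ k by rewrite -exprMn mulN1r opprK.
by rewrite -h /=; ring.
Qed.

Definition quopoly (n m l' : nat) : {poly F} :=
  \poly_(i < (l' + (m - n)).+1) qcoef n m (l' + (m - n) - i).

Lemma coef_XB1 n i : (('X - 1 : {poly F}) ^+ n)`_i = 'C(n, i)%:R * (-1) ^+ (n - i).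
Proof.
have -> : 'X - 1 = 'X + (-1)%:P :> {poly F} by rewrite polyCN.
rewrite addrC exprDn coef_sum; have [ip|ip] := leqP i n.
  rewrite (bigD1 (Ordinal (ip : (i < n.+1)%N))) //= big1 => [|k ki].
    by rewrite addr0 -polyC_exp coefMn coefCM coefXn eqxx mulr1 mulr_natl.
  rewrite -polyC_exp coefMn coefCM coefXn.
  case: eqP => [e|_]; last by rewrite mulr0 mul0rn.
  by case/eqP: ki; apply/val_inj.
rewrite bin_small // mul0r big1 // => k _.
rewrite -polyC_exp coefMn coefCM coefXn.
have -> : (i == k) = false by apply/eqP; have := ltn_ord k; lia.
by rewrite mulr0 mul0rn.
Qed.

Lemma coef_1BzX m i : ((1 - z *: 'X : {poly F}) ^+ m)`_i = 'C(m, i)%:R * (- z) ^+ i.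
Proof.
have -> : 1 - z *: 'X = 1 + (- z) *: 'X :> {poly F} by rewrite scaleNr.
rewrite exprDn coef_sum; have [ip|ip] := leqP i m.
  rewrite (bigD1 (Ordinal (ip : (i < m.+1)%N))) //= big1 => [|k ki].
    by rewrite addr0 expr1n mul1r exprZn coefMn coefZ coefXn eqxx mulr1 mulr_natl.
  rewrite expr1n mul1r exprZn coefMn coefZ coefXn.
  case: eqP => [e|_]; last by rewrite mulr0 mul0rn.
  by case/eqP: ki; apply/val_inj.
rewrite bin_small // mul0r big1 // => k _.
rewrite expr1n mul1r exprZn coefMn coefZ coefXn.
have -> : (i == k) = false by apply/eqP; have := ltn_ord k; lia.
by rewrite mulr0 mul0rn.
Qed.

Definition rempoly (n m l' : nat) : {poly F} :=
  (1 - z *: 'X) ^+ m * 'X^l' - quopoly n m l' * ('X - 1) ^+ n.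

(** [quopoly] is the polynomial part at infinity of (1 - z X)^m X^l' / (X - 1)^n, that is, the
    Euclidean quotient. The proof compares the coefficients of degree at least n, which [qcoef_sum]
    evaluates. *)
Lemma size_rempoly n m l' : (n <= m)%N -> (size (rempoly n m l') <= n)%N.
Proof.
move=> nm; apply/leq_sizeP => j nj; rewrite coefB; apply/eqP; rewrite subr_eq0; apply/eqP.
pose Q := (l' + (m - n))%N; pose r := (j - n)%N.
have jE : j = (n + r)%N by rewrite /r; lia.
have L1 : ((1 - z *: 'X) ^+ m * 'X^l')`_j =
    if (r <= Q)%N then (- z) ^ (m%:Z - (Q - r)%:Z) * 'C(m, Q - r)%:R else 0.
  rewrite coefMXn; case: ltnP => jl.
    have -> : (r <= Q)%N by rewrite /Q; lia.
    by rewrite bin_small ?mulr0 // /Q; lia.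
  rewrite coef_1BzX; case: leqP => rQ; last by rewrite bin_small ?mul0r // /Q; lia.
  have E : (j - l' = m - (Q - r))%N by rewrite /Q; lia.
  have le1 : (Q - r <= m)%N by rewrite /Q; lia.
  by rewrite E bin_sub // subzn // -exprnP mulrC.
rewrite L1 coefM.
have T i : (i < j.+1)%N -> (quopoly n m l')`_i * (('X - 1) ^+ n)`_(j - i) =
    if (r <= i <= Q)%N then 'C(n, i - r)%:R * (-1) ^+ (i - r) * qcoef n m (Q - i) else 0.
  move=> ij; rewrite coef_poly coef_XB1 ltnS -/Q.
  case: (leqP i Q) => iQ; last by rewrite andbF mul0r.
  rewrite andbT; case: leqP => ri; last by rewrite bin_small ?mul0r ?mulr0 //; lia.
  have [le1|gt1] := leqP (j - i) n.
    have -> : (n - (j - i) = i - r)%N by lia.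
    rewrite -[in LHS]bin_sub //; have -> : (n - (j - i) = i - r)%N by lia.
    by ring.
  by lia.
rewrite (eq_bigr (fun i : 'I_j.+1 => if (r <= i <= Q)%N then
  'C(n, i - r)%:R * (-1) ^+ (i - r) * qcoef n m (Q - i) else 0)); last first.
  by move=> i _; exact: T.
case: leqP => rQ; last first.
  by rewrite big1 // => i _; case: ifP => // /andP[]; lia.
rewrite -(qcoef_sum n) -big_mkcond /=.
rewrite -(big_mkord (fun i => (r <= i <= Q)%N)
  (fun i => 'C(n, i - r)%:R * (-1) ^+ (i - r) * qcoef n m (Q - i))).
rewrite -(big_mkord xpredT (fun k => 'C(n, k)%:R * (-1) ^+ k * qcoef n m (Q - r - k))).
apply: esym; rewrite (@big_cat_nat _ _ _ r) //=; last by lia.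
rewrite big1_seq ?add0r; last by move=> i; rewrite mem_index_iota; lia.
rewrite -{1}[r]add0n big_addn.
have [h|h] := leqP (j.+1 - r) (Q - r).+1.
  rewrite [RHS](@big_cat_nat _ _ _ (j.+1 - r)) //= [X in _ = _ + X]big1_seq ?addr0; last first.
    move=> i; rewrite mem_index_iota => /andP[_ /andP[hi _]].
    by rewrite bin_small ?mul0r //; lia.
  rewrite [LHS]big_seq_cond [RHS]big_seq_cond; apply: eq_big => [i|i].
    by rewrite mem_index_iota; lia.
  by rewrite mem_index_iota => _; rewrite addnK subnDA subnAC.
rewrite (@big_cat_nat _ _ _ (Q - r).+1) //=; last by lia.
rewrite [X in _ + X]big1_seq ?addr0; last by move=> i; rewrite mem_index_iota; lia.
rewrite [LHS]big_seq_cond [RHS]big_seq_cond; apply: eq_big => [i|i].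
  by rewrite mem_index_iota; lia.
by rewrite mem_index_iota => _; rewrite addnK subnDA subnAC.
Qed.

(* The kernel of the complementary projection: comparing coefficients in
   (1 - zX)^m X^l' = quo * (X - 1)^n + rem after division by (1 - zX)^m. *)
Lemma hlkernel_complement n m l l' : (n <= m)%N ->
  (l == l')%:R - \sum_(j < n) (rempoly n m l')`_j * (if (j <= l)%N then hcoef m (l - j) else 0) =
  (-1) ^+ l / (-1) ^+ l' * hlkernel z n m l l'.
Proof.
move=> nm; pose L := l.+1.
have E1 : ((1 - z *: 'X) ^+ m * 'X^l' * hpoly m L)`_l = (l == l')%:R.
  rewrite mulrAC coefMXn; case: ltnP => ll; first by rewrite (ltn_eqF ll).
  rewrite hpoly_inv; last by rewrite /L; lia.
  by congr (nat_of_bool _)%:R; apply/eqP/eqP; lia.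
have E2 : (rempoly n m l' * hpoly m L)`_l =
    \sum_(j < n) (rempoly n m l')`_j * (if (j <= l)%N then hcoef m (l - j) else 0).
  rewrite coefM.
  have h j : (j < l.+1)%N -> (rempoly n m l')`_j * (hpoly m L)`_(l - j) =
      (rempoly n m l')`_j * (if (j <= l)%N then hcoef m (l - j) else 0).
    by move=> jl; rewrite coef_poly ltnS leq_subr -ltnS jl.
  rewrite (eq_bigr (fun j : 'I_l.+1 => (rempoly n m l')`_j *
     (if (j <= l)%N then hcoef m (l - j) else 0))); last by move=> j _; exact: h.
  rewrite -(big_mkord xpredT (fun j => (rempoly n m l')`_j *
     (if (j <= l)%N then hcoef m (l - j) else 0))).
  rewrite -(big_mkord xpredT (fun j => (rempoly n m l')`_j *
     (if (j <= l)%N then hcoef m (l - j) else 0))).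
  have z1 j : (n <= j)%N -> (rempoly n m l')`_j = 0 by move/leq_sizeP: (size_rempoly l' nm); apply.
  have [nl|ln] := leqP n l.+1.
    rewrite (@big_cat_nat _ _ _ n) //= [X in _ + X]big1_seq ?addr0 // => j.
    by rewrite mem_index_iota => /andP[_ /andP[nj _]]; rewrite z1 ?mul0r.
  rewrite [RHS](@big_cat_nat _ _ _ l.+1) //=; last exact: ltnW.
  rewrite [X in _ = _ + X]big1_seq ?addr0 // => j.
  by rewrite mem_index_iota => /andP[_ /andP[lj _]]; rewrite leqNgt lj /= mulr0.
have E3 : (quopoly n m l' * ('X - 1) ^+ n * hpoly m L)`_l =
    (-1) ^+ l / (-1) ^+ l' * hlkernel z n m l l'.
  rewrite -mulrA coefM /hlkernel big_distrr [RHS]big_mkcond /=; apply: eq_bigr => i _.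
  have il : (i <= l)%N by rewrite -ltnS.
  rewrite acpoly_hpoly; last by rewrite /L ltnS leq_subr.
  rewrite coef_poly ltnS; case: ifP => iQ; last by rewrite mul0r.
  rewrite /qcoef.
  have -> : m%:Z - (l' + (m - n) - i)%:Z = n%:Z - l'%:Z + i%:Z by lia.
  have nu : (-1 : F) \is a GRing.unit by rewrite unitrN1.
  have zu : z \is a GRing.unit by rewrite unitfE.
  have -> : (- z) ^ (n%:Z - l'%:Z + i%:Z) =
      (-1) ^ (n%:Z - l'%:Z + i%:Z) * z ^ (n%:Z - l'%:Z + i%:Z).
    by rewrite -exprzMl // mulN1r.
  have n0 : (-1 : F) != 0 by rewrite oppr_eq0 oner_eq0.
  have -> : (-1 : F) ^ (n%:Z - l'%:Z + i%:Z) = (-1) ^+ n / (-1) ^+ l' * (-1) ^+ i.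
    by rewrite !expfzDr // exprnN.
  have -> : (-1 : F) ^+ l = (-1) ^+ (l - i) * (-1) ^+ i by rewrite -exprD subnK.
  rewrite exprD.
  have s2 k : (-1 : F) ^+ k * (-1) ^+ k = 1 by rewrite -expr2 sqrr_sign.
  set a := z ^ _; set b := acoef _ _ _ _; set c := acoef _ _ _ _.
  set x := (-1) ^+ n; set y := (-1) ^+ i; set v := ((-1) ^+ l')^-1; set u := (-1) ^+ (l - i).
  have -> : x * v * y * a * b * (x * u * c) = (x * x) * (v * y * a * b * u * c) by ring.
  by rewrite s2; ring.
by rewrite -E1 -E2 -coefB -mulrBl -E3 /rempoly subKr.
Qed.

End coefficients.

Lemma cvg_linear_rec (R : realType) (r : R) (x e : nat -> R) : 0 <= r < 1 ->
  (forall L, x L.+1 = r * x L + e L) -> e L @[L --> \oo] --> (0 : R) ->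
  x L @[L --> \oo] --> (0 : R).
Proof.
move=> /andP[r0 r1] xE ce; apply/cvgrPdist_le => /= eps eps0.
have d0 : 0 < eps * (1 - r) / 2 by rewrite divr_gt0 // mulr_gt0 // subr_gt0.
have /cvgrPdist_le/(_ _ d0)[L0 _ hL0] := ce.
have bd k : `|x (L0 + k)%N| <= r ^+ k * `|x L0| + eps / 2.
  elim: k => [|k IH]; first by rewrite addn0 expr0 mul1r lerDl divr_ge0 // ltW.
  rewrite addnS xE; apply: le_trans (ler_normD _ _) _; rewrite normrM (ger0_norm r0).
  have h : `|e (L0 + k)%N| <= eps * (1 - r) / 2.
    by have := hL0 _ (leq_addr k L0); rewrite sub0r normrN.
  have h2 : r * `|x (L0 + k)%N| <= r * (r ^+ k * `|x L0| + eps / 2) by rewrite ler_wpM2l.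
  rewrite exprS; lra.
have cr : r ^+ k * `|x L0| @[k --> \oo] --> (0 : R).
  rewrite -(mul0r `|x L0|); apply: cvgM; last exact: cvg_cst.
  by apply: cvg_expr; rewrite ger0_norm.
have e2 : 0 < eps / 2 by rewrite divr_gt0.
have /cvgrPdist_le/(_ _ e2)[k0 _ hk0] := cr.
exists (L0 + k0)%N => // L /= hL.
have -> : L = (L0 + (L - L0))%N by rewrite subnKC //; apply: leq_trans hL; exact: leq_addr.
rewrite sub0r normrN; apply: le_trans (bd _) _.
have := hk0 (L - L0)%N; rewrite /= leq_subRL; last by apply: leq_trans hL; exact: leq_addr.
move=> /(_ hL); rewrite sub0r normrN ger0_norm; last by rewrite mulr_ge0 ?exprn_ge0.
lra.
Qed.

Lemma det_gram_ge0 (R : realFieldType) n p (G : 'M[R]_(n, p)) : 0 <= \det (G *m G^T).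
Proof.
have [fG|nfG] := boolP (row_free G).
  by have /posdef_det/andP[/ltW] := gram_posdef fG.
suff -> : \det (G *m G^T) = 0 by [].
apply/eqP; apply: contraR nfG => d0.
have : G *m G^T \in unitmx by rewrite unitmxE unitfE.
rewrite -row_free_unit /row_free => /eqP h.
by rewrite eqn_leq rank_leq_row -{1}h mxrankM_maxl.
Qed.

(** * Companion matrices *)

Section companion.
Variables (F : fieldType) (n : nat) (Q : {poly F}).
Hypothesis sQ : size Q = n.+2.
Hypothesis mQ : Q \is monic.

(** On row vectors it is multiplication by X modulo Q in the basis 1, X, ..., X^n; [cvec0] stands
    for the polynomial 1. *)
Definition compan : 'M[F]_n.+1 :=
  \matrix_(i, j) if i == ord_max then - Q`_j else (i.+1 == j)%:R.

Definition cvec0 : 'rV[F]_n.+1 := delta_mx 0 0.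

Lemma compan_pow (k : nat) (kn : (k < n.+1)%N) :
  cvec0 *m compan ^+ k = delta_mx 0 (Ordinal kn).
Proof.
elim: k kn => [|k IH] kn; first by rewrite expr0 mulmx1; congr delta_mx; apply/val_inj.
have kn' : (k < n.+1)%N by apply: ltnW.
rewrite exprSr -mulmxE mulmxA (IH kn') -rowE; apply/rowP => j; rewrite !mxE eqxx /=.
rewrite ifF; last by apply/eqP => /(congr1 val) /=; lia.
by rewrite eq_sym.
Qed.

Lemma compan_horner (p : {poly F}) : (size p <= n.+1)%N ->
  cvec0 *m horner_mx compan p = \row_j p`_j.
Proof.
move=> sp.
have E : horner_mx compan p = \sum_(i < n.+1) p`_i *: compan ^+ i.
  have pE : p = \sum_(i < n.+1) p`_i *: 'X^i.
    by rewrite -poly_def; apply/polyP => i; rewrite coef_poly; case: ltnP => // h;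
       rewrite nth_default //; apply: leq_trans h.
  rewrite [in LHS]pE raddf_sum; apply: eq_bigr => i _.
  by rewrite -[LHS]/(horner_mx compan _) horner_mxZ rmorphXn /= horner_mx_X.
rewrite E mulmx_sumr; apply/rowP => j; rewrite summxE mxE.
rewrite (bigD1 j) //= big1 => [|i ij]; last first.
  rewrite -scalemxAr (compan_pow (ltn_ord i)) !mxE.
  rewrite (_ : (j == _) = false) ?andbF ?mulr0 //.
  by apply/eqP => /(congr1 val) /= h; case/eqP: ij; exact/val_inj.
rewrite addr0 -scalemxAr (compan_pow (ltn_ord j)) !mxE.
rewrite (_ : Ordinal _ = j); last exact/val_inj.
by rewrite !eqxx mulr1.
Qed.

Lemma compan_annihilate : horner_mx compan Q = 0.
Proof.
have e0Q : cvec0 *m horner_mx compan Q = 0.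
  pose Q' : {poly F} := \poly_(i < n.+1) Q`_i.
  have QE : Q = Q' + 'X^(n.+1).
    apply/polyP => i; rewrite coefD coef_poly coefXn.
    have [h|h] := ltnP i n.+1; first by rewrite (ltn_eqF h) addr0.
    have [->|ne] := eqVneq i n.+1.
      by rewrite add0r; have := monicP mQ; rewrite lead_coefE sQ.
    by rewrite addr0 nth_default // sQ ltn_neqAle eq_sym ne.
  rewrite QE rmorphD /= mulmxDr compan_horner ?size_poly // rmorphXn /= horner_mx_X.
  rewrite exprSr -mulmxE mulmxA (compan_pow (ltnSn n)) -rowE.
  apply/rowP => j; rewrite !mxE coef_poly ltn_ord.
  by rewrite ifT ?subrr //; apply/eqP/val_inj.
apply/row_matrixP => i; rewrite row0 rowE.
have -> : delta_mx 0 i = cvec0 *m compan ^+ i.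
  by rewrite (compan_pow (ltn_ord i)); congr delta_mx; apply/val_inj.
have -> : compan ^+ i = horner_mx compan 'X^i by rewrite rmorphXn /= horner_mx_X.
by rewrite -mulmxA mulmxE -rmorphM mulrC rmorphM /= -mulmxE mulmxA e0Q mul0mx.
Qed.

(** The Vandermonde columns at roots of Q are eigenvectors of the companion matrix, so polynomials
    in it become diagonal. *)
Lemma compan_vandermonde (x : 'rV[F]_n.+1) (p : {poly F}) :
  (forall i, root Q (x 0 i)) ->
  horner_mx compan p *m Vandermonde n.+1 x =
  Vandermonde n.+1 x *m diag_mx (\row_i p.[x 0 i]).
Proof.
move=> rx.
have base : compan *m Vandermonde n.+1 x = Vandermonde n.+1 x *m diag_mx x.
  apply/matrixP => i j; rewrite mul_mx_diag !mxE.
  have [iE|ine] := eqVneq i ord_max.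
    have := rx j; rewrite /root horner_coef sQ big_ord_recr /=.
    have -> : Q`_n.+1 = 1 by have := monicP mQ; rewrite lead_coefE sQ.
    rewrite mul1r addr_eq0 => /eqP h.
    rewrite (eq_bigr (fun k : 'I_n.+1 => - (Q`_k * x 0 j ^+ k))); last first.
      by move=> k _; rewrite !mxE iE eqxx mulNr.
    by rewrite sumrN h opprK iE exprSr.
  have ni : (i.+1 < n.+1)%N.
    rewrite ltnS ltn_neqAle -ltnS ltn_ord andbT; apply: contra ine => /eqP e.
    exact/eqP/val_inj.
  rewrite (bigD1 (Ordinal ni)) //= big1 => [|k kne].
    by rewrite !mxE (negbTE ine) eqxx mul1r addr0 exprSr.
  rewrite !mxE (negbTE ine); case: eqP => [e|_]; last by rewrite mul0r.
  by case/eqP: kne; apply/val_inj.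
elim/poly_ind: p => [|p c IH].
  by rewrite rmorph0 mul0mx; apply/esym/matrixP => i j; rewrite mul_mx_diag !mxE horner0 mulr0.
rewrite rmorphD rmorphM /= horner_mx_X horner_mx_C mulmxDl -mulmxE -mulmxA base mulmxA IH.
apply/matrixP => i j; rewrite mxE -mulmxA mulmx_diag mul_scalar_mx !mul_mx_diag !mxE.
by rewrite hornerMXaddC; ring.
Qed.

End companion.

(** * Positivity and monotonicity *)

Definition mcvg (R : realType) p q (A : nat -> 'M[R]_(p, q)) (B : 'M[R]_(p, q)) : Prop :=
  forall i j, A L i j @[L --> \oo] --> B i j.

Lemma cvg_shift1 (R : realType) (f : nat -> R) (l : R) :
  f L.+1 @[L --> \oo] --> l <-> f L @[L --> \oo] --> l.
Proof. by have := cvg_shiftS f (nbhs l) => E; split=> h; [rewrite -E|rewrite E]. Qed.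

Section mcvg_theory.
Variable R : realType.

Lemma mcvg_cst p q (B : 'M[R]_(p, q)) : mcvg (fun=> B) B.
Proof. by move=> i j; exact: cvg_cst. Qed.

Lemma mcvgD p q (A A' : nat -> 'M[R]_(p, q)) B B' :
  mcvg A B -> mcvg A' B' -> mcvg (fun L => A L + A' L) (B + B').
Proof. by move=> h h' i j; under eq_fun do rewrite mxE; rewrite mxE; exact: cvgD. Qed.

Lemma mcvgZ p q (A : nat -> 'M[R]_(p, q)) B (c : nat -> R) (l : R) :
  c L @[L --> \oo] --> l -> mcvg A B -> mcvg (fun L => c L *: A L) (l *: B).
Proof. by move=> hc h i j; under eq_fun do rewrite mxE; rewrite mxE; exact: cvgM. Qed.

Lemma mcvgM p q r (A : nat -> 'M[R]_(p, q)) B (A' : nat -> 'M[R]_(q, r)) B' :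
  mcvg A B -> mcvg A' B' -> mcvg (fun L => A L *m A' L) (B *m B').
Proof.
move=> h h' i j; under eq_fun do rewrite mxE; rewrite mxE.
by apply: cvg_sumr => k; apply: cvgM.
Qed.

Lemma mcvg_det p (A : nat -> 'M[R]_p) B : mcvg A B ->
  \det (A L) @[L --> \oo] --> \det B.
Proof.
move=> h; have h0 := @cvg_det R nat \oo p (fun L i j => A L i j) (fun i j => B i j) _ h.
have -> : B = \matrix_(i, j) B i j by apply/matrixP => i j; rewrite mxE.
have -> : (fun L => \det (A L)) = (fun L => \det (\matrix_(i, j) A L i j)).
  by apply/funext => L; congr determinant; apply/matrixP => i j; rewrite mxE.
exact: h0.
Qed.

Lemma mcvg_shift p q (A : nat -> 'M[R]_(p, q)) B :
  mcvg (fun L => A L.+1) B -> mcvg A B.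
Proof. by move=> h i j; apply/(cvg_shift1 (fun L => A L i j)); exact: h. Qed.

Lemma mcvg_near p q (A A' : nat -> 'M[R]_(p, q)) B :
  (\forall L \near \oo, A L = A' L) -> mcvg A B -> mcvg A' B.
Proof.
move=> E h i j; apply: cvg_trans (h i j); apply: near_eq_cvg.
by near=> L; rewrite (_ : A L = A' L) //; near: L.
Unshelve. all: by end_near. Qed.

End mcvg_theory.

(** * Kernel determinants as determinants of a finite rank form *)

Section meixner.
Variables (R : realType) (z : R) (n m : nat).
Hypothesis z01 : 0 < z < 1.
Hypothesis nm : (n < m)%N.

Let z0 : 0 < z. Proof. by case/andP: z01. Qed.
Let z1 : z < 1. Proof. by case/andP: z01. Qed.
Let zn0 : z != 0. Proof. by rewrite gt_eqF. Qed.

Notation Q := (('X - 1 : {poly R}) ^+ n.+1).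

Let XB1 : 'X - 1 = 'X - 1%:P :> {poly R}. Proof. by rewrite polyC1. Qed.

Lemma size_XB1 : size Q = n.+2. Proof. by rewrite XB1 size_exp_XsubC. Qed.
Lemma monic_XB1 : Q \is monic. Proof. by rewrite XB1 rpredX // monicXsubC. Qed.

(** X acting on polynomials modulo (X - 1)^(n + 1), a unipotent matrix. The number of variables is
    n.+1 from here on. *)
Definition ucompan : 'M[R]_n.+1 := compan n Q.
Notation M := ucompan.
Notation hm := (horner_mx M).

(** Coefficient of X^l in X^j (1 - z X)^(- k). *)
Definition hshift k j l : R := if (j <= l)%N then hcoef z k (l - j) else 0.

Lemma hshift0 j l : hshift 0 j l = (j == l)%:R.
Proof.
rewrite /hshift; case: (ltngtP j l) => [jl|lj|->].
- by rewrite hcoef_delta; case: eqP => //; lia.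
- by [].
- by rewrite subnn hcoef0.
Qed.

Lemma hshiftS k j l : hshift k.+1 j l.+1 = hshift k j l.+1 + z * hshift k.+1 j l.
Proof.
rewrite /hshift; case: (ltngtP j l.+1) => [jl|lj|->].
- by rewrite -ltnS jl subSn // hcoefS.
- by rewrite leqNgt (ltn_trans _ lj) //= mulr0 addr0.
- by rewrite ltnn subnn !hcoef0 mulr0 addr0.
Qed.

Lemma hshiftS0 k j : hshift k.+1 j 0 = hshift k j 0.
Proof. by rewrite /hshift; case: j => //=; rewrite !hcoef0. Qed.

(** For large l these coefficients are z^l times a polynomial in l. Only z^(l / 2) is given away
    here; the other half pays for the growth of the matrix powers in [ucompan_growth]. *)
Lemma hcoef_decay k j : hshift k j l * (Num.sqrt z)^-1 ^+ l @[l --> \oo] --> (0 : R).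
Proof.
have r0 : 0 < Num.sqrt z by rewrite sqrtr_gt0.
have r1 : Num.sqrt z < 1 by rewrite -sqrtr1 ltr_sqrt.
elim: k => [|k IH].
  have c0 : cst (0 : R) l @[l --> \oo] --> (0 : R) by exact: cvg_cst.
  apply: cvg_trans c0; apply: near_eq_cvg; exists j.+1 => // l /= jl.
  by rewrite hshift0 (ltn_eqF jl) mul0r.
apply: (@cvg_linear_rec _ (Num.sqrt z) _
  (fun l => hshift k j l.+1 * (Num.sqrt z)^-1 ^+ l.+1)).
- by rewrite ltW.
- move=> l; rewrite hshiftS mulrDl addrC; congr (_ + _).
  have zE : z = Num.sqrt z * Num.sqrt z by rewrite -expr2 sqr_sqrtr // ltW.
  rewrite {1}zE exprS; set r := Num.sqrt z; field.
  by rewrite /r gt_eqF.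
- by apply/(cvg_shift1 (fun l => hshift k j l * (Num.sqrt z)^-1 ^+ l)).
Qed.

Let sXpoly (s : R) : {poly R} := 1 - (s * z) *: 'X.

(** Powers of a unipotent matrix grow polynomially. Downward induction on i: (X - 1)^(n + 1)
    annihilates, and X^(L + 1) = X^L + X^L (X - 1) gives a contracting recursion with a vanishing
    error. *)
Lemma ucompan_growth (r : R) i : 0 <= r < 1 -> (i <= n.+1)%N ->
  mcvg (fun L => r ^+ L *: hm ('X^L * ('X - 1) ^+ i)) 0.
Proof.
move=> r01; move E : (n.+1 - i)%N => d; elim: d i E => [|d IH] i Ei hi.
  have -> : i = n.+1 by lia.
  move=> a b; under eq_fun do
    rewrite rmorphM /= (compan_annihilate size_XB1 monic_XB1) mulr0 scaler0.
  exact: cvg_cst.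
have Ei1 : (n.+1 - i.+1 = d)%N by lia.
have hi1 : (i.+1 <= n.+1)%N by lia.
have {}IH := IH _ Ei1 hi1.
move=> a b; rewrite mxE.
apply: (@cvg_linear_rec _ r _ (fun L => r * (r ^+ L *: hm ('X^L * ('X - 1) ^+ i.+1)) a b)) => //.
  move=> L; have -> : 'X^(L.+1) * ('X - 1) ^+ i =
      'X^L * ('X - 1) ^+ i + 'X^L * ('X - 1) ^+ i.+1 :> {poly R}.
    by rewrite !exprS; ring.
  by rewrite rmorphD /= !mxE exprS; ring.
rewrite -[X in _ --> X](mulr0 r); apply: cvgM; first exact: cvg_cst.
by have := IH a b; rewrite mxE.
Qed.

(** Truncation of (s X)^j (1 - s z X)^(- k). *)
Definition hseries (k j : nat) (s : R) (L : nat) : {poly R} :=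
  \sum_(l < L) (s ^+ l * hshift k j l) *: 'X^l.

Lemma hseries_rec k j s L : hseries k j s L.+1 =
  sXpoly s * hseries k.+1 j s L.+1 + (s ^+ L.+1 * z * hshift k.+1 j L) *: 'X^(L.+1).
Proof.
elim: L => [|L IH].
  rewrite /hseries !big_ord1 /= hshiftS0 /sXpoly !expr0 expr1 -!mul_polyC !rmorphM /=.
  by ring.
rewrite {1}/hseries big_ord_recr /= -/(hseries k j s L.+1) IH.
rewrite [hseries k.+1 j s L.+2]big_ord_recr /= -/(hseries k.+1 j s L.+1).
rewrite [hshift k.+1 j L.+1]hshiftS ['X^(L.+2)]exprS [s ^+ L.+2]exprS /sXpoly.
set a := s ^+ L.+1; set p := 'X^(L.+1); set u := hshift _ _ _; set v := hshift _ _ _.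
by rewrite -!mul_polyC !(rmorphM, rmorphD) /=; ring.
Qed.

(** [hseries_rec] makes the truncation error explicit: a decaying coefficient times a power of the
    matrix of polynomial growth. *)
Lemma hseries_cvg k j s : 0 <= s <= 1 ->
  mcvg (fun L => hm (sXpoly s ^+ k * hseries k j s L)) (s ^+ j *: M ^+ j).
Proof.
move=> /andP[s0 s1]; elim: k => [|k IH].
  apply: (@mcvg_near _ _ _ (fun=> s ^+ j *: M ^+ j)); last exact: mcvg_cst.
  exists j.+1 => // L /= jL.
  apply: esym; rewrite expr0 mul1r /hseries (bigD1 (Ordinal jL)) //= big1 => [|l lj].
    by rewrite addr0 hshift0 eqxx mulr1 horner_mxZ rmorphXn /= horner_mx_X.
  rewrite hshift0 (_ : (j == l) = false) ?mulr0 ?scale0r //.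
  by apply/eqP => e; case/eqP: lj; apply/val_inj; rewrite /= e.
apply: mcvg_shift.
pose G L :=
    hm (sXpoly s ^+ k * hseries k j s L.+1) +
    (- (s ^+ L.+1 * z * (hshift k.+1 j L * (Num.sqrt z)^-1 ^+ L) * (Num.sqrt z)^-1)) *:
      (hm (sXpoly s ^+ k) *m (Num.sqrt z ^+ L.+1 *: hm ('X^(L.+1) * ('X - 1) ^+ 0))).
have E L : hm (sXpoly s ^+ k.+1 * hseries k.+1 j s L.+1) = G L.
  rewrite /G; have r0 : Num.sqrt z != 0 by rewrite gt_eqF // sqrtr_gt0.
  rewrite expr0 mulr1 -scalemxAr scalerA mulmxE -rmorphM /=.
  have -> : - (s ^+ L.+1 * z * (hshift k.+1 j L * (Num.sqrt z)^-1 ^+ L) * (Num.sqrt z)^-1) *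
      Num.sqrt z ^+ L.+1 = - (s ^+ L.+1 * z * hshift k.+1 j L).
    rewrite exprVn [Num.sqrt z ^+ L.+1]exprS; set x := Num.sqrt z ^+ L.
    set y := s ^+ L.+1.
    have : x != 0 by rewrite expf_neq0.
    by move=> x0; field; rewrite x0 r0.
  rewrite -horner_mxZ -rmorphD /=; congr (hm _).
  rewrite (hseries_rec k j s L) exprSr; set P := sXpoly s ^+ k; set p := 'X^(L.+1).
  by rewrite -!mul_polyC rmorphN /=; ring.
have -> : (fun L => hm (sXpoly s ^+ k.+1 * hseries k.+1 j s L.+1)) = G.
  by apply/funext => L; exact: E.
rewrite -[s ^+ j *: _]addr0; apply: mcvgD.
  by move=> a b; apply/(cvg_shift1 (fun L => hm (sXpoly s ^+ k * hseries k j s L) a b)); exact: IH.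
have r01 : 0 <= Num.sqrt z < 1 by rewrite sqrtr_ge0 /= -[ltRHS]sqrtr1 ltr_sqrt.
have zE : (0 : 'M[R]_n.+1) = (- 0 : R) *: (hm (sXpoly s ^+ k) *m 0).
  by rewrite mulmx0 scaler0.
rewrite [X in mcvg _ X]zE.
apply: mcvgZ; last first.
  apply: mcvgM; first exact: mcvg_cst.
  move=> a b; have h := ucompan_growth r01 (leq0n n.+1); have := h a b.
  by move/(cvg_shift1 (fun L => (Num.sqrt z ^+ L *: hm ('X^L * ('X - 1) ^+ 0)) a b)).
apply: cvgN.
have hd := hcoef_decay k.+1 j.
set x := fun L => hshift k.+1 j L * (Num.sqrt z)^-1 ^+ L.
have cx : `|x L| * `|z * (Num.sqrt z)^-1| @[L --> \oo] --> (0 : R).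
  rewrite -(mul0r `|z * (Num.sqrt z)^-1|) -{1}(normr0 R); apply: cvgM; last exact: cvg_cst.
  exact: cvg_norm hd.
apply/cvgrPdist_le => /= e e0; move/cvgrPdist_le/(_ _ e0): cx; apply: filterS => L /=.
rewrite !sub0r !normrN !normrM !normr_id => h.
apply: le_trans h.
have sl : `|s ^+ L.+1| <= 1 by rewrite ger0_norm ?exprn_ge0 // exprn_ile1.
have g (a b c d f : R) : 0 <= b -> 0 <= c -> 0 <= d -> 0 <= f -> a <= 1 ->
    a * b * (c * d) * f <= c * d * (b * f).
  move=> b0 c0 d0 f0 a1; have -> : a * b * (c * d) * f = a * (c * d * (b * f)) by ring.
  by rewrite ler_piMl // !mulr_ge0.
exact: g.
Qed.

Notation K := (hlkernel z n.+1 m).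
Notation p1 := ((1 - z *: 'X : {poly R}) ^+ m).
Notation rem := (rempoly z n.+1 m).

(** Column and row of the l-th rank one term of the projection in [hlkernel_complement]; [rankn]
    puts the weight a l on this term. *)
Definition ccol l : 'cV[R]_n.+1 := \col_j hshift m j l.
Definition rrow l : 'rV[R]_n.+1 := \row_j (rem l)`_j.
Definition rankn L (a : nat -> R) : 'M[R]_n.+1 :=
  \sum_(l < L) a l *: (ccol l *m rrow l).

Lemma rrowE l : rrow l = cvec0 R n *m hm (p1 * 'X^l).
Proof.
have -> : p1 * 'X^l = rem l + quopoly z n.+1 m l * Q by rewrite /rempoly subrK.
rewrite rmorphD rmorphM /= (compan_annihilate size_XB1 monic_XB1) mulr0 addr0.
by rewrite (compan_horner size_XB1 monic_XB1 (size_rempoly zn0 l nm)).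
Qed.

Lemma row_rankn j L a : row j (rankn L a) =
  \sum_(l < L) (a l * hshift m j l) *: rrow l.
Proof.
rewrite /rankn linear_sum /=; apply: eq_bigr => l _.
by apply/rowP => i; rewrite !mxE big_ord1 !mxE; ring.
Qed.

Lemma row_rankn_exp (j : 'I_n.+1) L s : row j (rankn L (GRing.exp s)) =
  cvec0 R n *m hm (hseries m j s L * p1).
Proof.
rewrite row_rankn /hseries big_distrl /= raddf_sum mulmx_sumr; apply: eq_bigr => l _.
rewrite rrowE -scalerAl ['X^l * _]mulrC.
by rewrite -[X in _ = _ *m X]/(horner_mx M ((s ^+ l * hshift m j l) *: (p1 * 'X^l))) horner_mxZ -scalemxAr.
Qed.

Lemma delta_compan (j : 'I_n.+1) : cvec0 R n *m M ^+ j = delta_mx 0 j.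
Proof. by rewrite (compan_pow size_XB1 monic_XB1 (ltn_ord j)); congr delta_mx; apply/val_inj. Qed.

(** Duality of rows and columns: X^j (1 - z X)^(- m) times (1 - z X)^m is X^j. *)
Lemma rankn_cvg1 : mcvg (fun L => rankn L (fun=> 1)) 1%:M.
Proof.
have s1E : sXpoly 1 = 1 - z *: 'X by rewrite /sXpoly mul1r.
move=> i j.
have h : mcvg (fun L => cvec0 R n *m hm (p1 * hseries m i 1 L)) (delta_mx 0 i).
  rewrite -delta_compan -(scale1r (M ^+ i)) -{2}(expr1n R i) -s1E.
  by apply: mcvgM; [exact: mcvg_cst|apply: hseries_cvg; rewrite ler01 lexx].
have := h 0 j; rewrite !mxE eqxx /= [j == i]eq_sym.
apply: cvg_trans; apply: near_eq_cvg; near=> L.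
have <- : rankn L (GRing.exp 1) = rankn L (fun=> 1).
  by apply: eq_bigr => l _; rewrite expr1n.
by have := row_rankn_exp i L 1 => /rowP/(_ j); rewrite mxE mulrC => ->.
Unshelve. all: by end_near. Qed.

Definition dpow (s : R) : 'M[R]_n.+1 := diag_mx (\row_j s ^+ j).

(** With the weights s^l the inverse of (1 - s z X)^m at the matrix appears; right multiplication
    clears it. *)
Lemma rankn_cvg s : 0 <= s <= 1 ->
  mcvg (fun L => rankn L (GRing.exp s) *m hm ((1 - (s * z) *: 'X) ^+ m)) (dpow s *m hm p1).
Proof.
move=> s01 i j.
have h : mcvg (fun L => cvec0 R n *m hm (sXpoly s ^+ m * hseries m i s L) *m hm p1)
    (s ^+ i *: delta_mx 0 i *m hm p1).
  rewrite -delta_compan scalemxAr; apply: mcvgM; last exact: mcvg_cst.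
  by apply: mcvgM; [exact: mcvg_cst|exact: hseries_cvg].
have := h 0 j; have -> : (s ^+ i *: (delta_mx 0 i : 'rV[R]_n.+1) *m hm p1) 0 j = (dpow s *m hm p1) i j.
  by rewrite -scalemxAl mxE -rowE mul_diag_mx !mxE.
apply: cvg_trans; apply: near_eq_cvg; near=> L.
have := congr1 (mulmx^~ (hm (sXpoly s ^+ m))) (row_rankn_exp i L s).
rewrite /= -row_mul => /rowP/(_ j); rewrite mxE => ->.
rewrite -!mulmxA !mulmxE -!rmorphM /=; congr ((_ *m hm _) 0 j); ring.
Unshelve. all: by end_near. Qed.

Lemma det_conj (F : fieldType) b (f : nat -> F) (B : nat -> nat -> F) :
  (forall p, f p != 0) ->
  \det (\matrix_(i < b, j < b) (f i / f j * B i j)) = \det (\matrix_(i < b, j < b) B i j).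
Proof.
move=> f0; pose A : 'M[F]_b := 1%:M.
have E1 : \matrix_(i < b, j < b) (f i / f j * B i j) = 1%:M - 1 *:
    \matrix_(i < b, j < b) (f i / f j * ((i == j :> nat)%:R - B i j)).
  apply/matrixP => i j; rewrite !mxE mul1r.
  have [<-|ij] := eqVneq i j; first by rewrite eqxx divff //; ring.
  by rewrite (_ : (i == j :> nat) = false) ?mulr0n; [ring|exact/negbTE].
have E2 : \matrix_(i < b, j < b) B i j = 1%:M - 1 *:
    \matrix_(i < b, j < b) ((i == j :> nat)%:R - B i j).
  by apply/matrixP => i j; rewrite !mxE mul1r -val_eqE subKr.
by rewrite E1 (@det_conj_diag _ _ f (fun i j => (i == j)%:R - B i j)) // -E2.
Qed.

Definition kdet (b : nat) (g : nat -> R) : R :=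
  \det (\matrix_(i < b, j < b) ((i == j :> nat)%:R - g j * K i j)).

(** [sylvester1] moves the determinant from size n.+1 to size b, where rows times columns is the
    complement of K by [hlkernel_complement]. Taking phi j out of each column leaves the weight 1 -
    1 / phi j. *)
Lemma det_rankn b (phi : nat -> R) : (forall l, phi l != 0) ->
  \det (1%:M - rankn b (fun l => 1 - phi l)) =
  (\prod_(l < b) phi l) * kdet b (fun l => 1 - (phi l)^-1).
Proof.
move=> phi0.
pose Cm : 'M[R]_(n.+1, b) := \matrix_(j, l) hshift m j l.
pose Rm : 'M[R]_(b, n.+1) := \matrix_(l, j) (rem l)`_j.
pose D : 'rV[R]_b := \row_l (1 - phi l).
have -> : 1%:M - rankn b (fun l => 1 - phi l) = 1%:M + (- Cm) *m (diag_mx D *m Rm).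
  rewrite mulNmx; congr (_ - _); apply/matrixP => i j; rewrite summxE mxE.
  apply: eq_bigr => l _; rewrite mul_diag_mx !mxE big_ord1 !mxE; ring.
rewrite sylvester1 -det_tr mulmxN -mulmxA.
have -> : (1%:M - diag_mx D *m (Rm *m Cm))^T = \matrix_(i < b, j < b)
    ((-1) ^+ i / (-1) ^+ j * (phi j * ((i == j :> nat)%:R - (1 - (phi j)^-1) * K i j))).
  apply/matrixP => l l'; transitivity ((1%:M : 'M[R]_b) l' l - (diag_mx D *m (Rm *m Cm)) l' l); first by rewrite !mxE.
  rewrite mul_diag_mx !mxE.
  have := hlkernel_complement zn0 l l' nm.
  set S1 := \sum_(j < n.+1) _ => h.
  have -> : \sum_j Rm l' j * Cm j l = S1 by apply: eq_bigr => j _; rewrite !mxE.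
  rewrite -val_eqE /= [l' == l :> nat]eq_sym.
  have -> : S1 = (l == l' :> nat)%:R - (-1) ^+ l / (-1) ^+ l' * K l l' by rewrite -h subKr.
  have p0 := phi0 l'; have n0 k : (-1 : R) ^+ k != 0 by rewrite signr_eq0.
  case: eqP => [->|_] /=; field; rewrite ?p0 ?n0 //.
rewrite (@det_conj _ _ (fun k => (-1) ^+ k)
  (fun i j => phi j * ((i == j)%:R - (1 - (phi j)^-1) * K i j))); last first.
  by move=> k; rewrite signr_eq0.
have -> : \matrix_(i < b, j < b) (phi j * ((i == j :> nat)%:R - (1 - (phi j)^-1) * K i j)) =
    \matrix_(i < b, j < b) ((i == j :> nat)%:R - (1 - (phi j)^-1) * K i j) *m
    diag_mx (\row_(l < b) phi l).
  by apply/matrixP => i j; rewrite mul_mx_diag !mxE mulrC.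
rewrite det_mulmx det_diag mulrC; congr (_ * _).
by apply: eq_bigr => l _; rewrite mxE.
Qed.

(** [wt] is the negative binomial weight of the Meixner polynomials; [Y] is a change of basis that
    maps column l to wt l times the vector of the binomials 'C(l, k). *)
Let a := (m - n.+1)%N.
Let Pk k : {poly R} := (z *: 'X) ^+ k * (1 - z *: 'X) ^+ (n - k).
Let Y : 'M[R]_n.+1 := \matrix_(k, j) ('C(k + a, k)%:R * (Pk k)`_j).
Let wt l : R := 'C(l + a, l)%:R * z ^+ l.

Let wt_ge0 l : 0 <= wt l. Proof. by rewrite mulr_ge0 // exprn_ge0 // ltW. Qed.

Lemma hcoef_bin p i : hcoef z p.+1 i = 'C(i + p, i)%:R * z ^+ i.
Proof.
elim: p i => [|p IHp] i.
  elim: i => [|i IHi]; first by rewrite hcoef0 expr0 mulr1.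
  by rewrite hcoefS IHi hcoef_delta add0r !addn0 !binn exprS; ring.
elim: i => [|i IHi]; first by rewrite hcoef0 bin0 expr0 mulr1.
have e1 : (i.+1 + p.+1 = (i.+1 + p).+1)%N by lia.
have e2 : (i + p.+1 = i.+1 + p)%N by lia.
by rewrite hcoefS IHp IHi e1 e2 binS natrD exprS; ring.
Qed.

Lemma hpoly_mul i p L l : (l < L)%N ->
  ((1 - z *: 'X) ^+ i * hpoly z (p + i) L)`_l = hcoef z p l.
Proof.
elim: i l => [|i IH] l lL; first by rewrite expr0 mul1r addn0 coef_poly lL.
rewrite exprSr -mulrA -(IH _ lL); apply: (coef_mul_trunc _ _ lL) => {l lL} l lL.
rewrite addnS mulrBl mul1r coefB -scalerAl coefZ coefXM !coef_poly lL.
case: l lL => [|l] lL /=; first by rewrite mulr0 subr0 !hcoef0.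
by rewrite (ltnW lL) hcoefS addrK.
Qed.

Let Pk_coef k j : (k <= n)%N -> (Pk k)`_j =
  if (k <= j)%N then z ^+ k * ((1 - z *: 'X : {poly R}) ^+ (n - k))`_(j - k) else 0.
Proof.
move=> kn; rewrite /Pk exprZn -scalerAl coefZ coefXnM ltnNge; case: leqP => //=.
by rewrite mulr0.
Qed.

Let size_Pk k : (k <= n)%N -> (size (Pk k) <= n.+1)%N.
Proof.
move=> kn; apply/leq_sizeP => j jn; rewrite Pk_coef // ifT; last by lia.
have h := coef_1BzX zn0 (n - k) (j - k).
set P := _ ^+ (n - k) in h *; rewrite [P`_ _]h bin_small ?mul0r ?mulr0 //; clear -jn kn; lia.
Qed.

(** (z X)^k (1 - z X)^(n - k) (1 - z X)^(- m) equals (z X)^k (1 - z X)^(- (a + k + 1)), with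
    binomial coefficients; the normalisation 'C(k + a, k) makes them split into a factor in l alone
    and 'C(l, k). *)
Let Y_hshift (k : 'I_n.+1) l :
  \sum_(j < n.+1) Y k j * hshift m j l = wt l * 'C(l, k)%:R.
Proof.
have kn : (k <= n)%N by rewrite -ltnS.
have E : \sum_(j < n.+1) (Pk k)`_j * hshift m j l = (Pk k * hpoly z m l.+1)`_l.
  rewrite coefM.
  have h j : (j < l.+1)%N -> (Pk k)`_j * (hpoly z m l.+1)`_(l - j) = (Pk k)`_j * hshift m j l.
    by move=> jl; rewrite coef_poly ltnS leq_subr /hshift -ltnS jl.
  rewrite [RHS](eq_bigr (fun j : 'I_l.+1 => (Pk k)`_j * hshift m j l)); last first.
    by move=> j _; exact: h.
  rewrite -(big_mkord xpredT (fun j => (Pk k)`_j * hshift m j l)).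
  rewrite -(big_mkord xpredT (fun j => (Pk k)`_j * hshift m j l)).
  have z1' j : (n.+1 <= j)%N -> (Pk k)`_j = 0 by move/leq_sizeP: (size_Pk kn); apply.
  have [nl|ln] := leqP n.+1 l.+1.
    rewrite [RHS](@big_cat_nat _ _ _ n.+1) //= [X in _ = _ + X]big1_seq ?addr0 // => j.
    by rewrite mem_index_iota => /andP[_ /andP[nj _]]; rewrite z1' ?mul0r.
  rewrite [LHS](@big_cat_nat _ _ _ l.+1) //=; last exact: ltnW.
  rewrite [X in _ + X]big1_seq ?addr0 // => j.
  by rewrite mem_index_iota => /andP[_ /andP[lj _]]; rewrite /hshift leqNgt lj mulr0.
rewrite (eq_bigr (fun j : 'I_n.+1 => 'C(k + a, k)%:R * ((Pk k)`_j * hshift m j l))); last first.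
  by move=> j _; rewrite mxE mulrA.
rewrite -(mulr_sumr _ _ _ 'C(k + a, k)%:R) E /Pk.
have -> : (z *: 'X) ^+ k * (1 - z *: 'X) ^+ (n - k) * hpoly z m l.+1 =
    z ^+ k *: ('X^k * ((1 - z *: 'X) ^+ (n - k) * hpoly z m l.+1)).
  by rewrite exprZn -!scalerAl mulrA.
rewrite coefZ coefXnM.
case: ltnP => lk; first by rewrite (bin_small lk) !mulr0.
have mE : m = (a + k.+1 + (n - k))%N by rewrite /a; clear -kn nm; lia.
have -> : hpoly z m l.+1 = hpoly z (a + k.+1 + (n - k)) l.+1 by rewrite -mE.
rewrite hpoly_mul; last by clear -lk; lia.
rewrite addnS hcoef_bin /wt.
have -> : (l - k + (a + k) = l + a)%N by clear -lk; lia.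
have zE : z ^+ l = z ^+ k * z ^+ (l - k) by rewrite -exprD subnKC.
have B : ('C(k + a, k) * 'C(l + a, l - k) = 'C(l + a, l) * 'C(l, k))%N.
  apply/eqP; rewrite -(eqn_pmul2r (_ : 0 < (k`! * a`!) * ((l - k)`! * (k + a)`!))%N); last first.
    by rewrite !muln_gt0 !fact_gt0.
  have h1 : ('C(k + a, k) * (k`! * a`!) = (k + a)`!)%N.
    by have := bin_fact (leq_addr a k); rewrite addKn.
  have h2 : ('C(l + a, l - k) * ((l - k)`! * (k + a)`!) = (l + a)`!)%N.
    have := @bin_fact (l + a) (l - k); rewrite (_ : l + a - (l - k) = k + a)%N; last by clear -lk; lia.
    by apply; clear; lia.
  have h3 : ('C(l + a, l) * (l`! * a`!) = (l + a)`!)%N.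
    by have := bin_fact (leq_addr a l); rewrite addKn.
  have h4 : ('C(l, k) * (k`! * (l - k)`!) = l`!)%N by rewrite bin_fact.
  apply/eqP; rewrite mulnACA h1 h2.
  transitivity ('C(l + a, l) * (('C(l, k) * (k`! * (l - k)`!)) * a`!) * (k + a)`!)%N.
    by rewrite h4 h3 mulnC.
  by clear; lia.
have {}B : 'C(k + a, k)%:R * 'C(l + a, l - k)%:R = 'C(l + a, l)%:R * 'C(l, k)%:R :> R.
  by rewrite -!natrM B.
rewrite zE; set u := z ^+ k; set v := z ^+ (l - k).
have -> : 'C(l + a, l)%:R * (u * v) * 'C(l, k)%:R =
  ('C(l + a, l)%:R * 'C(l, k)%:R) * (u * v) :> R by ring.
by rewrite -B; ring.
Qed.

Let detY : 0 < \det Y.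
Proof.
rewrite -det_tr det_trig; last first.
  apply/is_trig_mxP => i j ij; rewrite !mxE Pk_coef; last by rewrite -ltnS.
  by rewrite leqNgt ij mulr0.
apply: prodr_gt0 => k _; rewrite !mxE Pk_coef; last by rewrite -ltnS.
rewrite leqnn subnn.
have h := coef_1BzX zn0 (n - k) 0.
set P := _ ^+ (n - k) in h *; rewrite [P`_ _]h bin0 expr0 !mulr1 mulr_gt0 ?exprn_gt0 //.
by rewrite ltr0n bin_gt0 leq_addr.
Qed.

Let Xm : 'M[R]_n.+1 := \matrix_(k, j) (cvec0 R n *m hm (p1 * ('X - 1) ^+ k)) 0 j.

(** X^l is expanded in powers of X - 1, and those beyond the n-th vanish modulo (X - 1)^(n + 1). *)
Let rrow_bin l : rrow l = \row_(k < n.+1) 'C(l, k)%:R *m Xm.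
Proof.
pose G k : 'rV[R]_n.+1 := 'C(l, k)%:R *: (cvec0 R n *m hm (p1 * ('X - 1) ^+ k)).
have Gz k : (n.+1 <= k)%N -> G k = 0.
  move=> nk; rewrite /G -(subnKC nk) exprD mulrA [_ * Q]mulrC -mulrA.
  by rewrite rmorphM /= (compan_annihilate size_XB1 monic_XB1) mul0r mulmx0 scaler0.
have E1 : rrow l = \sum_(k < l.+1) G k.
  have XE : 'X^l = \sum_(k < l.+1) ('X - 1 : {poly R}) ^+ k *+ 'C(l, k).
    have {1}-> : 'X = 1 + ('X - 1) :> {poly R} by rewrite addrC subrK.
    by rewrite exprDn; apply: eq_bigr => k _; rewrite expr1n mul1r.
  rewrite rrowE XE big_distrr /= raddf_sum mulmx_sumr; apply: eq_bigr => k _.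
  rewrite /G mulrnAr -scaler_nat.
  by rewrite -[X in _ *m X = _]/(horner_mx M ('C(l, k)%:R *: (p1 * ('X - 1) ^+ k))) horner_mxZ -scalemxAr.
have -> : \row_(k < n.+1) 'C(l, k)%:R *m Xm = \sum_(k < n.+1) G k.
  apply/rowP => j; rewrite mxE summxE; apply: eq_bigr => k _.
  by rewrite !mxE.
rewrite E1 -(big_mkord xpredT G) -(big_mkord xpredT G).
have [nl|ln] := leqP n.+1 l.+1.
  rewrite (@big_cat_nat _ _ _ n.+1) //= [X in _ + X]big1_seq ?addr0 // => j.
  by rewrite mem_index_iota => /andP[_ /andP[nj _]]; rewrite Gz.
rewrite [RHS](@big_cat_nat _ _ _ l.+1) //=; last exact: ltnW.
rewrite [X in _ = _ + X]big1_seq ?addr0 // => j.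
by rewrite mem_index_iota => /andP[_ /andP[lj _]]; rewrite /G bin_small // scale0r.
Qed.

Let Sm L (phi : nat -> R) : 'M[R]_n.+1 :=
  \sum_(l < L) (wt l * phi l) *: \matrix_(i < n.+1, j < n.+1) ('C(l, i)%:R * 'C(l, j)%:R).

Let Y_rankn L phi : Y *m rankn L phi = Sm L phi *m Xm.
Proof.
rewrite mulmx_sumr mulmx_suml; apply: eq_bigr => l _.
rewrite -scalemxAr -scalemxAl mulmxA.
have -> : Y *m ccol l = wt l *: \col_(k < n.+1) 'C(l, k)%:R.
  apply/colP => k; rewrite !mxE -Y_hshift; apply: eq_bigr => j _; rewrite !mxE //.
rewrite rrow_bin -scalemxAl scalerA mulrC mulmxA; congr (_ *: (_ *m _)).
by apply/matrixP => i j; rewrite !mxE big_ord1 !mxE.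
Qed.

Let detS L phi : (forall l, 0 <= phi l) -> 0 <= \det (Sm L phi).
Proof.
move=> ph; pose G : 'M[R]_(n.+1, L) := \matrix_(i, l) (Num.sqrt (wt l * phi l) * 'C(l, i)%:R).
have -> : Sm L phi = G *m G^T; last exact: det_gram_ge0.
apply/matrixP => i j; rewrite summxE mxE; apply: eq_bigr => l _; rewrite !mxE.
have : wt l * phi l = Num.sqrt (wt l * phi l) ^+ 2 by rewrite sqr_sqrtr // mulr_ge0.
by set s := Num.sqrt _; move=> ->; ring.
Qed.

(** The sign is inferred rather than computed: [Y] is the limit of products of [Sm], of non-negative
    determinant, and [Xm], so a non-positive determinant of [Xm] would contradict [detY]. *)
Let detX : 0 < \det Xm.
Proof.
rewrite ltNge; apply/negP => dX.
have h : mcvg (fun L => Y *m rankn L (fun=> 1)) (Y *m 1%:M).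
  by apply: mcvgM; [exact: mcvg_cst|exact: rankn_cvg1].
have := mcvg_det h; rewrite mulmx1 => h2.
have : \det Y <= 0.
  apply: (@cvgr_to_le _ _ _ _ _ _ _ h2); near=> L.
  by rewrite Y_rankn det_mulmx mulr_ge0_le0 // detS.
by rewrite leNgt detY.
Unshelve. all: by end_near. Qed.

(* The two factors of the rank-n form are, up to the positive weights [wt] and
   changes of basis, the same matrix, so the determinant is that of a
   weighted Gram matrix. *)
Lemma det_rankn_ge0 b (phi : nat -> R) : (forall l, 0 <= phi l) ->
  0 <= \det (1%:M - rankn b (fun l => 1 - phi l)).
Proof.
move=> ph; rewrite -(pmulr_rge0 _ detY) -det_mulmx.
pose ph' l := if (l < b)%N then phi l else 1.
have h : mcvg (fun L => Y *m (rankn L (fun=> 1) + - rankn b (fun l => 1 - phi l)))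
    (Y *m (1%:M - rankn b (fun l => 1 - phi l))).
  apply: mcvgM; first exact: mcvg_cst.
  by apply: mcvgD; [exact: rankn_cvg1|exact: mcvg_cst].
apply: (@cvgr_to_ge _ _ _ _ _ _ _ (mcvg_det h)); exists b => // L /= bL.
have -> : rankn L (fun=> 1) + - rankn b (fun l => 1 - phi l) = rankn L ph'.
  rewrite /rankn (big_ord_widen L (fun l => (1 - phi l) *: (ccol l *m rrow l)) bL).
  rewrite [X in _ - X]big_mkcond -sumrB; apply: eq_bigr => l _; rewrite /ph'; case: ifP => _.
    by rewrite -scalerBl subKr.
  by rewrite subr0.
rewrite Y_rankn det_mulmx mulr_ge0 ?(ltW detX) // detS // => l.
by rewrite /ph'; case: ifP.
Qed.

Lemma kdet_ge0_lt b (g : nat -> R) : (forall l, g l < 1) -> 0 <= kdet b g.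
Proof.
move=> g1; pose phi l := (1 - g l)^-1.
have p0 l : 0 < phi l by rewrite invr_gt0 subr_gt0.
have := @det_rankn_ge0 b phi (fun l => ltW (p0 l)).
rewrite det_rankn; last by move=> l; rewrite gt_eqF.
rewrite pmulr_rge0; last by apply: prodr_gt0.
rewrite (_ : (fun l => 1 - (phi l)^-1) = g) //.
by apply/funext => l; rewrite /phi invrK subKr.
Qed.

End meixner.

Definition upd (T : Type) (g : nat -> T) (l : nat) (x : T) : nat -> T :=
  fun k => if k == l then x else g k.

Section kdet_sandwich.
Variables (R : realType) (z : R) (n m : nat).
Hypothesis z01 : 0 < z < 1.
Hypothesis nm : (n < m)%N.
Notation K := (hlkernel z n.+1 m).
Notation kd := (kdet z n m).

Lemma eq_kdet b (g g' : nat -> R) : (forall l, (l < b)%N -> g l = g' l) -> kd b g = kd b g'.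
Proof.
by move=> e; congr determinant; apply/matrixP => i j; rewrite !mxE e.
Qed.

Lemma kdet_ge0 b (g : nat -> R) : (forall l, g l <= 1) -> 0 <= kd b g.
Proof.
move=> g1; pose e k : R := k.+1%:R^-1.
have e0 k : 0 < e k by rewrite invr_gt0 ltr0n.
have ce : e k @[k --> \oo] --> (0 : R) by exact: cvg_harmonic.
have : kd b (fun l => g l - e k) @[k --> \oo] --> kd b g.
  apply: cvg_det => i j; apply: cvgB; first exact: cvg_cst.
  apply: cvgM; last exact: cvg_cst.
  by rewrite -[X in _ --> X]subr0; apply: cvgB => //; exact: cvg_cst.
move=> h; apply: (@cvgr_to_ge _ _ _ _ _ _ _ h); near=> k.
apply: kdet_ge0_lt => // l; rewrite ltrBlDr (le_lt_trans (g1 l)) // ltrDl //.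
Unshelve. all: by end_near. Qed.

Lemma kdet_affine b g l x : (l < b)%N ->
  kd b (upd g l x) = (1 - x) * kd b (upd g l 0) + x * kd b (upd g l 1).
Proof.
move=> lb; rewrite /kdet -[LHS]det_tr -[X in (1 - x) * X]det_tr -[X in x * X]det_tr.
apply: (determinant_multilinear (i0 := Ordinal lb)).
- by apply/rowP => j; rewrite !mxE /upd /= eqxx; ring.
- by apply/matrixP => i j; rewrite !mxE /upd /= [bump _ _ == _]eq_sym (negbTE (neq_bump _ _)).
- by apply/matrixP => i j; rewrite !mxE /upd /= [bump _ _ == _]eq_sym (negbTE (neq_bump _ _)).
Qed.

Lemma upd_le1 (g : nat -> R) l x : (forall l, g l <= 1) -> x <= 1 -> forall k, upd g l x k <= 1.
Proof. by move=> g1 x1 k; rewrite /upd; case: eqP. Qed.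

(** An affine function that is non-negative on the whole half-line x <= 1 cannot increase. *)
Lemma kdet_slope b g l : (forall l, g l <= 1) -> (l < b)%N ->
  kd b (upd g l 1) <= kd b (upd g l 0).
Proof.
move=> g1 lb; rewrite leNgt; apply/negP => h.
set f0 := kd b (upd g l 0) in h; set f1 := kd b (upd g l 1) in h.
have f00 : 0 <= f0 by apply: kdet_ge0; apply: upd_le1.
(* At this point the affine function would equal - 1. *)
pose x := - (f0 + 1) / (f1 - f0).
have d0 : 0 < f1 - f0 by rewrite subr_gt0.
have x0 : x <= 0 by rewrite /x mulNr oppr_le0 divr_ge0 ?ltW // ltr_wpDl.
have := kdet_affine g x lb.
have : 0 <= kd b (upd g l x) by apply: kdet_ge0; apply: upd_le1 => //; apply: le_trans x0 _.
rewrite -/f0 -/f1 => + E; rewrite E.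
have -> : (1 - x) * f0 + x * f1 = f0 + x * (f1 - f0) by ring.
by rewrite /x divfK ?gt_eqF //; lra.
Qed.

Lemma kdet_mono1 b g l x y : (forall l, g l <= 1) -> (l < b)%N -> x <= y ->
  kd b (upd g l y) <= kd b (upd g l x).
Proof.
move=> g1 lb xy; rewrite (kdet_affine g x lb) (kdet_affine g y lb).
have := kdet_slope g1 lb; set f0 := kd b _; set f1 := kd b _ => h.
rewrite -subr_ge0.
have -> : (1 - x) * f1 + x * f0 - ((1 - y) * f1 + y * f0) = (y - x) * (f1 - f0) by ring.
by rewrite mulr_ge0 // subr_ge0.
Qed.

Lemma kdet_step b g l x : (forall l, g l <= 1) -> (l < b)%N -> 0 <= x ->
  (1 - x) * kd b (upd g l 0) <= kd b (upd g l x).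
Proof.
move=> g1 lb x0; rewrite (kdet_affine g x lb) lerDl mulr_ge0 //.
by apply: kdet_ge0; apply: upd_le1.
Qed.

Lemma updE (T : Type) (g : nat -> T) l : upd g l (g l) = g.
Proof. by apply/funext => k; rewrite /upd; case: eqP => [->|]. Qed.

Lemma kdet_mono b g g' : (forall l, g l <= g' l) -> (forall l, g' l <= 1) ->
  kd b g' <= kd b g.
Proof.
move=> gg g1; pose h k l := if (l < k)%N then g l else g' l.
have h1 k l : h k l <= 1 by rewrite /h; case: ifP => // _; apply: le_trans (gg l) _.
have -> : kd b g' = kd b (h 0).
  by apply: eq_kdet => l _; rewrite /h.
have -> : kd b g = kd b (h b) by apply: eq_kdet => l lb; rewrite /h lb.
have H k : (k <= b)%N -> kd b (h 0) <= kd b (h k).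
  elim: k => [|k IH] kb //; apply: le_trans (IH (ltnW kb)) _.
  have -> : h k.+1 = upd (h k) k (g k).
    by apply/funext => l; rewrite /upd /h ltnS leq_eqVlt; case: eqP => [->|].
  rewrite -{1}(updE (h k) k); apply: kdet_mono1 => //.
  by rewrite /h ltnn.
exact: H.
Qed.

Lemma kdet_trunc b g : g b = 0 -> kd b.+1 g = kd b g.
Proof.
move=> gb; rewrite /kdet (expand_det_col _ ord_max) (bigD1 ord_max) //= big1 => [|i ib].
  rewrite !mxE gb mul0r eqxx subr0 addr0 mul1r /cofactor addnn -signr_odd odd_double mul1r.
  by congr determinant; apply/matrixP => i j; rewrite !mxE /= /bump !(leqNgt b) !ltn_ord.
by rewrite !mxE gb mul0r subr0 (negbTE ib : (i == b :> nat) = false) mul0r.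
Qed.

(** Indices from b on are switched off one at a time, each at the price 1 - g l of [kdet_step]; the
    remaining weights are then raised to 1. *)
Lemma kdet_lower b L g : (forall l, 0 <= g l <= 1) -> (b <= L)%N ->
  (\prod_(b <= l < L) (1 - g l)) * kd b (fun=> 1) <= kd L g.
Proof.
move=> g01; have g0 l : 0 <= g l by case/andP: (g01 l).
have g1 l : g l <= 1 by case/andP: (g01 l).
elim: L => [|L IH] bL.
  by move: bL; rewrite leqn0 => /eqP ->; rewrite big_geq // mul1r kdet_mono.
move: bL; rewrite leq_eqVlt => /predU1P[->|bL].
  by rewrite big_geq // mul1r kdet_mono.
rewrite big_nat_recr //= mulrAC.
apply: (@le_trans _ _ ((1 - g L) * kd L.+1 (upd g L 0))); last first.
  by rewrite -[X in _ <= kd _ X](updE g L); apply: kdet_step.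
rewrite mulrC ler_wpM2l ?subr_ge0 //; apply: le_trans (IH bL) _.
rewrite kdet_trunc; last by rewrite /upd eqxx.
by rewrite (eq_kdet (g' := g)) // => l lL; rewrite /upd (ltn_eqF lL).
Qed.

(** By monotonicity, switching off the indices from b on and lowering the other weights to c can
    only increase the determinant. *)
Lemma kdet_upper b L g c : (forall l, 0 <= g l <= 1) -> (b <= L)%N ->
  (forall l, (l < b)%N -> c <= g l) -> kd L g <= kd b (fun=> c).
Proof.
move=> g01 + gc; have g0 l : 0 <= g l by case/andP: (g01 l).
have g1 l : g l <= 1 by case/andP: (g01 l).
have base : kd b g <= kd b (fun=> c).
  case: b gc => [|b] gc; first by rewrite /kdet !det_mx00.
  pose g' l := if (l < b.+1)%N then g l else 1.
  have -> : kd b.+1 g = kd b.+1 g' by apply: eq_kdet => l lb; rewrite /g' lb.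
  apply: kdet_mono => l; rewrite /g'; case: ifP => // lb; first exact: gc.
  by apply: le_trans (gc _ (ltn0Sn b)) _.
elim: L => [|L IH] bL; first by move: bL base; rewrite leqn0 => /eqP ->.
move: bL; rewrite leq_eqVlt => /predU1P[<-//|bL].
apply: le_trans (IH bL).
have -> : kd L g = kd L.+1 (upd g L 0).
  rewrite kdet_trunc; last by rewrite /upd eqxx.
  by apply: eq_kdet => l lL; rewrite /upd (ltn_eqF lL).
by rewrite -{1}(updE g L); apply: kdet_mono1.
Qed.

Lemma kdet_rev b c : kd b.+1 (fun=> c) =
  \det (1%:M - c *: \matrix_(i < b.+1, j < b.+1) K (b - i)%N (b - j)%N).
Proof.
pose s : {perm 'I_b.+1} := perm (@rev_ord_inj b.+1).
set A : 'M[R]_b.+1 := \matrix_(i, j) ((i == j :> nat)%:R - c * K i j).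
have -> : 1%:M - c *: \matrix_(i < b.+1, j < b.+1) K (b - i)%N (b - j)%N =
    row_perm s (col_perm s A).
  apply/matrixP => i j; rewrite !mxE !permE /= !subSS; congr (_%:R - _).
  by rewrite -(inj_eq (@rev_ord_inj b.+1)) -val_eqE /= !subSS.
rewrite row_permE col_permE !det_mulmx !det_perm odd_permV.
by rewrite mulrC -mulrA -expr2 sqrr_sign mulr1.
Qed.

(** The finite determinant where both sides meet: [qdet_cvg] reaches it from the Fredholm
    determinants of K, [esum_hllaw] from the expectation. *)
Definition qdet (t u : R) : R :=
  \det (horner_mx (ucompan R n) ((1 - (t * z) *: 'X) ^+ m) -
        u *: (dpow n t *m horner_mx (ucompan R n) ((1 - z *: 'X) ^+ m))).

(** [det_rankn] with phi l = 1 - u t^l; multiplication by (1 - t z M)^m turns the series of weights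
    t^l into an explicit limit, and its determinant is divided out again. *)
Lemma qdet_cvg (t u : R) : 0 < t < 1 -> u < 0 -> qdet t 0 != 0 ->
  (\prod_(l < L) (1 - u * t ^+ l)) * kd L (fun l => 1 - (1 - u * t ^+ l)^-1)
    @[L --> \oo] --> qdet t u / qdet t 0.
Proof.
move=> /andP[t0 t1] u0 q0; rewrite /qdet scale0r subr0 in q0 *.
set Pt := horner_mx _ _ in q0 *; set P1 := horner_mx _ _.
have h := @rankn_cvg _ z n m z01 nm t.
have t01 : 0 <= t <= 1 by rewrite !ltW.
have {}h := h t01; rewrite -/Pt -/P1 in h.
have h2 : mcvg (fun L => (1%:M - u *: rankn z n m L (GRing.exp t)) *m Pt)
    (Pt - u *: (dpow n t *m P1)).
  have h3 := mcvgD (@mcvg_cst _ _ _ Pt) (mcvgZ (cvg_cst (- u)) h).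
  rewrite !scaleNr in h3; apply: (mcvg_near _ (h3 _)); exists 0 => // L _ /=.
  by rewrite mulmxBl mul1mx scaleNr scalemxAl.
have -> : (fun L => (\prod_(l < L) (1 - u * t ^+ l)) * kd L (fun l => 1 - (1 - u * t ^+ l)^-1)) =
    (fun L => \det ((1%:M - u *: rankn z n m L (GRing.exp t)) *m Pt) / \det Pt).
  apply/funext => L; rewrite det_mulmx mulfK //.
  rewrite -det_rankn //; last first.
    move=> l; rewrite gt_eqF // subr_gt0 (le_lt_trans _ ltr01) //.
    by rewrite mulr_le0_ge0 ?exprn_ge0 // ltW.
  congr (\det (_ - _)); rewrite /rankn scaler_sumr; apply: eq_bigr => l _.
  by rewrite scalerA subKr.
by apply: cvgM; [exact: mcvg_det|exact: cvg_cst].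
Qed.

End kdet_sandwich.

(** * Exchange relations *)

Section exchange.
Variables (F : fieldType) (t : F).
Hypothesis t0 : t != 0.
Implicit Types (x y : F) (f g : seq int -> F) (c d : seq int) (a : int).

(* One variable y added to a function of the column lengths: the components keep,
   resp. shorten by one, the first column.  The lengths are integers so that the
   operators need no truncation. *)
Fixpoint hlAB y f c : F * F :=
  if c is a :: c' then
    let p := hlAB y (fun d => f (a :: d)) c' in
    let q := hlAB y (fun d => f (a - 1 :: d)) c' in
    (p.1 + p.2, y * ((1 - t ^ (a - head 0 c')) * q.1 + q.2))
  else (f [::], 0).

Definition hlA y f c := (hlAB y f c).1.
Definition hlB y f c := (hlAB y f c).2.
Definition hlU y f c := hlA y f c + hlB y f c.

Lemma hlA_nil y f : hlA y f [::] = f [::]. Proof. by []. Qed.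
Lemma hlB_nil y f : hlB y f [::] = 0. Proof. by []. Qed.

Lemma hlA_cons y f a c : hlA y f (a :: c) =
  hlA y (fun d => f (a :: d)) c + hlB y (fun d => f (a :: d)) c.
Proof. by []. Qed.

Lemma hlB_cons y f a c : hlB y f (a :: c) =
  y * ((1 - t ^ (a - head 0 c)) * hlA y (fun d => f (a - 1 :: d)) c +
       hlB y (fun d => f (a - 1 :: d)) c).
Proof. by []. Qed.

Lemma hlAB_lin y u v f g c :
  hlA y (fun d => u * f d + v * g d) c = u * hlA y f c + v * hlA y g c /\
  hlB y (fun d => u * f d + v * g d) c = u * hlB y f c + v * hlB y g c.
Proof.
elim: c f g => [|a c IH] f g; first by rewrite !hlA_nil !hlB_nil; split; [|ring].
have [h1 h2] := IH (fun d => f (a :: d)) (fun d => g (a :: d)).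
have [h3 h4] := IH (fun d => f (a - 1 :: d)) (fun d => g (a - 1 :: d)).
by rewrite !hlA_cons !hlB_cons h1 h2 h3 h4; split; ring.
Qed.

Lemma hlA_lin y u v f g c :
  hlA y (fun d => u * f d + v * g d) c = u * hlA y f c + v * hlA y g c.
Proof. by case: (hlAB_lin y u v f g c). Qed.

Lemma hlB_lin y u v f g c :
  hlB y (fun d => u * f d + v * g d) c = u * hlB y f c + v * hlB y g c.
Proof. by case: (hlAB_lin y u v f g c). Qed.

Lemma hlU_lin y u v f g c :
  hlU y (fun d => u * f d + v * g d) c = u * hlU y f c + v * hlU y g c.
Proof. by rewrite /hlU hlA_lin hlB_lin; ring. Qed.

Lemma hlAZ y u f c : hlA y (fun d => u * f d) c = u * hlA y f c.
Proof.
have <- : (fun d => u * f d + 0 * f d) = (fun d => u * f d) by apply/funext => d; ring.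
by rewrite hlA_lin; ring.
Qed.

Lemma hlBZ y u f c : hlB y (fun d => u * f d) c = u * hlB y f c.
Proof.
have <- : (fun d => u * f d + 0 * f d) = (fun d => u * f d) by apply/funext => d; ring.
by rewrite hlB_lin; ring.
Qed.

Lemma hlUZ y u f c : hlU y (fun d => u * f d) c = u * hlU y f c.
Proof. by rewrite /hlU hlAZ hlBZ; ring. Qed.

Lemma hlAD y f g c : hlA y (fun d => f d + g d) c = hlA y f c + hlA y g c.
Proof.
have <- : (fun d => 1 * f d + 1 * g d) = (fun d => f d + g d) by apply/funext => d; ring.
by rewrite hlA_lin; ring.
Qed.

Lemma hlBD y f g c : hlB y (fun d => f d + g d) c = hlB y f c + hlB y g c.
Proof.
have <- : (fun d => 1 * f d + 1 * g d) = (fun d => f d + g d) by apply/funext => d; ring.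
by rewrite hlB_lin; ring.
Qed.

Lemma hlU_sum y (I : Type) (r : seq I) (G : I -> seq int -> F) c :
  hlU y (fun d => \sum_(i <- r) G i d) c = \sum_(i <- r) hlU y (G i) c.
Proof.
elim: r => [|i r IH].
  have -> : (fun d => \sum_(i <- [::]) G i d) = (fun d => 0 * (0 : F)).
    by apply/funext => d; rewrite big_nil mul0r.
  by rewrite hlUZ mul0r big_nil.
rewrite big_cons -IH (_ : (fun d => _) = (fun d => 1 * G i d + 1 * \sum_(i <- r) G i d)).
  by rewrite hlU_lin !mul1r.
by apply/funext => d; rewrite big_cons !mul1r.
Qed.

(** Part A keeps the first column and part B shortens it by one, so the multiplication by t^(- head)
    passes through A unchanged and through B with a factor t. *)
Lemma hlA_head y f c :
  hlA y (fun d => t ^ (- head 0 d) * f d) c = t ^ (- head 0 c) * hlA y f c.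
Proof. by case: c => [|a c] //; rewrite !hlA_cons /= hlAZ hlBZ; ring. Qed.

Lemma hlB_head y f c :
  hlB y (fun d => t ^ (- head 0 d) * f d) c = t ^ (1 - head 0 c) * hlB y f c.
Proof.
case: c => [|a c]; first by rewrite !hlB_nil mulr0.
by rewrite !hlB_cons /= hlAZ hlBZ opprB; ring.
Qed.

Let tD a b : t ^ (a + b) = t ^ a * t ^ b. Proof. exact: expfzDr. Qed.

(** The coefficient in [hlB_cons] involves the first column of the list on which the operator of x
    acts, hence the detour through [hlA_head]. *)
Lemma hlA_hlB_cons x y f a c : hlA x (fun d => hlB y f (a :: d)) c =
  y * ((1 - t ^ (a - head 0 c)) * hlA x (hlA y (fun d => f (a - 1 :: d))) c +
       hlA x (hlB y (fun d => f (a - 1 :: d))) c).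
Proof.
set g := fun d => f (a - 1 :: d).
have -> : (fun d => hlB y f (a :: d)) = (fun d => y * (hlA y g d + hlB y g d) +
    (- y * t ^ a) * (t ^ (- head 0 d) * hlA y g d)).
  by apply/funext => d; rewrite hlB_cons -/g tD; ring.
by rewrite hlA_lin hlA_head hlAD tD; ring.
Qed.

Lemma hlB_hlB_cons x y f a c : hlB x (fun d => hlB y f (a :: d)) c =
  y * ((1 - t * t ^ (a - head 0 c)) * hlB x (hlA y (fun d => f (a - 1 :: d))) c +
       hlB x (hlB y (fun d => f (a - 1 :: d))) c).
Proof.
set g := fun d => f (a - 1 :: d).
have -> : (fun d => hlB y f (a :: d)) = (fun d => y * (hlA y g d + hlB y g d) +
    (- y * t ^ a) * (t ^ (- head 0 d) * hlA y g d)).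
  by apply/funext => d; rewrite hlB_cons -/g tD; ring.
by rewrite hlB_lin hlB_head hlBD !tD expr1z; ring.
Qed.

Lemma hl_AB_BA x y (AxBy AyBx BxAy ByAx : F) :
  (y - x) * AxBy = (y - t * x) * ByAx - (1 - t) * y * BxAy ->
  (x - y) * AyBx = (x - t * y) * BxAy - (1 - t) * x * ByAx ->
  (y - x) * (AxBy + BxAy) = (y - x) * (AyBx + ByAx).
Proof.
move=> h1 h2; have -> : (y - x) * (AyBx + ByAx) = - ((x - y) * AyBx) + (y - x) * ByAx by ring.
by rewrite mulrDr h1 h2; ring.
Qed.

(** Induction on the columns with all four relations at once. For x <> y the third one, used in both
    orders, gives the fourth through [hl_AB_BA]; x = y is treated apart because of the division by y
    - x. *)
Lemma hl_exchange c x y f : [/\ hlA x (hlA y f) c = hlA y (hlA x f) c,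
    hlB x (hlB y f) c = hlB y (hlB x f) c,
    (y - x) * hlA x (hlB y f) c =
      (y - t * x) * hlB y (hlA x f) c - (1 - t) * y * hlB x (hlA y f) c &
    hlA x (hlB y f) c + hlB x (hlA y f) c = hlA y (hlB x f) c + hlB y (hlA x f) c].
Proof.
elim: c x y f => [|a c IH] x y f.
  by rewrite !(hlA_nil, hlB_nil); split => //; ring.
have expA u g h : hlA u g (a :: c) = hlA u (fun d => g (a :: d)) c + hlB u (fun d => g (a :: d)) c.
  by [].
have [xy|xy] := eqVneq x y.
  subst y; split => //; rewrite !hlA_cons !hlB_cons hlA_hlB_cons hlB_hlB_cons.
  rewrite (_ : (fun d => hlA x f (a - 1 :: d)) =
    (fun d => hlA x (fun d' => f (a - 1 :: d')) d + hlB x (fun d' => f (a - 1 :: d')) d)) //.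
  rewrite hlAD hlBD; set T := t ^ _; set g := fun d => f (a - 1 :: d).
  by have [_ _ h _] := IH x x g; rewrite subrr mul0r; ring.
have yx0 : y - x != 0 by rewrite subr_eq0 eq_sym.
have main3 u v g : u - v != 0 -> (u - v) * hlA v (hlB u g) (a :: c) =
      (u - t * v) * hlB u (hlA v g) (a :: c) - (1 - t) * u * hlB v (hlA u g) (a :: c).
  move=> uv0; rewrite !hlA_cons !hlB_cons hlA_hlB_cons hlB_hlB_cons.
  rewrite (_ : (fun d => hlA v g (a - 1 :: d)) =
    (fun d => hlA v (fun d' => g (a - 1 :: d')) d + hlB v (fun d' => g (a - 1 :: d')) d)) //.
  rewrite (_ : (fun d => hlA u g (a - 1 :: d)) =
    (fun d => hlA u (fun d' => g (a - 1 :: d')) d + hlB u (fun d' => g (a - 1 :: d')) d)) //.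
  rewrite !hlAD !hlBD; set T := t ^ _; set k := fun d => g (a - 1 :: d).
  have [e1 e2 e3 _] := IH v u k; have [_ _ e3' e4] := IH u v k.
  move: e1 e2 e3 e3' e4.
  set AA := hlA u (hlA v k) c; set AA' := hlA v (hlA u k) c.
  set BB := hlB u (hlB v k) c; set BB' := hlB v (hlB u k) c.
  set AB := hlA u (hlB v k) c; set AB' := hlA v (hlB u k) c.
  set BA := hlB u (hlA v k) c; set BA' := hlB v (hlA u k) c.
  move=> -> -> e3 e3' e4.
  have E1 : AB = AB' + BA' - BA by rewrite -e4 addrK.
  have E2 : AB' = ((u - t * v) * BA - (1 - t) * u * BA') / (u - v).
    by rewrite -e3 mulrC mulKf.
  by rewrite E1 E2; field.
have m3 := main3 _ _ f yx0.
have xy0 : x - y != 0 by rewrite subr_eq0.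
have m3' := main3 _ _ f xy0.
have m4 : hlA x (hlB y f) (a :: c) + hlB x (hlA y f) (a :: c) =
   hlA y (hlB x f) (a :: c) + hlB y (hlA x f) (a :: c).
  exact/(mulfI yx0)/(hl_AB_BA m3 m3').
split=> //.
  rewrite !hlA_cons.
  rewrite (_ : (fun d => hlA y f (a :: d)) =
    (fun d => hlA y (fun d' => f (a :: d')) d + hlB y (fun d' => f (a :: d')) d)) //.
  rewrite (_ : (fun d => hlA x f (a :: d)) =
    (fun d => hlA x (fun d' => f (a :: d')) d + hlB x (fun d' => f (a :: d')) d)) //.
  rewrite !hlAD !hlBD; have [e1 e2 _ e4] := IH x y (fun d => f (a :: d)).
  by rewrite e1 e2 -!addrA; congr (_ + _); rewrite !addrA e4.
rewrite !hlB_cons.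
have sh u g : (fun d => hlB u g (a - 1 :: d)) = (fun d => hlB u g (a - 1 :: d)) by [].
rewrite !hlA_hlB_cons !hlB_hlB_cons.
set T := t ^ (a - head 0 c); have -> : t ^ (a - 1 - head 0 c) = T / t.
  by rewrite -addrA [-1 + _]addrC addrA tD -/T exprN1.
set k := fun d => f (a - 1 - 1 :: d).
have [e1 e2 _ e4] := IH x y k; move: e1 e2 e4.
set AA := hlA x (hlA y k) c; set BB := hlB x (hlB y k) c.
set AB := hlA x (hlB y k) c; set BA := hlB x (hlA y k) c.
move=> -> -> e4; have -> : AB = hlA y (hlB x k) c + hlB y (hlA x k) c - BA by rewrite -e4 addrK.
by field.
Qed.

Lemma hlU_comm x y f c : hlU x (hlU y f) c = hlU y (hlU x f) c.
Proof.
have [e1 e2 _ e4] := hl_exchange c x y f.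
rewrite /hlU !hlAD !hlBD e1 e2 -!addrA; congr (_ + _); by rewrite !addrA e4.
Qed.

(* Twisting by t^(- lambda'_1) turns [hl_exchange] into the commutation relation of
   a Bethe ansatz: a wanted term, and one where x and y are exchanged. *)
Definition hlAt x f c : F := t ^ (- head 0 c) * hlA x f c.
Definition hlcc y x : F := (y - t * x) / (y - x).
Definition hldd y x : F := (t - 1) * y / (y - x).

Lemma hlAt_hlU x y f c : x != y -> t * hlAt x (hlU y f) c =
  hlcc y x * hlU y (hlAt x f) c + hldd y x * hlU x (hlAt y f) c.
Proof.
move=> xy; have yx0 : y - x != 0 by rewrite subr_eq0 eq_sym.
have [e1 _ e3 _] := hl_exchange c x y f.
rewrite /hlAt /hlU !hlA_head !hlB_head hlAD tD expr1z e1.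
have -> : hlA x (hlB y f) c =
  ((y - t * x) * hlB y (hlA x f) c - (1 - t) * y * hlB x (hlA y f) c) / (y - x).
  by rewrite -e3 mulrC mulKf.
rewrite /hlcc /hldd; field.
exact: yx0.
Qed.

(** Thanks to the appended 0 the condition says at once that the list decreases weakly, is bounded
    by b and is non-negative. *)
Definition colsle (b : int) c : bool := path >=%R b (rcons c 0).

Lemma colsle_cons b a c : colsle b (a :: c) = (a <= b) && colsle a c.
Proof. by []. Qed.

Lemma colsle_mono b b' c : b <= b' -> colsle b c -> colsle b' c.
Proof.
by case: c => [|a c] bb; rewrite /colsle /= => /andP[h h2]; rewrite (le_trans h bb).
Qed.

(** [hlB] could shorten a column below its right neighbour, but then the two were equal and the
    coefficient 1 - t^0 vanishes. So only the values on genuine column lists matter. *)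
Lemma hlAB_eq y c b f g : (forall d, colsle b d -> f d = g d) ->
  (colsle b c -> hlA y f c = hlA y g c) /\ (colsle (b + 1) c -> hlB y f c = hlB y g c).
Proof.
elim: c b f g => [|a c IH] b f g fg; first by rewrite !hlA_nil !hlB_nil; split => // /fg.
rewrite !colsle_cons; split=> /andP[ab hc].
  have h d : colsle a d -> f (a :: d) = g (a :: d).
    by move=> ad; apply: fg; rewrite colsle_cons ab.
  have [h1 h2] := IH a (fun d => f (a :: d)) (fun d => g (a :: d)) h.
  rewrite !hlA_cons h1 // h2 //; apply: colsle_mono hc; rewrite lerDl //.
have h d : colsle (a - 1) d -> f (a - 1 :: d) = g (a - 1 :: d).
  by move=> ad; apply: fg; rewrite colsle_cons ad lerBlDr ab.
have [h1 h2] := IH (a - 1) (fun d => f (a - 1 :: d)) (fun d => g (a - 1 :: d)) h.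
rewrite !hlB_cons h2 ?subrK //; congr (_ * (_ + _)).
have [hc1|hc1] := boolP (colsle (a - 1) c); first by rewrite h1.
suff -> : head 0 c = a by rewrite subrr expr0z subrr !mul0r.
move: hc hc1; case: (c) => [|a' c']; rewrite /colsle /= => /andP[h3 h4].
  by rewrite andbT => h5; lia.
by rewrite h4 andbT => h5; lia.
Qed.

Lemma hlU_eq y c b f g : (forall d, colsle b d -> f d = g d) ->
  colsle b c -> hlU y f c = hlU y g c.
Proof.
move=> fg bc; have [h1 h2] := hlAB_eq y c fg.
by rewrite /hlU h1 // h2 //; apply: colsle_mono bc; rewrite lerDl.
Qed.

(** The vacuum of the Bethe ansatz, the indicator of the empty partition; [hlPsi] creates one
    variable at a time from it. *)
Definition hlvac c : F := (all (pred1 0) c)%:R.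
Definition hlPsi (ys : seq F) : seq int -> F := foldr hlU hlvac ys.

Lemma hlvac_cons a c : hlvac (a :: c) = (a == 0)%:R * hlvac c.
Proof. by rewrite /hlvac /=; case: eqP => //=; rewrite ?mul1r ?mul0r. Qed.

Lemma hlAt_vac x b c : colsle b c -> hlAt x hlvac c = hlvac c.
Proof.
have h0 v c' : hlA v (fun=> 0) c' = 0 /\ hlB v (fun=> 0) c' = 0.
  have -> : (fun=> 0) = (fun d : seq int => 0 * hlvac d) by apply/funext => d; rewrite mul0r.
  by rewrite hlAZ hlBZ !mul0r.
have H : colsle b c -> hlA x hlvac c = hlvac c /\ (b = 0 -> hlB x hlvac c = 0).
  elim: c b => [|a c IH] b //; rewrite colsle_cons => /andP[ab hc].
  have a0 : 0 <= a by elim: (c) a hc {ab} => [|a' c' IH'] a; rewrite /colsle /= ?andbT // => /andP[+ /IH']; lia.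
  rewrite hlA_cons hlB_cons; have [az|anz] := eqVneq a 0.
    subst a; have -> : (fun d => hlvac (0 :: d)) = hlvac.
      by apply/funext => d; rewrite hlvac_cons mul1r.
    have [-> hB] := IH 0 hc; rewrite hB // addr0 hlvac_cons mul1r; split=> // _.
    have -> : (fun d => hlvac (0 - 1 :: d)) = (fun=> 0) by apply/funext => d; rewrite hlvac_cons mul0r.
    by have [-> ->] := h0 x c; rewrite mulr0 addr0 mulr0.
  have -> : (fun d => hlvac (a :: d)) = (fun=> 0).
    by apply/funext => d; rewrite hlvac_cons (negbTE anz) mul0r.
  have [-> ->] := h0 x c; rewrite hlvac_cons (negbTE anz) mul0r addr0; split=> // b0.
  by move: anz; rewrite eq_le a0 -b0 ab.
move=> bc; rewrite /hlAt (H bc).1; case: c {H bc} => [|a c]; first by rewrite oppr0 expr0z mul1r.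
by rewrite hlvac_cons /=; case: eqP => [->|_]; rewrite ?mul0r ?mulr0 // oppr0 expr0z mul1r.
Qed.

Lemma hlPsi_nil ys : hlPsi ys [::] = 1.
Proof. by elim: ys => //= y ys IH; rewrite /hlU hlA_nil hlB_nil addr0. Qed.

(** Moving [hlAt] through the variables one by one by [hlAt_hlU] down to the vacuum, where it acts
    trivially: one term keeps all variables, the others have some v replaced by x. *)
Lemma hl_bethe ys x b c : uniq (x :: ys) -> colsle b c ->
  t ^+ size ys * hlAt x (hlPsi ys) c = (\prod_(y <- ys) hlcc y x) * hlPsi ys c +
    \sum_(v <- ys) (hldd v x * \prod_(w <- rem v ys) hlcc w v) * hlU x (hlPsi (rem v ys)) c.
Proof.
elim: ys x b c => [|y ys IH] x b c.
  by move=> _ bc; rewrite !big_nil expr0 !mul1r addr0; exact: hlAt_vac bc.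
rewrite /= inE negb_or => /andP[/andP[xy xys] /andP[yys uys]] bc.
have IHx d : colsle b d -> t ^+ size ys * hlAt x (hlPsi ys) d = (\prod_(y <- ys) hlcc y x) * hlPsi ys d +
    \sum_(v <- ys) (hldd v x * \prod_(w <- rem v ys) hlcc w v) * hlU x (hlPsi (rem v ys)) d.
  by move=> bd; apply: IH bd; rewrite /= xys.
have IHy d : colsle b d -> t ^+ size ys * hlAt y (hlPsi ys) d = (\prod_(w <- ys) hlcc w y) * hlPsi ys d +
    \sum_(v <- ys) (hldd v y * \prod_(w <- rem v ys) hlcc w v) * hlU y (hlPsi (rem v ys)) d.
  by move=> bd; apply: IH bd; rewrite /= yys.
have Ex := hlU_eq y IHx bc; have Ey := hlU_eq x IHy bc.
rewrite hlUZ in Ex; rewrite hlUZ in Ey.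
rewrite exprSr -mulrA (hlAt_hlU _ _ xy) mulrDr mulrCA [X in _ + X]mulrCA Ex Ey.
have dist u G (coef : F -> F) (p : F) : hlU u (fun d => p * hlPsi ys d + \sum_(v <- ys) coef v * G v d) c =
    p * hlU u (hlPsi ys) c + \sum_(v <- ys) coef v * hlU u (G v) c.
  have -> : (fun d => p * hlPsi ys d + \sum_(v <- ys) coef v * G v d) =
    (fun d => p * hlPsi ys d + 1 * (\sum_(v <- ys) coef v * G v d)) by apply/funext => d; rewrite mul1r.
  rewrite hlU_lin mul1r hlU_sum; congr (_ + _); apply: eq_bigr => v _; exact: hlUZ.
rewrite !dist big_cons [in RHS]big_cons /= eqxx.
rewrite (eq_big_seq (fun v => hldd v x * (hlcc y v * \prod_(w <- rem v ys) hlcc w v) *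
    hlU x (hlU y (hlPsi (rem v ys))) c) (r := ys) (F1 := fun v => _ * _ * hlU x (hlPsi (if y == v then _ else _)) _)); last first.
  move=> v vys; have yv : (y == v) = false by apply: contraNF yys => /eqP ->.
  by rewrite yv big_cons.
set P0 := hlU y (hlPsi ys) c; set P1 := hlU x (hlPsi ys) c.
set S1 := \sum_(v <- ys) _; set S2 := \sum_(v <- ys) _; set S3 := \sum_(v <- ys) _.
(* The term in which v is lost arises directly or through y; the two coefficients add up to the
   product form by a rational identity in x, y, v. *)
suff <- : hlcc y x * S1 + hldd y x * S2 = S3 by ring.
rewrite !mulr_sumr -big_split /=; apply: eq_big_seq => v vys.
have yv : y - v != 0 by rewrite subr_eq0; apply: contraNneq yys => ->.
have xv : v - x != 0 by rewrite subr_eq0; apply: contraNneq xys => <-.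
have yx : y - x != 0 by rewrite subr_eq0 eq_sym.
have vy : v - y != 0 by rewrite -opprB oppr_eq0.
rewrite (hlU_comm y x) /hlcc /hldd; set P := \prod_(_ <- _) _; set V := hlU x _ _.
by field; rewrite ?yv ?xv ?yx ?vy.
Qed.

Lemma hlAB_0 f c : hlA 0 f c = f c /\ hlB 0 f c = 0.
Proof.
elim: c f => [|a c IH] f //.
by rewrite hlA_cons hlB_cons mul0r; have [-> ->] := IH (fun d => f (a :: d)); rewrite addr0.
Qed.

(** At x = 0 the operator [hlAt] is the multiplication by t^(- lambda'_1), so the Bethe relation
    becomes a linear equation between values of [hlPsi]. *)
Lemma hl_bethe0 ys b c : uniq ys -> 0 \notin ys -> colsle b c ->
  (1 - t ^ ((size ys)%:Z - head 0 c)) * hlPsi ys c =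
  (1 - t) * \sum_(v <- ys) (\prod_(w <- rem v ys) hlcc w v) * hlPsi (rem v ys) c.
Proof.
move=> uys z0 bc; have := @hl_bethe ys 0 b c; rewrite /= z0 => /(_ uys bc).
rewrite /hlAt (hlAB_0 _ c).1 big_seq big1 => [|y yys]; last first.
  by rewrite /hlcc mulr0 !subr0 divff //; apply: contraNneq z0 => <-.
rewrite mul1r mulrA => E; rewrite mulrBl mul1r tD -exprnP E opprD addNKr.
rewrite mulr_sumr -sumrN; apply: eq_big_seq => v vys.
have v0 : v != 0 by apply: contraNneq z0 => <-.
rewrite /hlU (hlAB_0 _ c).1 (hlAB_0 _ c).2 addr0 /hldd subr0 mulfK //; ring.
Qed.

(** [hl_bethe0] on the empty list, where all values of [hlPsi] are 1. *)
Lemma sum_prod_hlcc ys : uniq ys -> 0 \notin ys ->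
  (1 - t) * \sum_(v <- ys) \prod_(w <- rem v ys) hlcc w v = 1 - t ^+ size ys.
Proof.
move=> uys z0; have := @hl_bethe0 ys 0 [::] uys z0 isT.
rewrite hlPsi_nil mulr1 subr0 -exprnP => ->; congr (_ * _).
by apply: eq_bigr => v _; rewrite hlPsi_nil mulr1.
Qed.

End exchange.

(** * Sums over subsets *)

(** Gaussian binomial coefficients. *)
Fixpoint qbin (F : fieldType) (t : F) (n k : nat) : F :=
  match n, k with
  | _, 0 => 1
  | 0, _.+1 => 0
  | n'.+1, k'.+1 => t ^+ k * qbin t n' k + qbin t n' k'
  end.

Section qbinomial.
Variables (F : fieldType) (t : F).
Hypothesis t0 : t != 0.
Hypothesis qt : forall k, t ^+ k.+1 != 1.

Lemma qbin0 n : qbin t n 0 = 1. Proof. by case: n. Qed.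

Lemma qbinS n k : qbin t n.+1 k.+1 = t ^+ k.+1 * qbin t n k.+1 + qbin t n k.
Proof. by []. Qed.

Lemma qbin_small n k : (n < k)%N -> qbin t n k = 0.
Proof. by elim: n k => [|n IH] [|k] //= nk; rewrite !IH ?mulr0 ?addr0 // ltnW. Qed.

Lemma qbin_rec n k : (1 - t ^+ k.+1) * qbin t n k.+1 = (1 - t ^ (n%:Z - k%:Z)) * qbin t n k.
Proof.
elim: n k => [|n IH] k.
  case: k => [|k]; first by rewrite !subr0 expr0z subrr mulr0 mul0r.
  by rewrite /= !mulr0.
rewrite qbinS; have [kn|nk] := leqP k n.
  case: k kn => [|k] kn.
    have := IH 0; rewrite !qbin0 !subr0 -!exprnP => h.
    by rewrite mulrDr mulrCA h !mulr1 [t ^+ n.+1]exprS expr1; ring.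
  have e1 := IH k.+1; have e2 := IH k.
  rewrite mulrDr mulrCA e1 qbinS.
  have E : t ^ (n%:Z - k%:Z) = t * t ^ (n%:Z - k.+1%:Z).
    by rewrite -{2}(expr1z t) -expfzDr //; congr (_ ^ _); lia.
  have E2 : t ^ (n.+1%:Z - k.+1%:Z) = t ^ (n%:Z - k%:Z) by congr (_ ^ _); lia.
  rewrite E2.
  have E3 : t ^+ k.+1 * t ^ (n%:Z - k%:Z) = t ^+ k.+2 * t ^ (n%:Z - k.+1%:Z).
    by rewrite E [t ^+ k.+2]exprS; ring.
  set X := qbin t n k.+1 in e1 e2 *; set Y := qbin t n k in e1 e2 *.
  have -> : t ^+ k.+2 * ((1 - t ^ (n%:Z - k.+1%:Z)) * X) + (1 - t ^+ k.+2) * X =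
     (1 - t ^+ k.+2 * t ^ (n%:Z - k.+1%:Z)) * X by ring.
  rewrite -E3; have -> : (1 - t ^ (n%:Z - k%:Z)) * (t ^+ k.+1 * X + Y) =
     (1 - t ^ (n%:Z - k%:Z)) * t ^+ k.+1 * X + (1 - t ^ (n%:Z - k%:Z)) * Y by ring.
  by rewrite -e2; ring.
rewrite (qbin_small (ltnW nk : (n < k.+1)%N)) mulr0 add0r.
move: nk; rewrite leq_eqVlt => /predU1P[<-|nk]; last first.
  by rewrite (qbin_small (ltnW nk)) (qbin_small nk) !mulr0.
by rewrite subrr expr0z subrr mul0r qbin_small // mulr0.
Qed.

Lemma qbinomial u N n : (N <= n)%N ->
  \sum_(k < n.+1) (- u) ^+ k * t ^+ 'C(k, 2) * qbin t N k = \prod_(i < N) (1 - u * t ^+ i).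
Proof.
elim: N u n => [|N IH] u n Nn.
  rewrite big_ord0 big_ord_recl /= big1 => [|i _]; last by rewrite mulr0.
  by rewrite !mulr1 addr0.
case: n Nn => [|n] // Nn.
rewrite [RHS]big_ord_recl expr0 mulr1.
have -> : \prod_(i < N) (1 - u * t ^+ bump 0 i) = \prod_(i < N) (1 - (u * t) * t ^+ i).
  by apply: eq_bigr => i _; rewrite /bump /= add1n exprS mulrA.
rewrite big_ord_recl qbin0 expr0 /= !mulr1.
have -> : \sum_(i < n.+1) (- u) ^+ bump 0 i * t ^+ 'C(bump 0 i, 2) *
     (t ^+ (bump 0 i) * qbin t N (bump 0 i) + qbin t N i) =
   \sum_(i < n.+1) (- (u * t)) ^+ i.+1 * t ^+ 'C(i.+1, 2) * qbin t N i.+1 +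
   (- u) * \sum_(i < n.+1) (- (u * t)) ^+ i * t ^+ 'C(i, 2) * qbin t N i.
  rewrite mulr_sumr -big_split /=; apply: eq_bigr => i _; rewrite /bump /= add1n.
  rewrite binS bin1 exprD -mulNr !exprMn ![_ ^+ i.+1]exprS; ring.
have := IH (u * t) n.+1 (leqW Nn); rewrite big_ord_recl qbin0 expr0 /= !mulr1.
have -> : \sum_(i < n.+1) (- (u * t)) ^+ bump 0 i * t ^+ 'C(bump 0 i, 2) * qbin t N (bump 0 i) =
  \sum_(i < n.+1) (- (u * t)) ^+ i.+1 * t ^+ 'C(i.+1, 2) * qbin t N i.+1.
  by apply: eq_bigr => i _; rewrite /bump /= add1n.
by rewrite (IH _ n Nn) => h; rewrite addrA h; ring.
Qed.

(** A sequence with the successive ratios of the Gaussian binomials is a multiple of them, so the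
    q-binomial theorem sums it. *)
Lemma qbinomial_rec (s : nat -> F) u N n : (N <= n)%N ->
  (forall k, (k < n)%N -> (1 - t ^+ k.+1) * s k.+1 = (1 - t ^ (N%:Z - k%:Z)) * s k) ->
  \sum_(k < n.+1) (- u) ^+ k * t ^+ 'C(k, 2) * s k = \prod_(i < N) (1 - u * t ^+ i) * s 0.
Proof.
move=> Nn hs; have sE k : (k <= n)%N -> s k = qbin t N k * s 0.
  elim: k => [|k IH] kn; first by rewrite qbin0 mul1r.
  have q0 : 1 - t ^+ k.+1 != 0 by rewrite subr_eq0 eq_sym.
  by apply: (mulfI q0); rewrite hs // IH ?(ltnW kn) // !mulrA qbin_rec.
rewrite -(qbinomial u Nn) big_distrl /=; apply: eq_bigr => k _.
by rewrite sE ?mulrA // -ltnS.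
Qed.

End qbinomial.

Section subset_formula.
Variables (F : fieldType) (t : F).
Hypothesis t0 : t != 0.
Hypothesis qt : forall k, t ^+ k.+1 != 1.
Variables (n : nat) (y : 'I_n -> F).
Hypothesis y_inj : injective y.
Hypothesis y0 : forall i, y i != 0.

Notation cc := (hlcc t).

Lemma hlcc_inv a b : a != 0 -> b != 0 -> a != b -> cc a^-1 b^-1 = cc b a.
Proof.
move=> a0 b0 ab; rewrite /hlcc.
have d : a^-1 - b^-1 != 0 by rewrite subr_eq0 (inj_eq invr_inj).
have d2 : b - a != 0 by rewrite subr_eq0 eq_sym.
by apply: (mulIf d); rewrite divfK //; field; rewrite d2 a0 b0.
Qed.

Definition ysub (A : {set 'I_n}) : seq F := [seq y i | i <- enum A].
Definition PsiS A := hlPsi t (ysub A).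
Definition crossS (A : {set 'I_n}) : F := \prod_(i in A) \prod_(j in ~: A) cc (y j) (y i).

Lemma ysub_uniq A : uniq (ysub A).
Proof. by rewrite map_inj_uniq // enum_uniq. Qed.

Lemma ysub_rem (f : 'I_n -> F) (A : {set 'I_n}) i : injective f ->
  rem (f i) [seq f i | i <- enum A] = [seq f i | i <- enum (A :\ i)].
Proof.
move=> fi; rewrite rem_filter ?map_inj_uniq ?enum_uniq // filter_map; congr map.
rewrite /enum_mem -filter_predI; apply: eq_filter => j /=.
by rewrite (inj_eq fi) !inE.
Qed.

Lemma ysub0 A : 0 \notin ysub A.
Proof. by apply/mapP => -[i _ /esym/eqP]; apply/negP. Qed.

Lemma bethe_set (A : {set 'I_n}) b c : colsle b c ->
  (1 - t ^ (#|A|%:Z - head 0 c)) * PsiS A c =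
  (1 - t) * \sum_(i in A) (\prod_(j in A :\ i) cc (y j) (y i)) * PsiS (A :\ i) c.
Proof.
move=> bc; have := hl_bethe0 t0 (ysub_uniq A) (ysub0 A) bc.
rewrite size_map -cardE => ->; congr (_ * _); rewrite big_map big_enum /=.
apply: eq_bigr => i _; rewrite ysub_rem // /PsiS /ysub; congr (_ * _).
by rewrite big_map big_enum.
Qed.

(** [sum_prod_hlcc] at the inverse variables, since inversion exchanges the two arguments of
    [hlcc]. *)
Lemma cross_sum (A : {set 'I_n}) :
  (1 - t) * \sum_(i in A) \prod_(j in A :\ i) cc (y i) (y j) = 1 - t ^+ #|A|.
Proof.
have yi : injective (fun i => (y i)^-1) by move=> i j /invr_inj/y_inj.
have u : uniq [seq (y i)^-1 | i <- enum A] by rewrite map_inj_uniq // enum_uniq.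
have z : 0 \notin [seq (y i)^-1 | i <- enum A].
  by apply/mapP => -[i _ /esym/eqP]; rewrite invr_eq0; apply/negP.
have := sum_prod_hlcc t0 u z; rewrite size_map -cardE => <-; congr (_ * _).
rewrite big_map big_enum /=; apply: eq_bigr => i _.
rewrite (ysub_rem (f := fun i => (y i)^-1)) // big_map big_enum /=.
apply: eq_bigr => j; rewrite !inE => /andP[ji _]; rewrite hlcc_inv //.
by rewrite (inj_eq y_inj).
Qed.

Lemma crossS_add (A : {set 'I_n}) i : i \notin A ->
  crossS A * \prod_(j in ~: A :\ i) cc (y j) (y i) =
  crossS (i |: A) * \prod_(j in A) cc (y i) (y j).
Proof.
move=> iA; have E : ~: (i |: A) = ~: A :\ i by apply/setP => j; rewrite !inE negb_or.
rewrite /crossS big_setU1 //= E mulrC -!mulrA; congr (_ * _).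
rewrite -big_split /=; apply: eq_bigr => a _.
by rewrite (big_setD1 i) ?inE //= mulrC.
Qed.

Definition PsiSum (k : nat) c : F := \sum_(A : {set 'I_n} | #|A| == k) crossS A * PsiS (~: A) c.

(** Both sides become one sum over pairs of a set and an element: on the right [bethe_set] adds an
    element to a set of size k, on the left [cross_sum] marks one in a set of size k + 1. *)
Lemma PsiSum_rec k b c : colsle b c -> (k < n)%N ->
  (1 - t ^+ k.+1) * PsiSum k.+1 c = (1 - t ^ ((n - k)%N%:Z - head 0 c)) * PsiSum k c.
Proof.
move=> bc kn; rewrite /PsiSum !mulr_sumr.
have -> : \sum_(A : {set 'I_n} | #|A| == k) (1 - t ^ ((n - k)%N%:Z - head 0 c)) * (crossS A * PsiS (~: A) c) =
   \sum_(A : {set 'I_n} | #|A| == k) \sum_(i in ~: A)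
      (1 - t) * (crossS (i |: A) * (\prod_(j in A) cc (y i) (y j)) * PsiS (~: (i |: A)) c).
  apply: eq_bigr => A /eqP cA; rewrite mulrCA.
  have -> : (n - k)%N = #|~: A| by rewrite [#|~: A|]cardsCs finset.setCK card_ord cA.
  rewrite (bethe_set _ bc) mulrCA -mulr_sumr; congr (_ * _); rewrite mulr_sumr.
  apply: eq_bigr => i; rewrite inE => iA; rewrite mulrA crossS_add //.
  by congr (_ * PsiS _ _); apply/setP => j; rewrite !inE negb_or.
have -> : \sum_(A : {set 'I_n} | #|A| == k.+1) (1 - t ^+ k.+1) * (crossS A * PsiS (~: A) c) =
   \sum_(A : {set 'I_n} | #|A| == k.+1) \sum_(i in A)
      (1 - t) * (crossS A * (\prod_(j in A :\ i) cc (y i) (y j)) * PsiS (~: A) c).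
  apply: eq_bigr => A /eqP cA; rewrite -cA -cross_sum -mulr_sumr -mulrA; congr (_ * _).
  rewrite mulr_suml; apply: eq_bigr => i _; ring.
rewrite !pair_big_dep /=.
rewrite (reindex_onto (fun p : {set 'I_n} * 'I_n => (p.2 |: p.1, p.2))
   (fun p : {set 'I_n} * 'I_n => (p.1 :\ p.2, p.2))) /=; last first.
  by move=> [A i] /= /andP[_ iA]; rewrite finset.setD1K.
apply: eq_big => [[A i]|[A i]] /=.
  rewrite xpair_eqE eqxx andbT setU11 andbT finset.in_setC.
  have [iA|iA] := boolP (i \in A); last by rewrite cardsU1 iA add1n eqSS setU1K // eqxx andbT.
  rewrite andbF; apply/negbTE/nandP; right; apply: contraL iA => /eqP <-.
  by rewrite !inE eqxx.
by move=> /andP[/andP[_ _] /eqP [E]]; rewrite E.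
Qed.

(** [PsiSum] satisfies the recursion of [qbinomial_rec] with N = n - h, where h is the length
    lambda'_1. *)
Lemma PsiS_subset u b c (h : nat) : colsle b c -> head 0 c = h%:Z -> (h <= n)%N ->
  \prod_(i < n - h) (1 - u * t ^+ i) * PsiS [set: 'I_n] c =
  \sum_(A : {set 'I_n}) (- u) ^+ #|A| * t ^+ 'C(#|A|, 2) * crossS A * PsiS (~: A) c.
Proof.
move=> bc hc hn.
have -> : PsiS [set: 'I_n] c = PsiSum 0 c.
  rewrite /PsiSum (big_pred1 finset.set0) => [|A]; last by rewrite cards_eq0.
  by rewrite finset.setC0 /crossS big_set0 mul1r.
rewrite -(@qbinomial_rec _ t t0 qt (PsiSum^~ c) u (n - h) n (leq_subr _ _)); last first.
  move=> k kn; rewrite (PsiSum_rec bc kn) hc; congr ((1 - t ^ _) * _); lia.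
rewrite (partition_big (fun A : {set 'I_n} => inord #|A| : 'I_n.+1) xpredT) //=.
apply: eq_bigr => k _; rewrite /PsiSum mulr_sumr; apply: eq_big => [A|A /eqP ->]; last by ring.
have cA : (#|A| < n.+1)%N by rewrite ltnS -[X in (_ <= X)%N](card_ord n) max_card.
by rewrite -(inj_eq val_inj) /= inordK.
Qed.

Notation Vd := (Vandermonde n (\row_i y i)).

Lemma det_Vandermonde_neq0 : \det Vd != 0.
Proof.
rewrite det_Vandermonde; apply/prodf_neq0 => i _; apply/prodf_neq0 => j ij.
by rewrite !mxE subr_eq0 (inj_eq y_inj) eq_sym -(inj_eq val_inj) neq_ltn ij.
Qed.

Lemma prod_ordered_pairs (A : {set 'I_n}) :
  \prod_(i < n) \prod_(j < n | (i < j)%N && ((i \in A) && (j \in A))) t = t ^+ 'C(#|A|, 2).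
Proof.
rewrite (eq_bigr (fun i : 'I_n => t ^+ \sum_(j < n | (i < j)%N) ((i \in A) && (j \in A)))); last first.
  by move=> i _; rewrite big_mkcondr expr_sum; apply: eq_bigr => j _; case: andP.
rewrite -expr_sum; congr (_ ^+ _).
set X := (\sum_(i < n) _)%N.
have XE : X = (\sum_(i < n) \sum_(j < n | (j < i)%N) ((i \in A) && (j \in A)))%N.
  by rewrite /X (exchange_big_dep xpredT) //=; apply: eq_bigr => j _; apply: eq_bigr => i _; rewrite andbC.
have cA : #|A| = (\sum_(i < n) (i \in A))%N.
  by rewrite -sum1_card big_mkcond; apply: eq_bigr => i _; case: (i \in A).
have tot : (X + X + #|A| = #|A| * #|A|)%N.
  rewrite {2}XE {2}cA {1}/X -!big_split /= [in X in (_ * X)%N]cA big_distrr /=.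
  rewrite [X in (_ + X)%N = _]cA -big_split /=; apply: eq_bigr => i _.
  have [iA|iA] := boolP (i \in A); last by rewrite muln0 !big1.
  rewrite /= muln1 [RHS](bigID (fun j : 'I_n => (i < j)%N)) /= -addnA; congr (_ + _)%N.
  rewrite [RHS](bigD1 i) ?ltnn //= iA addnC; congr (_ + _)%N.
  by apply: eq_bigl => j; rewrite -leqNgt ltn_neqAle andbC.
rewrite bin2; have -> : (#|A| * #|A|.-1 = X.*2)%N.
  by move: tot; case: (#|A|) => [|q] /=; rewrite -addnn; nia.
by rewrite doubleK.
Qed.

(** Pairs inside A contribute t, pairs outside contribute 1, and a mixed pair contributes its factor
    of [crossS] whichever index is the larger. *)
Lemma det_Vandermonde_scaled (A : {set 'I_n}) :
  \det (Vandermonde n (\row_i (if i \in A then t * y i else y i))) =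
  t ^+ 'C(#|A|, 2) * crossS A * \det Vd.
Proof.
rewrite !det_Vandermonde.
pose r i j : F := if i \in A then if j \in A then 1 else cc (y j) (y i)
  else if j \in A then cc (y i) (y j) else 1.
rewrite (eq_bigr (fun i : 'I_n =>
   (\prod_(j < n | (i < j)%N && ((i \in A) && (j \in A))) t) *
   (\prod_(j < n | (i < j)%N) r i j) *
   \prod_(j < n | (i < j)%N) ((\row_i y i) 0 j - (\row_i y i) 0 i))); last first.
  move=> i _; rewrite big_mkcondr -!big_split /=; apply: eq_bigr => j ij.
  rewrite !mxE /r /hlcc; have d : y j - y i != 0.
    by rewrite subr_eq0 (inj_eq y_inj) eq_sym -(inj_eq val_inj) neq_ltn ij.
  have d' : y i - y j != 0 by rewrite -opprB oppr_eq0.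
  by case: (i \in A); case: (j \in A) => /=; field; rewrite ?d ?d'.
rewrite !big_split /= prod_ordered_pairs; congr (_ * _ * _).
rewrite (eq_bigr (fun i : 'I_n =>
  (\prod_(j < n | (i < j)%N) (if (i \in A) && (j \notin A) then cc (y j) (y i) else 1)) *
  (\prod_(j < n | (i < j)%N) (if (i \notin A) && (j \in A) then cc (y i) (y j) else 1)))); last first.
  move=> i _; rewrite -big_split /=; apply: eq_bigr => j _; rewrite /r.
  by case: (i \in A); case: (j \in A); rewrite /= ?mulr1 ?mul1r.
rewrite big_split /= [X in _ * X](exchange_big_dep xpredT) //= -big_split /= /crossS.
rewrite [RHS]big_mkcond /=; apply: eq_bigr => i _.
have [iA|iA] := boolP (i \in A); last by rewrite !big1 ?mulr1 // => j _; rewrite /= andbF.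
rewrite [RHS]big_mkcond [RHS](bigID (fun j : 'I_n => (i < j)%N)) /=; congr (_ * _).
  by apply: eq_bigr => j _; rewrite inE.
rewrite [RHS](bigD1 i) ?ltnn //= inE iA mul1r; apply: eq_big => [j|j _].
  by rewrite -leqNgt andbC -ltn_neqAle.
by rewrite inE andbT.
Qed.

(** Expanding by rows, the choice of the second term for the rows in A produces the Vandermonde
    matrix with y i replaced by t y i there. *)
Lemma det_subset (u : F) (f : 'I_n -> F) :
  \det (\matrix_(i < n, j < n) (y i ^+ j - u * (f i * (t * y i) ^+ j))) =
  (\sum_(A : {set 'I_n}) (- u) ^+ #|A| * t ^+ 'C(#|A|, 2) * crossS A * \prod_(i in A) f i) *
  \det Vd.
Proof.
have -> : \matrix_(i < n, j < n) (y i ^+ j - u * (f i * (t * y i) ^+ j)) =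
   \matrix_(i < n, j < n) y i ^+ j + \matrix_(i < n, j < n) (- u * (f i * (t * y i) ^+ j)).
  by apply/matrixP => i j; rewrite !mxE mulNr.
rewrite det_pick_rows big_distrl /=; apply: eq_bigr => A _.
set W := Vandermonde n (\row_i (if i \in A then t * y i else y i)).
have -> : \matrix_(i, j) (if i \in A then (\matrix_(i < n, j < n) (- u * (f i * (t * y i) ^+ j))) i j
     else (\matrix_(i < n, j < n) y i ^+ j) i j) =
   diag_mx (\row_i (if i \in A then - u * f i else 1)) *m W^T.
  apply/matrixP => i j; rewrite mul_diag_mx !mxE; case: (i \in A); last by rewrite mul1r.
  by rewrite mulrA.
rewrite det_mulmx det_diag det_tr det_Vandermonde_scaled.
have -> : \prod_(i < n) (\row_i (if i \in A then - u * f i else 1)) 0 i =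
   (- u) ^+ #|A| * \prod_(i in A) f i.
  rewrite -prodr_const -big_split /= [RHS]big_mkcond; apply: eq_bigr => i _.
  by rewrite mxE.
ring.
Qed.

End subset_formula.

(** * Partitions by columns *)

(** Membership of a box in the diagram, read by columns on the left and by rows on the right. *)
Lemma ltn_count_sorted (s : seq nat) i j : sorted geq s ->
  (i < count (fun p => j < p)%N s)%N = (j < nth 0%N s i)%N.
Proof.
elim: s i => [|a s IH] i; first by rewrite nth_nil.
move=> sa; have ss := path_sorted sa.
have [ja|aj] := ltnP j a; first by case: i => [|i]; rewrite /= ja ?add1n ?ltnS ?IH.
have gt : transitive geq by move=> x y z /= h1 h2; apply: leq_trans h2 h1.
have h0 : all (fun p => p <= j)%N (a :: s).
  rewrite /= aj; apply/allP => p ps; have /allP/(_ _ ps) := order_path_min gt sa.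
  by move=> /= pa; apply: leq_trans aj.
rewrite (eq_in_count (a2 := pred0)) ?count_pred0; last first.
  by move=> p /(allP h0); rewrite leqNgt => /negbTE.
rewrite ltn0; apply/esym/negbTE; rewrite -leqNgt.
by have [lt|ge] := ltnP i (size (a :: s)); [apply: (allP h0); exact: mem_nth|rewrite nth_default].
Qed.

Section partitions.
Implicit Types la mu nu : int_partition.

(** Columns are counted from 0, so lambda'_1 is [lcol la 0]. *)
Definition lcol la j : nat := conj_part la j.+1.

Lemma part_sorted la : sorted geq la. Proof. by case/andP: (partsP la). Qed.

Lemma ltn_lcol la i j : (i < lcol la j)%N = (j < nth 0%N la i)%N.
Proof. exact: ltn_count_sorted (part_sorted la). Qed.

Lemma nth_part_neq0 la i : (0 < nth 0%N la i)%N = (i < size la)%N.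
Proof.
case: (ltnP i (size la)) => hi; last by rewrite nth_default.
have /andP[_ h0] := partsP la; rewrite lt0n.
by apply: contra h0 => /eqP <-; apply: mem_nth.
Qed.

Lemma eq_ltn_nat (a b : nat) : (forall j, (j < a)%N = (j < b)%N) -> a = b.
Proof.
move=> h; apply/eqP; rewrite eqn_leq; apply/andP; split; rewrite leqNgt.
  by rewrite h ltnn.
by rewrite -h ltnn.
Qed.

Lemma lcol_inj la mu : lcol la =1 lcol mu -> la = mu.
Proof.
move=> h; have hn i : nth 0%N la i = nth 0%N mu i.
  by apply: eq_ltn_nat => j; rewrite -!ltn_lcol h.
apply/val_inj/(@eq_from_nth _ 0%N) => //=.
by apply: eq_ltn_nat => j; rewrite -!nth_part_neq0 hn.
Qed.

Lemma leq_ltnP (a b : nat) : (forall j, (j < a)%N -> (j < b)%N) -> (a <= b)%N.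
Proof. by move=> h; rewrite leqNgt; apply/negP => /h; rewrite ltnn. Qed.

Lemma interlaceP la mu : interlace la mu <->
  (forall j, (lcol mu j <= lcol la j <= (lcol mu j).+1)%N).
Proof.
split=> h.
  move=> j; apply/andP; split; apply: leq_ltnP => i.
    by rewrite !ltn_lcol => hi; apply: leq_trans hi _; have [] := h i.
  case: i => // i; rewrite ltn_lcol ltnS ltn_lcol => hi.
  by apply: leq_trans hi _; have [] := h i.
move=> i; split; apply: leq_ltnP => j; rewrite -!ltn_lcol.
  by move=> hi; apply: leq_trans hi _; have /andP[] := h j.
by move=> hi; rewrite -ltnS; apply: leq_trans hi _; have /andP[] := h j.
Qed.

Lemma lcol_mono la j : (lcol la j.+1 <= lcol la j)%N.
Proof. by apply: leq_ltnP => i; rewrite !ltn_lcol; apply: ltn_trans. Qed.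

Lemma lcol_eq0 la j : (head 0%N la <= j)%N -> lcol la j = 0%N.
Proof. by rewrite -nth0 leqNgt -ltn_lcol -eqn0Ngt => /eqP. Qed.

Lemma lcol_head la j : lcol la j = 0%N -> (head 0%N la <= j)%N.
Proof. by move=> h; rewrite -nth0 leqNgt -ltn_lcol h. Qed.

Lemma mult_part_lcol la j : mult_part j.+1 la = (lcol la j - lcol la j.+1)%N.
Proof.
rewrite /mult_part /lcol /conj_part; elim: (parts la) => //= p s ->.
have : (count (fun p0 => j.+2 <= p0) s <= count (fun p0 => j.+1 <= p0) s)%N.
  by apply: sub_count => x /=; apply: ltnW.
by case: (ltngtP p j.+1); lia.
Qed.

Lemma psize_lcol la L : (head 0%N la <= L)%N -> psize la = (\sum_(0 <= j < L) lcol la j)%N.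
Proof.
move=> hL; rewrite /psize sumnE.
have -> : (\sum_(p <- la) p = \sum_(p <- la) \sum_(0 <= j < L) (j < p))%N.
  apply: eq_big_seq => p pla.
  have pL : (p <= L)%N.
    have := part_sorted la; move: pla hL; case: (parts la) => //= a s.
    rewrite inE => /predU1P[->//|ps] aL pa; apply: leq_trans aL.
    have gt : transitive geq by move=> x y z /= h1 h2; apply: leq_trans h2 h1.
    by have /allP/(_ _ ps) := order_path_min gt pa.
  rewrite (@big_cat_nat _ _ _ p) //= [X in (_ + X)%N]big1_seq ?addn0; last first.
    by move=> j; rewrite mem_index_iota => /andP[_ /andP[pj _]]; rewrite ltnNge pj.
  rewrite (eq_big_nat _ _ (F2 := fun=> 1%N)) => [|j /andP[_ ->]//].
  by rewrite sum_nat_const_nat subn0 muln1.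
rewrite exchange_big /=; apply: eq_bigr => j _.
rewrite /lcol /conj_part -sum1_count [in RHS]big_mkcond; apply: eq_bigr => p _.
by case: ltnP.
Qed.

Definition pcols (L : nat) la : seq nat := mkseq (lcol la) L.

Lemma size_pcols L la : size (pcols L la) = L. Proof. exact: size_mkseq. Qed.

Lemma pcols_sorted L la : sorted geq (pcols L la).
Proof.
apply/(sortedP 0%N) => i; rewrite size_pcols => iL.
by rewrite /= !nth_mkseq ?lcol_mono // ltnW.
Qed.

(* The conjugate of a sorted list; filtering the zeros makes it total. *)
Definition part_of_list (c : seq nat) : seq nat :=
  [seq p <- [seq count (fun a => i < a)%N c | i <- iota 0 (head 0%N c)] | (0 < p)%N].

Lemma part_of_listP (c : seq nat) :
  sorted geq (part_of_list c) && (0 \notin part_of_list c)%N.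
Proof.
apply/andP; split; last by rewrite mem_filter.
apply: sorted_filter; first by move=> x y z /= h1 h2; apply: leq_trans h2 h1.
rewrite (map_comp (fun i => count (fun a => i < a)%N c) id) map_id.
apply/(sortedP 0%N) => i; rewrite size_map size_iota => iL.
rewrite /= !(nth_map 0%N) ?size_iota ?(ltnW iL) // !nth_iota ?(ltnW iL) // !add0n.
by apply: sub_count => x /=; apply: ltnW.
Qed.

Definition part_of (c : seq nat) : int_partition := Partition (part_of_listP c).

Lemma lcol_part_of (c : seq nat) j : sorted geq c -> lcol (part_of c) j = nth 0%N c j.
Proof.
move=> sc; rewrite /lcol /conj_part /= count_filter.
rewrite (eq_count (a2 := fun p => j < p)%N); last first.
  by move=> p /=; lia.
rewrite count_map (eq_count (a2 := fun i => i < nth 0%N c j)%N); last first.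
  by move=> i /=; rewrite ltn_count_sorted.
have hj : (nth 0%N c j <= head 0%N c)%N.
  apply: leq_ltnP => i; rewrite -nth0 -!ltn_count_sorted //; exact: leq_ltn_trans.
rewrite -(subnKC hj) iotaD count_cat add0n.
rewrite (eq_in_count (a2 := predT)); last by move=> i; rewrite mem_iota add0n.
rewrite count_predT size_iota (eq_in_count (a2 := pred0)) ?count_pred0 ?addn0 //.
by move=> i; rewrite mem_iota => /andP[h _]; rewrite ltnNge h.
Qed.

Lemma pcols_part_of (c : seq nat) : sorted geq c -> pcols (size c) (part_of c) = c.
Proof.
move=> sc; apply: (@eq_from_nth _ 0%N); rewrite size_mkseq // => i ic.
by rewrite nth_mkseq // lcol_part_of.
Qed.

Lemma head_part_of (c : seq nat) : sorted geq c -> (head 0%N (part_of c) <= size c)%N.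
Proof. by move=> sc; apply: lcol_head; rewrite lcol_part_of // nth_default. Qed.

Lemma part_of_pcols L la : (head 0%N la <= L)%N -> part_of (pcols L la) = la.
Proof.
move=> hL; apply: lcol_inj => j; rewrite lcol_part_of ?pcols_sorted //.
have [jL|Lj] := ltnP j L; first by rewrite nth_mkseq.
by rewrite nth_default ?size_pcols // lcol_eq0 // (leq_trans hL).
Qed.

End partitions.

(** * Branching weights column by column *)

Section weights.
Variables (R : realType) (t : R).
Implicit Types (la mu : int_partition) (c d : seq nat) (y : R).

(* One column of the pair [c], [d]: the column lengths are [a], [b], and the
   next ones [h], [h']. *)
Definition wQloc y (a b h h' : nat) : R :=
  if b == a then 1 else if b.+1 == a then y * (if h == h' then 1 - t ^+ (a - h) else 1) else 0.

Definition wPloc (a b h h' : nat) : R :=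
  if b == a then if h == h' then 1 else 1 - t ^+ (b - h') else if b.+1 == a then 1 else 0.

Fixpoint wlist (loc : nat -> nat -> nat -> nat -> R) c d : R :=
  match c, d with
  | a :: c', b :: d' => loc a b (head 0%N c') (head 0%N d') * wlist loc c' d'
  | _, _ => 1
  end.

Lemma wlist_map loc (f g : nat -> nat) s L : f (s + L)%N = 0%N -> g (s + L)%N = 0%N ->
  wlist loc (map f (iota s L)) (map g (iota s L)) =
  \prod_(s <= j < s + L) loc (f j) (g j) (f j.+1) (g j.+1).
Proof.
elim: L s => [|L IH] s fs gs; first by rewrite addn0 big_geq.
rewrite big_ltn ?addnS ?ltnS ?leq_addr //= IH ?addSnnS //.
have hd (k : nat -> nat) : k (s + L.+1)%N = 0%N -> head 0%N (map k (iota s.+1 L)) = k s.+1.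
  by case: (L) => //=; rewrite addn1 => ->.
by rewrite !hd // addnS.
Qed.

Lemma wlist_pcols loc L la mu : (head 0%N la <= L)%N -> (head 0%N mu <= L)%N ->
  wlist loc (pcols L la) (pcols L mu) =
  \prod_(0 <= j < L) loc (lcol la j) (lcol mu j) (lcol la j.+1) (lcol mu j.+1).
Proof. by move=> h1 h2; rewrite /pcols /mkseq wlist_map ?add0n // lcol_eq0. Qed.

(** One proof for P and Q: the product over part sizes becomes a product over columns. Without
    interlacing some column difference is neither 0 nor 1, and its local factor is 0. *)
Lemma skew_wlist (loc : nat -> nat -> nat -> nat -> R) (w : nat -> R) (P : nat -> bool) L la mu y :
  (head 0%N la <= L)%N -> (head 0%N mu <= L)%N ->
  (forall a b h h', b != a -> b.+1 != a -> loc a b h h' = 0) ->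
  (interlace la mu -> forall j, loc (lcol la j) (lcol mu j) (lcol la j.+1) (lcol mu j.+1) =
     (if P j.+1 then w j.+1 else 1) * y ^+ (lcol la j - lcol mu j)) ->
  (interlace la mu -> forall j, P j.+1 -> (j < head 0%N la)%N) ->
  (if `[< interlace la mu >] then \prod_(1 <= j < (head 0%N la).+1 | P j) w j else 0) *
    y ^+ (psize la - psize mu) = wlist loc (pcols L la) (pcols L mu).
Proof.
move=> hl hm loc0 locE hP; rewrite wlist_pcols //; case: asboolP => [il|nil]; last first.
  rewrite mul0r; apply/esym/eqP; rewrite -[_ == _]negbK; apply/negP => nz; apply: nil.
  apply/interlaceP => j; have [jL|Lj] := ltnP j L; last first.
    by rewrite !lcol_eq0 // (leq_trans _ Lj).
  have : loc (lcol la j) (lcol mu j) (lcol la j.+1) (lcol mu j.+1) != 0.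
    apply: contraNneq nz => z0; rewrite prodf_seq_eq0.
    by apply/hasP; exists j; rewrite ?mem_index_iota //= z0 eqxx.
  apply: contraNT => h; apply/eqP/loc0; apply: contra h => /eqP.
    by move=> ->; rewrite leqnn leqW.
  by move=> <-; rewrite leqnSn leqnn.
rewrite (eq_bigr _ (fun j _ => locE il j)) big_split /=; congr (_ * _).
  rewrite big_add1 /= big_mkcond /= [RHS](@big_cat_nat _ _ _ (head 0%N la)) //=.
  rewrite [X in _ = _ * X]big1_seq ?mulr1 // => j; rewrite mem_index_iota => /andP[_ /andP[hj _]].
  by case: ifP => // /(hP il); rewrite ltnNge hj.
rewrite (psize_lcol hl) (psize_lcol hm) -sumnB; last first.
  by move=> j _; have /andP[] := (interlaceP _ _).1 il j.
by rewrite expr_sum.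
Qed.

Lemma lcol_diff la mu j : interlace la mu ->
  lcol la j = lcol mu j \/ lcol la j = (lcol mu j).+1.
Proof.
move=> /interlaceP/(_ j) /andP[h1 h2].
by case: (ltngtP (lcol mu j) (lcol la j)) h1 => // h _; [right; lia|left].
Qed.

Lemma skewQ1_wlist L la mu y : (head 0%N la <= L)%N -> (head 0%N mu <= L)%N ->
  skewQ1 t la mu y = wlist (wQloc y) (pcols L la) (pcols L mu).
Proof.
move=> hl hm; rewrite /skewQ1 /phi.
apply: (skew_wlist (P := indexI la mu) (w := fun i => 1 - t ^+ mult_part i la)) => //.
- by move=> a b h h' /negbTE n1 /negbTE n2; rewrite /wQloc n1 n2.
- move=> il j; rewrite mult_part_lcol /indexI /wQloc -!/(lcol _ _).
  case: (lcol_diff j il) => ->; first by rewrite eqxx subnn ltnn andbF mulr1.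
  rewrite ltnSn andbT (_ : (_ == _.+1) = false); last by apply/eqP; lia.
  rewrite eqxx subSnn expr1 mulrC; congr (_ * _); by case: eqP => // ->.
- move=> il j /andP[_]; rewrite -!/(lcol _ _) => h.
  by have := leq_ltn_trans (leq0n _) h; rewrite ltn_lcol nth0.
Qed.

Lemma psi_wlist L la mu : (head 0%N la <= L)%N -> (head 0%N mu <= L)%N ->
  psi t la mu = wlist wPloc (pcols L la) (pcols L mu).
Proof.
move=> hl hm; rewrite -[LHS]mulr1 -(expr1n _ (psize la - psize mu)) /psi.
apply: (skew_wlist (P := indexJ la mu) (w := fun i => 1 - t ^+ mult_part i mu)) => //.
- by move=> a b h h' /negbTE n1 /negbTE n2; rewrite /wPloc n1 n2.
- move=> il j; rewrite expr1n mulr1 mult_part_lcol /indexJ /wPloc -!/(lcol _ _).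
  case: (lcol_diff j il) => ->; last first.
    rewrite (_ : (_ == _.+1) = false) ?eqxx; last by apply/eqP; lia.
    by rewrite (_ : (_.+1 == _) = false) ?andbF //; apply/eqP; lia.
  rewrite !eqxx andbT; case: (lcol_diff j.+1 il) => ->; first by rewrite eqxx ltnn.
  by rewrite (_ : (_.+1 == _) = false) ?ltnSn //; apply/eqP; lia.
- move=> il j /andP[h _]; apply: leq_trans (_ : j.+1 < _)%N => //.
  move: h; rewrite -!/(lcol _ _) => h.
  by have := leq_ltn_trans (leq0n _) h; rewrite ltn_lcol nth0.
Qed.

Lemma psi_not_interlace la mu : ~ interlace la mu -> psi t la mu = 0.
Proof. by rewrite /psi; case: asboolP. Qed.

Lemma skewQ1_not_interlace la mu y : ~ interlace la mu -> skewQ1 t la mu y = 0.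
Proof. by rewrite /skewQ1 /phi; case: asboolP => // _ _; rewrite mul0r. Qed.

Hypothesis t01 : 0 < t < 1.

Lemma expr_t_le1 k : 0 <= 1 - t ^+ k.
Proof. by case/andP: t01 => t0 t1; rewrite subr_ge0 exprn_ile1 // ltW. Qed.

Lemma psi_ge0 la mu : 0 <= psi t la mu.
Proof. by rewrite /psi; case: asboolP => // _; apply: prodr_ge0 => j _; exact: expr_t_le1. Qed.

Lemma skewQ1_ge0 la mu y : 0 <= y -> 0 <= skewQ1 t la mu y.
Proof.
move=> y0; rewrite /skewQ1 mulr_ge0 ?exprn_ge0 // /phi; case: asboolP => // _.
by apply: prodr_ge0 => j _; exact: expr_t_le1.
Qed.

End weights.

Local Open Scope ereal_scope.

Section esum_theory.
Variable R : realType.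

Lemma esum_swap (T1 T2 : choiceType) (a : T1 -> T2 -> \bar R) :
  (forall i j, 0 <= a i j) ->
  \esum_(i in [set: T1]) \esum_(j in [set: T2]) a i j =
  \esum_(j in [set: T2]) \esum_(i in [set: T1]) a i j.
Proof.
move=> a0; rewrite !esum_esum //.
rewrite (@reindex_esum R (T1 * T2)%type (T2 * T1)%type [set: T1 * T2] _ (fun p => (p.2, p.1))).
  by have -> : [set: T1] `*`` (fun=> [set: T2]) = [set: T1 * T2] by apply/seteqP.
by split; [move=> p _|move=> [a1 b1] [a2 b2] _ _ [-> ->]|move=> [b1 a1] _; exists (a1, b1)].
Qed.

Lemma esumZ (T : choiceType) (c : R) (f : T -> \bar R) : (0 <= c)%R -> (forall i, 0 <= f i) ->
  \esum_(i in [set: T]) (c%:E * f i) = c%:E * \esum_(i in [set: T]) f i.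
Proof.
move=> c0 f0; have [->|cn0] := eqVneq c 0%R.
  by rewrite mul0e esum1 // => i _; rewrite mul0e.
have H (b : R) (g : T -> \bar R) : (0 < b)%R -> (forall i, 0 <= g i) ->
    \esum_(i in [set: T]) (b%:E * g i) <= b%:E * \esum_(i in [set: T]) g i.
  move=> b0 g0; apply: ge_ereal_sup => _ /= [X [fX _] <-].
  rewrite -ge0_mule_fsumr // lee_pmul2l ?fin_numE ?lte_fin // ereal_sup_ubound //.
  by exists X.
have cp : (0 < c)%R by rewrite lt0r cn0.
apply/eqP; rewrite eq_le H //=.
have h := H c^-1%R (fun i => c%:E * f i).
rewrite -(@lee_pmul2l _ (c^-1)%:E) ?lte_fin ?invr_gt0 // muleA -EFinM mulVf // mul1e.
apply: le_trans (h _ _); rewrite ?invr_gt0 //; last by move=> i; rewrite mule_ge0 ?lee_fin.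
by apply: le_esum => i _; rewrite muleA -EFinM mulVf // mul1e.
Qed.

Lemma esum_uniq_seq (T : choiceType) (r : seq T) (f : T -> \bar R) : uniq r ->
  (forall x, 0 <= f x) -> (forall x, x \notin r -> f x = 0) ->
  \esum_(x in [set: T]) f x = \sum_(x <- r) f x.
Proof.
move=> ur f0 fr; rewrite fsbig_seq // -esum_fset; [|exact: finite_seq|by []].
rewrite [RHS]esum_mkcond; apply: eq_esum => x _.
case: ifPn => // h; apply: fr; apply: contra h => xr; exact/mem_set.
Qed.

(** Every finite set of indices eventually lies in [r p], so the truncated sums S p determine the
    total. *)
Lemma esum_le_limit (T : choiceType) (f : T -> \bar R) (r : nat -> T -> bool) (S : nat -> R) (l : R) :
  (forall x, 0 <= f x) -> (forall x, exists p0, forall p, (p0 <= p)%N -> r p x) ->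
  (forall p, \esum_(x in [set: T]) (if r p x then f x else 0) = (S p)%:E) ->
  (S p @[p --> \oo] --> l)%R -> \esum_(x in [set: T]) f x = l%:E.
Proof.
move=> f0 hr hS cS; apply/eqP; rewrite eq_le; apply/andP; split; last first.
  have cE : (S p)%:E @[p --> \oo] --> l%:E by apply: cvg_EFin => //; exact: nearW.
  have := @cvgr_to_le.
  have le p : (S p)%:E <= \esum_(x in [set: T]) f x.
    by rewrite -hS; apply: le_esum => x _; case: ifP.
  move=> _; move: le; case: (\esum_(x in [set: T]) f x) => [s||] le.
  - rewrite lee_fin; apply: (@cvgr_to_le _ _ _ _ _ _ _ cS); apply: nearW => p.
    by have := le p; rewrite lee_fin.
  - by rewrite leey.
  - by have := le 0%N.
apply: ge_ereal_sup => _ /= [X [fX _] <-].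
have [p0 hp0] : exists p0, forall p, (p0 <= p)%N -> forall x, X x -> r p x.
  have /finite_seqP[s Xs] := fX.
  have [p0 h] : exists p0, forall p, (p0 <= p)%N -> forall x, x \in s -> r p x.
    elim: (s) => [|x s' [p1 h1]]; first by exists 0%N.
    have [p2 h2] := hr x; exists (maxn p1 p2) => p; rewrite geq_max => /andP[h3 h4] z.
    by rewrite inE => /predU1P[->|]; [exact: h2|exact: h1].
  by exists p0 => p pp x; rewrite Xs; exact: h.
rewrite -esum_fset //.
have le p : (p0 <= p)%N -> \esum_(x in X) f x <= (S p)%:E.
  move=> pp; rewrite -hS esum_mkcond; apply: le_esum => x _.
  case: ifPn => h; first by rewrite hp0 // -in_setE.
  by case: ifP.
have E0 : 0 <= \esum_(x in X) f x by apply: esum_ge0.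
move: le E0; case: (\esum_(x in X) f x) => [s||] le E0 //.
- rewrite lee_fin; apply: (@cvgr_to_ge _ _ _ _ _ _ _ cS); by exists p0.
- by have := le p0 (leqnn _).
Qed.

End esum_theory.
Local Close Scope ereal_scope.

Definition dstep (a b : nat) : bool := (b == a) || (b.+1 == a).

(** With [ups], the lists that differ by at most one in each place. They need not be decreasing:
    [wQ_unsorted] and [wP_unsorted] show that the weights discard the others. *)
Fixpoint downs (c : seq nat) : seq (seq nat) :=
  if c is a :: c' then
    [seq a :: d | d <- downs c'] ++ (if a is a'.+1 then [seq a' :: d | d <- downs c'] else [::])
  else [:: [::]].

Fixpoint ups (c : seq nat) : seq (seq nat) :=
  if c is a :: c' then [seq a :: d | d <- ups c'] ++ [seq a.+1 :: d | d <- ups c'] else [:: [::]].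

Lemma mem_map_cons (T : eqType) (a b : T) (s : seq T) (r : seq (seq T)) :
  ((b :: s) \in [seq a :: d | d <- r]) = (b == a) && (s \in r).
Proof.
apply/mapP/andP => [[d dr [-> ->]]|[/eqP -> sr]]; first by rewrite eqxx.
by exists s.
Qed.

Lemma nil_map_cons (T : eqType) (a : T) (r : seq (seq T)) : ([::] \in [seq a :: d | d <- r]) = false.
Proof. by apply/mapP => -[]. Qed.

Lemma mem_downs c d : (d \in downs c) = all2 dstep c d.
Proof.
elim: c d => [|a c IH] [|b d] //=; rewrite mem_cat.
  by rewrite nil_map_cons; case: (a) => //= a'; rewrite nil_map_cons.
rewrite mem_map_cons -IH /dstep; case: a => [|a] /=; first by rewrite in_nil !orbF.
by rewrite mem_map_cons eqSS -andb_orl.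
Qed.

Lemma mem_ups c d : (d \in ups c) = all2 dstep d c.
Proof.
elim: c d => [|a c IH] [|b d] //=; rewrite mem_cat ?nil_map_cons // !mem_map_cons -IH /dstep.
by rewrite -andb_orl [b == a]eq_sym [b == a.+1]eq_sym.
Qed.

Lemma uniq_map_cons (T : eqType) (a : T) (r : seq (seq T)) : uniq r -> uniq [seq a :: d | d <- r].
Proof. by move=> ur; rewrite map_inj_uniq // => d d' []. Qed.

Lemma has_map_cons (T : eqType) (a b : T) (r r' : seq (seq T)) : a != b ->
  ~~ has (mem [seq a :: d | d <- r]) [seq b :: d | d <- r'].
Proof.
move=> ab; apply/hasPn => x /mapP[d _ ->] /=; rewrite mem_map_cons negb_and.
by rewrite eq_sym ab.
Qed.

Lemma uniq_downs c : uniq (downs c).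
Proof.
elim: c => //= a c IH; rewrite cat_uniq uniq_map_cons //; case: a => [|a] //=.
by rewrite uniq_map_cons // andbT has_map_cons //; lia.
Qed.

Lemma uniq_ups c : uniq (ups c).
Proof.
elim: c => //= a c IH; rewrite cat_uniq !uniq_map_cons // andbT has_map_cons //; lia.
Qed.

Lemma all2_dstep_size c d : all2 dstep c d -> size d = size c.
Proof. by elim: c d => [|a c IH] [|b d] //= /andP[_ /IH ->]. Qed.

Lemma sorted_geq_cons a c : sorted geq (a :: c) = (head 0%N c <= a)%N && sorted geq c.
Proof. by case: c => [|b c] //=. Qed.

Lemma all2_dstep_head c d : all2 dstep c d ->
  head 0%N d = head 0%N c \/ (head 0%N d).+1 = head 0%N c.
Proof. by case: c d => [|a c] [|b d] //=; [left|move=> /andP[/orP[]/eqP] ->; [left|right]]. Qed.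

Section links.
Variables (R : realType) (t : R).
Implicit Types (la mu : int_partition) (c d : seq nat) (y : R).

(** Order is lost only if the first of two equal columns shrinks and the second does not; its weight
    then contains 1 - t^0. *)
Lemma wQ_unsorted y c d : sorted geq c -> all2 dstep c d -> ~~ sorted geq d ->
  wlist (wQloc t y) c d = 0.
Proof.
elim: c d => [|a c IH] [|b d] //; rewrite [all2 _ _ _]/= !sorted_geq_cons.
move=> /andP[ha sc] /andP[/orP hb cd]; rewrite negb_and -ltnNge => /orP[hd|nd]; last first.
  by rewrite /= IH ?mulr0.
have hh := all2_dstep_head cd.
rewrite /= /wQloc; case: hb => /eqP hb; first by exfalso; lia.
have -> : (b == a) = false by apply/eqP; lia.
have -> : head 0%N c = head 0%N d by lia.
by rewrite hb !eqxx (_ : a = head 0%N d) ?subnn ?expr0 ?subrr ?mulr0 ?mul0r //; lia.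
Qed.

Lemma wP_unsorted c d : sorted geq d -> all2 dstep c d -> ~~ sorted geq c ->
  wlist (wPloc t) c d = 0.
Proof.
elim: c d => [|a c IH] [|b d] //; rewrite [all2 _ _ _]/= !sorted_geq_cons.
move=> /andP[ha sc] /andP[/orP hb cd]; rewrite negb_and -ltnNge => /orP[hd|nd]; last first.
  by rewrite /= IH ?mulr0.
have hh := all2_dstep_head cd.
rewrite /= /wPloc; case: hb => /eqP hb; last by exfalso; lia.
have -> : (head 0%N c == head 0%N d) = false by apply/eqP; lia.
by rewrite hb eqxx (_ : a = head 0%N d) ?subnn ?expr0 ?subrr ?mul0r //; lia.
Qed.

Notation posz := (map Posz).

Lemma head_posz c : head 0 (posz c) = (head 0%N c)%:Z. Proof. by case: c. Qed.

(** The operators of the exchange relations are the branching sums, split by whether the first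
    column shrinks. *)
Lemma hlAB_downs y c (f : seq int -> R) : sorted geq c ->
  hlA t y f (posz c) = \sum_(d <- downs c | head 0%N d == head 0%N c) wlist (wQloc t y) c d * f (posz d) /\
  hlB t y f (posz c) = \sum_(d <- downs c | head 0%N d != head 0%N c) wlist (wQloc t y) c d * f (posz d).
Proof.
elim: c f => [|a c IH] f.
  by move=> _; rewrite hlA_nil hlB_nil !big_cons !big_nil eqxx /= mul1r addr0.
rewrite sorted_geq_cons => /andP[ha sc].
have ID (G : seq nat -> R) : \sum_(d <- downs c | head 0%N d == head 0%N c) G d +
    \sum_(d <- downs c | head 0%N d != head 0%N c) G d = \sum_(d <- downs c) G d.
  by rewrite [RHS](bigID (fun d => head 0%N d == head 0%N c)).
have hd d : d \in downs c -> head 0%N d = head 0%N c \/ (head 0%N d).+1 = head 0%N c.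
  by rewrite mem_downs => /all2_dstep_head.
split.
  rewrite [posz _]/= hlA_cons; have [-> ->] := IH (fun d : seq int => f (a%:Z :: d)) sc.
  rewrite ID /= big_cat /= [X in _ + X]big1_seq ?addr0; last first.
    case: (a) => [|a'] x; first by rewrite in_nil andbF.
    by move=> /andP[/eqP h /mapP[d _ E]]; move: h; rewrite E /=; lia.
  rewrite big_map; apply: eq_big => [d|d _] /=; first by rewrite eqxx.
  by rewrite /wQloc eqxx mul1r.
rewrite [posz _]/= hlB_cons; have [-> ->] := IH (fun d : seq int => f (a%:Z - 1 :: d)) sc.
rewrite head_posz /= big_cat /= [X in _ = X + _]big1_seq ?add0r; last first.
  by move=> x /andP[h /mapP[d _ E]]; move: h; rewrite E /= eqxx.
case: a ha => [|a] ha.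
  have h0 : head 0%N c = 0%N by lia.
  have -> : t ^ (0%Z - (head 0%N c)%:Z) = 1 by rewrite h0.
  rewrite big_nil subrr mul0r add0r big1_seq ?mulr0 // => d /andP[dc ds].
  by have := hd d ds; move/eqP: dc; lia.
have TE : t ^ (a.+1%:Z - (head 0%N c)%:Z) = t ^+ (a.+1 - head 0%N c) by rewrite subzn.
have aE : a.+1%:Z - 1 = a%:Z by lia.
rewrite TE aE big_map.
rewrite [RHS](bigID (fun d => head 0%N d == head 0%N c)) /= mulrDr; congr (_ + _).
  rewrite mulrA mulr_sumr; apply: eq_big => [d|d /eqP h].
    by rewrite (ltn_eqF (ltnSn a)).
  rewrite /wQloc eqxx (_ : (a == a.+1) = false) ?h ?eqxx ?mulrA //; apply/eqP; lia.
rewrite mulr_sumr; apply: eq_big => [d|d h].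
  by rewrite (ltn_eqF (ltnSn a)).
rewrite /wQloc eqxx (_ : (a == a.+1) = false); last by apply/eqP; lia.
by rewrite eq_sym (negbTE h) mulr1 mulrA.
Qed.

Lemma hlU_downs y c (f : seq int -> R) : sorted geq c ->
  hlU t y f (posz c) = \sum_(d <- downs c) wlist (wQloc t y) c d * f (posz d).
Proof.
by move=> sc; rewrite /hlU; have [-> ->] := hlAB_downs y f sc; rewrite [RHS](bigID (fun d => head 0%N d == head 0%N c)).
Qed.

Lemma all2_dstep_interlace L la mu : (head 0%N la <= L)%N -> (head 0%N mu <= L)%N ->
  all2 dstep (pcols L la) (pcols L mu) <-> interlace la mu.
Proof.
move=> hl hm; rewrite /pcols /mkseq.
have H s k : all2 dstep (map (lcol la) (iota s k)) (map (lcol mu) (iota s k)) <->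
    (forall j, (s <= j < s + k)%N -> dstep (lcol la j) (lcol mu j)).
  elim: k s => [|k IH] s /=; first by split=> // _ j; lia.
  split=> [/andP[h1 /IH h2] j hj|h].
    by have [->//|sj] := eqVneq j s; apply: h2; lia.
  by apply/andP; split; [apply: h|apply/IH => j hj; apply: h]; lia.
split=> [/H h|/interlaceP h].
  apply/interlaceP => j; have [jL|Lj] := ltnP j L; last first.
    by rewrite !lcol_eq0 // (leq_trans _ Lj).
  by have /orP[] := h j ltac:(lia); move=> /eqP; lia.
by apply/H => j _; have := h j; rewrite /dstep; lia.
Qed.

Hypothesis t01 : 0 < t < 1.

Lemma esum_skewQ1 L la y (F : int_partition -> R) (f : seq int -> R) :
  (head 0%N la <= L)%N -> 0 <= y -> (forall mu, 0 <= F mu) ->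
  (forall mu, (head 0%N mu <= L)%N -> f (posz (pcols L mu)) = F mu) ->
  \esum_(mu in [set: int_partition]) (skewQ1 t la mu y * F mu)%:E =
  (hlU t y f (posz (pcols L la)))%:E.
Proof.
move=> hl y0 F0 fF; set c := pcols L la.
have sc : sorted geq c by exact: pcols_sorted.
have szc : size c = L by exact: size_pcols.
pose D := [seq d <- downs c | sorted geq d].
have DP d : d \in D -> [/\ sorted geq d, all2 dstep c d & size d = L].
  rewrite mem_filter mem_downs => /andP[sd cd]; split=> //.
  by rewrite (all2_dstep_size cd).
have pinj : {in D &, injective part_of}.
  move=> d d' /DP[sd _ zd] /DP[sd' _ zd'] E.
  by rewrite -(pcols_part_of sd) -(pcols_part_of sd') zd zd' E.
rewrite (@esum_uniq_seq _ _ [seq part_of d | d <- D]).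
- rewrite sumEFin big_map big_filter hlU_downs //; congr EFin.
  rewrite [RHS](bigID (sorted geq)) /= [X in _ = _ + X]big1_seq ?addr0; last first.
    move=> d /andP[nd]; rewrite mem_downs => cd.
    by rewrite wQ_unsorted ?mul0r.
  rewrite big_seq_cond [RHS]big_seq_cond; apply: eq_bigr => d /andP[dc sd].
  have dD : d \in D by rewrite mem_filter sd.
  have [_ cd zd] := DP d dD.
  have hd : (head 0%N (part_of d) <= L)%N by rewrite -zd head_part_of.
  have E : pcols L (part_of d) = d by rewrite -zd pcols_part_of.
  by rewrite (skewQ1_wlist _ _ hl hd) -fF // E.
- by rewrite map_inj_in_uniq // filter_uniq // uniq_downs.
- by move=> mu; rewrite lee_fin mulr_ge0 ?skewQ1_ge0.
- move=> mu hmu; rewrite skewQ1_not_interlace ?mul0r // => il.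
  have hm : (head 0%N mu <= L)%N.
    apply: leq_trans hl; apply: lcol_head; have := (interlaceP _ _).1 il (head 0%N la).
    by rewrite [lcol la _]lcol_eq0 // leqn0 => /andP[/eqP].
  move/negP: hmu; apply; apply/mapP; exists (pcols L mu); last by rewrite part_of_pcols.
  rewrite mem_filter pcols_sorted mem_downs; exact/all2_dstep_interlace.
Qed.

Lemma hlAB_rcons0 y (f : seq int -> R) (c : seq int) :
  hlAB t y f (rcons c 0) = hlAB t y (fun d : seq int => f (rcons d 0)) c.
Proof.
elim: c f => [|a c IH] f /=; first by rewrite subr0 expr0z subrr !mul0r !addr0 mulr0.
by rewrite !IH; case: (c).
Qed.

Lemma hlPsi_rcons0 ys (c : seq int) : hlPsi t ys (rcons c 0) = hlPsi t ys c.
Proof.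
elim: ys c => [|y ys IH] c; first by rewrite /= /hlvac all_rcons.
rewrite /= /hlU /hlA /hlB hlAB_rcons0 (_ : (fun d : seq int => _) = hlPsi t ys) //.
by apply/funext.
Qed.

(** Q_lambda in the variables ys. Using exactly lambda_1 columns is a normalisation; by
    [hlPsi_pcols] further empty columns change nothing. *)
Definition HLQs (ys : seq R) la : R := hlPsi t ys (posz (pcols (head 0%N la) la)).

Lemma hlPsi_pcols ys L la : (head 0%N la <= L)%N -> hlPsi t ys (posz (pcols L la)) = HLQs ys la.
Proof.
move=> hL; rewrite -(subnKC hL); elim: (L - _)%N => [|k IH]; first by rewrite addn0.
rewrite addnS /pcols mkseqS map_rcons -/(pcols _ _).
by rewrite lcol_eq0 ?leq_addr // hlPsi_rcons0.
Qed.

Lemma HLQs_nil la : HLQs [::] la = (la == part0)%:R.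
Proof.
rewrite /HLQs /= /hlvac all_map; congr (nat_of_bool _)%:R; apply/idP/eqP => [h|->//].
apply: lcol_inj => j; rewrite [RHS]/lcol /conj_part /=.
have [jl|lj] := ltnP j (head 0%N la); last by rewrite lcol_eq0.
by have /allP/(_ (lcol la j)) := h; rewrite map_f ?mem_iota //= => /(_ isT)/eqP[].
Qed.

Lemma HLQs_ge0_cons y ys la : 0 <= y -> (forall mu, 0 <= HLQs ys mu) ->
  \esum_(mu in [set: int_partition]) (skewQ1 t la mu y * HLQs ys mu)%:E = (HLQs (y :: ys) la)%:E.
Proof.
by move=> y0 h0; rewrite (esum_skewQ1 (f := hlPsi t ys) (leqnn _)) // => mu /hlPsi_pcols.
Qed.

Lemma HLQs_ge0 ys la : all (>= 0) ys -> 0 <= HLQs ys la.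
Proof.
elim: ys la => [|y ys IH] la; first by rewrite HLQs_nil.
move=> /andP[y0 /IH ys0]; rewrite -lee_fin -HLQs_ge0_cons //.
by apply: esum_ge0 => mu _; rewrite lee_fin mulr_ge0 ?skewQ1_ge0.
Qed.

Lemma HLQs_cons y ys la : 0 <= y -> all (>= 0) ys ->
  \esum_(mu in [set: int_partition]) (skewQ1 t la mu y * HLQs ys mu)%:E = (HLQs (y :: ys) la)%:E.
Proof. by move=> y0 h0; apply: HLQs_ge0_cons => // mu; exact: HLQs_ge0. Qed.

End links.

(** * The skew Cauchy identity *)

Ltac decide_eqs := repeat match goal with
  |- context [@eq_op ?T ?x ?y] =>
    first [rewrite (_ : @eq_op T x y = true); [|by apply/eqP; lia]
          |rewrite (_ : @eq_op T x y = false); [|by apply/eqP; lia]]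
  end.

Lemma subz_eq0 (a c : nat) : (a%:Z - c%:Z == 0) = (c == a).
Proof. by apply/eqP/eqP; lia. Qed.

Lemma subz_eq1 (a c : nat) : (a%:Z - c%:Z == 1) = (c.+1 == a).
Proof. by apply/eqP/eqP; lia. Qed.

Lemma subz1_eq0 (a c : nat) : (a%:Z - c%:Z + 1 == 0) = (c == (a + 1)%N).
Proof. by apply/eqP/eqP; lia. Qed.

Lemma subz1_eq1 (a c : nat) : (a%:Z - c%:Z + 1 == 1) = (c.+1 == (a + 1)%N).
Proof. by apply/eqP/eqP; lia. Qed.

Lemma addz1_eq (a c : nat) : (a%:Z + 1 == c%:Z) = (a.+1 == c).
Proof. by apply/eqP/eqP; lia. Qed.

Lemma eqn_addn1 (a : nat) : (a == (a + 1)%N) = false.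
Proof. by apply/eqP; lia. Qed.

Lemma eqS_addn1 (a : nat) : (a.+1 == (a + 1)%N) = true.
Proof. by apply/eqP; lia. Qed.

Section cauchy_kernel.
Variables (R : realType) (t y : R).
Hypothesis t01 : 0 < t < 1.
Hypothesis y01 : 0 <= y < 1.

Let t0 : t != 0. Proof. by case/andP: t01 => h _; rewrite gt_eqF. Qed.
Let y1 : 1 - y != 0. Proof. by case/andP: y01 => _ h; rewrite gt_eqF // subr_gt0. Qed.

(* [wQloc] and [wPloc] for a column difference eta, with e the equality of the
   neighbouring columns and T the relevant power of t. *)
Definition kQ (eta : int) (e : bool) (T : R) : R :=
  if eta == 0 then 1 else if eta == 1 then y * (if e then 1 - T else 1) else 0.
Definition kP (eta : int) (e : bool) (T : R) : R :=
  if eta == 0 then if e then 1 else 1 - T else if eta == 1 then 1 else 0.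

(* The list holds the pairs of column lengths of the two outer partitions; the
   two components sort the inner partition by its first column. *)
Fixpoint kerL (x : R) (s : seq (int * int)) : R * R :=
  if s is p :: s' then
    let l := kerL x s' in let h := head (0, 0) s' in let T := t ^ (p.1 - h.1) in
    let eta := p.1 - p.2 in
    (kQ eta (h.1 == h.2) T * l.1 + (1 - T) * kQ eta (h.1 + 1 == h.2) (T / t) * l.2,
     kQ (eta + 1) (h.1 == h.2) (t * T) * l.1 + kQ (eta + 1) (h.1 + 1 == h.2) T * l.2)
  else (1, x).

Fixpoint kerR (s : seq (int * int)) : R * R :=
  if s is p :: s' then
    let r := kerR s' in let h := head (0, 0) s' in let T := t ^ (p.1 - h.1) in
    let eta := p.2 - p.1 in
    (kP eta (h.1 == h.2) T * r.1 + kP eta (h.1 - 1 == h.2) (t * T) * r.2,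
     y * ((1 - T) * kP (eta + 1) (h.1 == h.2) (T / t) * r.1 +
          kP (eta + 1) (h.1 - 1 == h.2) T * r.2))
  else (1, 0).

(** The Cauchy factor of one variable. [g0] is the fixed point of the second component of [kerL]
    along empty columns: the weight of all ways to add columns of length 1 beyond the given ones. *)
Let g := (1 - t * y) / (1 - y).
Let g0 := (1 - t) * y / (1 - y).
Let b := (1 - t) / (1 - y).

(* The relations between both sides that are stable under adding a column; only
   their sum [kerLR] is the Cauchy identity. *)
Definition kid (p : int * int) (l r : R * R) : Prop :=
  [/\ (p.1 = p.2 -> l.1 = r.1 + b * r.2 /\ l.2 = g0 * r.1 + t * r.2),
      (p.1 = p.2 + 1 -> [/\ l.1 = g * r.2, l.2 = 0 & r.1 = 0]),
      (p.2 = p.1 + 1 -> [/\ l.2 = g * r.1, l.1 = 0 & r.2 = 0]) &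
      (p.1 <> p.2 -> p.1 <> p.2 + 1 -> p.2 <> p.1 + 1 ->
         [/\ l.1 = 0, l.2 = 0, r.1 = 0 & r.2 = 0])].

(** Only the differences - 1, 0 and 1 between the outer column lengths survive, so the induction is
    a finite case analysis. *)
Lemma kid_ker s : kid (head (0, 0) s) (kerL g0 s) (kerR s).
Proof.
elim: s => [|[a c] s IH].
  split=> /= h; [|exfalso; lia|exfalso; lia|by []].
  by split; ring.
rewrite /= in IH *; case: (kerL g0 s) IH => l0 l1; case: (kerR s) => r0 r1.
case: (head (0, 0) s) => h k /= [/= i1 i2 i3 i4]; set T := t ^ _.
have [e|ne1] := eqVneq h k.
  have {i1 i2 i3 i4}[-> ->] := i1 e; rewrite e /kQ /kP; split=> /= d; rewrite ?d.
  - by decide_eqs; split; rewrite /g0 /b; field; rewrite ?y1 ?t0.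
  - by decide_eqs; split; rewrite /g /g0 /b; field; rewrite ?y1 ?t0.
  - by decide_eqs; split; rewrite /g /g0 /b; field; rewrite ?y1 ?t0.
  - by move=> d2 d3; decide_eqs; split; ring.
have [e|ne2] := eqVneq h (k + 1).
  have {i1 i2 i3 i4}[-> -> ->] := i2 e; rewrite e /kQ /kP; split=> /= d; rewrite ?d.
  - by decide_eqs; split; rewrite /g /g0 /b; field; rewrite ?y1 ?t0.
  - by decide_eqs; split; rewrite /g /g0 /b; field; rewrite ?y1 ?t0.
  - by decide_eqs; split; rewrite /g /g0 /b; field; rewrite ?y1 ?t0.
  - by move=> d2 d3; decide_eqs; split; ring.
have [e|ne3] := eqVneq k (h + 1).
  have {i1 i2 i3 i4}[-> -> ->] := i3 e; rewrite e /kQ /kP; split=> /= d; rewrite ?d.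
  - by decide_eqs; split; rewrite /g /g0 /b; field; rewrite ?y1 ?t0.
  - by decide_eqs; split; rewrite /g /g0 /b; field; rewrite ?y1 ?t0.
  - by decide_eqs; split; rewrite /g /g0 /b; field; rewrite ?y1 ?t0.
  - by move=> d2 d3; decide_eqs; split; ring.
have [-> -> -> ->] := i4 (elimN eqP ne1) (elimN eqP ne2) (elimN eqP ne3).
by rewrite !(mulr0, addr0); split=> *; split; rewrite /= ?mulr0 ?addr0.
Qed.

Lemma kerLR s : (kerL g0 s).1 + (kerL g0 s).2 = g * ((kerR s).1 + (kerR s).2).
Proof.
have := kid_ker s; case: (kerL g0 s) => l0 l1; case: (kerR s) => r0 r1.
case: (head (0, 0) s) => h k /= [/= i1 i2 i3 i4].
have [e|ne1] := eqVneq h k; first by have [-> ->] := i1 e; rewrite /g /g0 /b; field.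
have [e|ne2] := eqVneq h (k + 1); first by have [-> -> ->] := i2 e; ring.
have [e|ne3] := eqVneq k (h + 1); first by have [-> -> ->] := i3 e; ring.
have [-> -> -> ->] := i4 (elimN eqP ne1) (elimN eqP ne2) (elimN eqP ne3); ring.
Qed.

Lemma kerL_cvg (x : nat -> R) (l : R) s : x p @[p --> \oo] --> l ->
  (kerL (x p) s).1 @[p --> \oo] --> (kerL l s).1 /\
  (kerL (x p) s).2 @[p --> \oo] --> (kerL l s).2.
Proof.
move=> cx; elim: s => [|[a c] s [IH1 IH2]] /=; first by split => //; exact: cvg_cst.
by split; apply: cvgD; apply: cvgM => //; exact: cvg_cst.
Qed.

(** The second component of [kerL] after p empty columns, when started from 0. *)
Definition kzero (p : nat) : R := g0 * (1 - y ^+ p).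

Lemma kerL_pad s p : kerL 0 (s ++ nseq p (0, 0)) = kerL (kzero p) s.
Proof.
elim: s => [|[a c] s IH] /=; last first.
  by rewrite IH; case: (s) => //=; case: (p).
elim: p => [|p IH]; first by rewrite /kzero expr0 subrr mulr0.
rewrite /= IH (_ : head _ _ = (0, 0)); last by case: (p).
rewrite /= subrr expr0z /kQ /=; decide_eqs; congr (_, _); rewrite /kzero /g0 ?exprS; field => //.
Qed.

Lemma kzero_cvg : kzero p @[p --> \oo] --> g0.
Proof.
rewrite -[X in _ --> X]mulr1 -[X in _ * X]subr0; apply: cvgM; first exact: cvg_cst.
apply: cvgB; first exact: cvg_cst.
by apply: cvg_expr; case/andP: y01 => h1 h2; rewrite ger0_norm.
Qed.

Notation zipz m k := (zip (map Posz m) (map Posz k)).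

Lemma head_zipz (m k : seq nat) : size m = size k ->
  head (0, 0) (zipz m k) = ((head 0%N m)%:Z, (head 0%N k)%:Z).
Proof. by case: m k => [|a m] [|c k]. Qed.

Let tpow (a h : nat) : (h <= a)%N -> t ^+ (a - h) = t ^ (a%:Z - h%:Z).
Proof. by move=> ha; rewrite exprnP subzn. Qed.

Let tD (a c : int) : t ^ (a + c) = t ^ a * t ^ c. Proof. exact: expfzDr. Qed.

Let kerL_term (m k c : seq nat) : R := wlist (wPloc t) c m * wlist (wQloc t y) c k.

Lemma kerL_ups (m k : seq nat) : sorted geq m -> size m = size k ->
  (kerL 0 (zipz m k)).1 = \sum_(c <- ups m | head 0%N c == head 0%N m) kerL_term m k c /\
  (kerL 0 (zipz m k)).2 = \sum_(c <- ups m | head 0%N c != head 0%N m) kerL_term m k c.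
Proof.
elim: m k => [|a m IH] [|c k] //.
  by move=> _ _; rewrite !big_cons !big_nil eqxx /kerL_term /= mul1r addr0.
rewrite sorted_geq_cons => /andP[ha sm] [szmk].
have hd d : d \in ups m -> head 0%N d = head 0%N m \/ head 0%N d = (head 0%N m).+1.
  by rewrite mem_ups => /all2_dstep_head[]; [left|right].
have nhd d : d \in ups m -> (head 0%N d != head 0%N m) -> head 0%N d = (head 0%N m).+1.
  by move=> /hd[->|//]; rewrite eqxx.
have [E1 E2] := IH k sm szmk.
have split_sum (P : pred (seq nat)) (G : seq nat -> R) (u v : R) (r : seq (seq nat)) :
    (forall d, d \in r -> P d -> G d = u * kerL_term m k d) ->
    (forall d, d \in r -> ~~ P d -> G d = v * kerL_term m k d) ->
    \sum_(d <- r) G d = u * (\sum_(d <- r | P d) kerL_term m k d) +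
       v * (\sum_(d <- r | ~~ P d) kerL_term m k d).
  move=> h1 h2; rewrite (bigID P) /= !mulr_sumr; congr (_ + _).
    by rewrite big_seq_cond [RHS]big_seq_cond; apply: eq_bigr => d /andP[]; exact: h1.
  by rewrite big_seq_cond [RHS]big_seq_cond; apply: eq_bigr => d /andP[]; exact: h2.
have fac (e : nat) d : kerL_term (a :: m) (c :: k) (a + e :: d)%N =
    wPloc t (a + e) a (head 0%N d) (head 0%N m) * wQloc t y (a + e) c (head 0%N d) (head 0%N k) *
    kerL_term m k d.
  by rewrite /kerL_term /=; ring.
have S0 : \sum_(d <- ups (a :: m) | head 0%N d == head 0%N (a :: m)) kerL_term (a :: m) (c :: k) d =
   \sum_(d <- ups m) kerL_term (a :: m) (c :: k) (a + 0 :: d)%N.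
  rewrite big_cat /= [X in _ + X]big1_seq ?addr0; last first.
    by move=> d /andP[h /mapP[d' _ E]]; move: h; rewrite E /= => /eqP; lia.
  by rewrite big_map addn0; apply: eq_bigl => d; rewrite /= eqxx.
have S1 : \sum_(d <- ups (a :: m) | head 0%N d != head 0%N (a :: m)) kerL_term (a :: m) (c :: k) d =
   \sum_(d <- ups m) kerL_term (a :: m) (c :: k) (a + 1 :: d)%N.
  rewrite big_cat /= [X in X + _]big1_seq ?add0r; last first.
    by move=> d /andP[h /mapP[d' _ E]]; move: h; rewrite E /= eqxx.
  by rewrite big_map addn1; apply: eq_bigl => d; apply/eqP; rewrite /=; lia.
have hm := head_zipz szmk.
set T := t ^ (a%:Z - (head 0%N m)%:Z).
have TE : t ^+ (a - head 0%N m) = T by rewrite tpow.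
have TE1 : t ^+ (a + 1 - head 0%N m) = t * T.
  by rewrite /T tpow; [rewrite -{2}(expr1z t) -tD; congr (_ ^ _)|]; lia.
(* If a equals its right neighbour the natural subtraction truncates, but then 1 - T is 0. *)
have T2 : (1 - T) * (t ^+ (a - (head 0%N m).+1)) = (1 - T) * (T / t).
  have [e|ne] := eqVneq a (head 0%N m); first by rewrite /T e subrr expr0z subrr !mul0r.
  congr (_ * _); rewrite tpow; last by move/eqP: ne; lia.
  by rewrite /T -exprN1 -tD; congr (_ ^ _); lia.
have TE3 : t ^+ (a + 1 - (head 0%N m).+1) = T by rewrite addn1 subSS.
rewrite S0 S1 !(eq_bigr _ (fun d _ => fac _ d)) [zipz _ _]/= [kerL _ _]/= hm E1 E2 /= -/T.
split; apply/esym/split_sum => d dm hP.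
- congr (_ * _); rewrite (eqP hP) /wPloc /wQloc /kQ addn0 !eqxx mul1r TE.
  rewrite subz_eq0.
  rewrite subz_eq1.
  by rewrite eqz_nat.
- congr (_ * _); rewrite (nhd d dm hP) /wPloc /wQloc /kQ addn0 !eqxx.
  rewrite (_ : (_.+1 == _) = false); last by apply/eqP; lia.
  rewrite TE subz_eq0.
  rewrite subz_eq1.
  rewrite addz1_eq.
  case: (c == a) => //; case: (c.+1 == a) => //; case: (_ == _) => //.
  by rewrite mulrCA [RHS]mulrCA; congr (_ * _); rewrite !mulrBr T2.
- congr (_ * _); rewrite (eqP hP) /wPloc /wQloc /kQ.
  rewrite eqn_addn1.
  rewrite eqS_addn1.
  rewrite mul1r TE1 subz1_eq0.
  rewrite subz1_eq1.
  by rewrite eqz_nat.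
- congr (_ * _); rewrite (nhd d dm hP) /wPloc /wQloc /kQ.
  rewrite eqn_addn1.
  rewrite eqS_addn1.
  rewrite mul1r TE3 subz1_eq0.
  rewrite subz1_eq1.
  by rewrite addz1_eq.
Qed.

Let kerR_term (m k d : seq nat) : R := wlist (wQloc t y) m d * wlist (wPloc t) k d.

Lemma kerR_downs (m k : seq nat) : sorted geq m -> size m = size k ->
  (kerR (zipz m k)).1 = \sum_(d <- downs m | head 0%N d == head 0%N m) kerR_term m k d /\
  (kerR (zipz m k)).2 = \sum_(d <- downs m | head 0%N d != head 0%N m) kerR_term m k d.
Proof.
elim: m k => [|a m IH] [|c k] //.
  by move=> _ _; rewrite !big_cons !big_nil eqxx /kerR_term /= mul1r addr0.
rewrite sorted_geq_cons => /andP[ha sm] [szmk].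
have hd d : d \in downs m -> head 0%N d = head 0%N m \/ (head 0%N d).+1 = head 0%N m.
  by rewrite mem_downs => /all2_dstep_head.
have nhd d : d \in downs m -> (head 0%N d != head 0%N m) -> (head 0%N d).+1 = head 0%N m.
  by move=> /hd[->|//]; rewrite eqxx.
have [E1 E2] := IH k sm szmk.
have split_sum (P : pred (seq nat)) (G : seq nat -> R) (u v : R) (r : seq (seq nat)) :
    (forall d, d \in r -> P d -> G d = u * kerR_term m k d) ->
    (forall d, d \in r -> ~~ P d -> G d = v * kerR_term m k d) ->
    \sum_(d <- r) G d = u * (\sum_(d <- r | P d) kerR_term m k d) +
       v * (\sum_(d <- r | ~~ P d) kerR_term m k d).
  move=> h1 h2; rewrite (bigID P) /= !mulr_sumr; congr (_ + _).
    by rewrite big_seq_cond [RHS]big_seq_cond; apply: eq_bigr => d /andP[]; exact: h1.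
  by rewrite big_seq_cond [RHS]big_seq_cond; apply: eq_bigr => d /andP[]; exact: h2.
have fac (b' : nat) d : kerR_term (a :: m) (c :: k) (b' :: d) =
    wQloc t y a b' (head 0%N m) (head 0%N d) * wPloc t c b' (head 0%N k) (head 0%N d) *
    kerR_term m k d.
  by rewrite /kerR_term /=; ring.
have S0 : \sum_(d <- downs (a :: m) | head 0%N d == head 0%N (a :: m)) kerR_term (a :: m) (c :: k) d =
   \sum_(d <- downs m) kerR_term (a :: m) (c :: k) (a :: d).
  rewrite big_cat /= [X in _ + X]big1_seq ?addr0; last first.
    case: (a) => [|a'] x; first by rewrite in_nil andbF.
    by move=> /andP[/eqP h /mapP[d _ E]]; move: h; rewrite E /=; lia.
  by rewrite big_map; apply: eq_bigl => d; rewrite /= eqxx.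
have hm := head_zipz szmk.
set T := t ^ (a%:Z - (head 0%N m)%:Z).
have TE : t ^+ (a - head 0%N m) = T by rewrite tpow.
rewrite [zipz _ _]/= [kerR _]/= hm E1 E2 /= -/T; split.
  rewrite [RHS]S0 !(eq_bigr _ (fun d _ => fac _ d)); apply/esym/split_sum => d dm hP.
    congr (_ * _); rewrite (eqP hP) /wPloc /wQloc /kP eqxx mul1r TE eqz_nat.
    rewrite subz_eq0.
    rewrite subz_eq1.
    by rewrite [head 0%N m == _]eq_sym.
  congr (_ * _); have hh := nhd d dm hP; rewrite /wPloc /wQloc /kP eqxx mul1r.
  rewrite subz_eq0.
  rewrite subz_eq1.
  rewrite (_ : ((head 0%N m)%:Z - 1 == (head 0%N k)%:Z) = (head 0%N k == head 0%N d)); last by apply/eqP/eqP; lia.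
  rewrite (_ : t ^+ (a - head 0%N d) = t * T) //.
  by rewrite /T tpow; [rewrite -{2}(expr1z t) -tD; congr (_ ^ _)|]; lia.
case: (posnP a) => [a0|apos].
  have h0 : head 0%N m = 0%N by lia.
  have z0 : \sum_(d <- downs m | head 0%N d != head 0%N m) kerR_term m k d = 0.
    by apply: big1_seq => d /andP[dc ds]; have := nhd d ds dc; lia.
  have T1 : T = 1 by rewrite /T a0 h0.
  rewrite z0 T1 subrr !mul0r mulr0 addr0 mulr0 a0 /=.
  rewrite big_cat /= big_nil addr0 big1_seq // => d /andP[h /mapP[d' _ E]].
  by move: h; rewrite E.
have aE : a = a.-1.+1 by lia.
have S1 : \sum_(d <- downs (a :: m) | head 0%N d != head 0%N (a :: m)) kerR_term (a :: m) (c :: k) d =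
   \sum_(d <- downs m) kerR_term (a :: m) (c :: k) (a.-1 :: d).
  rewrite big_cat /= [X in X + _]big1_seq ?add0r; last first.
    by move=> d /andP[h /mapP[d' _ E]]; move: h; rewrite E /= eqxx.
  case: (a) apos => [|a'] // _; rewrite big_map /=; apply: eq_bigl => d; apply/eqP; lia.
rewrite [RHS]S1 !(eq_bigr _ (fun d _ => fac _ d)) mulrDr 2!mulrA; apply/esym/split_sum => d dm hP.
  congr (_ * _); rewrite (eqP hP) /wPloc /wQloc /kP.
  rewrite (_ : (a.-1 == a) = false); last by apply/eqP; lia.
  rewrite (_ : (a.-1.+1 == a) = true); last by apply/eqP; lia.
  rewrite eqxx TE -!mulrA; congr (_ * _).
  rewrite (_ : (c%:Z - a%:Z + 1 == 0) = (a.-1 == c)); last by apply/eqP/eqP; lia.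
  rewrite (_ : (c%:Z - a%:Z + 1 == 1) = (a.-1.+1 == c)); last by apply/eqP/eqP; lia.
  rewrite eqz_nat [head 0%N m == _]eq_sym.
  case: (a.-1 == c); last by [].
  case: (head 0%N k == head 0%N m) => //.
  have [e|ne] := eqVneq a (head 0%N m); first by rewrite /T e subrr expr0z subrr !mul0r.
  congr (_ * (1 - _)); rewrite tpow; last by move/eqP: ne; lia.
  by rewrite /T -exprN1 -tD; congr (_ ^ _); lia.
congr (_ * _); have hh := nhd d dm hP; rewrite /wPloc /wQloc /kP.
rewrite (_ : (a.-1 == a) = false); last by apply/eqP; lia.
rewrite (_ : (a.-1.+1 == a) = true); last by apply/eqP; lia.
rewrite (_ : (head 0%N m == head 0%N d) = false); last by apply/eqP; lia.
rewrite mulr1; congr (_ * _).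
rewrite (_ : (c%:Z - a%:Z + 1 == 0) = (a.-1 == c)); last by apply/eqP/eqP; lia.
rewrite (_ : (c%:Z - a%:Z + 1 == 1) = (a.-1.+1 == c)); last by apply/eqP/eqP; lia.
rewrite (_ : ((head 0%N m)%:Z - 1 == (head 0%N k)%:Z) = (head 0%N k == head 0%N d)); last by apply/eqP/eqP; lia.
rewrite (_ : t ^+ (a.-1 - head 0%N d) = T) //.
by rewrite /T tpow; [congr (_ ^ _)|]; lia.
Qed.

End cauchy_kernel.

Section skew_cauchy.
Variables (R : realType) (t : R).
Hypothesis t01 : 0 < t < 1.
Implicit Types (la mu ka nu : int_partition) (y : R).

Notation zipz m k := (zip (map Posz m) (map Posz k)).
Definition hlgamma y : R := (1 - t * y) / (1 - y).

Lemma hlgamma_ge0 y : 0 <= y < 1 -> 0 <= hlgamma y.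
Proof.
case/andP: t01 => t0 t1 /andP[y0 y1]; rewrite divr_ge0 ?subr_ge0 ?ltW //.
by rewrite (le_lt_trans _ y1) // ler_piMl // ltW.
Qed.

Lemma interlace_head la mu : interlace la mu -> (head 0%N mu <= head 0%N la)%N.
Proof. by move=> h; rewrite -!nth0; case: (h 0%N). Qed.

Lemma nseqSr (T : Type) (x : T) p : nseq p.+1 x = rcons (nseq p x) x.
Proof. by elim: p => //= q <-. Qed.

Lemma pcols_pad L p mu : (head 0%N mu <= L)%N -> pcols (L + p) mu = pcols L mu ++ nseq p 0%N.
Proof.
move=> hL; elim: p => [|p IH]; first by rewrite addn0 cats0.
rewrite addnS /pcols mkseqS -!/(pcols _ _) IH lcol_eq0 ?(leq_trans hL) ?leq_addr //.
by rewrite nseqSr rcons_cat.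
Qed.

Section kernel.
Variable y : R.
Hypothesis y01 : 0 <= y < 1.
Let y0 : 0 <= y. Proof. by case/andP: y01. Qed.

Lemma esum_kerL_trunc L mu ka : (head 0%N mu <= L)%N -> (head 0%N ka <= L)%N ->
  \esum_(la in [set: int_partition])
     (if (head 0%N la <= L)%N then (psi t la mu * skewQ1 t la ka y)%:E else 0%E) =
  ((kerL t y 0 (zipz (pcols L mu) (pcols L ka))).1 +
   (kerL t y 0 (zipz (pcols L mu) (pcols L ka))).2)%:E.
Proof.
move=> hm hk; set m := pcols L mu; set k := pcols L ka.
have sm : sorted geq m by exact: pcols_sorted.
have sz : size m = size k by rewrite !size_pcols.
have [-> ->] := kerL_ups t01 y01 sm sz.
have ID (G : seq nat -> R) : \sum_(d <- ups m | head 0%N d == head 0%N m) G d +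
    \sum_(d <- ups m | head 0%N d != head 0%N m) G d = \sum_(d <- ups m) G d.
  by rewrite [RHS](bigID (fun d => head 0%N d == head 0%N m)).
rewrite ID; pose D := [seq d <- ups m | sorted geq d].
have DP d : d \in D -> [/\ sorted geq d, all2 dstep d m & size d = L].
  rewrite mem_filter mem_ups => /andP[sd cd]; split=> //.
  by rewrite -(all2_dstep_size cd) size_pcols.
have pinj : {in D &, injective part_of}.
  move=> d d' /DP[sd _ zd] /DP[sd' _ zd'] E.
  by rewrite -(pcols_part_of sd) -(pcols_part_of sd') zd zd' E.
rewrite (@esum_uniq_seq _ _ [seq part_of d | d <- D]).
- rewrite big_map big_filter [in RHS](bigID (sorted geq)) /= [X in (_ + X)%:E]big1_seq ?addr0; last first.
    by move=> d /andP[nd]; rewrite mem_ups => cd; rewrite wP_unsorted ?mul0r.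
  rewrite -sumEFin big_seq_cond [RHS]big_seq_cond; apply: eq_bigr => d /andP[dc sd].
  have dD : d \in D by rewrite mem_filter sd.
  have [_ cd zd] := DP d dD.
  have hd : (head 0%N (part_of d) <= L)%N by rewrite -zd head_part_of.
  have E : pcols L (part_of d) = d by rewrite -zd pcols_part_of.
  by rewrite hd (psi_wlist _ hd hm) (skewQ1_wlist _ _ hd hk) E.
- by rewrite map_inj_in_uniq // filter_uniq // uniq_ups.
- by move=> la; case: ifP => // _; rewrite lee_fin mulr_ge0 ?skewQ1_ge0 ?psi_ge0.
- move=> la hla; case: ifP => // hl.
  rewrite psi_not_interlace ?mul0r // => il.
  move/negP: hla; apply; apply/mapP; exists (pcols L la); last by rewrite part_of_pcols.
  rewrite mem_filter pcols_sorted mem_ups; exact/all2_dstep_interlace.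
Qed.

Lemma esum_kerR L mu ka : (head 0%N mu <= L)%N -> (head 0%N ka <= L)%N ->
  \esum_(nu in [set: int_partition]) (psi t ka nu * skewQ1 t mu nu y)%:E =
  ((kerR t y (zipz (pcols L mu) (pcols L ka))).1 +
   (kerR t y (zipz (pcols L mu) (pcols L ka))).2)%:E.
Proof.
move=> hm hk; set m := pcols L mu; set k := pcols L ka.
have sm : sorted geq m by exact: pcols_sorted.
have sz : size m = size k by rewrite !size_pcols.
have [-> ->] := kerR_downs t01 y01 sm sz.
have ID (G : seq nat -> R) : \sum_(d <- downs m | head 0%N d == head 0%N m) G d +
    \sum_(d <- downs m | head 0%N d != head 0%N m) G d = \sum_(d <- downs m) G d.
  by rewrite [RHS](bigID (fun d => head 0%N d == head 0%N m)).
rewrite ID; pose D := [seq d <- downs m | sorted geq d].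
have DP d : d \in D -> [/\ sorted geq d, all2 dstep m d & size d = L].
  rewrite mem_filter mem_downs => /andP[sd cd]; split=> //.
  by rewrite (all2_dstep_size cd) size_pcols.
have pinj : {in D &, injective part_of}.
  move=> d d' /DP[sd _ zd] /DP[sd' _ zd'] E.
  by rewrite -(pcols_part_of sd) -(pcols_part_of sd') zd zd' E.
rewrite (@esum_uniq_seq _ _ [seq part_of d | d <- D]).
- rewrite big_map big_filter [in RHS](bigID (sorted geq)) /= [X in (_ + X)%:E]big1_seq ?addr0; last first.
    by move=> d /andP[nd]; rewrite mem_downs => cd; rewrite wQ_unsorted ?mul0r.
  rewrite -sumEFin big_seq_cond [RHS]big_seq_cond; apply: eq_bigr => d /andP[dc sd].
  have dD : d \in D by rewrite mem_filter sd.
  have [_ cd zd] := DP d dD.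
  have hd : (head 0%N (part_of d) <= L)%N by rewrite -zd head_part_of.
  have E : pcols L (part_of d) = d by rewrite -zd pcols_part_of.
  by rewrite (psi_wlist _ hk hd) (skewQ1_wlist _ _ hm hd) E mulrC.
- by rewrite map_inj_in_uniq // filter_uniq // uniq_downs.
- by move=> la; rewrite lee_fin mulr_ge0 ?skewQ1_ge0 ?psi_ge0.
- move=> nu hnu; rewrite skewQ1_not_interlace ?mulr0 // => il.
  have hn : (head 0%N nu <= L)%N by apply: leq_trans (interlace_head il) hm.
  move/negP: hnu; apply; apply/mapP; exists (pcols L nu); last by rewrite part_of_pcols.
  rewrite mem_filter pcols_sorted mem_downs; exact/all2_dstep_interlace.
Qed.

(** The larger partition may have any number of columns. The sum over those with at most L + p
    columns is [kerL] with p empty columns appended, and [esum_le_limit] lets p grow. *)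
Lemma esum_kernel mu ka :
  \esum_(la in [set: int_partition]) (psi t la mu * skewQ1 t la ka y)%:E =
  ((hlgamma y)%:E * \esum_(nu in [set: int_partition]) (psi t ka nu * skewQ1 t mu nu y)%:E)%E.
Proof.
set L := maxn (head 0%N mu) (head 0%N ka).
have hm : (head 0%N mu <= L)%N by rewrite leq_maxl.
have hk : (head 0%N ka <= L)%N by rewrite leq_maxr.
rewrite (esum_kerR hm hk) -EFinM -(kerLR t01 y01).
set s := zipz _ _; set g0 := (1 - t) * y / (1 - y).
have [c1 c2] := @kerL_cvg R t y _ _ s (@kzero_cvg R t y y01).
apply: (@esum_le_limit _ _ _ (fun p la => (head 0%N la <= L + p)%N)
   (fun p => (kerL t y (kzero t y p) s).1 + (kerL t y (kzero t y p) s).2)).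
- by move=> la; rewrite lee_fin mulr_ge0 ?skewQ1_ge0 ?psi_ge0.
- by move=> la; exists (head 0%N la) => p hp; apply: leq_trans hp (leq_addl _ _).
- move=> p; rewrite esum_kerL_trunc ?(leq_trans hm) ?(leq_trans hk) ?leq_addr //.
  rewrite !pcols_pad // !map_cat zip_cat ?size_map ?size_pcols // -/s.
  have -> : zipz (nseq p 0%N) (nseq p 0%N) = nseq p (0, 0) by elim: (p) => //= q ->.
  by rewrite kerL_pad.
- exact: cvgD.
Qed.

End kernel.

(** The variables are taken one at a time: [esum_kernel] exchanges P with the factor Q of the first
    variable. *)
Lemma skew_cauchy ys mu : all (fun y => 0 <= y < 1) ys ->
  \esum_(la in [set: int_partition]) (psi t la mu * HLQs t ys la)%:E =
  ((\prod_(y <- ys) hlgamma y) * HLQs t ys mu)%:E.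
Proof.
elim: ys mu => [|y ys IH] mu.
  move=> _; rewrite big_nil mul1r (@esum_uniq_seq _ _ [:: part0]) //.
  - rewrite big_seq1 !HLQs_nil eqxx mulr1; congr EFin.
    have [->|ne] := eqVneq mu part0.
      by rewrite /psi asboolT ?big_geq // => i; rewrite !nth_nil.
    rewrite psi_not_interlace // => /interlaceP h; move/eqP: ne; apply.
    apply: lcol_inj => j; have /andP[] := h j.
    by rewrite [lcol part0 j]lcol_eq0 // leqn0 => /eqP.
  - by move=> la; rewrite lee_fin mulr_ge0 ?psi_ge0 ?HLQs_ge0.
  - by move=> la; rewrite inE => /negbTE h; rewrite HLQs_nil h mulr0.
rewrite /= => /andP[y01 hys].
have y0 : 0 <= y by case/andP: y01.
have ys0 : all (>= 0) ys by apply: sub_all hys => v /andP[].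
have H0 la : 0 <= HLQs t ys la by exact: HLQs_ge0.
transitivity (\esum_(la in [set: int_partition]) \esum_(ka in [set: int_partition])
    (psi t la mu * (skewQ1 t la ka y * HLQs t ys ka))%:E).
  apply: eq_esum => la _; rewrite EFinM -HLQs_cons // -esumZ ?psi_ge0 //.
  by move=> ka; rewrite lee_fin mulr_ge0 ?skewQ1_ge0.
rewrite esum_swap; last by move=> la ka; rewrite lee_fin mulr_ge0 ?psi_ge0 // mulr_ge0 ?skewQ1_ge0.
transitivity (\esum_(ka in [set: int_partition]) \esum_(nu in [set: int_partition])
    (hlgamma y * (skewQ1 t mu nu y * (psi t ka nu * HLQs t ys ka)))%:E).
  apply: eq_esum => ka _.
  transitivity ((HLQs t ys ka)%:E * \esum_(la in [set: int_partition]) (psi t la mu * skewQ1 t la ka y)%:E)%E.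
    rewrite -esumZ //; last by move=> la; rewrite lee_fin mulr_ge0 ?psi_ge0 ?skewQ1_ge0.
    by apply: eq_esum => la _; rewrite -EFinM; congr EFin; ring.
  rewrite esum_kernel // muleA -EFinM -esumZ ?(mulr_ge0 (H0 ka) (hlgamma_ge0 y01)) //.
    by apply: eq_esum => nu _; rewrite -EFinM; congr EFin; ring.
  by move=> la; rewrite lee_fin mulr_ge0 ?psi_ge0 ?skewQ1_ge0.
rewrite esum_swap; last by move=> ka nu; rewrite lee_fin mulr_ge0 ?hlgamma_ge0 // mulr_ge0 ?skewQ1_ge0 // mulr_ge0 ?psi_ge0.
transitivity (\esum_(nu in [set: int_partition])
    (((hlgamma y * \prod_(v <- ys) hlgamma v)%:E) * (skewQ1 t mu nu y * HLQs t ys nu)%:E)%E).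
  apply: eq_esum => nu _.
  transitivity ((hlgamma y * skewQ1 t mu nu y)%:E * \esum_(ka in [set: int_partition]) (psi t ka nu * HLQs t ys ka)%:E)%E.
    rewrite -esumZ ?(mulr_ge0 (hlgamma_ge0 y01) (skewQ1_ge0 t01 _ _ y0)) //; last first.
      by move=> la; rewrite lee_fin mulr_ge0 ?psi_ge0.
    by apply: eq_esum => la _; rewrite -EFinM; congr EFin; ring.
  by rewrite IH // -!EFinM; congr EFin; ring.
have g0 : 0 <= hlgamma y * \prod_(v <- ys) hlgamma v.
  by rewrite mulr_ge0 ?hlgamma_ge0 // big_seq prodr_ge0 // => v /(allP hys)/hlgamma_ge0.
rewrite esumZ //; last by move=> nu; rewrite lee_fin mulr_ge0 ?skewQ1_ge0.
by rewrite HLQs_cons // -EFinM big_cons.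
Qed.

Definition qfac (k : nat) : R := \prod_(i < k) (1 - t ^+ i.+1).

Lemma qfacS k : qfac k.+1 = qfac k * (1 - t ^+ k.+1).
Proof. by rewrite /qfac big_ord_recr. Qed.

Lemma qfac_gt0 k : 0 < qfac k.
Proof.
apply: prodr_gt0 => i _; case/andP: t01 => t0 t1.
by rewrite subr_gt0 exprn_ilt1 // ltW.
Qed.

(** The factor b_lambda(t) with Q_lambda = b_lambda P_lambda, a product over columns because
    multiplicities are differences of consecutive column lengths. *)
Fixpoint bcols (c : seq nat) : R :=
  if c is a :: c' then qfac (a - head 0%N c') * bcols c' else 1.

Lemma bcols_gt0 c : 0 < bcols c.
Proof. by elim: c => //= a c IH; rewrite mulr_gt0 // qfac_gt0. Qed.

Lemma bcols_wlist (c d : seq nat) : sorted geq c -> sorted geq d -> all2 dstep c d ->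
  wlist (wQloc t 1) c d * bcols d = bcols c * wlist (wPloc t) c d.
Proof.
elim: c d => [|a c IH] [|b d] //.
rewrite !sorted_geq_cons => /andP[ha sc] /andP[hb sd] /= /andP[hab cd].
have := all2_dstep_head cd; have := IH d sc sd cd.
set h := head 0%N c in ha *; set h' := head 0%N d in hb *.
set X := wlist _ _ _; set Y := wlist _ _ _ => E hh.
suff L : wQloc t 1 a b h h' * qfac (b - h') = qfac (a - h) * wPloc t a b h h'.
  transitivity (wQloc t 1 a b h h' * qfac (b - h') * (X * bcols d)); first by ring.
  by rewrite L E; ring.
rewrite /wQloc /wPloc; move: hab; rewrite /dstep; case: eqP => [e|ne] /=.
  move=> _; case: hh => e2; first by rewrite e2 eqxx e mul1r mulr1.
  rewrite (_ : (h == h') = false); last by apply/eqP; lia.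
  have -> : (b - h' = (a - h).+1)%N by lia.
  by rewrite qfacS mul1r.
move=> /eqP e; rewrite e eqxx mul1r mulr1; case: hh => e2; last first.
  rewrite (_ : (h == h') = false); last by apply/eqP; lia.
  by rewrite mul1r; congr qfac; lia.
rewrite e2 eqxx; have -> : (a - h = (b - h).+1)%N by lia.
by rewrite qfacS mulrC.
Qed.

Definition hlb la : R := bcols (pcols (head 0%N la) la).

Lemma bcols_pcols L la : (head 0%N la <= L)%N -> bcols (pcols L la) = hlb la.
Proof.
move=> hL; rewrite -(subnKC hL) pcols_pad //.
elim: (L - _)%N => [|p IH]; first by rewrite cats0.
rewrite nseqSr -rcons_cat -IH; elim: (_ ++ _) => [|a c IHc] /=; first by rewrite /qfac big_ord0 mulr1.
by rewrite IHc; case: (c).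
Qed.

Lemma hlb_gt0 la : 0 < hlb la. Proof. exact: bcols_gt0. Qed.

Lemma hlb_part0 : hlb part0 = 1. Proof. by []. Qed.

Lemma skewQ1_psi la mu : skewQ1 t la mu 1 / hlb la = psi t la mu / hlb mu.
Proof.
have [il|nil] := pselect (interlace la mu); last first.
  by rewrite skewQ1_not_interlace // psi_not_interlace // !mul0r.
set L := head 0%N la; have hl : (head 0%N la <= L)%N by [].
have hm : (head 0%N mu <= L)%N by exact: interlace_head.
rewrite (psi_wlist _ hl hm) (skewQ1_wlist _ _ hl hm) -(bcols_pcols hl) -(bcols_pcols hm).
have := bcols_wlist (pcols_sorted L la) (pcols_sorted L mu) ((all2_dstep_interlace hl hm).2 il).
have := bcols_gt0 (pcols L la); have := bcols_gt0 (pcols L mu).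
set u := bcols _; set v := bcols _ => u0 v0 E.
apply: (mulIf (lt0r_neq0 v0)); apply: (mulIf (lt0r_neq0 u0)).
by rewrite divfK ?gt_eqF // E; field; rewrite gt_eqF.
Qed.

End skew_cauchy.

(** * The marginal law *)

Lemma esum_tupleS (R : realType) (T : choiceType) n (H : n.+1.-tuple T -> \bar R) :
  (forall l, 0 <= H l)%E ->
  \esum_(l in [set: n.+1.-tuple T]) H l =
  \esum_(v in [set: n.-tuple T]) \esum_(x in [set: T]) H (rcons_tuple v x).
Proof.
move=> H0; rewrite esum_esum //.
rewrite (@reindex_esum R (n.-tuple T * T)%type (n.+1.-tuple T)
  ([set: n.-tuple T] `*`` (fun=> [set: T])) _ (fun p => rcons_tuple p.1 p.2)) //.
split=> //.
  move=> [v x] [v' x'] _ _ /= /(congr1 (fun l : n.+1.-tuple T => val l)) /= /rcons_inj[E ->].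
  by congr (_, _); apply/val_inj.
move=> l _; case/tupleP: l => x v.
have : size (val [tuple of x :: v]) = n.+1 by rewrite size_tuple.
case/lastP E : (val [tuple of x :: v]) => [|s y] //; rewrite size_rcons => -[sn].
have sn' : size s == n by rewrite sn.
by exists (Tuple sn', y) => //=; apply/val_inj; rewrite /= -E.
Qed.

Lemma chain_at_rcons n (v : n.-tuple int_partition) x i : (i <= n)%N ->
  chain_at (rcons_tuple v x) i = chain_at v i.
Proof. by move=> hi; rewrite /chain_at /= -rcons_cons nth_rcons /= size_tuple ltnS hi. Qed.

Lemma chain_at_last n (v : n.-tuple int_partition) x : chain_at (rcons_tuple v x) n.+1 = x.
Proof. by rewrite /chain_at /= nth_rcons size_tuple ltnn eqxx. Qed.

Section chain_sums.
Variables (R : realType) (w : int_partition -> int_partition -> R) (K : nat -> int_partition -> R).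
Hypothesis w0 : forall la mu, 0 <= w la mu.
Hypothesis K0 : forall n la, 0 <= K n la.
Hypothesis K_part0 : forall la, K 0 la = (la == part0)%:R.
Hypothesis KS : forall n la,
  \esum_(mu in [set: int_partition]) (w la mu * K n mu)%:E = (K n.+1 la)%:E.

Definition chain_weight n (l : n.-tuple int_partition) : R :=
  \prod_(i < n) w (chain_at l i.+1) (chain_at l i).

Lemma chain_weight_ge0 n (l : n.-tuple int_partition) : 0 <= chain_weight l.
Proof. by apply: prodr_ge0. Qed.

Lemma chain_weight_rcons n (v : n.-tuple int_partition) x :
  chain_weight (rcons_tuple v x) = chain_weight v * w x (chain_at v n).
Proof.
rewrite /chain_weight big_ord_recr /= chain_at_last chain_at_rcons //; congr (_ * _).
by apply: eq_bigr => i _; rewrite !chain_at_rcons // ltnW.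
Qed.

Lemma esum_chain n (G : int_partition -> R) : (forall la, 0 <= G la) ->
  \esum_(l in [set: n.-tuple int_partition]) (chain_weight l * G (chain_at l n))%:E =
  \esum_(la in [set: int_partition]) (K n la * G la)%:E.
Proof.
elim: n G => [|n IH] G G0.
  rewrite (@esum_uniq_seq _ _ [:: [tuple]]) //; first last.
  - by move=> l; rewrite tuple0 inE eqxx.
  - by move=> l; rewrite lee_fin mulr_ge0 ?chain_weight_ge0.
  rewrite (@esum_uniq_seq _ _ [:: part0]) //; first last.
  - by move=> la; rewrite inE K_part0 => /negbTE ->; rewrite mul0r.
  - by move=> la; rewrite lee_fin mulr_ge0.
  by rewrite !big_seq1 K_part0 eqxx /chain_weight big_ord0.
rewrite esum_tupleS; last by move=> l; rewrite lee_fin mulr_ge0 ?chain_weight_ge0.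
rewrite esum_swap; last by move=> v x; rewrite lee_fin mulr_ge0 ?chain_weight_ge0.
apply: eq_esum => la _.
transitivity (\esum_(v in [set: n.-tuple int_partition]) (chain_weight v * (w la (chain_at v n) * G la))%:E).
  by apply: eq_esum => v _; rewrite chain_weight_rcons chain_at_last mulrA.
rewrite (IH (fun mu => w la mu * G la)); last by move=> mu; rewrite mulr_ge0.
rewrite mulrC EFinM -KS -esumZ //; last by move=> mu; rewrite lee_fin mulr_ge0.
by apply: eq_esum => mu _; rewrite -EFinM; congr EFin; ring.
Qed.

(** The steps after time k are summed out from the last one back, each leaving a factor gam since F
    is an eigenfunction; the steps up to time k build K. *)
Lemma esum_chain_marked k d (gam : R) (B F : int_partition -> R) :
  0 <= gam -> (forall la, 0 <= B la) -> (forall la, 0 <= F la) ->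
  (forall mu, \esum_(la in [set: int_partition]) (w la mu * F la)%:E = (gam * F mu)%:E) ->
  \esum_(l in [set: (d + k).-tuple int_partition])
     (chain_weight l * (B (chain_at l k) * F (chain_at l (d + k))))%:E =
  ((gam ^+ d)%:E * \esum_(la in [set: int_partition]) (K k la * (B la * F la))%:E)%E.
Proof.
move=> g0 B0 F0 TF; elim: d => [|d IH].
  rewrite expr0 mul1e -(@esum_chain k (fun la => B la * F la)) // => la.
  by rewrite mulr_ge0.
rewrite esum_tupleS; last by move=> l; rewrite lee_fin mulr_ge0 ?chain_weight_ge0 // mulr_ge0.
rewrite exprS EFinM -muleA -IH -esumZ //; last first.
  by move=> l; rewrite lee_fin mulr_ge0 ?chain_weight_ge0 // mulr_ge0.
apply: eq_esum => v _.
transitivity ((chain_weight v * B (chain_at v k))%:E *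
   \esum_(la in [set: int_partition]) (w la (chain_at v (d + k)) * F la)%:E)%E.
  rewrite -esumZ ?mulr_ge0 ?chain_weight_ge0 //; last first.
    by move=> la; rewrite lee_fin mulr_ge0.
  apply: eq_esum => la _; rewrite chain_weight_rcons chain_at_last chain_at_rcons ?leq_addl //.
  by rewrite -EFinM; congr EFin; ring.
by rewrite TF -!EFinM; congr EFin; ring.
Qed.

End chain_sums.

Section hl_law.
Variables (R : realType) (t z : R).
Hypothesis t01 : 0 < t < 1.
Hypothesis z01 : 0 < z < 1.

Lemma all_nseq_ge0 n (x : R) : 0 <= x -> all (>= 0) (nseq n x).
Proof. by move=> x0; rewrite all_nseq x0 orbT. Qed.

(** Chains that fail to interlace have weight 0, so the sum may run over all tuples and be evaluated
    by [esum_chain]. *)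
Lemma HLQ_HLQs n x la : 0 <= x -> HLQ t (fun _ : 'I_n => x) la = HLQs t (nseq n x) la.
Proof.
move=> x0; apply: EFin_inj.
rewrite /HLQ -fsumEFin; last exact: finite_chains.
pose w la mu := skewQ1 t la mu x.
have w0 la' mu : 0 <= w la' mu by exact: skewQ1_ge0.
rewrite -esum_fset; [|exact: finite_chains|by move=> v _; rewrite lee_fin; apply: prodr_ge0 => i _; exact: skewQ1_ge0].
rewrite esum_mkcond.
transitivity (\esum_(l in [set: n.-tuple int_partition]) (chain_weight w l * (chain_at l n == la)%:R)%:E).
  apply: eq_esum => v _; case: ifPn => [/set_mem[_ ->]|hv]; first by rewrite eqxx mulr1.
  case: eqP => [e|_]; last by rewrite mulr0.
  have [i hi] : exists i : 'I_n, ~ interlace (chain_at v i.+1) (chain_at v i).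
    apply/not_existsP => h; move/negP: hv; apply; apply/mem_set; split=> // i ilt.
    by have /contrapT := h (Ordinal ilt).
  by rewrite /chain_weight (bigD1 i) //= /w skewQ1_not_interlace // !mul0r.
rewrite (@esum_chain _ w (fun n => HLQs t (nseq n x)) _ _ _ _ n (fun mu => (mu == la)%:R)) //.
- rewrite (@esum_uniq_seq _ _ [:: la]) //.
  + by rewrite big_seq1 eqxx mulr1.
  + by move=> mu; rewrite lee_fin mulr_ge0 // HLQs_ge0 ?all_nseq_ge0.
  + by move=> mu; rewrite inE => /negbTE ->; rewrite mulr0.
- by move=> k mu; rewrite HLQs_ge0 ?all_nseq_ge0.
- by move=> mu; rewrite HLQs_nil.
- by move=> k mu; rewrite HLQs_cons ?all_nseq_ge0.
Qed.

(** P_lambda(1^k), as Q_lambda(1^k) / b_lambda. *)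
Definition hlP (k : nat) la : R := HLQs t (nseq k 1) la / hlb t la.

Lemma hlP_ge0 k la : 0 <= hlP k la.
Proof. by rewrite divr_ge0 ?HLQs_ge0 ?all_nseq_ge0 // ltW // hlb_gt0. Qed.

Lemma hlP0 la : hlP 0 la = (la == part0)%:R.
Proof.
rewrite /hlP HLQs_nil; case: eqP => [->|_]; last by rewrite mul0r.
by rewrite hlb_part0 divr1.
Qed.

Lemma hlP_S k la : \esum_(mu in [set: int_partition]) (psi t la mu * hlP k mu)%:E = (hlP k.+1 la)%:E.
Proof.
rewrite /hlP [X in (X / _)%:E](_ : _ = HLQs t (1 :: nseq k 1) la) // mulrC EFinM.
have b0 := ltW (hlb_gt0 t01 la).
rewrite -HLQs_cons ?all_nseq_ge0 // -esumZ ?invr_ge0 //; last first.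
  by move=> mu; rewrite lee_fin mulr_ge0 ?skewQ1_ge0 ?HLQs_ge0 ?all_nseq_ge0.
apply: eq_esum => mu _; rewrite -EFinM; congr EFin.
transitivity (psi t la mu / hlb t mu * HLQs t (nseq k 1) mu); first by ring.
by rewrite -(skewQ1_psi t01); ring.
Qed.

Lemma HLQs_homog n la : HLQs t (nseq n z) la = z ^+ psize la * HLQs t (nseq n 1) la.
Proof.
have z0 : 0 <= z by case/andP: z01 => /ltW.
elim: n la => [|n IH] la.
  by rewrite !HLQs_nil; case: eqP => [->|_]; rewrite ?mulr0 // expr0 mul1r.
apply: EFin_inj; rewrite -[nseq _ z]/(z :: nseq n z) -[nseq _ 1]/(1 :: nseq n 1) EFinM.
rewrite -!HLQs_cons ?all_nseq_ge0 // -esumZ ?exprn_ge0 //; last first.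
  by move=> mu; rewrite lee_fin mulr_ge0 ?skewQ1_ge0 ?HLQs_ge0 ?all_nseq_ge0.
apply: eq_esum => mu _; rewrite -EFinM; congr EFin; rewrite IH.
have [il|nil] := pselect (interlace la mu); last by rewrite !skewQ1_not_interlace // !mul0r mulr0.
have le : (psize mu <= psize la)%N.
  have hm := interlace_head il.
  rewrite (psize_lcol (leqnn (head 0%N la))) (psize_lcol hm); apply: leq_sum => j _.
  by have /andP[] := (interlaceP _ _).1 il j.
rewrite /skewQ1 expr1n -{2}(subnK le) exprD; ring.
Qed.

Definition hllaw (k n : nat) la : R :=
  (hlgamma t z)^-1 ^+ (n * k) * (hlP k la * HLQs t (nseq n z) la).

(** By homogeneity the weight is z^|lambda| Q_lambda(1^n) Q_lambda(1^k) / b_lambda. *)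
Lemma hllaw_sym k n la : hllaw k n la = hllaw n k la.
Proof. by rewrite /hllaw /hlP mulnC !HLQs_homog; congr (_ * _); ring. Qed.

Lemma hlgamma_gt0 : 0 < hlgamma t z.
Proof.
case/andP: t01 => t0 t1; case/andP: z01 => z0 z1.
rewrite divr_gt0 ?subr_gt0 // (lt_trans _ z1) // gtr_pMl //.
Qed.

Lemma hllaw_ge0 k n la : 0 <= hllaw k n la.
Proof.
have z0 : 0 <= z by case/andP: z01 => /ltW.
by rewrite mulr_ge0 ?exprn_ge0 ?invr_ge0 ?(ltW hlgamma_gt0) // mulr_ge0 ?hlP_ge0 ?HLQs_ge0 ?all_nseq_ge0.
Qed.

Lemma HLprob_law (M N k : nat) (P : int_partition -> bool) : (k <= M)%N ->
  HLprob t z N [set l : M.-tuple int_partition | P (chain_at l k)] =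
  \esum_(la in [set: int_partition]) (if P la then hllaw k N la else 0)%:E.
Proof.
move=> kM; case/andP: z01 => z0 z1; have z0' := ltW z0.
have z01' : 0 <= z < 1 by rewrite z0' z1.
have cE : (1 - z) / (1 - t * z) = (hlgamma t z)^-1 by rewrite /hlgamma invf_div.
have g0 := hlgamma_gt0; have gi0 : 0 <= (hlgamma t z)^-1 by rewrite invr_ge0 ltW.
move: kM => /subnK; set d := (M - k)%N => <-.
rewrite /HLprob esum_mkcond.
pose B la : R := (P la)%:R; pose F := HLQs t (nseq N z).
have B0 la : 0 <= B la by rewrite /B.
have F0 la : 0 <= F la by rewrite HLQs_ge0 ?all_nseq_ge0.
transitivity (((hlgamma t z)^-1 ^+ (N * (d + k)))%:E *
  \esum_(l in [set: (d + k).-tuple int_partition])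
     (chain_weight (psi t) l * (B (chain_at l k) * F (chain_at l (d + k))))%:E)%E.
  rewrite -esumZ ?exprn_ge0 //; last first.
    move=> l; rewrite lee_fin mulr_ge0 ?chain_weight_ge0 //; last by rewrite mulr_ge0.
    by move=> la mu; exact: psi_ge0.
  apply: eq_esum => l _; rewrite -EFinM /B.
  case: ifPn => [/set_mem /= ->|/negP hP]; last first.
    have -> : P (chain_at l k) = false by apply/negP => h; apply: hP; exact/mem_set.
    by rewrite mul0r !mulr0.
  rewrite /HLmass cE HLQ_HLQs // mul1r -mulrA; congr EFin; congr (_ * (_ * _)).
  by apply: eq_bigr => i _; rewrite /skewP1 expr1n mulr1.
rewrite (@esum_chain_marked _ (psi t) hlP _ _ _ _ _ d (hlgamma t z ^+ N) B F) ?exprn_ge0 ?ltW //.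
- rewrite muleA -EFinM -exprM mulnDr exprD.
  have -> : (hlgamma t z)^-1 ^+ (N * d) * (hlgamma t z)^-1 ^+ (N * k) * hlgamma t z ^+ (N * d) =
     (hlgamma t z)^-1 ^+ (N * k).
    by rewrite mulrAC -exprMn mulVf ?expr1n ?mul1r // gt_eqF.
  rewrite -esumZ ?exprn_ge0 //; last by move=> la; rewrite lee_fin mulr_ge0 ?hlP_ge0 // mulr_ge0.
  apply: eq_esum => la _; rewrite -EFinM /hllaw /B /F; case: (P la); rewrite ?mul1r //.
  by rewrite mul0r !mulr0.
- by move=> la mu; exact: psi_ge0.
- by move=> n la; exact: hlP_ge0.
- by move=> la; exact: hlP0.
- by move=> n la; exact: hlP_S.
- move=> mu; rewrite /F (skew_cauchy t01) ?all_nseq ?z01' ?orbT //.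
  by congr (_ * _)%:E; rewrite big_nseq iter_mulr_1.
Qed.

End hl_law.

(** * The determinantal expectation *)

Section esum_limits.
Variable R : realType.

(** For coefficients of both signs: the negative terms are moved to the other side, and finiteness
    allows the subtraction. *)
Lemma esum_lincomb (T : choiceType) (I : finType) (F : T -> R) (G : I -> T -> R) (c s : I -> R) :
  (forall x, 0 <= F x) -> (forall i x, 0 <= G i x) ->
  (forall x, F x = \sum_i c i * G i x) ->
  (forall i, \esum_(x in [set: T]) (G i x)%:E = (s i)%:E) ->
  \esum_(x in [set: T]) (F x)%:E = (\sum_i c i * s i)%:E.
Proof.
move=> F0 G0 FE Gs; pose P i := 0 <= c i.
have sumE (Q : pred I) (b : I -> R) : (forall i, Q i -> 0 <= b i) ->
    \esum_(x in [set: T]) (\sum_(i | Q i) b i * G i x)%:E = (\sum_(i | Q i) b i * s i)%:E.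
  move=> b0; under eq_esum do rewrite -sumEFin.
  rewrite esum_sum; last by move=> x i _ Qi; rewrite lee_fin mulr_ge0 // b0.
  rewrite -sumEFin; apply: eq_bigr => i Qi.
  rewrite EFinM -Gs -esumZ ?b0 // => x; by rewrite lee_fin.
have hp := sumE P c (fun i h => h).
have hn : \esum_(x in [set: T]) (\sum_(i | ~~ P i) - c i * G i x)%:E = (\sum_(i | ~~ P i) - c i * s i)%:E.
  by apply: (sumE _ (fun i => - c i)) => i; rewrite -ltNge oppr_ge0 => /ltW.
have E : (\esum_(x in [set: T]) (F x)%:E + (\sum_(i | ~~ P i) - c i * s i)%:E =
    (\sum_(i | P i) c i * s i)%:E)%E.
  rewrite -hn -hp -esumD; last 2 first.
  - by move=> x _; rewrite lee_fin.
  - by move=> x _; rewrite lee_fin sumr_ge0 // => i; rewrite -ltNge => /ltW h; rewrite mulr_ge0 ?oppr_ge0.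
  apply: eq_esum => x _; rewrite -EFinD; congr EFin.
  rewrite FE (bigID P) /= -addrA -big_split /= [X in _ + X]big1 ?addr0 // => i _; ring.
have : (\esum_(x in [set: T]) (F x)%:E)%E \is a fin_num.
  by move: E; case: (\esum_(x in [set: T]) (F x)%:E).
move=> /fineK fE; rewrite -fE -EFinD in E *; case: E => E; congr EFin.
rewrite (bigID P) /= -E -addrA -big_split /= [X in _ + X]big1 ?addr0 // => i _; ring.
Qed.

Lemma esum_mono_limit (T : choiceType) (f : T -> R) (fp : nat -> T -> R) (S : nat -> R) (l : R) :
  (forall p x, 0 <= fp p x <= f x) -> (forall x, fp p x @[p --> \oo] --> f x) ->
  (forall p, \esum_(x in [set: T]) (fp p x)%:E = (S p)%:E) ->
  S p @[p --> \oo] --> l -> \esum_(x in [set: T]) (f x)%:E = l%:E.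
Proof.
move=> h0 hf hS cS; apply/eqP; rewrite eq_le; apply/andP; split.
  apply: ge_ereal_sup => _ /= [X [fX _] <-].
  have cX : \sum_(x \in X) fp p x @[p --> \oo] --> \sum_(x \in X) f x.
    have H (s : seq T) : \sum_(x <- s) fp p x @[p --> \oo] --> \sum_(x <- s) f x.
      elim: s => [|x s IH]; first by rewrite big_nil; under eq_fun do rewrite big_nil; exact: cvg_cst.
      by rewrite big_cons; under eq_fun do rewrite big_cons; apply: cvgD.
    by rewrite fsbig_finite //=; under eq_fun do rewrite fsbig_finite //=; exact: H.
  rewrite fsumEFin // lee_fin; apply: (ler_cvg_to cX cS); apply: nearW => p.
  rewrite -lee_fin -hS -fsumEFin //; apply: ereal_sup_ubound; exists X => //.
have le p : ((S p)%:E <= \esum_(x in [set: T]) (f x)%:E)%E.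
  by rewrite -hS; apply: le_esum => x _; rewrite lee_fin; case/andP: (h0 p x).
move: le; case: (\esum_(x in [set: T]) (f x)%:E) => [s||] le.
- rewrite lee_fin; apply: (@cvgr_to_le _ _ _ _ _ _ _ cS); apply: nearW => p.
  by have := le p; rewrite lee_fin.
- by rewrite leey.
- by have := le 0%N.
Qed.

End esum_limits.

Section hl_expectation.
Variables (R : realType) (t : R).
Hypothesis t01 : 0 < t < 1.
Let t0 : t != 0. Proof. by case/andP: t01 => h _; rewrite gt_eqF. Qed.
Let qt k : t ^+ k.+1 != 1.
Proof. by case/andP: t01 => h h1; rewrite lt_eqF // exprn_ilt1 // ltW. Qed.

Lemma HLQs_size ys la : all (>= 0) ys -> (size ys < lcol la 0)%N -> HLQs t ys la = 0.
Proof.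
elim: ys la => [|y ys IH] la; first by rewrite HLQs_nil; case: eqP => // ->.
move=> /andP[y0 ys0] h; apply: EFin_inj; rewrite -HLQs_cons // esum1 // => mu _; congr EFin.
have [il|nil] := pselect (interlace la mu); last by rewrite skewQ1_not_interlace ?mul0r.
rewrite IH ?mulr0 //; have /andP[_ h2] := (interlaceP _ _).1 il 0%N.
by move: h; rewrite /=; lia.
Qed.

(** The q-Pochhammer symbol (u; t)_k. *)
Definition qpoch (u : R) (k : nat) : R := \prod_(i < k) (1 - u * t ^+ i).

Lemma qpoch_ge0 u k : u <= 0 -> 0 <= qpoch u k.
Proof.
case/andP: t01 => h _ u0; apply: prodr_ge0 => i _.
by rewrite subr_ge0 (le_trans _ ler01) // mulr_le0_ge0 // exprn_ge0 // ltW.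
Qed.

Lemma colsle_posz (c : seq nat) : sorted geq c -> colsle (head 0%N c)%:Z (map Posz c).
Proof.
have H b : (head 0%N c <= b)%N -> sorted geq c -> colsle b%:Z (map Posz c).
  elim: c b => [|a c IH] b //=; rewrite /colsle /= => ab; rewrite -/(sorted geq (a :: c)) sorted_geq_cons.
  by move=> /andP[ha sc]; rewrite lez_nat ab; exact: (IH a).
exact: H.
Qed.

Lemma head_pcols (la : int_partition) : head 0%N (pcols (head 0%N la) la) = lcol la 0.
Proof. by case E: (head 0%N la) => [|k] //; rewrite [RHS]lcol_eq0 ?E. Qed.

Lemma esum_hlP m ys : all (fun y => 0 <= y < 1) ys ->
  \esum_(la in [set: int_partition]) (hlP t m la * HLQs t ys la)%:E =
  ((\prod_(y <- ys) hlgamma t y) ^+ m)%:E.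
Proof.
move=> hys; have ys0 : all (>= 0) ys by apply: sub_all hys => v /andP[].
have Q0 la : 0 <= HLQs t ys la by exact: HLQs_ge0.
elim: m => [|m IH].
  rewrite (@esum_uniq_seq _ _ [:: part0]) //.
  - by rewrite big_seq1 hlP0 eqxx mul1r expr0 /HLQs hlPsi_nil.
  - by move=> la; rewrite lee_fin mulr_ge0 ?hlP_ge0.
  - by move=> la; rewrite inE hlP0 => /negbTE ->; rewrite mul0r.
transitivity (\esum_(la in [set: int_partition]) \esum_(mu in [set: int_partition])
    (HLQs t ys la * (psi t la mu * hlP t m mu))%:E).
  apply: eq_esum => la _; rewrite mulrC EFinM -hlP_S // -esumZ //.
  by move=> mu; rewrite lee_fin mulr_ge0 ?psi_ge0 ?hlP_ge0.
rewrite esum_swap; last by move=> la mu; rewrite lee_fin mulr_ge0 // mulr_ge0 ?psi_ge0 ?hlP_ge0.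
rewrite exprS EFinM -IH -esumZ; last 2 first.
- by rewrite big_seq prodr_ge0 // => v /(allP hys)/(hlgamma_ge0 t01).
- by move=> mu; rewrite lee_fin mulr_ge0 ?hlP_ge0.
apply: eq_esum => mu _.
transitivity ((hlP t m mu)%:E * \esum_(la in [set: int_partition]) (psi t la mu * HLQs t ys la)%:E)%E.
  rewrite -esumZ ?hlP_ge0 //; last by move=> la; rewrite lee_fin mulr_ge0 ?psi_ge0.
  by apply: eq_esum => la _; rewrite -EFinM; congr EFin; ring.
by rewrite skew_cauchy // -!EFinM; congr EFin; ring.
Qed.

Section distinct.
Variables (n m : nat) (y : 'I_n -> R) (u : R).
Hypothesis y_inj : injective y.
Hypothesis y01 : forall i, 0 < y i < 1.
Hypothesis u0 : u <= 0.
Let y_neq0 i : y i != 0. Proof. by case/andP: (y01 i) => h _; rewrite gt_eqF. Qed.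

Let ysub_ge0 A : all (>= 0) (ysub y A).
Proof. by apply/allP => _ /mapP[i _ ->]; case/andP: (y01 i) => /ltW. Qed.

(** [PsiS_subset] requires lambda'_1 <= n. For longer partitions the subtraction truncates, but both
    sides are 0 since Q_lambda in n variables vanishes. *)
Lemma HLQs_subset la :
  qpoch u (n - lcol la 0) * HLQs t (ysub y [set: 'I_n]) la =
  \sum_(A : {set 'I_n}) (- u) ^+ #|A| * t ^+ 'C(#|A|, 2) * crossS t y A * HLQs t (ysub y (~: A)) la.
Proof.
have szA A : (size (ysub y A) <= n)%N by rewrite size_map -cardE -[X in (_ <= X)%N]card_ord max_card.
have [ln|nl] := leqP (lcol la 0) n; last first.
  rewrite HLQs_size ?(leq_ltn_trans (szA _)) // mulr0 big1 // => A _.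
  by rewrite HLQs_size ?(leq_ltn_trans (szA _)) // mulr0.
rewrite /HLQs; set c := pcols _ _.
have sc : sorted geq c by exact: pcols_sorted.
have hc : head 0 (map Posz c) = (lcol la 0)%:Z by rewrite head_posz head_pcols.
exact: (PsiS_subset t0 qt y_inj y_neq0 u (colsle_posz sc) hc ln).
Qed.

Definition hl_det : R :=
  \det (\matrix_(i < n, j < n) ((1 - t * y i) ^+ m * y i ^+ j -
      u * t ^+ j * ((1 - y i) ^+ m * y i ^+ j))).

(** The Cauchy identity evaluates each term of [HLQs_subset]; the values depend on A through a
    product over its elements, so [det_subset] sums them up. *)
Lemma esum_hl_distinct :
  \esum_(la in [set: int_partition])
    (hlP t m la * (qpoch u (n - lcol la 0) * HLQs t (ysub y [set: 'I_n]) la))%:E =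
  (hl_det / \det (Vandermonde n (\row_i y i)) / \prod_i (1 - y i) ^+ m)%:E.
Proof.
pose c (A : {set 'I_n}) : R := (- u) ^+ #|A| * t ^+ 'C(#|A|, 2) * crossS t y A.
pose s (A : {set 'I_n}) : R := (\prod_(v <- ysub y (~: A)) hlgamma t v) ^+ m.
rewrite (@esum_lincomb _ _ {set 'I_n} _ (fun A la => hlP t m la * HLQs t (ysub y (~: A)) la) c s).
- congr EFin.
  have g0 i : hlgamma t (y i) != 0.
    case/andP: (y01 i) => h h1; case/andP: t01 => th th1.
    by rewrite gt_eqF // divr_gt0 ?subr_gt0 // (lt_trans _ h1) // gtr_pMl.
  have one0 i : 1 - y i != 0 by case/andP: (y01 i) => _ h; rewrite gt_eqF // subr_gt0.
  have tone0 i : 1 - t * y i != 0.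
    by have := g0 i; rewrite /hlgamma mulf_eq0 negb_or => /andP[].
  pose f i : R := (hlgamma t (y i))^-1 ^+ m.
  have sE A : s A = (\prod_i hlgamma t (y i)) ^+ m * \prod_(i in A) f i.
    rewrite /s /ysub big_map big_enum /= (bigID (fun i => i \in A) xpredT) /= exprMn.
    rewrite mulrAC -!prodrXl -big_split /= [X in _ = X * _]big1 ?mul1r => [|i _]; last first.
      by rewrite /f -exprMn mulfV ?expr1n.
    by apply: eq_bigl => i; rewrite inE.
  have E : \sum_(A : {set 'I_n}) c A * s A = (\prod_i hlgamma t (y i)) ^+ m *
      (\sum_(A : {set 'I_n}) c A * \prod_(i in A) f i).
    by rewrite mulr_sumr; apply: eq_bigr => A _; rewrite sE; ring.
  have V0 := det_Vandermonde_neq0 y_inj.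
  have p0 : \prod_i (1 - y i) ^+ m != 0 by apply/prodf_neq0 => i _; rewrite expf_neq0.
  apply: (mulIf p0); rewrite divfK //; apply: (mulIf V0); rewrite divfK // E.
  have D := det_subset t0 y_inj u f; rewrite -/c in D.
  transitivity ((\prod_i hlgamma t (y i)) ^+ m * (\prod_i (1 - y i) ^+ m) *
    (\sum_(A : {set 'I_n}) c A * \prod_(i in A) f i * \det (Vandermonde n (\row_i y i)))).
    by rewrite -mulr_suml; ring.
  rewrite -mulr_suml -D -prodrXl -big_split /=.
  have -> : \prod_i (hlgamma t (y i) ^+ m * (1 - y i) ^+ m) = \det (diag_mx (\row_i (1 - t * y i) ^+ m)).
    rewrite det_diag; apply: eq_bigr => i _; rewrite mxE -exprMn /hlgamma divfK //.
  rewrite -det_mulmx /hl_det; congr determinant; apply/matrixP => i j.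
  rewrite mul_diag_mx !mxE /f /hlgamma invf_div exprMn [(t * y i) ^+ j]exprMn exprVn.
  by field; rewrite expf_neq0.
- move=> la; rewrite mulr_ge0 ?hlP_ge0 // mulr_ge0 ?qpoch_ge0 // HLQs_ge0 //.
- by move=> A la; rewrite mulr_ge0 ?hlP_ge0 // HLQs_ge0.
- move=> la; rewrite HLQs_subset mulr_sumr; apply: eq_bigr => A _.
  by rewrite /c; ring.
- move=> A; rewrite esum_hlP //; apply/allP => _ /mapP[i _ ->].
  by case/andP: (y01 i) => h ->; rewrite ltW.
Qed.

End distinct.
End hl_expectation.

(** * From distinct to equal variables *)

Section hlPsi_limits.
Variables (R : realType) (t : R).
Hypothesis t01 : 0 < t < 1.

Lemma hlAB_cvg (y : nat -> R) (y' : R) (f : nat -> seq int -> R) f' c :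
  y p @[p --> \oo] --> y' -> (forall d, f p d @[p --> \oo] --> f' d) ->
  hlA t (y p) (f p) c @[p --> \oo] --> hlA t y' f' c /\
  hlB t (y p) (f p) c @[p --> \oo] --> hlB t y' f' c.
Proof.
move=> cy; elim: c f f' => [|a c IH] f f' cf.
  by split; [exact: cf|exact: cvg_cst].
have [h1 h2] := IH (fun p d => f p (a :: d)) (fun d => f' (a :: d)) (fun d => cf (a :: d)).
have [h3 h4] := IH (fun p d => f p (a - 1 :: d)) (fun d => f' (a - 1 :: d)) (fun d => cf (a - 1 :: d)).
split; first exact: (cvgD h1 h2).
apply: (cvgM cy); apply: cvgD; last exact: h4.
by apply: cvgM; [exact: cvg_cst|exact: h3].
Qed.

Lemma hlPsi_cvg (I : Type) (s : seq I) (Y : nat -> I -> R) (Y' : I -> R) c :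
  (forall i, Y p i @[p --> \oo] --> Y' i) ->
  hlPsi t [seq Y p i | i <- s] c @[p --> \oo] --> hlPsi t [seq Y' i | i <- s] c.
Proof.
move=> cY; elim: s c => [|i s IH] c; first exact: cvg_cst.
have [h1 h2] := hlAB_cvg c (cY i) IH.
exact: (cvgD h1 h2).
Qed.

Lemma skewQ1_mono la mu y y' : 0 <= y -> y <= y' -> skewQ1 t la mu y <= skewQ1 t la mu y'.
Proof.
move=> y0 yy; have p0 : 0 <= phi t la mu.
  by rewrite /phi; case: asboolP => // _; apply: prodr_ge0 => j _; exact: expr_t_le1.
by rewrite /skewQ1 ler_wpM2l // lerXn2r ?nnegrE // (le_trans y0).
Qed.

Lemma HLQs_mono (I : Type) (s : seq I) (Y Y' : I -> R) la :
  (forall i, 0 <= Y i) -> (forall i, Y i <= Y' i) ->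
  HLQs t [seq Y i | i <- s] la <= HLQs t [seq Y' i | i <- s] la.
Proof.
move=> Y0 YY; have Y0' i : 0 <= Y' i by apply: le_trans (YY i).
have a0 (Z : I -> R) (s' : seq I) : (forall i, 0 <= Z i) -> all (>= 0) [seq Z i | i <- s'].
  by move=> Z0; elim: s' => //= i s' ->; rewrite Z0.
elim: s la => [|i s IH] la //=.
rewrite -lee_fin -!HLQs_cons ?a0 //; apply: le_esum => mu _; rewrite lee_fin.
by rewrite ler_pM ?skewQ1_ge0 ?HLQs_ge0 ?a0 // skewQ1_mono.
Qed.

End hlPsi_limits.

Section companion_limits.
Variables (R : realType) (n : nat).

Lemma coef_prod_XsubC_cvg (I : Type) (s : seq I) (x : nat -> I -> R) (x' : I -> R) k :
  (forall i, x p i @[p --> \oo] --> x' i) ->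
  (\prod_(i <- s) ('X - (x p i)%:P))`_k @[p --> \oo] --> (\prod_(i <- s) ('X - (x' i)%:P))`_k.
Proof.
move=> cx; elim: s k => [|i s IH] k.
  by rewrite big_nil; under eq_fun do rewrite big_nil; exact: cvg_cst.
have E (y : I -> R) : (\prod_(i <- i :: s) ('X - (y i)%:P))`_k =
    (if k is k'.+1 then (\prod_(i <- s) ('X - (y i)%:P))`_k' else 0) -
    (\prod_(i <- s) ('X - (y i)%:P))`_k * y i.
  by rewrite big_cons mulrC mulrBr coefB coefMX coefMC; case: k.
rewrite E; under eq_fun do rewrite E.
apply: cvgB; last by apply: cvgM.
by case: k {E} => [|k]; [exact: cvg_cst|exact: IH].
Qed.

Lemma compan_cvg (P : nat -> {poly R}) (P' : {poly R}) :
  (forall k, (P p)`_k @[p --> \oo] --> P'`_k) -> mcvg (fun p => compan n (P p)) (compan n P').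
Proof.
move=> cP i j; under eq_fun do rewrite mxE; rewrite mxE.
by case: eqP => _; [apply: cvgN|exact: cvg_cst].
Qed.

Lemma horner_mx_cvg (A : nat -> 'M[R]_n.+1) A' (q : {poly R}) :
  mcvg A A' -> mcvg (fun p => horner_mx (A p) q) (horner_mx A' q).
Proof.
move=> cA; elim/poly_ind: q => [|q c IH].
  move=> i j; under eq_fun do rewrite rmorph0; rewrite rmorph0; exact: cvg_cst.
have E B : horner_mx B (q * 'X + c%:P) = horner_mx B q *m B + c%:M.
  by rewrite rmorphD rmorphM /= horner_mx_X horner_mx_C.
move=> i j; rewrite E; under eq_fun do rewrite E.
by apply: mcvgD; [apply: mcvgM|exact: mcvg_cst].
Qed.

End companion_limits.

Section confluent.
Variables (R : realType) (t z u : R) (n m : nat).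
Hypothesis t01 : 0 < t < 1.
Hypothesis z01 : 0 < z < 1.
Hypothesis u0 : u <= 0.
Let z0 : 0 < z. Proof. by case/andP: z01. Qed.

Let ptpoly : {poly R} := (1 - (t * z) *: 'X) ^+ m.
Let p1poly : {poly R} := (1 - z *: 'X) ^+ m.

Let xroots (x : 'I_n.+1 -> R) : {poly R} := \prod_(i <- enum 'I_n.+1) ('X - (x i)%:P).

(** The points enter only through the coefficients of [xroots], so that the expression stays
    continuous when they collide. *)
Definition qdetx (x : 'I_n.+1 -> R) : R :=
  \det (horner_mx (compan n (xroots x)) ptpoly -
        u *: (dpow n t *m horner_mx (compan n (xroots x)) p1poly)).

Lemma hl_det_qdetx (x : 'I_n.+1 -> R) : injective x ->
  hl_det t m (fun i => z * x i) u / \det (Vandermonde n.+1 (\row_i (z * x i))) = qdetx x.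
Proof.
move=> xi; set Q := xroots x.
have sQ : size Q = n.+2 by rewrite /Q /xroots size_prod_XsubC size_enum_ord.
have mQ : Q \is monic by exact: monic_prod_XsubC.
set xr : 'rV[R]_n.+1 := \row_i x i.
have rx i : root Q (xr 0 i) by rewrite mxE /Q /xroots -(big_map x xpredT (fun a => 'X - a%:P)) root_prod_XsubC map_f // mem_enum.
set W := Vandermonde n.+1 xr.
set Dz : 'M[R]_n.+1 := diag_mx (\row_(j < n.+1) z ^+ j).
have VE : Vandermonde n.+1 (\row_i (z * x i)) = Dz *m W.
  by apply/matrixP => i j; rewrite mul_diag_mx !mxE exprMn.
have hp (a b : R) : ((1 - a *: 'X) ^+ m).[b] = (1 - a * b) ^+ m by rewrite horner_exp !hornerE.
have hE : hl_det t m (fun i => z * x i) u = \det (Dz *m ((horner_mx (compan n Q) ptpoly -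
        u *: (dpow n t *m horner_mx (compan n Q) p1poly)) *m W)).
  rewrite /hl_det -det_tr; congr determinant; apply/matrixP => j i.
  rewrite mul_diag_mx mulmxBl -scalemxAl -mulmxA !(compan_vandermonde sQ mQ _ rx).
  rewrite /dpow mul_diag_mx !mul_mx_diag !mxE !hp exprMn -[t * z * x i]mulrA.
  by set v := _ ^+ m; set w := (1 - z * x i) ^+ m; ring.
rewrite hE VE !det_mulmx.
have W0 : \det W != 0 by exact: det_Vandermonde_neq0.
have D0 : \det Dz != 0.
  by rewrite det_diag; apply/prodf_neq0 => j _; rewrite mxE expf_neq0 // gt_eqF.
rewrite /qdetx -/Q; set X := \det (_ - _); field.
by rewrite W0 D0.
Qed.

(** Distinct points of ]0, 1[ that all tend to 1; the denominator exceeds every numerator i + 1. *)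
Let xp (p : nat) (i : 'I_n.+1) : R := 1 - i.+1%:R / (p + n.+2)%:R.

Let xp01 p i : 0 < xp p i < 1.
Proof.
have d0 : 0 < (p + n.+2)%:R :> R by rewrite ltr0n addnS.
rewrite /xp; apply/andP; split; last by rewrite ltrBlDr ltrDl divr_gt0 // ltr0n.
rewrite subr_gt0 ltr_pdivrMr // mul1r ltr_nat.
by have := ltn_ord i; lia.
Qed.

Let xp_inj p : injective (xp p).
Proof.
move=> i j; rewrite /xp => /addrI/oppr_inj/divIf h; apply/val_inj.
have : i.+1%:R = j.+1%:R :> R by apply: h; rewrite pnatr_eq0 addnS.
by move/eqP; rewrite eqr_nat eqSS => /eqP.
Qed.

Let xp_cvg i : xp p i @[p --> \oo] --> (1 : R).
Proof.
rewrite -[X in _ --> X](subr0 1); apply: cvgB; first exact: cvg_cst.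
rewrite -(mulr0 (i.+1%:R)); apply: cvgM; first exact: cvg_cst.
have h : (fun p : nat => (p.+1%:R : R)^-1) @ \oo --> (0 : R) by exact: cvg_harmonic.
have := (cvg_shiftn n.+1 (fun p : nat => (p.+1%:R : R)^-1) (nbhs (0 : R))).
move=> E; have : (fun p : nat => ((p + n.+1).+1%:R : R)^-1) @ \oo --> (0 : R) by rewrite E.
by under eq_fun do rewrite -addnS.
Qed.

Let yp p i := z * xp p i.

Lemma qdetx_cvg : qdetx (xp p) @[p --> \oo] --> qdet z n m t u.
Proof.
have XE : xroots (fun=> 1) = ('X - 1) ^+ n.+1.
  by rewrite /xroots big_const_seq count_predT size_enum_ord iter_mulr mulr1 polyC1.
have cM : mcvg (fun p => compan n (xroots (xp p))) (ucompan R n).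
  rewrite /ucompan -XE; apply: compan_cvg => k.
  by apply: coef_prod_XsubC_cvg => i; exact: xp_cvg.
have h1 := @horner_mx_cvg _ _ _ _ ptpoly cM; have h2 := @horner_mx_cvg _ _ _ _ p1poly cM.
have h3 := mcvgD h1 (mcvgZ (cvg_cst (- u)) (mcvgM (@mcvg_cst _ _ _ (dpow n t)) h2)).
have E (A B : 'M[R]_n.+1) : A - u *: B = A + (- u) *: B by rewrite scaleNr.
rewrite /qdetx /qdet E; under eq_fun do rewrite E.
exact: (mcvg_det (h3 _)).
Qed.

(** The variables approach z from below, so each summand is bounded by its limit ([HLQs_mono]), as
    [esum_mono_limit] asks. *)
Lemma esum_hl_qdet :
  \esum_(la in [set: int_partition])
    (hlP t m la * (qpoch t u (n.+1 - lcol la 0) * HLQs t (nseq n.+1 z) la))%:E =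
  (qdet z n m t u / (1 - z) ^+ (m * n.+1))%:E.
Proof.
have yp01 p i : 0 < yp p i < 1.
  case/andP: (xp01 p i) => h1 h2; case/andP: z01 => h3 h4; rewrite mulr_gt0 //=.
  by rewrite -[ltRHS]mulr1 ltr_pM // ltW.
have yp_inj p : injective (yp p) by move=> i j /mulfI h; apply: (@xp_inj p); apply: h; rewrite gt_eqF.
pose sT : {set 'I_n.+1} := [set: 'I_n.+1]%SET.
have nE : nseq n.+1 z = [seq (fun=> z) i | i <- enum sT].
  have H (s : seq 'I_n.+1) : nseq (size s) z = [seq (fun=> z) i | i <- s] by elim: s => //= i s ->.
  by rewrite -H -cardE cardsT card_ord.
have yz p i : yp p i <= z by rewrite /yp ger_pMr //; case/andP: (xp01 p i) => _ /ltW.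
pose g (Y : seq R) la := hlP t m la * (qpoch t u (n.+1 - lcol la 0) * HLQs t Y la).
pose f la := g (nseq n.+1 z) la.
apply: (@esum_mono_limit _ _ f (fun p la => g (ysub (yp p) sT) la)
  (fun p => qdetx (xp p) / \prod_(i < n.+1) (1 - yp p i) ^+ m)).
- move=> p la; rewrite /f /g; apply/andP; split.
    rewrite mulr_ge0 ?hlP_ge0 // mulr_ge0 ?qpoch_ge0 // HLQs_ge0 //.
    by apply/allP => _ /mapP[i _ ->]; case/andP: (yp01 p i) => /ltW.
  rewrite ler_wpM2l ?hlP_ge0 // ler_wpM2l ?qpoch_ge0 // nE /ysub; apply: (@HLQs_mono _ _ t01 _ _ (yp p) (fun=> z)) => // i.
  by case/andP: (yp01 p i) => /ltW.
- move=> la; apply: cvgM; first exact: cvg_cst.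
  apply: cvgM; first exact: cvg_cst.
  rewrite nE /HLQs /ysub; apply: (@hlPsi_cvg _ _ _ _ yp (fun=> z)) => i; rewrite -[X in _ --> X](mulr1 z).
  by apply: cvgM; [exact: cvg_cst|exact: xp_cvg].
- move=> p; rewrite /g (esum_hl_distinct t01 m (@yp_inj p) (yp01 p) u0) -(hl_det_qdetx (@xp_inj p)).
  by [].
apply: cvgM; first exact: qdetx_cvg.
have -> : (1 - z) ^+ (m * n.+1) = \prod_(i < n.+1) (1 - z) ^+ m.
  by rewrite prodr_const card_ord exprM.
apply: cvgV.
  by rewrite prodr_const expf_neq0 // expf_neq0 // gt_eqF // subr_gt0; case/andP: z01.
apply: cvg_prodr => i; apply: cvg_exprn; apply: cvgB; first exact: cvg_cst.
by rewrite -[X in _ --> X](mulr1 z); apply: cvgM; [exact: cvg_cst|exact: xp_cvg].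
Qed.

End confluent.

Section hllaw_qdet.
Variables (R : realType) (t z : R) (n m : nat).
Hypothesis t01 : 0 < t < 1.
Hypothesis z01 : 0 < z < 1.

(** Read off from the Cauchy identity at u = 0 instead of being computed as a determinant. *)
Lemma qdet0 : qdet z n m t 0 = (hlgamma t z * (1 - z)) ^+ (m * n.+1).
Proof.
case/andP: z01 => z0 z1; have one0 : 1 - z != 0 by rewrite gt_eqF // subr_gt0.
have := @esum_hl_qdet R t z 0 n m t01 z01 (lexx 0).
rewrite (eq_esum (b := fun la => (hlP t m la * HLQs t (nseq n.+1 z) la)%:E)); last first.
  by move=> la _; rewrite /qpoch big1 ?mul1r // => i _; rewrite mul0r subr0.
rewrite esum_hlP ?all_nseq ?(ltW z0) ?z1 ?orbT // big_nseq iter_mulr_1 => -[] h.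
rewrite exprMn mulnC exprM h mulnC divfK // expf_neq0 //.
Qed.

Lemma qdet0_neq0 : qdet z n m t 0 != 0.
Proof.
rewrite qdet0 expf_neq0 // mulf_neq0 ?(gt_eqF (hlgamma_gt0 t01 z01)) //.
by rewrite gt_eqF // subr_gt0; case/andP: z01.
Qed.

Lemma esum_hllaw u : u <= 0 ->
  \esum_(la in [set: int_partition]) (hllaw t z m n.+1 la * qpoch t u (n.+1 - lcol la 0))%:E =
  (qdet z n m t u / qdet z n m t 0)%:E.
Proof.
move=> u0; have z0 : 0 <= z by case/andP: z01 => /ltW.
have g0 := hlgamma_gt0 t01 z01.
have one0 : 1 - z != 0 by case/andP: z01 => _ h; rewrite gt_eqF // subr_gt0.
transitivity (((hlgamma t z)^-1 ^+ (n.+1 * m))%:E * \esum_(la in [set: int_partition])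
    (hlP t m la * (qpoch t u (n.+1 - lcol la 0) * HLQs t (nseq n.+1 z) la))%:E)%E.
  rewrite -esumZ ?exprn_ge0 ?invr_ge0 ?(ltW g0) //; last first.
    by move=> la; rewrite lee_fin mulr_ge0 ?hlP_ge0 // mulr_ge0 ?qpoch_ge0 // HLQs_ge0 ?all_nseq_ge0.
  by apply: eq_esum => la _; rewrite -EFinM /hllaw; congr EFin; ring.
rewrite esum_hl_qdet // -EFinM exprVn qdet0 [(n.+1 * m)%N]mulnC [(hlgamma t z * (1 - z)) ^+ _]exprMn; congr EFin.
have a0 : hlgamma t z ^+ (m * n.+1) != 0 by rewrite expf_neq0 // gt_eqF.
have b0 : (1 - z) ^+ (m * n.+1) != 0 by rewrite expf_neq0.
by set a := hlgamma t z ^+ _; set b := (1 - z) ^+ _; rewrite invfM; ring.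
Qed.

End hllaw_qdet.

(** * From expectations to probabilities *)

Section gap_probability.
Variables (R : realType) (t z : R) (n m : nat).
Hypothesis t01 : 0 < t < 1.
Hypothesis z01 : 0 < z < 1.
Hypothesis nm : (n < m)%N.
Let t0 : 0 < t. Proof. by case/andP: t01. Qed.
Let t1 : t < 1. Proof. by case/andP: t01. Qed.

Notation kd := (kdet z n m).
Notation law := (hllaw t z m n.+1).
Notation qp := (qpoch t).
Definition hlh (la : int_partition) : nat := (n.+1 - lcol la 0)%N.

Let law_ge0 la : 0 <= law la. Proof. exact: hllaw_ge0. Qed.

(** Tail probability of n - lambda'_1 as a real number; [hlgeE] shows that [fine] loses nothing. *)
Definition hlge (c : nat) : R :=
  fine (\esum_(la in [set: int_partition]) (if (c <= hlh la)%N then law la else 0)%:E).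

Lemma esum_hllaw1 : \esum_(la in [set: int_partition]) (law la)%:E = 1%:E.
Proof.
have := @esum_hllaw R t z n m t01 z01 0 (lexx 0).
rewrite divff ?qdet0_neq0 // => <-; apply: eq_esum => la _.
by rewrite /qpoch big1 ?mulr1 // => i _; rewrite mul0r subr0.
Qed.

Lemma hlgeE c : \esum_(la in [set: int_partition]) (if (c <= hlh la)%N then law la else 0)%:E =
  (hlge c)%:E.
Proof.
rewrite /hlge fineK //; set X := \esum_(_ in _) _.
have X0 : (0 <= X)%E by apply: esum_ge0 => la _; rewrite lee_fin; case: ifP.
have X1 : (X <= 1%:E)%E.
  by rewrite -esum_hllaw1; apply: le_esum => la _; rewrite lee_fin; case: ifP.
by move: X0 X1; case: X.
Qed.

Lemma hlge_ge0 c : 0 <= hlge c.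
Proof. by rewrite -lee_fin -hlgeE; apply: esum_ge0 => la _; rewrite lee_fin; case: ifP. Qed.

Lemma qpoch_split u b L : (b <= L)%N -> qp u L = qp u b * \prod_(b <= l < L) (1 - u * t ^+ l).
Proof. by move=> bL; rewrite /qpoch -!(big_mkord xpredT (fun l => 1 - u * t ^+ l)) (@big_cat_nat _ _ _ b). Qed.

Lemma qpoch_fac_ge1 u l : u <= 0 -> 1 <= 1 - u * t ^+ l.
Proof. by move=> u0; rewrite lerDl oppr_ge0 mulr_le0_ge0 // exprn_ge0 // ltW. Qed.

Lemma qpoch_gt0 u b : u <= 0 -> 0 < qp u b.
Proof.
move=> u0; apply: prodr_gt0 => l _; exact: lt_le_trans ltr01 (qpoch_fac_ge1 _ u0).
Qed.

Lemma qpoch_mono u b L : u <= 0 -> (b <= L)%N -> qp u b <= qp u L.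
Proof.
move=> u0 bL; rewrite (qpoch_split u bL) ler_peMr ?(ltW (qpoch_gt0 _ u0)) //.
elim/big_ind: _ => // [x y x1 y1|l _]; last exact: qpoch_fac_ge1.
by rewrite -[1]mulr1 ler_pM.
Qed.

(** Each factor 1 + v is at most exp v, and the exponents form a geometric series. *)
Lemma qpoch_tail u b L : u <= 0 -> qp u L <= qp u b * expR (- u * t ^+ b / (1 - t)).
Proof.
move=> u0; have e1 : 1 <= expR (- u * t ^+ b / (1 - t)).
  by rewrite -[X in X <= _]expR0 ler_expR divr_ge0 ?subr_ge0 ?(ltW t1) // mulr_ge0 ?oppr_ge0 // exprn_ge0 // ltW.
have [Lb|bL] := leqP L b.
  by apply: le_trans (qpoch_mono u0 Lb) _; rewrite ler_peMr // ltW // qpoch_gt0.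
rewrite (qpoch_split u (ltnW bL)) ler_wpM2l ?(ltW (qpoch_gt0 _ u0)) //.
have le1 : \prod_(b <= l < L) (1 - u * t ^+ l) <= \prod_(b <= l < L) expR (- u * t ^+ l).
  apply: ler_prod => l _; rewrite (le_trans ler01 (qpoch_fac_ge1 _ u0)) /=.
  by have := expR_ge1Dx (- u * t ^+ l); rewrite mulNr.
apply: le_trans le1 _; rewrite -expR_sum ler_expR -mulr_sumr -mulrA ler_wpM2l ?oppr_ge0 //.
rewrite ler_pdivlMr ?subr_gt0 //.
have tel : (\sum_(b <= l < L) t ^+ l) * (1 - t) = t ^+ b - t ^+ L.
  elim: L {e1} bL => // L IH; rewrite ltnS leq_eqVlt => /predU1P[->|bL].
    by rewrite big_nat1 exprS; ring.
  by rewrite big_nat_recr /= ?(ltnW bL) // mulrDl IH // exprS; ring.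
by rewrite tel gerBl exprn_ge0 // ltW.
Qed.

Definition hlE u : R := qdet z n m t u / qdet z n m t 0.

Lemma hlE_ge_prob u c : u <= 0 -> hlge c * qp u c <= hlE u.
Proof.
move=> u0; rewrite -lee_fin /hlE -(esum_hllaw n m t01 z01 u0) mulrC EFinM -hlgeE -esumZ; last 2 first.
- by rewrite ltW // qpoch_gt0.
- by move=> la; rewrite lee_fin; case: ifP.
apply: le_esum => la _; rewrite -EFinM lee_fin; case: ifP => h; last first.
  by rewrite mulr0 mulr_ge0 // ltW // qpoch_gt0.
by rewrite mulrC ler_wpM2l // qpoch_mono.
Qed.

Lemma hlE_le_prob u c : u <= 0 -> hlE u <= qp u c + hlge c * qp u n.+1.
Proof.
move=> u0; rewrite -lee_fin /hlE -(esum_hllaw n m t01 z01 u0) EFinD.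
rewrite -[X in (X%:E + _)%E]mulr1 EFinM -esum_hllaw1 [hlge c * _]mulrC EFinM -hlgeE.
have p0 b : 0 <= qp u b by rewrite ltW // qpoch_gt0.
rewrite -!esumZ //; last by move=> la; rewrite lee_fin; case: ifP.
rewrite -esumD; last 2 first.
- by move=> la _; rewrite mule_ge0 ?lee_fin.
- by move=> la _; rewrite mule_ge0 ?lee_fin //; case: ifP.
apply: le_esum => la _; rewrite -!EFinM -EFinD lee_fin.
have hn : (hlh la <= n.+1)%N by rewrite leq_subr.
case: ifP => h; last first.
  by rewrite mulr0 addr0 mulrC ler_wpM2r // qpoch_mono // ltnW // ltnNge h.
apply: le_trans (_ : qp u n.+1 * law la <= _); last by rewrite lerDr mulr_ge0.
by rewrite mulrC ler_wpM2r // qpoch_mono.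
Qed.

Let gu (u : R) (l : nat) : R := 1 - (1 - u * t ^+ l)^-1.

Let gu01 u l : u <= 0 -> 0 <= gu u l <= 1.
Proof.
move=> u0; have h := qpoch_fac_ge1 l u0; have h0 := lt_le_trans ltr01 h.
by rewrite /gu subr_ge0 invf_le1 // h /= gerBl invr_ge0 ltW.
Qed.

(** The factors 1 - u t^l with l >= b cancel exactly against the price 1 - g l paid in
    [kdet_lower]. *)
Lemma hlE_lower u b : u < 0 -> qp u b * kd b (fun=> 1) <= hlE u.
Proof.
move=> u0; have q0 := @qdet0_neq0 R t z n m t01 z01.
have c := @qdet_cvg R z n m z01 nm t u t01 u0 q0.
apply: (@cvgr_to_ge _ _ _ _ _ _ _ c); exists b => // L /= bL.
rewrite -/(qp u L) (qpoch_split u bL) -mulrA ler_wpM2l ?(ltW (qpoch_gt0 _ (ltW u0))) //.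
have h := kdet_lower z01 nm (fun l => gu01 l (ltW u0)) bL.
have P0 : 0 < \prod_(b <= l < L) (1 - u * t ^+ l).
  by apply: prodr_gt0 => l _; exact: lt_le_trans ltr01 (qpoch_fac_ge1 _ (ltW u0)).
rewrite -(ler_pM2l P0) mulrA -big_split /= big1 ?mul1r // in h.
by move=> l _; rewrite /gu subKr mulfV // gt_eqF // (lt_le_trans ltr01) // qpoch_fac_ge1 // ltW.
Qed.

Lemma hlE_upper u b c e : u < 0 -> (forall l, (l < b)%N -> e <= 1 - (1 - u * t ^+ l)^-1) ->
  hlE u <= qp u c * expR (- u * t ^+ c / (1 - t)) * kd b (fun=> e).
Proof.
move=> u0 he; have q0 := @qdet0_neq0 R t z n m t01 z01.
have cv := @qdet_cvg R z n m z01 nm t u t01 u0 q0.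
have k0 L g : (forall l, 0 <= g l <= 1) -> 0 <= kd L g.
  by move=> h; apply: kdet_ge0 => // l; case/andP: (h l).
apply: (@cvgr_to_le _ _ _ _ _ _ _ cv); exists b => // L /= bL.
rewrite -/(qp u L); apply: ler_pM.
- by rewrite ltW // qpoch_gt0 // ltW.
- by apply: k0 => l; apply: gu01; apply: ltW.
- by apply: qpoch_tail; apply: ltW.
- by apply: (kdet_upper z01 nm (fun l => gu01 l (ltW u0)) bL) => l lb; exact: he.
Qed.

Section thresholds.
Variables a s : nat.
Hypothesis sa : (s <= a)%N.
(** At this u the weight of an index l < a - s is within t^s of 1, and the factors of [qpoch] from a
    + s on multiply to at most exp(t^s / (1 - t)); s is a safety margin around the threshold a. *)
Let u : R := - (t ^+ a)^-1.
Let u0 : u < 0. Proof. by rewrite /u oppr_lt0 invr_gt0 exprn_gt0. Qed.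
Let uE l : - u * t ^+ l = t ^+ l / t ^+ a. Proof. by rewrite /u opprK mulrC. Qed.

Let tE : t ^+ (a + s) / t ^+ a = t ^+ s.
Proof. by rewrite exprD mulrAC divff ?mul1r // expf_neq0 // gt_eqF. Qed.

Lemma hlge_upper : hlge (a + s) <= expR (t ^+ s / (1 - t)) * kd (a - s) (fun=> 1 - t ^+ s).
Proof.
have ta0 : t ^+ a != 0 by rewrite expf_neq0 // gt_eqF.
have h1 := hlE_ge_prob (a + s) (ltW u0).
have h2 : hlE u <= qp u (a + s) * expR (- u * t ^+ (a + s) / (1 - t)) * kd (a - s) (fun=> 1 - t ^+ s).
  apply: hlE_upper => // l la; rewrite lerD2l lerN2.
  set v := t ^+ l / t ^+ a.
  have -> : 1 - u * t ^+ l = 1 + v by rewrite -mulNr uE.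
  have tl : t ^+ a = t ^+ (a - l) * t ^+ l by rewrite -exprD subnK //; lia.
  have tl0 : 0 < t ^+ (a - l) by rewrite exprn_gt0.
  have vE : v = (t ^+ (a - l))^-1.
    by rewrite /v tl invfM mulrCA divff ?mulr1 // expf_neq0 // gt_eqF.
  have le : t ^+ (a - l) <= t ^+ s by apply: ler_wiXn2l; rewrite ?ltW //; lia.
  apply: le_trans le; rewrite vE -[X in _ <= X]invrK lef_pV2 ?posrE ?invr_gt0 //.
    by rewrite lerDr.
  by rewrite addr_gt0 ?invr_gt0.
rewrite uE tE in h2.
by have := le_trans h1 h2; rewrite mulrC -mulrA ler_pM2l // qpoch_gt0 // ltW.
Qed.

Lemma hlge_lower : (0 < s)%N -> kd (a + s) (fun=> 1) <= t ^+ s + hlge (a - s) * expR (t ^+ s / (1 - t)).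
Proof.
move=> s0; have ta0 : t ^+ a != 0 by rewrite expf_neq0 // gt_eqF.
have h1 := hlE_lower (a + s) u0; have h2 := hlE_le_prob (a - s) (ltW u0).
have h3 := qpoch_tail (a + s) n.+1 (ltW u0).
rewrite uE tE in h3.
have q0 b : 0 < qp u b by rewrite qpoch_gt0 // ltW.
(* The single factor 1 + t^(- s) of index a - s already gives the gain; as s > 0 it is among the
   first a + s factors. *)
have h4 : qp u (a - s) <= t ^+ s * qp u (a + s).
  have le : (a - s < a + s)%N by lia.
  apply: (@le_trans _ _ (t ^+ s * qp u (a - s).+1)); last first.
    apply: ler_wpM2l; first by rewrite exprn_ge0 // ltW.
    by apply: qpoch_mono => //; apply: ltW.
  rewrite {2}/qpoch big_ord_recr /= -/(qp u (a - s)) mulrCA ler_peMr ?(ltW (q0 _)) //.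
  have -> : 1 - u * t ^+ (a - s) = 1 + t ^+ (a - s) / t ^+ a by rewrite -mulNr uE.
  have tl : t ^+ a = t ^+ s * t ^+ (a - s) by rewrite -exprD subnKC.
  rewrite tl invfM mulrCA [t ^+ (a - s) / _]divff ?mulr1; last by rewrite expf_neq0 // gt_eqF.
  by rewrite mulrDr mulr1 divff ?lerDr ?exprn_ge0 ?ltW // expf_neq0 // gt_eqF.
rewrite -(ler_pM2l (q0 (a + s)%N)); apply: le_trans h1 _.
apply: le_trans h2 _; rewrite mulrDr; apply: lerD; first by rewrite mulrC.
by rewrite mulrCA ler_wpM2l ?hlge_ge0.
Qed.

End thresholds.
End gap_probability.

(** * Asymptotics of the length *)

Section critical_point.
Variables (R : realType) (z n m e0 j0 rho : R).
Hypotheses (z0 : 0 < z) (z_rho : z < rho) (rho1 : rho < 1).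
Hypotheses (n_rho : n * rho ^+ 2 = z * m) (ne : n + e0 = m + j0).

(** rho^2 = z m / n parametrises the double critical point, and [jc] is the critical index. The
    relations below hold exactly for every j0, with d = jc - j0. *)
Let w := (1 - rho) / (rho - z).
Let jc := n * (1 - rho) ^+ 2 / (1 - z).

Let mE : m = n * rho ^+ 2 / z. Proof. by rewrite n_rho mulrC mulKf // gt_eqF. Qed.
Let e0E : e0 = n * rho ^+ 2 / z + j0 - n. Proof. by rewrite -mE -ne; ring. Qed.
Let z_neq0 : z != 0. Proof. by rewrite gt_eqF. Qed.
Let rz0 : rho - z != 0. Proof. by rewrite gt_eqF // subr_gt0. Qed.
Let z10 : 1 - z != 0. Proof. by rewrite gt_eqF // subr_gt0 (lt_trans z_rho). Qed.
Let r0 : rho != 0. Proof. by rewrite gt_eqF // (lt_trans z0). Qed.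
Let wE : 1 + w = (1 - z) / (rho - z). Proof. by rewrite /w; field. Qed.
Let zwE : 1 + z * w = rho * (1 - z) / (rho - z). Proof. by rewrite /w; field. Qed.

Lemma crit1_rho : n * (1 - z) * w / (1 + w) = e0 * z * w + j0 + (jc - j0) * (1 + z * w).
Proof. by rewrite wE zwE e0E /w /jc; field; rewrite ?rz0 ?z10 ?z_neq0. Qed.

Lemma crit2_rho : n * (1 - z) / (1 + w) ^+ 2 = z * (e0 + (jc - j0)).
Proof. by rewrite wE e0E /jc; field; rewrite ?rz0 ?z10 ?z_neq0. Qed.

Lemma kap3_rho : n * ((1 - rho) ^+ 2 * (rho - z) ^+ 2 / (rho * (1 - z) ^+ 3)) =
  n * (1 - z) * w ^+ 2 / ((1 + w) ^+ 3 * (1 + z * w)).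
Proof. by rewrite wE zwE /w; field; rewrite ?rz0 ?z10 ?r0. Qed.

End critical_point.

Section gap_asymptotics.
Variables (R : realType) (t z : R) (n m : nat -> nat) (rho kap : nat -> R) (rinf : R).
Hypothesis t01 : 0 < t < 1.
Hypothesis z01 : 0 < z < 1.
Hypothesis nm : \forall N \near \oo, (0 < n N <= m N)%N.
Hypothesis n_rho : \forall N \near \oo, (n N)%:R * rho N ^+ 2 = z * (m N)%:R.
Hypothesis crho : rho N @[N --> \oo] --> rinf.
Hypothesis rinf01 : z < rinf < 1.
Hypothesis cn : (n N)%:R @[N --> \oo] --> (+oo : set_system R).
Let V (r : R) := (1 - r) ^+ 2 * (r - z) ^+ 2 / (r * (1 - z) ^+ 3).
Hypothesis kap_ge0 : \forall N \near \oo, 0 <= kap N.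
Hypothesis kap3 : \forall N \near \oo, kap N ^+ 3 = (n N)%:R * V (rho N).

Let z0 : 0 < z. Proof. by case/andP: z01. Qed.
Let z1 : z < 1. Proof. by case/andP: z01. Qed.
Let jc N := (n N)%:R * (1 - rho N) ^+ 2 / (1 - z).

Let rho_itv : \forall N \near \oo, z < rho N /\ rho N < 1.
Proof.
by case/andP: rinf01 => h1 h2; near=> N; split; near: N; [exact: (cvgr_gt _ crho)|exact: (cvgr_lt _ crho)].
Unshelve. all: by end_near. Qed.

Let V_gt0 r : z < r -> r < 1 -> 0 < V r.
Proof.
move=> zr r1; rewrite divr_gt0 ?mulr_gt0 ?exprn_gt0 ?subr_gt0 //.
exact: lt_trans z0 zr.
Qed.

Let cV : V (rho N) @[N --> \oo] --> V rinf.
Proof.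
case/andP: rinf01 => h1 h2.
have rn : rinf * (1 - z) ^+ 3 != 0.
  by rewrite gt_eqF // mulr_gt0 ?exprn_gt0 ?subr_gt0 // (lt_trans z0).
by rewrite /V; cvg_arith.
Qed.

Lemma kap_cvgy : kap N @[N --> \oo] --> (+oo : set_system R).
Proof.
case/andP: rinf01 => h1 h2; have Vi := V_gt0 h1 h2.
apply/cvgryPge => A; near=> N.
rewrite leNgt; apply/negP => kA.
have k0 : 0 <= kap N by near: N.
have A0 : 0 <= A by rewrite (le_trans k0) // ltW.
have : kap N ^+ 3 <= A ^+ 3 by rewrite lerXn2r ?nnegrE // ltW.
rewrite (_ : kap N ^+ 3 = (n N)%:R * V (rho N)); last by near: N.
have Vh : V rinf / 2 <= V (rho N).
  by near: N; apply: (cvgr_ge _ cV); rewrite ltr_pdivrMr // ltr_pMr // ltr1n.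
have nA : (A ^+ 3 + 1) / (V rinf / 2) <= (n N)%:R by near: N; exact: (cvgryPge _).1 cn _.
have V20 : 0 < V rinf / 2 by rewrite divr_gt0.
rewrite ler_pdivrMr // in nA => h.
have : (n N)%:R * (V rinf / 2) <= (n N)%:R * V (rho N) by rewrite ler_wpM2l.
lra.
Unshelve. all: by end_near. Qed.

Let kap_gt0 : \forall N \near \oo, 0 < kap N.
Proof.
near=> N; have h : 1 <= kap N by near: N; exact: (cvgryPge _).1 kap_cvgy _.
by rewrite (lt_le_trans ltr01 h).
Unshelve. all: by end_near. Qed.

Lemma jc_ge A : \forall N \near \oo, A * kap N <= jc N.
Proof.
case/andP: rinf01 => h1 h2.
near=> N; have [zr r1] : z < rho N /\ rho N < 1 by near: N.
have r0 : 0 < rho N by exact: lt_trans zr.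
have k0 : 0 < kap N by near: N.
have E : kap N ^+ 3 = jc N * ((rho N - z) ^+ 2 / (rho N * (1 - z) ^+ 2)).
  rewrite (_ : kap N ^+ 3 = (n N)%:R * V (rho N)); last by near: N.
  by rewrite /V /jc; field; rewrite !gt_eqF ?subr_gt0.
have jE : jc N = kap N ^+ 3 * (rho N * (1 - z) ^+ 2 / (rho N - z) ^+ 2).
  rewrite E; field; rewrite !gt_eqF ?subr_gt0 //.
have r2 : rinf / 2 <= rho N.
  near: N; apply: (cvgr_ge _ crho); rewrite ltr_pdivrMr // ltr_pMr ?ltr1n //.
  exact: lt_trans z0 h1.
have ri0 : 0 < rinf / 2 by rewrite divr_gt0 // (lt_trans z0).
have g1 : rinf / 2 <= rho N * (1 - z) ^+ 2 / (rho N - z) ^+ 2.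
  apply: le_trans r2 _; rewrite ler_pdivlMr ?exprn_gt0 ?subr_gt0 // ler_wpM2l ?(ltW r0) //.
  by rewrite lerXn2r ?nnegrE ?subr_ge0 ?(ltW zr) ?(ltW z1) // lerD2r ltW.
have k1 : 1 <= kap N by near: N; exact: (cvgryPge _).1 kap_cvgy _.
have kA : A / (rinf / 2) <= kap N by near: N; exact: (cvgryPge _).1 kap_cvgy _.
rewrite ler_pdivrMr // in kA.
rewrite jE; apply: (@le_trans _ _ (kap N ^+ 3 * (rinf / 2))); last first.
  by rewrite ler_wpM2l // exprn_ge0 // ltW.
apply: (@le_trans _ _ (kap N * (rinf / 2) * kap N)); first by rewrite ler_wpM2r // ltW.
have -> : kap N ^+ 3 * (rinf / 2) = kap N * (rinf / 2) * kap N * kap N by ring.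
by rewrite ler_peMr // (mulr_ge0 (mulr_ge0 (ltW k0) (ltW ri0)) (ltW k0)).
Unshelve. all: by end_near. Qed.

Lemma index_ge (b : nat -> nat) (y A : R) :
  (jc N - (b N)%:R) / kap N @[N --> \oo] --> y ->
  \forall N \near \oo, A * kap N <= (b N)%:R.
Proof.
move=> cb; near=> N.
have k0 : 0 < kap N by near: N.
have h1 : (A + y + 1) * kap N <= jc N by near: N; exact: jc_ge.
have h2 : (jc N - (b N)%:R) / kap N <= y + 1 by near: N; apply: (cvgr_le _ cb); rewrite ltrDl.
rewrite ler_pdivrMr // in h2; lra.
Unshelve. all: by end_near. Qed.

Lemma kap_cvgV : (kap N)^-1 @[N --> \oo] --> (0 : R).
Proof.
apply/cvgrPdist_le => /= e e0; near=> N.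
have k0 : 0 < kap N by near: N.
rewrite sub0r normrN ger0_norm ?invr_ge0 ?(ltW k0) // -[leRHS]invrK lef_pV2 ?posrE ?invr_gt0 //.
by near: N; exact: (cvgryPge _).1 kap_cvgy _.
Unshelve. all: by end_near. Qed.

(** The last index is j0 = b - 1; this shift by one disappears after division by kap. *)
Lemma kdet_cvg_F_GUE (b : nat -> nat) (e : nat -> R) (y : R) :
  e N @[N --> \oo] --> (1 : R) -> (jc N - (b N)%:R) / kap N @[N --> \oo] --> y ->
  kdet z (n N).-1 (m N) (b N) (fun=> e N) @[N --> \oo] --> F_GUE y.
Proof.
move=> ce cb; case/andP: rinf01 => h1 h2.
pose w N := (1 - rho N) / (rho N - z).
have cw : w N @[N --> \oo] --> (1 - rinf) / (rinf - z).
  have rz : rinf - z != 0 by rewrite gt_eqF // subr_gt0.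
  by rewrite /w; cvg_arith.
pose j0 N := (b N).-1; pose e0 N := (m N + j0 N - n N)%N.
have bpos : \forall N \near \oo, (0 < b N)%N.
  near=> N; rewrite -(ltr_nat R).
  have k0 : 0 < kap N by near: N.
  have : 1 * kap N <= (b N)%:R by near: N; exact: index_ge cb.
  by rewrite mul1r; exact: lt_le_trans.
have cd : (jc N - (j0 N)%:R) / kap N @[N --> \oo] --> y.
  have h : (jc N - (b N)%:R) / kap N + (kap N)^-1 @[N --> \oo] --> y + 0 by apply: cvgD; [exact: cb|exact: kap_cvgV].
  rewrite addr0 in h; apply: cvg_trans h; apply: near_eq_cvg; near=> N.
  have b0 : (0 < b N)%N by near: N.
  by rewrite /j0 -[in LHS](prednK b0) -natr1; ring.
(* [hlkernel_det_cvg] wants its hypotheses for all N, so the sequences are shifted by N0. *)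
have [N0 _ good] : \forall N \near \oo, [/\ (0 < n N <= m N)%N,
    (n N)%:R * rho N ^+ 2 = z * (m N)%:R, z < rho N /\ rho N < 1, 0 < kap N /\
    kap N ^+ 3 = (n N)%:R * V (rho N) & (0 < b N)%N].
  by near=> N; split; [near: N|near: N|near: N|split; near: N|near: N].
have {}good N : [/\ (0 < n (N + N0)%N <= m (N + N0)%N)%N,
    (n (N + N0)%N)%:R * rho (N + N0)%N ^+ 2 = z * (m (N + N0)%N)%:R,
    z < rho (N + N0)%N /\ rho (N + N0)%N < 1, 0 < kap (N + N0)%N /\
    kap (N + N0)%N ^+ 3 = (n (N + N0)%N)%:R * V (rho (N + N0)%N) & (0 < b (N + N0)%N)%N].
  by apply: good; rewrite /= leq_addl.
have ne N : (n (N + N0) + e0 (N + N0) = m (N + N0) + j0 (N + N0))%N.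
  by have [/andP[_ le] _ _ _ _] := good N; rewrite /e0; lia.
have neR N : (n (N + N0)%N)%:R + (e0 (N + N0)%N)%:R = (m (N + N0)%N)%:R + (j0 (N + N0)%N)%:R :> R.
  by rewrite -!natrD ne.
have wi0 : 0 < (1 - rinf) / (rinf - z) by rewrite divr_gt0 ?subr_gt0.
have sh (f : nat -> R) (l : set_system R) : f N @[N --> \oo] --> l -> f (N + N0)%N @[N --> \oo] --> l.
  by move=> h; rewrite (cvg_shiftn N0 f l).
have main := @hlkernel_det_cvg R z (fun N => n (N + N0)%N) (fun N => m (N + N0)%N)
  (fun N => e0 (N + N0)%N) (fun N => j0 (N + N0)%N) (fun N => w (N + N0)%N)
  (fun N => jc (N + N0)%N - (j0 (N + N0)%N)%:R) (fun N => kap (N + N0)%N) _ y z01.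
have {}main := main _ _ wi0.
rewrite -(cvg_shiftn N0 (fun N => kdet z (n N).-1 (m N) (b N) (fun=> e N)) (nbhs (F_GUE y))).
have E N : kdet z (n (N + N0)%N).-1 (m (N + N0)%N) (b (N + N0)%N) (fun=> e (N + N0)%N) =
  \det (1%:M - e (N + N0)%N *: \matrix_(i < (j0 (N + N0)%N).+1, j < (j0 (N + N0)%N).+1)
     hlkernel z (n (N + N0)%N) (m (N + N0)%N) (j0 (N + N0)%N - i) (j0 (N + N0)%N - j)).
  have [/andP[n0 _] _ _ _ b0] := good N.
  by rewrite -{1}(prednK b0) kdet_rev -/(j0 _) (prednK n0).
under eq_fun do rewrite E.
apply: main.
- move=> N; have [_ _ [zr r1] _ _] := good N; by rewrite divr_gt0 ?subr_gt0.
- by move=> N; have [_ _ _ [k0 _] _] := good N.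
- by move=> N; have [/andP[_ le] _ _ _ _] := good N.
- exact: ne.
- move=> N; have [_ nr [zr r1] _ _] := good N; exact: (crit1_rho z0 zr r1 nr (neR N)).
- move=> N; have [_ nr [zr r1] _ _] := good N; exact: (crit2_rho z0 zr r1 nr (neR N)).
- move=> N; have [_ nr [zr r1] [_ k3] _] := good N; rewrite k3; exact: (kap3_rho _ z0 zr r1).
- exact: sh cw.
- exact: sh kap_cvgy.
- exact: (sh (fun N => (jc N - (j0 N)%:R) / kap N) _ cd).
- exact: (sh e _ ce).
Unshelve. all: by end_near. Qed.

Lemma hlge_cvg_F_GUE (c : nat -> nat) (y : R) :
  (jc N - (c N)%:R) / kap N @[N --> \oo] --> y ->
  hlge t z (n N).-1 (m N) (c N) @[N --> \oo] --> F_GUE y.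
Proof.
move=> cc; case/andP: (t01) => t0 t1.
(* The margin tends to infinity, which removes the errors t^s, but more slowly than kap, so that
   thresholds moved by 2 s have the same limit. *)
pose s N := Num.truncn (Num.sqrt (kap N)).
have s_itv : \forall N \near \oo, (s N)%:R <= Num.sqrt (kap N) < (s N).+1%:R.
  by near=> N; apply: truncn_itv; rewrite sqrtr_ge0.
have sy (A : R) : \forall N \near \oo, A <= (s N)%:R.
  near=> N; have /andP[_ h] : (s N)%:R <= Num.sqrt (kap N) < (s N).+1%:R by near: N.
  have kA : (`|A| + 1) ^+ 2 <= kap N by near: N; exact: (cvgryPge _).1 kap_cvgy _.
  have A1 : 0 <= `|A| + 1 by rewrite addr_ge0.
  have : `|A| + 1 <= Num.sqrt (kap N).
    by rewrite -[leLHS](ger0_norm A1) -sqrtr_sqr ler_wsqrtr.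
  by have := ler_norm A; move: h; rewrite -natr1; lra.
have sk : (s N)%:R / kap N @[N --> \oo] --> (0 : R).
  apply/cvgrPdist_le => /= e e0; near=> N.
  have k0 : 0 < kap N by near: N.
  have /andP[h _] : (s N)%:R <= Num.sqrt (kap N) < (s N).+1%:R by near: N.
  rewrite sub0r normrN ger0_norm ?divr_ge0 ?(ltW k0) // ler_pdivrMr //.
  apply: le_trans h _; rewrite -{2}[kap N]sqr_sqrtr ?(ltW k0) // expr2 mulrA ler_peMl ?sqrtr_ge0 //.
  rewrite mulrC -ler_pdivrMr // mul1r -[leLHS]ger0_norm ?invr_ge0 ?(ltW e0) // -sqrtr_sqr.
  by apply: ler_wsqrtr; near: N; exact: (cvgryPge _).1 kap_cvgy _.
have s2 : \forall N \near \oo, (2 * s N <= c N)%N.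
  near=> N; rewrite -(ler_nat R) natrM.
  have k0 : 0 < kap N by near: N.
  have h1 : (s N)%:R / kap N <= 1 by near: N; apply: (cvgr_le _ sk).
  rewrite ler_pdivrMr // mul1r in h1.
  have : 2 * kap N <= (c N)%:R by near: N; exact: index_ge cc.
  lra.
have ts : t ^+ s N @[N --> \oo] --> (0 : R).
  apply/cvgrPdist_le => /= e e0.
  have ct : t ^+ k @[k --> \oo] --> (0 : R) by apply: cvg_expr; rewrite ger0_norm // ltW.
  have /cvgrPdist_le/(_ _ e0)[K _ hK] := ct.
  by near=> N; apply: hK; rewrite /= -(ler_nat R); near: N; exact: sy.
have cexp : expR (t ^+ s N / (1 - t)) @[N --> \oo] --> (1 : R).
  rewrite -[X in _ --> X]expR0; apply: cvg_continuous; first exact: continuous_expR.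
  by rewrite -(mul0r (1 - t)^-1); apply: cvgM; [exact: ts|exact: cvg_cst].
have up : expR (t ^+ s N / (1 - t)) * kdet z (n N).-1 (m N) (c N - 2 * s N) (fun=> 1 - t ^+ s N)
    @[N --> \oo] --> F_GUE y.
  rewrite -[X in _ --> X]mul1r; apply: cvgM => //; apply: kdet_cvg_F_GUE.
    by rewrite -[X in _ --> X]subr0; apply: cvgB; [exact: cvg_cst|exact: ts].
  have h : (jc N - (c N)%:R) / kap N + 2 * ((s N)%:R / kap N) @[N --> \oo] --> y + 2 * 0.
    by apply: cvgD => //; apply: cvgM => //; exact: cvg_cst.
  rewrite mulr0 addr0 in h; apply: cvg_trans h; apply: near_eq_cvg; near=> N.
  by rewrite natrB ?natrM; [ring|near: N].
have lo : (kdet z (n N).-1 (m N) (c N + 2 * s N) (fun=> 1) - t ^+ s N) / expR (t ^+ s N / (1 - t))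
    @[N --> \oo] --> F_GUE y.
  have -> : F_GUE y = (F_GUE y - 0) / 1 by rewrite subr0 divr1.
  apply: cvgM; last by apply: cvgV => //; exact: oner_neq0.
  apply: cvgB => //; apply: kdet_cvg_F_GUE; first exact: cvg_cst.
  have h : (jc N - (c N)%:R) / kap N - 2 * ((s N)%:R / kap N) @[N --> \oo] --> y - 2 * 0.
    by apply: cvgB => //; apply: cvgM => //; exact: cvg_cst.
  rewrite mulr0 subr0 in h; apply: cvg_trans h; apply: near_eq_cvg; near=> N.
  by rewrite natrD natrM; ring.
apply: squeeze_cvgr lo up; near=> N.
have s2N : (2 * s N <= c N)%N by near: N.
have nmN : ((n N).-1 < m N)%N by have : (0 < n N <= m N)%N by [near: N]; lia.
have s0 : (0 < s N)%N by rewrite -(ler_nat R); near: N; exact: sy.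
apply/andP; split.
  rewrite ler_pdivrMr ?expR_gt0 // lerBlDl.
  have sa : (s N <= c N + s N)%N by rewrite leq_addl.
  have := @hlge_lower R t z (n N).-1 (m N) t01 z01 nmN (c N + s N) (s N) sa s0.
  by rewrite addnK (_ : c N + s N + s N = c N + 2 * s N)%N //; lia.
have sa : (s N <= c N - s N)%N by lia.
have := @hlge_upper R t z (n N).-1 (m N) t01 z01 nmN (c N - s N) (s N) sa.
by rewrite subnK; [rewrite -subnDA (_ : s N + s N = 2 * s N)%N //; lia|lia].
Unshelve. all: by end_near. Qed.

End gap_asymptotics.

(** * The constants of the limit law *)

Section scaling.
Variable R : realType.

Lemma powR_natn (a p : R) n : 0 <= a -> (a `^ p) ^+ n = a `^ (p * n%:R).
Proof. by move=> a0; rewrite powRrM powR_mulrn // powR_ge0. Qed.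

Lemma cvg_powR (T : Type) (F : set_system T) (FF : Filter F) (f : T -> R) (a p : R) : 0 < a ->
  f x @[x --> F] --> a -> f x `^ p @[x --> F] --> a `^ p.
Proof.
move=> a0 cf; have E c : 0 < c -> c `^ p = expR (p * ln c) by move=> c0; rewrite /powR gt_eqF.
rewrite (E _ a0); have h : expR (p * ln (f x)) @[x --> F] --> expR (p * ln a).
  apply: cvg_continuous; first exact: continuous_expR.
  by apply: cvgM; [exact: cvg_cst|apply: cvg_comp cf _; exact: continuous_ln].
apply: cvg_trans h; apply: near_eq_cvg; near=> x.
by rewrite E //; near: x; exact: (cvgr_gt _ cf).
Unshelve. all: by end_near. Qed.

Lemma cvg_sqrt (T : Type) (F : set_system T) (FF : Filter F) (f : T -> R) (a : R) :
  f x @[x --> F] --> a -> Num.sqrt (f x) @[x --> F] --> Num.sqrt a.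
Proof. by move=> cf; apply: cvg_continuous => //; exact: sqrt_continuous. Qed.

Variable z : R.
Hypothesis z01 : 0 < z < 1.
Let z0 : 0 < z. Proof. by case/andP: z01. Qed.
Let z1 : z < 1. Proof. by case/andP: z01. Qed.
Let one_z : 1 - z != 0. Proof. by rewrite gt_eqF // subr_gt0. Qed.

Lemma sqrt_itv nu : z < nu < z^-1 -> [/\ 0 < nu, z < Num.sqrt (z * nu) < 1,
  z < Num.sqrt (z / nu) < 1 & Num.sqrt (z / nu) * Num.sqrt (z * nu) = z].
Proof.
move=> /andP[h1 h2]; have nu0 : 0 < nu by exact: lt_trans h1.
have zn : z * nu < 1 by rewrite mulrC -ltr_pdivlMr // mul1r.
have zn2 : z / nu < 1 by rewrite ltr_pdivrMr // mul1r.
have sz (c : R) : z ^+ 2 < c -> c < 1 -> z < Num.sqrt c < 1.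
  move=> zc c1; have c0 : 0 < c by apply: le_lt_trans zc; rewrite exprn_ge0 // ltW.
  rewrite -{1}(ger0_norm (ltW z0)) -sqrtr_sqr ltr_sqrt // zc /=.
  by rewrite -[ltRHS]sqrtr1 ltr_sqrt.
split=> //.
- by apply: sz => //; rewrite expr2 ltr_pM2l.
- by apply: sz => //; rewrite expr2 ltr_pM2l // -[ltLHS]invrK ltf_pV2 ?posrE ?invr_gt0.
- rewrite -sqrtrM ?divr_ge0 ?(ltW z0) ?(ltW nu0) //.
  have -> : z / nu * (z * nu) = z ^+ 2 by field; rewrite gt_eqF.
  by rewrite sqrtr_sqr ger0_norm // ltW.
Qed.

Lemma sigma_mu_gt0 nu : z < nu < z^-1 -> 0 < sigma_mu z nu.
Proof.
move=> /sqrt_itv[nu0 /andP[_ h1] /andP[_ h2] _].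
by rewrite /sigma_mu divr_gt0 ?mulr_gt0 ?powR_gt0 ?subr_gt0 // mulr_gt0.
Qed.

Lemma sigma_mu3 nu : z < nu < z^-1 -> sigma_mu z nu ^+ 3 =
  Num.sqrt (z * nu) * (1 - Num.sqrt (z * nu)) ^+ 2 * (1 - Num.sqrt (z / nu)) ^+ 2 / (1 - z) ^+ 3.
Proof.
move=> /sqrt_itv[nu0 /andP[_ h1] /andP[_ h2] _].
have zn0 : 0 <= z * nu by rewrite mulr_ge0 // ltW.
have a0 : 0 <= 1 - Num.sqrt (z * nu) by rewrite subr_ge0 ltW.
have b0 : 0 <= 1 - Num.sqrt (z / nu) by rewrite subr_ge0 ltW.
rewrite /sigma_mu exprMn exprVn !exprMn !powR_natn //.
have -> : 1 / 6 * 3 = 2^-1 :> R by field.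
have -> : 2 / 3 * 3 = 2%:R :> R by field.
by rewrite powR12_sqrt // !powR_mulrn.
Qed.

Lemma sigma_mu_cvg (T : Type) (F : set_system T) (FF : Filter F) (f : T -> R) nu :
  z < nu < z^-1 -> f x @[x --> F] --> nu -> sigma_mu z (f x) @[x --> F] --> sigma_mu z nu.
Proof.
move=> hnu cf; have [nu0 /andP[_ h1] /andP[_ h2] _] := sqrt_itv hnu.
have c1 : z * f x @[x --> F] --> z * nu by apply: cvgM => //; exact: cvg_cst.
have c2 : z / f x @[x --> F] --> z / nu.
  by apply: cvgM; [exact: cvg_cst|apply: cvgV => //; rewrite gt_eqF].
have one (g : T -> R) l : g x @[x --> F] --> l -> 1 - Num.sqrt (g x) @[x --> F] --> 1 - Num.sqrt l.
  by move=> cg; apply: cvgB; [exact: cvg_cst|exact: cvg_sqrt].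
rewrite /sigma_mu; apply: cvgM; last exact: cvg_cst.
apply: cvgM; last by apply: cvg_powR; rewrite ?subr_gt0 //; exact: one.
apply: cvgM; last by apply: cvg_powR; rewrite ?subr_gt0 //; exact: one.
by apply: cvg_powR => //; rewrite mulr_gt0.
Qed.

(* The formulas in [rho] become symmetric when the roles of the two sizes [k]
   and [N] are exchanged, that is, when [nu = k / N] becomes its inverse. *)
Lemma kap3_sym (k N : nat) : (0 < k)%N -> (0 < N)%N ->
  let n := minn k N in let m := maxn k N in let nu : R := k%:R / N%:R in
  let rho := Num.sqrt (z * (m%:R / n%:R)) in
  z < nu < z^-1 ->
  N%:R * sigma_mu z nu ^+ 3 = n%:R * ((1 - rho) ^+ 2 * (rho - z) ^+ 2 / (rho * (1 - z) ^+ 3)) /\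
  n%:R - n%:R * (1 - rho) ^+ 2 / (1 - z) = N%:R * f1 z nu.
Proof.
move=> k0 N0 n m nu rho hnu; rewrite sigma_mu3 //.
have [nu0 /andP[r1 r2] /andP[r3 r4] rr] := sqrt_itv hnu.
have kR : 0 < k%:R :> R by rewrite ltr0n.
have NR : 0 < N%:R :> R by rewrite ltr0n.
have kE : k%:R = nu * N%:R by rewrite /nu divfK // gt_eqF.
rewrite /f1; have [kN|Nk] := leqP k N.
  have rE : rho = Num.sqrt (z / nu).
    rewrite /rho /n /m (minn_idPl kN) (maxn_idPr kN); congr (Num.sqrt (z * _)).
    by rewrite /nu invf_div.
  rewrite /n (minn_idPl kN) kE rE; move: rr r3 r4; set v := Num.sqrt (z / nu) => rr r3 r4.
  have v0 : 0 < v by exact: lt_trans r3.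
  have -> : Num.sqrt (z * nu) = z / v.
    by apply: (mulfI (lt0r_neq0 v0)); rewrite rr mulrC divfK // gt_eqF.
  have nuE : nu = z / v ^+ 2.
    rewrite /v sqr_sqrtr ?divr_ge0 ?(ltW z0) ?(ltW nu0) //; field.
    by rewrite !gt_eqF.
  rewrite nuE; split; field; rewrite ?one_z ?gt_eqF //.
have rE : rho = Num.sqrt (z * nu).
  by rewrite /rho /n /m (minn_idPr (ltnW Nk)) (maxn_idPl (ltnW Nk)).
rewrite /n (minn_idPr (ltnW Nk)) rE; move: rr r1 r2; set v := Num.sqrt (z * nu) => rr r1 r2.
have v0 : 0 < v by exact: lt_trans r1.
have -> : Num.sqrt (z / nu) = z / v.
  by apply: (mulIf (lt0r_neq0 v0)); rewrite rr divfK // gt_eqF.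
by split; field; rewrite ?one_z ?gt_eqF.
Qed.

(** f1 is a quadratic polynomial in the square root of its argument, so the expansion has an exact
    remainder. With q the cube root of N, q (nu - mu) stays bounded and the remainder vanishes like
    1 / q. *)
Lemma f1_taylor mu nu q x : 0 < mu -> 0 < nu -> 0 < q ->
  let a := Num.sqrt nu in let b := Num.sqrt mu in
  (f1 z mu * q ^+ 3 + f1' z mu * x * q ^+ 2 + x ^+ 2 / 2 * f1'' z mu * q - q ^+ 3 * f1 z nu) / q =
  f1' z mu * (((mu - nu) * q ^+ 3 + x * q ^+ 2) / q) +
  f1'' z mu / 2 * (x ^+ 2 - (q * (nu - mu)) ^+ 2) -
  2 * Num.sqrt z / (1 - z) * (q * (nu - mu) / (a + b)) ^+ 3 * q^-1 * ((a + 3 * b) / (8 * b ^+ 3)).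
Proof.
move=> mu0 nu0 q0 a b.
have a0 : 0 < a by rewrite sqrtr_gt0.
have b0 : 0 < b by rewrite sqrtr_gt0.
have nuE : nu = a ^+ 2 by rewrite sqr_sqrtr // ltW.
have muE : mu = b ^+ 2 by rewrite sqr_sqrtr // ltW.
have zE : z = Num.sqrt z ^+ 2 by rewrite sqr_sqrtr // ltW.
rewrite /f1 /f1' /f1'' !sqrtrM ?(ltW z0) //.
have -> : mu `^ (3 / 2) = b ^+ 3.
  have -> : 3 / 2 = 2^-1 * 3%:R :> R by field.
  by rewrite powRrM powR12_sqrt ?(ltW mu0) // powR_mulrn // sqrtr_ge0.
rewrite -/a -/b nuE muE; have := one_z; rewrite zE.
have s0 : Num.sqrt (Num.sqrt z ^+ 2) = Num.sqrt z by rewrite -zE.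
rewrite s0; set s := Num.sqrt z => os.
by field; rewrite os !gt_eqF // addr_gt0.
Qed.

End scaling.

(** * From the interpolated length to the length at an integer time *)

Section events.
Variables (R : realType) (t z : R) (N M : nat).
Hypothesis t01 : 0 < t < 1.
Hypothesis z01 : 0 < z < 1.

Lemma HLmass_ge0 (l : M.-tuple int_partition) : 0 <= HLmass t z N l.
Proof.
case/andP: (t01) => t0 t1; case/andP: (z01) => z0 z1.
rewrite /HLmass !mulr_ge0 ?exprn_ge0 ?divr_ge0 ?subr_ge0 ?(ltW z1) //.
- by rewrite ltW // (le_lt_trans _ z1) // ler_piMl // ltW.
- by apply: prodr_ge0 => i _; rewrite /skewP1 expr1n mulr1 psi_ge0.
- by rewrite HLQ_HLQs ?(ltW z0) // HLQs_ge0 // all_nseq_ge0 // ltW.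
Qed.

Lemma HLmass_interlace (l : M.-tuple int_partition) i : (i < M)%N -> HLmass t z N l != 0 ->
  interlace (chain_at l i.+1) (chain_at l i).
Proof.
move=> iM; have [//|nil] := pselect (interlace (chain_at l i.+1) (chain_at l i)).
rewrite /HLmass (bigD1 (Ordinal iM)) //= /skewP1 psi_not_interlace // !mul0r mulr0 mul0r.
by rewrite eqxx.
Qed.

(** The inclusion of events is needed only on sequences of non-zero mass, which interlace. *)
Lemma le_HLprob (A B : set (M.-tuple int_partition)) :
  (forall l, HLmass t z N l != 0 -> A l -> B l) -> (HLprob t z N A <= HLprob t z N B)%E.
Proof.
move=> AB; rewrite /HLprob esum_mkcond [leRHS]esum_mkcond; apply: le_esum => l _.
case: ifPn => [/set_mem Al|_]; last by case: ifP => // _; rewrite lee_fin HLmass_ge0.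
have [->|nz] := eqVneq (HLmass t z N l) 0; first by case: ifP.
by rewrite ifT //; apply/mem_set/AB.
Qed.

Lemma lam1'_itv (l : M.-tuple int_partition) (s : R) : 0 <= s -> (Num.truncn s < M)%N ->
  HLmass t z N l != 0 ->
  (lcol (chain_at l (Num.truncn s)) 0)%:R <= lam1' l s <= (lcol (chain_at l (Num.truncn s)) 0).+1%:R.
Proof.
move=> s0 kM nz; set k := Num.truncn s in kM *.
have /andP[h1 h2] : k%:R <= s < k.+1%:R by exact: truncn_itv.
have il := HLmass_interlace kM nz.
rewrite /lam1' -/k -!/(lcol _ _).
have d1 : (lcol (chain_at l k.+1) 0)%:R - (lcol (chain_at l k) 0)%:R = (0 : R) \/
    (lcol (chain_at l k.+1) 0)%:R - (lcol (chain_at l k) 0)%:R = (1 : R).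
  by case: (lcol_diff 0 il) => ->; [left; rewrite subrr|right; rewrite -natr1; ring].
move: h2; rewrite -natr1 -[(lcol (chain_at l k) 0).+1%:R]natr1 => h2.
by case: d1 => ->; rewrite ?mulr0 ?mulr1; lra.
Qed.

End events.

Section length_limit.
Variables (R : realType) (t z mu x : R).
Hypothesis t01 : 0 < t < 1.
Hypothesis z01 : 0 < z < 1.
Hypothesis hmu : z < mu < z^-1.
Let z0 : 0 < z. Proof. by case/andP: z01. Qed.
Let mu0 : 0 < mu. Proof. by case/andP: hmu => h _; exact: lt_trans h. Qed.

Let q (N : nat) : R := N%:R `^ (1 / 3).
Let s N := mu * N%:R + x * q N ^+ 2.
Hypothesis s_ge0 : \forall N \near \oo, 0 <= s N.
Let k N := Num.truncn (s N).
(** The exact ratio at the integer time k N; it differs from mu by about x / q N. *)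
Let nu N : R := (k N)%:R / N%:R.
Let nn N := minn (k N) N.
Let mm N := maxn (k N) N.
Let rho N : R := Num.sqrt (z * ((mm N)%:R / (nn N)%:R)).
(** The fraction is the maximum of mu and 1 / mu, in a form whose continuity is immediate. *)
Let rinf : R := Num.sqrt (z * ((mu + mu^-1 + `|mu - mu^-1|) / 2)).
Let kap N := q N * sigma_mu z (nu N).
(** For N > 0 this is the fractional part of s N, written in the form in which it appears in
    [f1_taylor]. *)
Let th N := (mu - nu N) * q N ^+ 3 + x * q N ^+ 2.

Lemma q3 N : q N ^+ 3 = N%:R.
Proof. by rewrite /q powR_natn // (_ : 1 / 3 * 3 = 1) ?powRr1 //; field. Qed.

Let qy : q N @[N --> \oo] --> (+oo : set_system R).
Proof.
apply/cvgryPge => A; near=> N.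
rewrite leNgt; apply/negP => qA.
have q0 : 0 <= q N by exact: powR_ge0.
have A0 : 0 <= A by rewrite (le_trans q0) // ltW.
have : q N ^+ 3 < A ^+ 3 by rewrite ltrXn2r // ?nnegrE.
rewrite q3 ltNge => /negP; apply; near: N; exact: nbhs_infty_ger.
Unshelve. all: by end_near. Qed.

Let q1 : \forall N \near \oo, 1 <= q N.
Proof. by near=> N; near: N; exact: (cvgryPge _).1 qy _. Unshelve. all: by end_near. Qed.

Let k_itv : \forall N \near \oo, (k N)%:R <= s N < (k N).+1%:R.
Proof. by near=> N; apply: truncn_itv; near: N. Unshelve. all: by end_near. Qed.

Let th_itv : \forall N \near \oo, 0 <= th N <= 1.
Proof.
near=> N; have N0 : (0 < N)%N by near: N.
have NR : N%:R != 0 :> R by rewrite pnatr_eq0 -lt0n.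
have -> : th N = s N - (k N)%:R by rewrite /th /s q3 /nu; field.
have /andP[h1 h2] : (k N)%:R <= s N < (k N).+1%:R by near: N.
by rewrite -natr1 in h2; apply/andP; split; lra.
Unshelve. all: by end_near. Qed.

Let qV : (q N)^-1 @[N --> \oo] --> (0 : R).
Proof.
apply/cvgrPdist_le => /= e e0; near=> N.
have k0 : 1 <= q N by near: N.
rewrite sub0r normrN ger0_norm ?invr_ge0 ?(le_trans ler01 k0) // -[leRHS]invrK.
rewrite lef_pV2 ?posrE ?invr_gt0 ?(lt_le_trans ltr01 k0) //.
by near: N; exact: (cvgryPge _).1 qy _.
Unshelve. all: by end_near. Qed.

Let cth : th N / q N @[N --> \oo] --> (0 : R).
Proof.
have c0 : cst (0 : R) N @[N --> \oo] --> (0 : R) by exact: cvg_cst.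
apply: squeeze_cvgr c0 qV; near=> N.
have /andP[h1 h2] : 0 <= th N <= 1 by near: N.
have k0 : 1 <= q N by near: N.
have q0 : 0 < q N by rewrite (lt_le_trans ltr01).
by rewrite divr_ge0 ?(ltW q0) //= -[leRHS]mul1r ler_wpM2r // invr_ge0 ltW.
Unshelve. all: by end_near. Qed.

Let ch : q N * (nu N - mu) @[N --> \oo] --> x.
Proof.
have h : x - th N / q N * (q N)^-1 @[N --> \oo] --> x - 0 * 0.
  by apply: cvgB; [exact: cvg_cst|apply: cvgM].
rewrite mulr0 subr0 in h; apply: cvg_trans h; apply: near_eq_cvg; near=> N.
have k0 : 1 <= q N by near: N.
by rewrite /th; field; rewrite gt_eqF // (lt_le_trans ltr01).
Unshelve. all: by end_near. Qed.

Let cnu : nu N @[N --> \oo] --> mu.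
Proof.
have h : mu + q N * (nu N - mu) * (q N)^-1 @[N --> \oo] --> mu + x * 0.
  by apply: cvgD; [exact: cvg_cst|apply: cvgM].
rewrite mulr0 addr0 in h; apply: cvg_trans h; apply: near_eq_cvg; near=> N.
have k0 : 1 <= q N by near: N.
by field; rewrite gt_eqF // (lt_le_trans ltr01).
Unshelve. all: by end_near. Qed.

Let nu_itv : \forall N \near \oo, z < nu N < z^-1.
Proof.
case/andP: hmu => h1 h2.
by near=> N; apply/andP; split; near: N; [exact: (cvgr_gt _ cnu)|exact: (cvgr_lt _ cnu)].
Unshelve. all: by end_near. Qed.

Let k_gt0 : \forall N \near \oo, (0 < k N)%N.
Proof.
near=> N; rewrite lt0n; apply/negP => /eqP k0.
have /andP[h _] : z < nu N < z^-1 by near: N.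
by move: h; rewrite /nu k0 mul0r ltNge (ltW z0).
Unshelve. all: by end_near. Qed.

Let nm : \forall N \near \oo, (0 < nn N <= mm N)%N.
Proof.
near=> N; have k0 : (0 < k N)%N by near: N.
have N0 : (0 < N)%N by near: N.
by rewrite /nn /mm; lia.
Unshelve. all: by end_near. Qed.

Let n_rho : \forall N \near \oo, (nn N)%:R * rho N ^+ 2 = z * (mm N)%:R.
Proof.
near=> N; have /andP[n0 _] : (0 < nn N <= mm N)%N by near: N.
have nR : 0 < (nn N)%:R :> R by rewrite ltr0n.
rewrite /rho sqr_sqrtr; last by rewrite mulr_ge0 ?divr_ge0 // ltW.
by field; rewrite gt_eqF.
Unshelve. all: by end_near. Qed.

Let mnE : \forall N \near \oo, (mm N)%:R / (nn N)%:R = (nu N + (nu N)^-1 + `|nu N - (nu N)^-1|) / 2.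
Proof.
near=> N; have k0 : (0 < k N)%N by near: N.
have N0 : (0 < N)%N by near: N.
have kR : 0 < (k N)%:R :> R by rewrite ltr0n.
have NR : 0 < N%:R :> R by rewrite ltr0n.
rewrite /mm /nn /nu invf_div.
have d : (k N)%:R / N%:R - N%:R / (k N)%:R =
    ((k N)%:R - N%:R) * (((k N)%:R + N%:R) / ((k N)%:R * N%:R)) :> R.
  by field; rewrite !gt_eqF.
have p : 0 <= ((k N)%:R + N%:R) / ((k N)%:R * N%:R) :> R by rewrite divr_ge0.
case: (leqP (k N) N) => h.
  rewrite ler0_norm; last by rewrite d mulr_le0_ge0 // subr_le0 ler_nat.
  by field; rewrite !gt_eqF.
rewrite ger0_norm; last by rewrite d mulr_ge0 // subr_ge0 ler_nat ltnW.
by field; rewrite !gt_eqF.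
Unshelve. all: by end_near. Qed.

Let crho : rho N @[N --> \oo] --> rinf.
Proof.
have mn0 : mu != 0 by rewrite gt_eqF.
have h : Num.sqrt (z * ((nu N + (nu N)^-1 + `|nu N - (nu N)^-1|) / 2)) @[N --> \oo] --> rinf.
  apply: cvg_sqrt; apply: cvgM; first exact: cvg_cst.
  have cV : (nu N)^-1 @[N --> \oo] --> mu^-1 by apply: cvgV.
  apply: cvgM; last exact: cvg_cst.
  by apply: cvgD; [apply: cvgD|apply: cvg_norm; apply: cvgB].
apply: cvg_trans h; apply: near_eq_cvg; near=> N.
by rewrite /rho (_ : (mm N)%:R / (nn N)%:R = (nu N + (nu N)^-1 + `|nu N - (nu N)^-1|) / 2) //; near: N.
Unshelve. all: by end_near. Qed.

Let rinf01 : z < rinf < 1.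
Proof.
have [_ h1 h2 _] := sqrt_itv z01 hmu; rewrite /rinf.
have [le|ge] := leP mu mu^-1.
  rewrite ler0_norm ?subr_le0 // (_ : _ / 2 = mu^-1) //; field.
  by rewrite gt_eqF.
rewrite ger0_norm ?subr_ge0 ?(ltW ge) // (_ : _ / 2 = mu) //; field.
by rewrite gt_eqF.
Qed.

Let cn : (nn N)%:R @[N --> \oo] --> (+oo : set_system R).
Proof.
apply/cvgryPge => A; near=> N.
have N0 : (0 < N)%N by near: N.
have NR : 0 < N%:R :> R by rewrite ltr0n.
have h1 : A <= N%:R by near: N; exact: nbhs_infty_ger.
have h2 : mu / 2 <= nu N by near: N; apply: (cvgr_ge _ cnu); rewrite ltr_pdivrMr // ltr_pMr // ltr1n.
have h3 : A / (mu / 2) <= N%:R by near: N; exact: nbhs_infty_ger.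
have h4 : A <= (k N)%:R.
  rewrite ler_pdivrMr ?divr_gt0 // mulrC in h3; apply: le_trans h3 _.
  by move: h2; rewrite /nu ler_pdivlMr.
rewrite /nn; case: (leqP (k N) N) => _ //.
Unshelve. all: by end_near. Qed.

Let V (r : R) := (1 - r) ^+ 2 * (r - z) ^+ 2 / (r * (1 - z) ^+ 3).

Let kap_ge0 : \forall N \near \oo, 0 <= kap N.
Proof.
near=> N; have h : z < nu N < z^-1 by near: N.
by rewrite mulr_ge0 ?powR_ge0 // ltW // sigma_mu_gt0.
Unshelve. all: by end_near. Qed.

Let sym : \forall N \near \oo, kap N ^+ 3 = (nn N)%:R * V (rho N) /\
  (nn N)%:R - (nn N)%:R * (1 - rho N) ^+ 2 / (1 - z) = N%:R * f1 z (nu N).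
Proof.
near=> N; have h : z < nu N < z^-1 by near: N.
have k0 : (0 < k N)%N by near: N.
have N0 : (0 < N)%N by near: N.
have [e1 e2] := kap3_sym z01 k0 N0 h.
by split; [rewrite /kap exprMn q3 e1|exact: e2].
Unshelve. all: by end_near. Qed.

Let kap3 : \forall N \near \oo, kap N ^+ 3 = (nn N)%:R * V (rho N).
Proof. by apply: filterS sym => N []. Qed.

Variable y : R.
(** The threshold for lambda'_1 that corresponds to the value y of the rescaled length. *)
Definition hlT N : R := f1 z mu * N%:R + f1' z mu * x * q N ^+ 2 + x ^+ 2 / 2 * f1'' z mu * q N +
  sigma_mu z mu * y * q N.

Let D N := (hlT N - N%:R * f1 z (nu N)) / q N.

(** By [f1_taylor] the centring at mu and that at the ratio nu differ by o(q), so only sigma_mu y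
    remains. *)
Let cD : D N @[N --> \oo] --> sigma_mu z mu * y.
Proof.
pose a N := Num.sqrt (nu N); pose b := Num.sqrt mu.
have ca : a N @[N --> \oo] --> b by exact: cvg_sqrt.
have b0 : 0 < b by rewrite sqrtr_gt0.
have bb : b + b != 0 by rewrite gt_eqF // addr_gt0.
pose E N := sigma_mu z mu * y + (f1' z mu * (th N / q N) +
  f1'' z mu / 2 * (x ^+ 2 - (q N * (nu N - mu)) ^+ 2) -
  2 * Num.sqrt z / (1 - z) * (q N * (nu N - mu) / (a N + b)) ^+ 3 * (q N)^-1 *
    ((a N + 3 * b) / (8 * b ^+ 3))).
have cE : E N @[N --> \oo] --> sigma_mu z mu * y + (f1' z mu * 0 +
  f1'' z mu / 2 * (x ^+ 2 - x ^+ 2) -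
  2 * Num.sqrt z / (1 - z) * (x / (b + b)) ^+ 3 * 0 * ((b + 3 * b) / (8 * b ^+ 3))).
  apply: cvgD; first exact: cvg_cst.
  apply: cvgB.
    apply: cvgD; first by apply: cvgM => //; exact: cvg_cst.
    apply: cvgM; first exact: cvg_cst.
    by apply: cvgB; [exact: cvg_cst|exact: cvg_exprn].
  apply: cvgM; last by apply: cvgM; [apply: cvgD => //; exact: cvg_cst|exact: cvg_cst].
  apply: cvgM => //; apply: cvgM; first exact: cvg_cst.
  apply: cvg_exprn; apply: cvgM => //; apply: cvgV => //.
  by apply: cvgD => //; exact: cvg_cst.
rewrite subrr !mulr0 mul0r subr0 !addr0 in cE.
apply: cvg_trans cE; apply: near_eq_cvg; near=> N.
have k1 : 1 <= q N by near: N.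
have q0 : 0 < q N by rewrite (lt_le_trans ltr01).
have /andP[h _] : z < nu N < z^-1 by near: N.
have := @f1_taylor R z z01 mu (nu N) (q N) x mu0 (lt_trans z0 h) q0.
rewrite /= -/(th N) -/(a N) -/b => T.
rewrite /E -T /D /hlT -q3; field.
by rewrite gt_eqF.
Unshelve. all: by end_near. Qed.

Let sig0 : 0 < sigma_mu z mu. Proof. exact: sigma_mu_gt0. Qed.
Let csig : sigma_mu z (nu N) @[N --> \oo] --> sigma_mu z mu.
Proof. exact: sigma_mu_cvg. Qed.

(** By [nT_ge0] the argument is eventually non-negative, so that [Num.truncn] is its floor. *)
Definition hlc N : nat := Num.truncn ((nn N)%:R - hlT N).

Let jc N := (nn N)%:R * (1 - rho N) ^+ 2 / (1 - z).

Let sigN0 : \forall N \near \oo, sigma_mu z mu / 2 <= sigma_mu z (nu N).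
Proof. by near=> N; near: N; apply: (cvgr_ge _ csig); rewrite ltr_pdivrMr // ltr_pMr // ltr1n.
Unshelve. all: by end_near. Qed.

Let jcE : \forall N \near \oo, jc N - ((nn N)%:R - hlT N) = q N * D N.
Proof.
near=> N; have [_ e] : kap N ^+ 3 = (nn N)%:R * V (rho N) /\
  (nn N)%:R - (nn N)%:R * (1 - rho N) ^+ 2 / (1 - z) = N%:R * f1 z (nu N) by near: N; exact: sym.
have k1 : 1 <= q N by near: N.
rewrite /D mulrCA divff ?mulr1; last by rewrite gt_eqF // (lt_le_trans ltr01).
by rewrite -e -/(jc N); ring.
Unshelve. all: by end_near. Qed.

Let nT_ge0 : \forall N \near \oo, 0 <= (nn N)%:R - hlT N.
Proof.
have J := @jc_ge R z nn rho kap rinf z01 crho rinf01 cn kap_ge0 kap3.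
near=> N.
have h1 : (`|sigma_mu z mu * y| + 1) / (sigma_mu z mu / 2) * kap N <= jc N by near: N; exact: J.
have h2 : D N <= sigma_mu z mu * y + 1 by near: N; apply: (cvgr_le _ cD); rewrite ltrDl.
have e : jc N - ((nn N)%:R - hlT N) = q N * D N by near: N; exact: jcE.
have k1 : 1 <= q N by near: N.
have q0 : 0 < q N by rewrite (lt_le_trans ltr01).
have sg : sigma_mu z mu / 2 <= sigma_mu z (nu N) by near: N.
have s20 : 0 < sigma_mu z mu / 2 by rewrite divr_gt0.
have h3 : (`|sigma_mu z mu * y| + 1) * q N <= jc N.
  apply: le_trans h1; rewrite -mulrA ler_wpM2l ?addr_ge0 //.
  by rewrite mulrC ler_pdivlMr // /kap ler_wpM2l // ltW.
have h4 : q N * D N <= q N * (`|sigma_mu z mu * y| + 1).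
  rewrite ler_wpM2l ?(ltW q0) // (le_trans h2) // lerD2r ler_norm //.
rewrite mulrC in h4; lra.
Unshelve. all: by end_near. Qed.

Let c_itv : \forall N \near \oo, (hlc N)%:R <= (nn N)%:R - hlT N < (hlc N).+1%:R.
Proof. by near=> N; apply: truncn_itv; near: N. Unshelve. all: by end_near. Qed.

Let c_cvg (p : nat) : (jc N - (hlc N + p)%N%:R) / kap N @[N --> \oo] --> y.
Proof.
have tau : ((nn N)%:R - hlT N - (hlc N)%:R) / q N @[N --> \oo] --> (0 : R).
  have c0 : cst (0 : R) N @[N --> \oo] --> (0 : R) by exact: cvg_cst.
  apply: squeeze_cvgr c0 qV; near=> N.
  have /andP[h1 h2] : (hlc N)%:R <= (nn N)%:R - hlT N < (hlc N).+1%:R by near: N.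
  have k0 : 1 <= q N by near: N.
  have q0 : 0 < q N by rewrite (lt_le_trans ltr01).
  rewrite -natr1 in h2.
  rewrite divr_ge0 ?(ltW q0) ?subr_ge0 //= -[leRHS]mul1r ler_wpM2r ?invr_ge0 ?(ltW q0) //.
  lra.
have h : (D N + ((nn N)%:R - hlT N - (hlc N)%:R) / q N - p%:R * (q N)^-1) / sigma_mu z (nu N)
    @[N --> \oo] --> (sigma_mu z mu * y + 0 - p%:R * 0) / sigma_mu z mu.
  apply: cvgM; last by apply: cvgV => //; rewrite gt_eqF.
  apply: cvgB; first exact: cvgD.
  by apply: cvgM => //; exact: cvg_cst.
rewrite mulr0 subr0 addr0 mulrC mulKf ?gt_eqF // in h.
apply: cvg_trans h; apply: near_eq_cvg; near=> N.
have e : jc N - ((nn N)%:R - hlT N) = q N * D N by near: N; exact: jcE.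
have k1 : 1 <= q N by near: N.
have q0 : 0 < q N by rewrite (lt_le_trans ltr01).
have sg : sigma_mu z mu / 2 <= sigma_mu z (nu N) by near: N.
have sg0 : 0 < sigma_mu z (nu N) by rewrite (lt_le_trans _ sg) // divr_gt0.
have -> : jc N = q N * D N + ((nn N)%:R - hlT N) by rewrite -e subrK.
rewrite natrD /kap; field.
by rewrite !gt_eqF.
Unshelve. all: by end_near. Qed.

Lemma hlge_hlc_cvg (p : nat) :
  hlge t z (nn N).-1 (mm N) (hlc N + p) @[N --> \oo] --> F_GUE y.
Proof.
exact: (hlge_cvg_F_GUE t01 z01 nm n_rho crho rinf01 cn kap_ge0 kap3 (c_cvg p)).
Qed.

Lemma hllaw_minmax N : (0 < nn N)%N -> hllaw t z (k N) N =1 hllaw t z (mm N) (nn N).-1.+1.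
Proof.
move=> n0 la; rewrite (prednK n0) /mm /nn; case: (leqP (k N) N) => h //.
exact: hllaw_sym.
Qed.

Lemma HLprob_length_cvg (M : nat -> nat) : (\forall N \near \oo, (k N < M N)%N) ->
  HLprob t z N [set l : (M N).-tuple int_partition | lam1' l (s N) <= hlT N] @[N --> \oo] -->
  (F_GUE y)%:E.
Proof.
move=> kM.
(* The margin 2 absorbs the rounding in [hlc] and the possible unit step between two integer
   times. *)
have lo : (hlge t z (nn N).-1 (mm N) (hlc N + 2))%:E @[N --> \oo] --> (F_GUE y)%:E.
  by apply: cvg_EFin; [exact: nearW|exact: hlge_hlc_cvg].
have up : (hlge t z (nn N).-1 (mm N) (hlc N + 0))%:E @[N --> \oo] --> (F_GUE y)%:E.
  by apply: cvg_EFin; [exact: nearW|exact: hlge_hlc_cvg].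
apply: squeeze_cvge lo up; near=> N.
have /andP[n0 _] : (0 < nn N <= mm N)%N by near: N.
have kMN : (k N < M N)%N by near: N.
have sN0 : 0 <= s N by near: N.
have /andP[c1 c2] : (hlc N)%:R <= (nn N)%:R - hlT N < (hlc N).+1%:R by near: N.
have law0 la : 0 <= hllaw t z (mm N) (nn N).-1.+1 la by exact: hllaw_ge0.
apply/andP; split.
  apply: (@le_trans _ _ (HLprob t z N [set l : (M N).-tuple int_partition |
      ((lcol (chain_at l (k N)) 0).+1%:R <= hlT N)%R])).
    rewrite (@HLprob_law R t z t01 z01 (M N) N (k N) (fun la => (lcol la 0).+1%:R <= hlT N) (ltnW kMN)).
    rewrite -hlgeE //; apply: le_esum => la _; rewrite lee_fin (hllaw_minmax n0).
    case: ifP => h; last by case: ifP.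
    rewrite ifT //; move: h; rewrite /hlh (prednK n0) => h.
    have h2 : (hlc N + 2 + lcol la 0 <= nn N)%N.
      by move: h; move: (hlc N) (lcol la 0) (nn N) => a b d; clear; lia.
    rewrite -(ler_nat R) !natrD in h2; rewrite -natr1 in c2; rewrite -natr1; lra.
  apply: le_HLprob => // l nz /= h.
  by have /andP[_ h2] := lam1'_itv sN0 kMN nz; exact: le_trans h2 h.
apply: (@le_trans _ _ (HLprob t z N [set l : (M N).-tuple int_partition |
    ((lcol (chain_at l (k N)) 0)%:R <= hlT N)%R])).
  apply: le_HLprob => // l nz /= h.
  by have /andP[h2 _] := lam1'_itv sN0 kMN nz; exact: le_trans h2 h.
rewrite (@HLprob_law R t z t01 z01 (M N) N (k N) (fun la => (lcol la 0)%:R <= hlT N) (ltnW kMN)).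
rewrite -hlgeE //; apply: le_esum => la _; rewrite lee_fin (hllaw_minmax n0).
case: ifP => h; last by case: ifP.
have h2 : (hlc N + lcol la 0 <= nn N)%N by rewrite -(ler_nat R) natrD; lra.
rewrite ifT // addn0 /hlh (prednK n0).
by move: h2; move: (hlc N) (lcol la 0) (nn N) => a b d; clear; lia.
Unshelve. all: by end_near. Qed.

End length_limit.

Theorem theorem2p3 (R : realType) (r zeta t mu : R) (M : nat -> nat)
    (hr : 0 < r) (hzeta : 0 < zeta < 1) (ht : 0 < t < 1)
    (hmu : zeta < mu < zeta^-1)
    (hNM : \forall N \near \oo,
      (r + 2) * N%:R `^ (2 / 3) < mu * N%:R /\
      mu * N%:R + (r + 2) * N%:R `^ (2 / 3) < (M N)%:R)
    (x : R) (hx : - r - 1 <= x <= r + 1) (y : R) :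
  (fun N : nat =>
     HLprob t zeta N [set l : (M N).-tuple int_partition | fHL zeta mu N l x <= y])
    @ \oo --> (F_GUE y)%:E.
Proof.
have q2 (N : nat) : N%:R `^ (2 / 3) = (N%:R `^ (1 / 3)) ^+ 2 :> R.
  by rewrite powR_natn //; congr (_ `^ _); field.
case/andP: hx => x1 x2.
(* x >= - r - 1 while mu N exceeds (r + 2) N^(2/3), so the observed time is positive; likewise x <=
   r + 1 keeps it below M in [kM]. *)
have s_ge0 : \forall N \near \oo, 0 <= mu * N%:R + x * (N%:R `^ (1 / 3)) ^+ 2 :> R.
  apply: filterS hNM => N [h _]; rewrite q2 in h.
  have p0 : 0 <= (N%:R `^ (1 / 3)) ^+ 2 :> R by rewrite exprn_ge0 // powR_ge0.
  have : (- r - 1) * (N%:R `^ (1 / 3)) ^+ 2 <= x * (N%:R `^ (1 / 3)) ^+ 2 by rewrite ler_wpM2r.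
  move: h p0; set p := (N%:R `^ (1 / 3)) ^+ 2; lra.
have kM : \forall N \near \oo, (Num.truncn (mu * N%:R + x * (N%:R `^ (1 / 3)) ^+ 2) < M N)%N.
  near=> N; rewrite -(ltr_nat R).
  have [_ h] : (r + 2) * N%:R `^ (2 / 3) < mu * N%:R /\
      mu * N%:R + (r + 2) * N%:R `^ (2 / 3) < (M N)%:R by near: N.
  have s0 : 0 <= mu * N%:R + x * (N%:R `^ (1 / 3)) ^+ 2 by near: N.
  have /andP[h1 _] := truncn_itv s0; apply: le_lt_trans h1 _.
  have p0 : 0 <= (N%:R `^ (1 / 3)) ^+ 2 :> R by rewrite exprn_ge0 // powR_ge0.
  have : x * (N%:R `^ (1 / 3)) ^+ 2 <= (r + 1) * (N%:R `^ (1 / 3)) ^+ 2 by rewrite ler_wpM2r.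
  by move: h p0; rewrite q2; set p := (N%:R `^ (1 / 3)) ^+ 2; lra.
have := HLprob_length_cvg ht hzeta hmu s_ge0 (y:=y) kM.
apply: cvg_trans; apply: near_eq_cvg; near=> N; congr (HLprob _ _ _ _).
have q0 : 0 < N%:R `^ (1 / 3) :> R by rewrite powR_gt0 // ltr0n; near: N; exists 1%N.
have sg := sigma_mu_gt0 hzeta hmu.
apply/seteqP; split=> l /=; rewrite /fHL /hlT powRN q2; set p := N%:R `^ (1 / 3); set L := lam1' _ _.
  move=> h; rewrite -mulrA ler_pdivrMl // ler_pdivrMl //; lra.
by rewrite -mulrA ler_pdivrMl // ler_pdivrMl // => h; lra.
Unshelve. all: by end_near. Qed.
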